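(* Let $m$ be a positive integer, $\alpha>0$ real, $a_0,\dots,a_m\in\mathbb{R}$ with $a_m\neq 0$, and consider the equation $$\frac{d^\alpha\varphi}{dz^\alpha}=\frac{a_m}{\alpha^m}z^m\frac{d^m\varphi}{dz^m}+\frac{a_{m-1}}{\alpha^{m-1}}z^{m-1}\frac{d^{m-1}\varphi}{dz^{m-1}}+\cdots+\frac{a_1}{\alpha}z\frac{d\varphi}{dz}+a_0\varphi,\qquad z>0. \quad ( * )$$ Let $s_1,s_2,\dots,s_m$ be the roots of the characteristic polynomial $$\tilde P(s)=a_0+\sum_{i=1}^m a_i\prod_{j=0}^{i-1}\left(s-\frac{j}{\alpha}\right),$$ so that the right-hand side of $( * )$ equals $a_m\prod_{i=1}^m\left(\frac1\alpha z\frac{d}{dz}-s_i\right)\varphi$. (1) If $0<\alpha<m$ and $a_m>0$, then $( * )$ has the following as a solution, where $c_1$ is a constant: $$\varphi(z)=c_1\,H^{m,0}_{1,m}\left[\frac{z^{-\alpha}}{a_m}\,\Big|\,\begin{array}{c}(1,\alpha)\\(-s_1,1),(-s_2,1),\dots,(-s_m,1)\end{array}\right].$$ (2) If $\alpha>m$, then, with $n$ the positive integer satisfying $n-1<\alpha<n$, $( * )$ has as a solution $$\varphi(z)=\sum_{k=1}^n c_k z^{\alpha-k}\,{}_{m+1}\Psi_1\left[a_m z^\alpha\,\Big|\,\begin{array}{c}\left(1-\frac{k}{\alpha}-s_1,1\right),\dots,\left(1-\frac{k}{\alpha}-s_m,1\right),(1,1)\\(1+\alpha-k,\alpha)\end{array}\right],$$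 where $c_k$ ($k=1,\dots,n$) are arbitrary constants.
   Context: Riemann-Liouville derivative: for $\alpha=n\in\mathbb{N}$, $\frac{d^\alpha}{dz^\alpha}\varphi=\frac{d^n}{dz^n}\varphi$; for $\alpha\in(n-1,n)$ with $n\in\mathbb{N}=\{1,2,\dots\}$, $\frac{d^\alpha}{dz^\alpha}\varphi(z)=\frac{1}{\Gamma(n-\alpha)}\frac{d^n}{dz^n}\int_0^z(z-s)^{n-\alpha-1}\varphi(s)\,ds$. Notation: $(A_i,\alpha_i)_{1,p}$ denotes the list $(A_1,\alpha_1),\dots,(A_p,\alpha_p)$. Generalized Wright function: ${}_p\Psi_q\left[w\,\big|\,\begin{array}{c}(A_i,\alpha_i)_{1,p}\\(B_j,\beta_j)_{1,q}\end{array}\right]=\sum_{k=0}^\infty\frac{\prod_{i=1}^p\Gamma(A_i+\alpha_ik)}{\prod_{j=1}^q\Gamma(B_j+\beta_jk)}\frac{w^k}{k!}$, for $w\in\mathbb{C}$, $p,q\in\{0,1,2,\dots\}$, $A_i,B_j\in\mathbb{C}$, $\alpha_i,\beta_j\in\mathbb{R}\setminus\{0\}$. Fox H-function: for $w\in\mathbb{C}\setminus\{0\}$, $m,l,p,q\in\{0,1,2,\dots\}$ with $(m,l)\ne(0,0)$, $\alpha_i,\beta_j>0$ and $A_i,B_j\in\mathbb{R}$, $$H^{m,l}_{p,q}\left[w\,\Big|\,\begin{array}{c}(A_i,\alpha_i)_{1,p}\\(B_j,\beta_j)_{1,q}\end{array}\right]=\frac{1}{2\pi i}\int_{L}\frac{\prod_{j=1}^m\Gamma(B_j-\beta_js)\prod_{i=1}^l\Gamma(1-A_i+\alpha_is)}{\prod_{i=l+1}^p\Gamma(A_i-\alpha_is)\prod_{j=m+1}^q\Gamma(1-B_j+\beta_js)}\,w^s\,ds,$$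 where empty products are $1$ and $L$ is a contour from $\gamma-i\infty$ to $\gamma+i\infty$, with $\gamma$ chosen such that $L$ separates the poles of $\Gamma(B_j-\beta_js)$, $1\le j\le m$, from the poles of $\Gamma(1-A_i+\alpha_is)$, $1\le i\le l$ (for $l=0$: the former poles lie to the right of $L$). The integral converges when $\mu=\sum_{i=1}^l\alpha_i-\sum_{i=l+1}^p\alpha_i+\sum_{j=1}^m\beta_j-\sum_{j=m+1}^q\beta_j>0$ and $|\arg w|<\pi\mu/2$. *)

(* Defs.v *)
From Stdlib Require Import Reals Factorial List.
From Coquelicot Require Import Coquelicot.
Import ListNotations.

Open Scope R_scope.
Open Scope C_scope.

Definition Cprod (l : list C) : C := fold_right Cmult 1 l.

Definition Cexp (z : C) : C := (exp (Re z) * cos (Im z), exp (Re z) * sin (Im z))%R.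

(* Principal argument, with values in ]-PI, PI]. *)
Definition Carg (w : C) : R :=
  if Rle_dec 0 (Im w) then acos (Re w / Cmod w) else (- acos (Re w / Cmod w))%R.

Definition Clog (w : C) : C := (ln (Cmod w), Carg w).

(* Principal power w ^ s, meaningful for w <> 0.  (Coquelicot's [Cpow],
   written [w ^ n], is the power with a natural exponent.) *)
Definition Cpower (w s : C) : C := Cexp (s * Clog w).

(* The Euler-Gauss form of the Gamma function,
     Gamma z = lim_n  n! n^z / (z (z+1) ... (z+n)),
   valid for every z other than 0, -1, -2, ...  At these poles the terms are
   eventually / 0 = 0, so that the Gamma below vanishes there; consequently
   [/ Gamma z] is everywhere the value of the entire function 1 / Gamma. *)
Definition Gamma_seq (z : C) (n : nat) : C :=
  INR (fact n) * Cpower (INR n) z / Cprod (map (fun k => z + INR k) (seq 0 (S n))).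

Definition Gamma (z : C) : C :=
  (real (Lim_seq (fun n => Re (Gamma_seq z n))),
   real (Lim_seq (fun n => Im (Gamma_seq z n)))).

Definition Gamma_pole (z : C) : Prop := exists k : nat, z = - INR k.

(* Generalized Wright function.  A pair (A, alpha) is a parameter of the
   function; [P] is the upper row and [Q] the lower row. *)
Definition Wright_term (P Q : list (C * R)) (w : C) (k : nat) : C :=
  Cprod (map (fun p : C * R => Gamma (fst p + snd p * INR k)) P)
  * Cprod (map (fun p : C * R => / Gamma (fst p + snd p * INR k)) Q)
  * (w ^ k / INR (fact k)).

(* No Gamma function in a numerator is evaluated at a pole. *)
Definition Wright_defined (P : list (C * R)) : Prop :=
  forall p : C * R, In p P -> forall k : nat, ~ Gamma_pole (fst p + snd p * INR k).

Definition is_Wright (P Q : list (C * R)) (w v : C) : Prop :=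
  Wright_defined P /\ is_series (V := C_R_NormedModule) (Wright_term P Q w) v.

Definition Wright (P Q : list (C * R)) (w : C) : C :=
  (Series (fun k => Re (Wright_term P Q w k)), Series (fun k => Im (Wright_term P Q w k))).

(* Fox H-function H^{m,l}_{p,q}: [a] is the list (A_i, alpha_i)_{1,p} and [b]
   is the list (B_j, beta_j)_{1,q}, with complex A_i and B_j allowed. *)
Definition FoxH_integrand (m l : nat) (a b : list (C * R)) (w s : C) : C :=
  Cprod (map (fun p : C * R => Gamma (fst p - snd p * s)) (firstn m b))
  * Cprod (map (fun p : C * R => Gamma (1 - fst p + snd p * s)) (firstn l a))
  * Cprod (map (fun p : C * R => / Gamma (fst p - snd p * s)) (skipn l a))
  * Cprod (map (fun p : C * R => / Gamma (1 - fst p + snd p * s)) (skipn m b))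
  * Cpower w s.

(* The line Re s = gamma has the poles of the first m factors on its right and
   the poles of the l following factors on its left. *)
Definition FoxH_separates (m l : nat) (a b : list (C * R)) (gamma : R) : Prop :=
  (forall (p : C * R) (s : C), In p (firstn m b) -> Gamma_pole (fst p - snd p * s) -> gamma < Re s)%R
  /\ (forall (p : C * R) (s : C), In p (firstn l a) -> Gamma_pole (1 - fst p + snd p * s) -> Re s < gamma)%R.

(* The contour from gamma - i oo to gamma + i oo is the vertical line
   s = gamma + i t, so that ds = i dt; the integral is an improper one. *)
Definition is_FoxH (m l : nat) (a b : list (C * R)) (w h : C) : Prop :=
  exists (gamma : R) (J : C),
    FoxH_separates m l a b gamma
    /\ is_RInt_gen (V := C_R_NormedModule)
         (fun t : R => FoxH_integrand m l a b w (gamma + Ci * t) * Ci)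
         (Rbar_locally m_infty) (Rbar_locally p_infty) J
    /\ h = J / (2 * PI * Ci).

Definition FoxH (m l : nat) (a b : list (C * R)) (w : C) : C :=
  iota (T := C_R_CompleteNormedModule) (is_FoxH m l a b w).

(* Derivatives of complex-valued functions of a real variable. *)
Definition CDerive_n (f : R -> C) (n : nat) (x : R) : C :=
  (Derive_n (fun t => Re (f t)) n x, Derive_n (fun t => Im (f t)) n x).

Definition ex_CDerive_n_pos (f : R -> C) (n : nat) : Prop :=
  forall (k : nat) (x : R), (k <= n)%nat -> (0 < x)%R ->
    ex_derive_n (fun t => Re (f t)) k x /\ ex_derive_n (fun t => Im (f t)) k x.

(* [g] is the Riemann-Liouville derivative of order alpha of [f] on ]0, +oo[.
   For a non-integer alpha the integral is improper at both ends. *)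
Definition is_RL_derive (alpha : R) (f g : R -> C) : Prop :=
  (exists n : nat,
      (1 <= n)%nat /\ alpha = INR n /\ ex_CDerive_n_pos f n
      /\ forall z : R, (0 < z)%R -> g z = CDerive_n f n z)
  \/
  (exists (n : nat) (J : R -> C),
      (1 <= n)%nat /\ (INR n - 1 < alpha < INR n)%R
      /\ (forall z : R, (0 < z)%R ->
            is_RInt_gen (V := C_R_NormedModule)
              (fun s : R => Rpower (z - s) (INR n - alpha - 1) * f s)
              (at_right 0) (at_left z) (J z))
      /\ ex_CDerive_n_pos J n
      /\ forall z : R, (0 < z)%R -> g z = / Gamma (INR n - alpha)%R * CDerive_n J n z).

Definition eq_rhs (m : nat) (alpha : R) (a : nat -> R) (phi : R -> C) (z : R) : C :=
  sum_n (fun i => (a i / alpha ^ i * z ^ i)%R * CDerive_n phi i z) m.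

Definition is_solution (m : nat) (alpha : R) (a : nat -> R) (phi : R -> C) : Prop :=
  ex_CDerive_n_pos phi m /\ is_RL_derive alpha phi (eq_rhs m alpha a phi).

Definition char_poly (m : nat) (alpha : R) (a : nat -> R) (s : C) : C :=
  sum_n (fun i => a i * Cprod (map (fun j => s - (INR j / alpha)%R) (seq 0 i))) m.

(* The operator (1/alpha) z d/dz - r. *)
Definition euler_op (alpha : R) (r : C) (phi : R -> C) (z : R) : C :=
  (/ alpha * z)%R * CDerive_n phi 1 z - r * phi z.

(* The upper row of the k-th Wright function; [roots] is s_1, ..., s_m. *)
Definition sol_upper (alpha : R) (roots : list C) (k : nat) : list (C * R) :=
  map (fun r => (1 - (INR k / alpha)%R - r, 1%R)) roots ++ [(RtoC 1, 1%R)].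

Definition sol_lower (alpha : R) (k : nat) : list (C * R) :=
  [(RtoC (1 + alpha - INR k), alpha)].

(* Main.v *)
(** On a power of [z] the Euler operator [(z/alpha) d/dz] is multiplication by the exponent over
    [alpha], and [z^i/alpha^i d^i/dz^i] is the [i]-th Newton polynomial of that operator; so expanding
    the characteristic polynomial in the Newton basis factors the right-hand side of the equation.
    The Riemann-Liouville derivative also acts on powers, by the beta integral:
    [d^alpha z^e = Gamma (1+e) / Gamma (1+e-alpha) z^(e-alpha)].  Both solutions superpose powers, over
    a vertical line for the H-function and over a double series for the Wright functions, and once
    all operators have been moved inside, the equation says that the superposition is invariant
    under shifting the summation variable by one.  For the Wright series this is a change of index,
    whose boundary term vanishes because [1 / Gamma] does so at [0, -1, -2, ...].  For the H-function
    it is a shift of the contour, obtained from Cauchy's theorem for rectangles applied to Gauss'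
    approximations of Gamma (explicit elementary functions that converge locally uniformly) and from
    the bounds [|Gamma (x+iy)| = O (exp (-(PI/2-eps) |y|))] and
    [1 / |Gamma (x+iy)| = O (exp ((PI/2+eps) |y|))], which make the integrand decay for [alpha < m]. *)
Require Import Defs.
From Stdlib Require Import Reals List Lra Lia Psatz Factorial FunctionalExtensionality ClassicalEpsilon.
From Coquelicot Require Import Coquelicot.
Import ListNotations.
Open Scope R_scope.

(** * Limits and derivatives of complex-valued functions *)

(** All facts about Gamma are proved for its reciprocal [rGamma], which has no exceptional points:
    the finite products reach it at an explicit rate [O(1/n)] on discs, and continuity, the
    functional equation and the growth bounds are limits of finite statements.

    Both solutions fit one interface, [superposition], whose central requirement is an exchange with
    improper integrals. It serves the Riemann-Liouville integral and also differentiation: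
    integrating the formally differentiated superposition over a compact interval gives the
    increments of the original one. The coefficients must therefore survive multiplication by
    polynomials in the exponent, whence decay beyond every power on the line and beyond every
    geometric rate in the series.

    Coefficients are kept in the form [D x * rGamma (1 + e)], [e] being the exponent of [z]: the
    fractional derivative only turns [1] into [1 - alpha]. For the H-function the Euler factors turn
    each [Gamma (- r - s)] into [Gamma (1 - r - s)]; the poles move right by one, and this frees the
    strip through which the contour is shifted. *)

Notation Cderiv f x l := (is_derive (K := R_AbsRing) (V := C_R_NormedModule) f x l).
Notation Ccont f x := (continuous (T := R_UniformSpace) (U := C_UniformSpace) f x).
Notation Clim F f l := (filterlim f F (@locally C_UniformSpace l)).

Lemma Ceq (x y : C) : Re x = Re y -> Im x = Im y -> x = y.
Proof. destruct x, y; simpl; intros; subst; reflexivity. Qed.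

Lemma Cmod_ge_minus (x y : C) : Cmod x - Cmod y <= Cmod (x - y)%C.
Proof.
  assert (H := Cmod_triangle (x - y)%C y).
  replace (x - y + y)%C with x in H by ring. lra.
Qed.

Lemma Cmod_minus_sym (x y : C) : Cmod (x - y)%C = Cmod (y - x)%C.
Proof. rewrite <- (Cmod_opp (x - y)%C). f_equal; ring. Qed.

Lemma im_le_Cmod (c : C) : Rabs (Im c) <= Cmod c.
Proof. apply Rle_trans with (2 := Rmax_Cmod c). apply Rmax_r. Qed.

(** Neighbourhoods in [C_UniformSpace] are products of intervals; the norm form of the limit
    replaces them by discs, so that later estimates handle [Cmod] only. *)
Lemma Clim_eps {T} (F : (T -> Prop) -> Prop) {FF : Filter F} (f : T -> C) (l : C) :
  Clim F f l <-> (forall eps, 0 < eps -> F (fun x => Cmod (f x - l)%C < eps)).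
Proof.
  rewrite (filterlim_locally_ball_norm (K := C_AbsRing) (U := C_NormedModule) f l).
  split; intros H.
  - intros eps He. exact (H (mkposreal eps He)).
  - intros eps. exact (H eps (cond_pos eps)).
Qed.

Lemma Clim_mult {T} (F : (T -> Prop) -> Prop) {FF : Filter F} (f g : T -> C) (l m : C) :
  Clim F f l -> Clim F g m -> Clim F (fun x => f x * g x)%C (l * m)%C.
Proof.
  intros Hf Hg. rewrite Clim_eps in Hf, Hg. rewrite Clim_eps.
  2-3: assumption. 2: assumption.
  intros eps He.
  (* With [d <= 1], the three errors [u v], [|l| v] and [u |m|] add up to less than [A d]. *)
  set (A := Cmod l + Cmod m + 1).
  assert (Hl := Cmod_ge_0 l). assert (Hm := Cmod_ge_0 m).
  assert (HA : 0 < A) by (unfold A; lra).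
  set (d := Rmin 1 (eps / A)).
  assert (Hd : 0 < d) by (apply Rmin_pos; [lra | apply Rdiv_lt_0_compat; lra]).
  specialize (Hf d Hd). specialize (Hg d Hd).
  generalize (filter_and _ _ Hf Hg). apply filter_imp.
  intros x [H1 H2].
  replace (f x * g x - l * m)%C with ((f x - l) * (g x - m) + (l * (g x - m) + (f x - l) * m))%C by ring.
  eapply Rle_lt_trans. apply Cmod_triangle.
  eapply Rle_lt_trans. apply Rplus_le_compat_l, Cmod_triangle.
  rewrite !Cmod_mult.
  set (u := Cmod (f x - l)%C) in *. set (v := Cmod (g x - m)%C) in *.
  assert (0 <= u) by apply Cmod_ge_0. assert (0 <= v) by apply Cmod_ge_0.
  assert (d <= 1) by apply Rmin_l.
  assert (HdA : d * A <= eps).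
  { apply Rle_trans with (eps / A * A). apply Rmult_le_compat_r; [lra | apply Rmin_r].
    right; field; lra. }
  unfold A in HdA.
  assert (u * v <= u * 1) by (apply Rmult_le_compat_l; lra).
  assert (Cmod l * v <= Cmod l * d) by (apply Rmult_le_compat_l; lra).
  assert (u * Cmod m <= d * Cmod m) by (apply Rmult_le_compat_r; lra).
  nra.
Qed.

Lemma Clim_plus {T} (F : (T -> Prop) -> Prop) {FF : Filter F} (f g : T -> C) (l m : C) :
  Clim F f l -> Clim F g m -> Clim F (fun x => f x + g x)%C (l + m)%C.
Proof.
  intros Hf Hg. rewrite Clim_eps in Hf, Hg by assumption. rewrite Clim_eps by assumption.
  intros eps He. assert (He2 : 0 < eps / 2) by lra.
  generalize (filter_and _ _ (Hf _ He2) (Hg _ He2)).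
  apply filter_imp. intros x [H1 H2].
  replace (f x + g x - (l + m))%C with ((f x - l) + (g x - m))%C by ring.
  eapply Rle_lt_trans. apply Cmod_triangle. lra.
Qed.

Lemma Clim_const {T} (F : (T -> Prop) -> Prop) {FF : Filter F} (l : C) : Clim F (fun _ => l) l.
Proof. apply filterlim_const. Qed.

Lemma Clim_minus {T} (F : (T -> Prop) -> Prop) {FF : Filter F} (f g : T -> C) (l m : C) :
  Clim F f l -> Clim F g m -> Clim F (fun x => f x - g x)%C (l - m)%C.
Proof.
  intros Hf Hg. apply Clim_plus; auto.
  replace (- m)%C with (- (1) * m)%C by ring.
  apply filterlim_ext with (fun x => (- (1) * g x)%C). intros; ring.
  apply Clim_mult; auto. apply Clim_const. all: assumption.
Qed.

Lemma Clim_inv {T} (F : (T -> Prop) -> Prop) {FF : Filter F} (f : T -> C) (l : C) :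
  l <> 0%C -> Clim F f l -> Clim F (fun x => / f x)%C (/ l)%C.
Proof.
  intros Hl Hf. rewrite Clim_eps in Hf by assumption. rewrite Clim_eps by assumption.
  intros eps He.
  assert (Hm : 0 < Cmod l) by (apply Cmod_gt_0; auto).
  set (d := Rmin (Cmod l / 2) (eps * Cmod l * Cmod l / 2)).
  assert (Hd : 0 < d).
  { apply Rmin_pos. lra. apply Rdiv_lt_0_compat; [|lra]. repeat apply Rmult_lt_0_compat; lra. }
  generalize (Hf d Hd). apply filter_imp. intros x Hx.
  assert (d <= Cmod l / 2) by apply Rmin_l.
  assert (d <= eps * Cmod l * Cmod l / 2) by apply Rmin_r.
  assert (H1 := Cmod_ge_minus l (f x)). rewrite Cmod_minus_sym in H1.
  assert (Hfx : Cmod l / 2 < Cmod (f x)) by lra.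
  assert (Hf0 : f x <> 0%C) by (apply Cmod_gt_0; lra).
  replace (/ f x - / l)%C with ((l - f x) / (f x * l))%C by (field; auto).
  rewrite Cmod_div by (apply Cmult_neq_0; auto). rewrite Cmod_mult, Cmod_minus_sym.
  apply Rmult_lt_reg_r with (Cmod (f x) * Cmod l). apply Rmult_lt_0_compat; lra.
  replace (Cmod (f x - l)%C / (Cmod (f x) * Cmod l) * (Cmod (f x) * Cmod l)) with (Cmod (f x - l)%C)
    by (field; lra).
  apply Rlt_le_trans with (1 := Hx).
  apply Rle_trans with (1 := H0).
  assert (0 < eps * Cmod l) by (apply Rmult_lt_0_compat; lra). nra.
Qed.

Lemma Clim_comp {T} (F : (T -> Prop) -> Prop) {FF : Filter F} (f : T -> C) (g : C -> C) (l : C) :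
  continuous g l -> Clim F f l -> Clim F (fun x => g (f x)) (g l).
Proof. intros Hg Hf. eapply filterlim_comp; [exact Hf | exact Hg]. Qed.

Lemma Clim_RtoC {T} (F : (T -> Prop) -> Prop) {FF : Filter F} (f : T -> R) (l : R) :
  filterlim f F (locally l) -> Clim F (fun x => RtoC (f x)) (RtoC l).
Proof.
  intros H. rewrite Clim_eps by assumption. intros eps He.
  assert (H1 := proj1 (filterlim_locally (F := F) f l) H (mkposreal eps He)).
  revert H1. apply filter_imp. intros x Hx.
  rewrite <- RtoC_minus, Cmod_R. exact Hx.
Qed.

Lemma Clim_Re {T} (F : (T -> Prop) -> Prop) {FF : Filter F} (f : T -> C) (l : C) :
  Clim F f l -> filterlim (fun x => Re (f x)) F (locally (Re l)).
Proof.
  intros H. rewrite Clim_eps in H by assumption. apply filterlim_locally. intros eps.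
  generalize (H eps (cond_pos eps)). apply filter_imp. intros x Hx.
  apply Rle_lt_trans with (2 := Hx). apply (re_le_Cmod (f x - l)%C).
Qed.

Lemma Clim_Im {T} (F : (T -> Prop) -> Prop) {FF : Filter F} (f : T -> C) (l : C) :
  Clim F f l -> filterlim (fun x => Im (f x)) F (locally (Im l)).
Proof.
  intros H. rewrite Clim_eps in H by assumption. apply filterlim_locally. intros eps.
  generalize (H eps (cond_pos eps)). apply filter_imp. intros x Hx.
  apply Rle_lt_trans with (2 := Hx). apply (im_le_Cmod (f x - l)%C).
Qed.

Lemma Clim_pair {T} (F : (T -> Prop) -> Prop) {FF : Filter F} (f g : T -> R) (l m : R) :
  filterlim f F (locally l) -> filterlim g F (locally m) ->
  Clim F (fun x => (f x, g x)) ((l, m) : C).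
Proof.
  intros Hf Hg.
  apply filterlim_ext with (fun x => (RtoC (f x) + RtoC (g x) * Ci)%C).
  { intros x. unfold RtoC, Ci, Cplus, Cmult; simpl. f_equal; ring. }
  replace ((l, m) : C) with (RtoC l + RtoC m * Ci)%C
    by (unfold RtoC, Ci, Cplus, Cmult; simpl; f_equal; ring).
  apply Clim_plus; auto. apply Clim_RtoC; auto.
  apply Clim_mult; auto. apply Clim_RtoC; auto. apply Clim_const. all: assumption.
Qed.

Lemma Clim_Cmod {T} (F : (T -> Prop) -> Prop) {FF : Filter F} (f : T -> C) (l : C) :
  Clim F f l -> filterlim (fun x => Cmod (f x)) F (locally (Cmod l)).
Proof.
  intros H. rewrite Clim_eps in H by assumption. apply filterlim_locally. intros eps.
  generalize (H eps (cond_pos eps)). apply filter_imp. intros x Hx.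
  apply Rle_lt_trans with (2 := Hx).
  change (Rabs (Cmod (f x) - Cmod l) <= Cmod (f x - l)%C).
  assert (H1 := Cmod_ge_minus (f x) l). assert (H2 := Cmod_ge_minus l (f x)).
  rewrite (Cmod_minus_sym l) in H2. apply Rabs_le; lra.
Qed.

Lemma Clim_unique {T} (F : (T -> Prop) -> Prop) {FF : ProperFilter F} (f : T -> C) (l m : C) :
  Clim F f l -> Clim F f m -> l = m.
Proof.
  intros H1 H2. assert (H := Clim_minus F f f l m H1 H2).
  rewrite Clim_eps in H by apply FF.
  destruct (Req_dec (Cmod (l - m)%C) 0) as [H0|H0].
  - apply Cmod_eq_0 in H0. replace l with (l - m + m)%C by ring. rewrite H0; ring.
  - exfalso. assert (0 < Cmod (l - m)%C) by (assert (H3 := Cmod_ge_0 (l - m)%C); lra).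
    destruct (filter_ex _ (H _ H3)) as [x Hx].
    replace (f x - f x - (l - m))%C with (- (l - m))%C in Hx by ring.
    rewrite Cmod_opp in Hx. lra.
Qed.

Lemma Clim_le {T} (F : (T -> Prop) -> Prop) {FF : ProperFilter F} (f : T -> C) (l : C) (M : R) :
  Clim F f l -> F (fun x => Cmod (f x) <= M) -> Cmod l <= M.
Proof.
  intros H1 H2. apply Clim_Cmod in H1; [|apply FF].
  apply (filterlim_le (F := F) (fun x => Cmod (f x)) (fun _ => M) (Cmod l) M); auto.
  apply filterlim_const.
Qed.

Lemma Clim_squeeze {T} (F : (T -> Prop) -> Prop) {FF : Filter F} (f : T -> C) (l : C) (g : T -> R) :
  F (fun x => Cmod (f x - l)%C <= g x) -> filterlim g F (locally 0) -> Clim F f l.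
Proof.
  intros H1 H2. rewrite Clim_eps by assumption. intros eps He.
  assert (H3 := proj1 (filterlim_locally (F := F) g 0) H2 (mkposreal eps He)).
  generalize (filter_and _ _ H1 H3). apply filter_imp. intros x [H4 H5].
  change (Rabs (g x - 0) < eps) in H5.
  apply Rle_lt_trans with (1 := H4). apply Rabs_def2 in H5. lra.
Qed.

(** Reduces the calculus of complex-valued functions to their two coordinates; the rules for
    products, inverses and exponentials below become real computations. *)
Lemma Cderiv_comps (f : R -> C) (x : R) (l : C) :
  Cderiv f x l <->
  is_derive (fun t => Re (f t)) x (Re l) /\ is_derive (fun t => Im (f t)) x (Im l).
Proof.
  split.
  - intros H. split.
    + apply (filterdiff_comp' (U := R_NormedModule) (V := C_R_NormedModule) (W := R_NormedModule) f
        (fun z : C => fst z) x (fun y => scal y l) (fun z : C => fst z)).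
      exact H. apply filterdiff_linear, is_linear_fst.
    + apply (filterdiff_comp' (U := R_NormedModule) (V := C_R_NormedModule) (W := R_NormedModule) f
        (fun z : C => snd z) x (fun y => scal y l) (fun z : C => snd z)).
      exact H. apply filterdiff_linear, is_linear_snd.
  - intros [H1 H2].
    assert (H := filterdiff_comp'_2 (T := R_NormedModule) (U := R_NormedModule) (V := R_NormedModule)
      (W := C_R_NormedModule) (fun t => Re (f t)) (fun t => Im (f t))
      (fun a b => (a, b) : C) x _ _ (fun a b => (a, b) : C) H1 H2).
    assert (E : (fun y => (Re (f y), Im (f y)) : C) = f).
    { apply functional_extensionality. intros y. destruct (f y); reflexivity. }
    unfold is_derive. rewrite <- E.
    eapply filterdiff_ext_lin. apply H.
    + apply (filterdiff_linear (U := prod_NormedModule R_AbsRing R_NormedModule R_NormedModule)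
        (V := C_R_NormedModule) (fun p => (fst p, snd p))).
      apply (is_linear_ext (fun p : R * R => p)). intros []; reflexivity.
      apply is_linear_id.
    + intros y. reflexivity.
Qed.

Lemma is_derive_mult_R (u v : R -> R) (x du dv : R) :
  is_derive u x du -> is_derive v x dv -> is_derive (fun t => u t * v t) x (du * v x + u x * dv).
Proof. intros. apply (is_derive_mult (K := R_AbsRing) u v); auto. intros; apply Rmult_comm. Qed.

Lemma is_derive_plus_R (u v : R -> R) (x du dv : R) :
  is_derive u x du -> is_derive v x dv -> is_derive (fun t => u t + v t) x (du + dv).
Proof. intros. apply (is_derive_plus (V := R_NormedModule)); auto. Qed.

Lemma is_derive_minus_R (u v : R -> R) (x du dv : R) :
  is_derive u x du -> is_derive v x dv -> is_derive (fun t => u t - v t) x (du - dv).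
Proof. intros. apply (is_derive_minus (V := R_NormedModule)); auto. Qed.

Lemma is_derive_eq (f : R -> R) (x l l' : R) : is_derive f x l -> l = l' -> is_derive f x l'.
Proof. intros H <-; exact H. Qed.

Lemma Cderiv_mult (f g : R -> C) (x : R) (df dg : C) :
  Cderiv f x df -> Cderiv g x dg -> Cderiv (fun t => f t * g t)%C x (df * g x + f x * dg)%C.
Proof.
  rewrite !Cderiv_comps. intros [H1 H2] [H3 H4]. split.
  - eapply is_derive_eq.
    apply (is_derive_minus_R (fun t => Re (f t) * Re (g t)) (fun t => Im (f t) * Im (g t)));
      apply is_derive_mult_R; eassumption.
    simpl. unfold Re, Im. ring.
  - eapply is_derive_eq.
    apply (is_derive_plus_R (fun t => Re (f t) * Im (g t)) (fun t => Im (f t) * Re (g t)));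
      apply is_derive_mult_R; eassumption.
    simpl. unfold Re, Im. ring.
Qed.

Lemma Cderiv_plus (f g : R -> C) (x : R) (df dg : C) :
  Cderiv f x df -> Cderiv g x dg -> Cderiv (fun t => f t + g t)%C x (df + dg)%C.
Proof. intros. apply (is_derive_plus (V := C_R_NormedModule)); assumption. Qed.

Lemma Cderiv_const (c : C) (x : R) : Cderiv (fun _ => c) x (RtoC 0).
Proof. apply (is_derive_const (V := C_R_NormedModule)). Qed.

Lemma Cderiv_cmult (c : C) (f : R -> C) (x : R) (df : C) :
  Cderiv f x df -> Cderiv (fun t => c * f t)%C x (c * df)%C.
Proof.
  intros H. replace (c * df)%C with (0 * f x + c * df)%C by ring.
  apply (Cderiv_mult (fun _ => c)); auto. apply Cderiv_const.
Qed.

Lemma Cderiv_eq (f : R -> C) (x : R) (l l' : C) : Cderiv f x l -> l = l' -> Cderiv f x l'.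
Proof. intros H <-; exact H. Qed.

Lemma Cderiv_RtoC (f : R -> R) (x l : R) : is_derive f x l -> Cderiv (fun t => RtoC (f t)) x (RtoC l).
Proof. intros H. apply Cderiv_comps. split; simpl; auto. apply (is_derive_const (V := R_NormedModule)). Qed.

Lemma Cderiv_affine (p q : C) (x : R) : Cderiv (fun t => p + t * q)%C x q.
Proof.
  apply Cderiv_eq with (0 + (1 * q + x * 0))%C; [|ring].
  apply (Cderiv_plus (fun _ => p)). apply Cderiv_const.
  apply (Cderiv_mult (fun t => RtoC t) (fun _ => q)). apply (Cderiv_RtoC (fun t => t)).
  apply (is_derive_id (K := R_AbsRing)).
  apply Cderiv_const.
Qed.

Lemma Cderiv_inv (f : R -> C) (x : R) (df : C) :
  f x <> 0%C -> Cderiv f x df -> Cderiv (fun t => / f t)%C x (- df / (f x * f x))%C.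
Proof.
  intros H0. rewrite !Cderiv_comps. intros [H1 H2].
  assert (Hn : Re (f x) ^ 2 + Im (f x) ^ 2 <> 0).
  { rewrite <- Cmod2_alt. apply pow_nonzero. apply Rgt_not_eq. apply Cmod_gt_0; auto. }
  assert (Hi : is_derive (fun t => / (Re (f t) ^ 2 + Im (f t) ^ 2)) x
     (- (2 * Re (f x) * Re df + 2 * Im (f x) * Im df) / (Re (f x) ^ 2 + Im (f x) ^ 2) ^ 2)).
  { apply (is_derive_inv (fun t => Re (f t) ^ 2 + Im (f t) ^ 2)); auto.
    eapply is_derive_eq. apply is_derive_plus_R.
    apply (is_derive_pow (fun t => Re (f t)) 2 x _ H1). apply (is_derive_pow (fun t => Im (f t)) 2 x _ H2).
    simpl. ring. }
  (* The denominator met here is [|f^2|^2] in coordinates, that is [|f|^4]. *)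
  assert (Ha : forall a b c d : R, a ^ 2 + b ^ 2 <> 0 -> (a * a - b * b) ^ 2 + (a * b + b * a) ^ 2 <> 0).
  { intros a b _ _ Hab. replace ((a * a - b * b) ^ 2 + (a * b + b * a) ^ 2) with ((a ^ 2 + b ^ 2) ^ 2) by ring.
    apply pow_nonzero; auto. }
  split.
  - eapply is_derive_eq. apply (is_derive_mult_R (fun t => Re (f t)) _ x _ _ H1 Hi).
    cbv beta; unfold Re, Im in *; destruct (f x) as [a b]; destruct df as [c d]; simpl in *. specialize (Ha a b c d Hn).
    field. simpl in Ha. split; [intros E; apply Ha; lra | lra].
  - eapply is_derive_eq. apply (is_derive_mult_R (fun t => - Im (f t)) _ x (- Im df)).
    apply (is_derive_opp (V := R_NormedModule) (fun t => Im (f t))). exact H2. apply Hi.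
    cbv beta; unfold Re, Im in *; destruct (f x) as [a b]; destruct df as [c d]; simpl in *. specialize (Ha a b c d Hn).
    field. simpl in Ha. split; [intros E; apply Ha; lra | lra].
Qed.

Lemma Cderiv_cont (f : R -> C) (x : R) (l : C) : Cderiv f x l -> Ccont f x.
Proof. intros H. apply (ex_derive_continuous (V := C_R_NormedModule) f). exists l; exact H. Qed.

(** * The complex exponential *)

Lemma Cexp_plus (z w : C) : Cexp (z + w) = (Cexp z * Cexp w)%C.
Proof.
  destruct z as [a b], w as [c d]. unfold Cexp, Cmult, Cplus, Re, Im; simpl.
  rewrite exp_plus, cos_plus, sin_plus. f_equal; ring.
Qed.

Lemma Cexp_0 : Cexp 0 = 1%C.
Proof. unfold Cexp; simpl. rewrite exp_0, cos_0, sin_0. apply Ceq; simpl; ring. Qed.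

Lemma Cexp_RtoC (x : R) : Cexp (RtoC x) = RtoC (exp x).
Proof. unfold Cexp; simpl. rewrite cos_0, sin_0. apply Ceq; simpl; ring. Qed.

Lemma Cmod_Cexp (z : C) : Cmod (Cexp z) = exp (Re z).
Proof.
  rewrite <- (sqrt_Rsqr (exp (Re z))) by (left; apply exp_pos).
  unfold Cexp, Cmod; simpl. f_equal.
  assert (H := sin2_cos2 (Im z)). unfold Rsqr in *.
  transitivity (exp (Re z) * exp (Re z) * (sin (Im z) * sin (Im z) + cos (Im z) * cos (Im z))).
  ring. rewrite H; ring.
Qed.

Lemma Cexp_neq_0 (z : C) : Cexp z <> 0%C.
Proof. apply Cmod_gt_0. rewrite Cmod_Cexp. apply exp_pos. Qed.

Lemma Cexp_opp (z : C) : Cexp (- z) = (/ Cexp z)%C.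
Proof.
  assert (H : (Cexp (- z) * Cexp z)%C = 1%C).
  { rewrite <- Cexp_plus. replace (- z + z)%C with (RtoC 0) by ring. apply Cexp_0. }
  rewrite <- (Cmult_1_l (/ Cexp z)%C), <- H. field. apply Cexp_neq_0.
Qed.

Lemma Cderiv_Cexp (f : R -> C) (x : R) (df : C) :
  Cderiv f x df -> Cderiv (fun t => Cexp (f t)) x (df * Cexp (f x))%C.
Proof.
  rewrite !Cderiv_comps. intros [H1 H2].
  assert (He : is_derive (fun t => exp (Re (f t))) x (Re df * exp (Re (f x)))).
  { apply (is_derive_comp (V := R_NormedModule) exp (fun t => Re (f t))); auto. apply is_derive_exp. }
  split.
  - eapply is_derive_eq. apply (is_derive_mult_R (fun t => exp (Re (f t))) (fun t => cos (Im (f t)))). exact He.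
    apply (is_derive_comp (V := R_NormedModule) cos (fun t => Im (f t))); [apply is_derive_cos | exact H2].
    unfold Cexp, Cmult, Re, Im, scal; simpl. unfold mult; simpl. ring.
  - eapply is_derive_eq. apply (is_derive_mult_R (fun t => exp (Re (f t))) (fun t => sin (Im (f t)))). exact He.
    apply (is_derive_comp (V := R_NormedModule) sin (fun t => Im (f t))); [apply is_derive_sin | exact H2].
    unfold Cexp, Cmult, Re, Im, scal; simpl. unfold mult; simpl. ring.
Qed.

Lemma exp_le_compat (x y : R) : x <= y -> exp x <= exp y.
Proof. intros [H | ->]; [left; apply exp_increasing; auto | right; reflexivity]. Qed.

(** The mean value theorem fails for complex values, so the increment is written as the integral of
    [df] and the integral is bounded. *)
Lemma Cmod_increment_le (f df : R -> C) (M a b : R) : a <= b ->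
  (forall t, a <= t <= b -> Cderiv f t (df t)) ->
  (forall t, a <= t <= b -> Ccont df t) ->
  (forall t, a <= t <= b -> Cmod (df t) <= M) ->
  Cmod (f b - f a)%C <= M * (b - a).
Proof.
  intros Hab H1 H2 H3.
  assert (HI : is_RInt (V := C_R_NormedModule) df a b (minus (G := C_R_NormedModule) (f b) (f a))).
  { apply (is_RInt_derive (V := C_R_CompleteNormedModule)); intros x; rewrite Rmin_left, Rmax_right by lra.
    apply H1. apply H2. }
  assert (H := norm_RInt_le (V := C_R_NormedModule) df (fun _ => M) a b _ _ Hab
    (fun x Hx => eq_ind _ (fun r => r <= M) (H3 x Hx) _ (Cmod_norm (df x))) HI
    (is_RInt_const (V := R_NormedModule) a b M)).
  rewrite <- Cmod_norm in H. unfold scal in H; simpl in H. unfold mult in H; simpl in H.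
  rewrite Rmult_comm. exact H.
Qed.

Lemma continuous_Cexp (z : C) : continuous Cexp z.
Proof.
  assert (FF : Filter (@locally C_UniformSpace z)) by apply locally_filter.
  unfold continuous. apply (Clim_pair _ (fun z => exp (Re z) * cos (Im z)) (fun z => exp (Re z) * sin (Im z))).
  - assert (Hid : Clim (@locally C_UniformSpace z) (fun z => z) z) by apply filterlim_id.
    apply (continuous_mult (U := C_UniformSpace) (K := R_AbsRing) (fun z => exp (Re z)) (fun z => cos (Im z))).
    + apply continuous_comp. apply (Clim_Re _ _ _ Hid). apply continuous_exp.
    + apply (continuous_comp (fun z : C => Im z) cos). apply (Clim_Im _ _ _ Hid). apply continuous_cos.
  - assert (Hid : Clim (@locally C_UniformSpace z) (fun z => z) z) by apply filterlim_id.
    apply (continuous_mult (U := C_UniformSpace) (K := R_AbsRing) (fun z => exp (Re z)) (fun z => sin (Im z))).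
    + apply continuous_comp. apply (Clim_Re _ _ _ Hid). apply continuous_exp.
    + apply (continuous_comp (fun z : C => Im z) sin). apply (Clim_Im _ _ _ Hid). apply continuous_sin.
Qed.

(** Mean value inequality along the segment [t w], [0 <= t <= 1], on which the derivative has
    modulus at most [|w| exp |w|]. *)
Lemma Cexp_minus_1 (w : C) : Cmod (Cexp w - 1)%C <= Cmod w * exp (Cmod w).
Proof.
  assert (H := Cmod_increment_le (fun t => Cexp (0 + t * w)) (fun t => w * Cexp (0 + t * w))%C
    (Cmod w * exp (Cmod w)) 0 1 Rle_0_1).
  cbv beta in H. replace (Cexp (0 + 1 * w)) with (Cexp w) in H by (f_equal; ring).
  replace (Cexp (0 + 0 * w)) with (RtoC 1) in H by (rewrite <- Cexp_0; f_equal; ring).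
  rewrite Rminus_0_r, Rmult_1_r in H. apply H; clear H.
  - intros t _. apply Cderiv_Cexp, Cderiv_affine.
  - intros t _. eapply Cderiv_cont, Cderiv_cmult, Cderiv_Cexp, Cderiv_affine.
  - intros t Ht. rewrite Cmod_mult, Cmod_Cexp. apply Rmult_le_compat_l. apply Cmod_ge_0.
    apply exp_le_compat. simpl.
    assert (H := re_le_Cmod w). unfold Re in *. apply Rabs_le_between in H.
    assert (H0 := Cmod_ge_0 w). nra.
Qed.

(** Same segment, after subtracting the linear part: the derivative is [w (Cexp (t w) - 1)], to
    which the first-order bound applies. *)
Lemma Cexp_minus_1_w (w : C) : Cmod (Cexp w - 1 - w)%C <= Cmod w * Cmod w * exp (Cmod w).
Proof.
  assert (H := Cmod_increment_le (fun t => Cexp (0 + t * w) + (0 + t * (- w)))%C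
    (fun t => w * Cexp (0 + t * w) + (- w))%C
    (Cmod w * Cmod w * exp (Cmod w)) 0 1 Rle_0_1).
  cbv beta in H. replace (Cexp (0 + 1 * w)) with (Cexp w) in H by (f_equal; ring).
  replace (Cexp (0 + 0 * w)) with (RtoC 1) in H by (rewrite <- Cexp_0; f_equal; ring).
  rewrite Rminus_0_r, Rmult_1_r in H.
  replace (Cexp w + (0 + 1 * - w) - (1 + (0 + 0 * - w)))%C with (Cexp w - 1 - w)%C in H by ring.
  apply H; clear H.
  - intros t _. apply Cderiv_plus. apply Cderiv_Cexp, Cderiv_affine. apply Cderiv_affine.
  - intros t _. eapply Cderiv_cont, Cderiv_plus. eapply Cderiv_cmult, Cderiv_Cexp, Cderiv_affine. apply Cderiv_const.
  - intros t Ht. replace (w * Cexp (0 + t * w) + - w)%C with (w * (Cexp (0 + t * w) - 1))%C by ring.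
    rewrite Cmod_mult, Rmult_assoc. apply Rmult_le_compat_l. apply Cmod_ge_0.
    eapply Rle_trans. apply Cexp_minus_1.
    assert (E : Cmod (0 + t * w)%C <= Cmod w).
    { rewrite Cplus_0_l, Cmod_mult, Cmod_R, Rabs_pos_eq by lra. assert (H0 := Cmod_ge_0 w). nra. }
    apply Rmult_le_compat; auto. apply Cmod_ge_0. left; apply exp_pos. apply exp_le_compat; auto.
Qed.

(** * The entire function 1/Gamma *)

Lemma Cinv_0 : (/ RtoC 0)%C = RtoC 0.
Proof. unfold Cinv; simpl. apply Ceq; simpl; unfold Rdiv; ring. Qed.

Lemma Cinv_mult (x y : C) : (/ (x * y))%C = (/ x * / y)%C.
Proof.
  destruct (Ceq_dec x 0) as [-> | Hx]. rewrite Cmult_0_l, Cinv_0. ring.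
  destruct (Ceq_dec y 0) as [-> | Hy]. rewrite Cmult_0_r, Cinv_0. ring.
  field; auto.
Qed.

Lemma Cinv_inv (x : C) : (/ / x)%C = x.
Proof.
  destruct (Ceq_dec x 0) as [-> | Hx]. now rewrite !Cinv_0.
  field; auto.
Qed.

Lemma Cprod_app (l m : list C) : Cprod (l ++ m) = (Cprod l * Cprod m)%C.
Proof. induction l; simpl. ring. unfold Cprod in *; simpl. rewrite IHl. ring. Qed.

Lemma ln_le_minus_1 (x : R) : 0 < x -> ln x <= x - 1.
Proof.
  intros H. rewrite <- (ln_exp (x - 1)). apply ln_le; auto.
  assert (H1 := exp_ineq1_le (x - 1)). lra.
Qed.

Lemma ln_1_minus_bounds (h : R) : 0 <= h <= 1/2 -> - h - 2 * h * h <= ln (1 - h) <= - h.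
Proof.
  intros Hh. split.
  - assert (H := ln_le_minus_1 (/ (1 - h)) ltac:(apply Rinv_0_lt_compat; lra)).
    rewrite ln_Rinv in H by lra.
    assert (/ (1 - h) - 1 <= h + 2 * h * h).
    { apply Rmult_le_reg_r with (1 - h). lra. field_simplify; nra. }
    lra.
  - assert (H := ln_le_minus_1 (1 - h) ltac:(lra)). lra.
Qed.

(** The bases that occur are positive reals. There this is the principal power [Cpower], additive in
    the exponent with no branch to watch. *)
Definition cpw (x : R) (e : C) : C := Cexp (e * RtoC (ln x)).

Lemma Cpower_pos (x : R) (z : C) : 0 < x -> Cpower (RtoC x) z = cpw x z.
Proof.
  intros Hx. unfold Cpower, cpw, Clog, Carg. f_equal. f_equal.
  rewrite Cmod_R, Rabs_pos_eq by lra. simpl.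
  destruct (Rle_dec 0 0) as [_ | H]; [|lra].
  replace (x / x) with 1 by (field; lra). rewrite acos_1. reflexivity.
Qed.

Lemma Cmod_cpw (x : R) (e : C) : Cmod (cpw x e) = Rpower x (Re e).
Proof. unfold cpw, Rpower. rewrite Cmod_Cexp, re_scal_r. reflexivity. Qed.

Lemma cpw_plus (x : R) (e f : C) : cpw x (e + f) = (cpw x e * cpw x f)%C.
Proof. unfold cpw. rewrite <- Cexp_plus. f_equal. ring. Qed.

Lemma cpw_RtoC (x r : R) : cpw x (RtoC r) = RtoC (Rpower x r).
Proof. unfold cpw, Rpower. rewrite <- RtoC_mult. apply Cexp_RtoC. Qed.

Lemma cpw_neq_0 (x : R) (e : C) : cpw x e <> 0.
Proof. apply Cexp_neq_0. Qed.

(** * Gauss' product and its limit *)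

Definition rprod (n : nat) (z : C) : C := Cprod (map (fun k => z + RtoC (INR k))%C (seq 0 (S n))).

Lemma rprod_S (n : nat) (z : C) : rprod (S n) z = (rprod n z * (z + RtoC (INR (S n))))%C.
Proof.
  unfold rprod. rewrite (seq_S (S n)), map_app, Cprod_app.
  unfold Cprod at 2. unfold map at 2, fold_right. rewrite Nat.add_0_l. ring.
Qed.

Lemma rprod_0 (z : C) : rprod 0 z = z.
Proof. unfold rprod, Cprod; simpl. ring. Qed.

Lemma rprod_shift (n : nat) (z : C) :
  (rprod n (z + 1) * z)%C = (rprod n z * (z + RtoC (INR (S n))))%C.
Proof.
  induction n.
  - rewrite !rprod_0. simpl. ring.
  - rewrite !rprod_S. replace (rprod n (z + 1) * (z + 1 + RtoC (INR (S n))) * z)%C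
      with (rprod n (z + 1) * z * (z + 1 + RtoC (INR (S n))))%C by ring.
    rewrite IHn. replace (z + 1 + RtoC (INR (S n)))%C with (z + RtoC (INR (S (S n))))%C. ring.
    rewrite (S_INR (S n)), RtoC_plus. ring.
Qed.

Lemma rprod_zero_iff (n : nat) (z : C) :
  rprod n z = 0 <-> exists k, (k <= n)%nat /\ z = (- RtoC (INR k))%C.
Proof.
  induction n.
  - rewrite rprod_0. split.
    + intros ->. exists O. split; auto. simpl. ring.
    + intros [k [Hk ->]]. replace k with O by lia. simpl. ring.
  - rewrite rprod_S. split.
    + intros H. destruct (Ceq_dec (z + RtoC (INR (S n)))%C 0) as [H1 | H1].
      * exists (S n). split; auto. replace z with (z + RtoC (INR (S n)) - RtoC (INR (S n)))%C by ring.
        rewrite H1. ring.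
      * destruct (Ceq_dec (rprod n z) 0) as [H2 | H2].
        apply IHn in H2. destruct H2 as [k [Hk E]]. exists k. split; auto.
        exfalso. apply (Cmult_neq_0 _ _ H2 H1 H).
    + intros [k [Hk E]]. destruct (Nat.eq_dec k (S n)) as [-> | Hk'].
      * rewrite E. ring.
      * replace (rprod n z) with (RtoC 0). ring. symmetry. apply IHn. exists k; split; auto. lia.
Qed.

(** The reciprocal of [Gamma_seq z n] for [n >= 1]: an exponential times a polynomial, hence entire
    in [z], with zeros exactly at [0, -1, ..., -n]. *)
Definition rGamma_seq (n : nat) (z : C) : C :=
  (/ RtoC (INR (fact n)) * cpw (INR n) (- z) * rprod n z)%C.

(* [Gamma] vanishes at its poles and [/ 0 = 0], so this is the entire function 1/Gamma at every [z]. *)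
Definition rGamma (z : C) : C := (/ Gamma z)%C.

Lemma RtoC_INR_fact_neq_0 n : RtoC (INR (fact n)) <> 0.
Proof. intros H. apply RtoC_inj in H. apply (INR_fact_neq_0 n H). Qed.

Lemma Gamma_seq_inv (z : C) (n : nat) : (1 <= n)%nat -> Gamma_seq z n = (/ rGamma_seq n z)%C.
Proof.
  intros Hn. unfold Gamma_seq, rGamma_seq.
  rewrite Cpower_pos by (apply lt_0_INR; lia).
  rewrite !Cinv_mult, Cinv_inv. unfold Cdiv. fold (rprod n z). f_equal. f_equal.
  unfold cpw. rewrite <- Cexp_opp. f_equal. ring.
Qed.

(** Quotient of consecutive approximations for [h = 1 / (n + 1)]. It is [(1 + z h) (1 - h)^z], whose
    terms of first order in [h] cancel. *)
Definition rGamma_ratio (h : R) (z : C) : C := ((1 + z * RtoC h) * Cexp (z * RtoC (ln (1 - h))))%C.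

Lemma rGamma_seq_S (n : nat) (z : C) : (1 <= n)%nat ->
  rGamma_seq (S n) z = (rGamma_seq n z * rGamma_ratio (/ INR (S n)) z)%C.
Proof.
  intros Hn. assert (H0 : 0 < INR n) by (apply lt_0_INR; lia).
  assert (H1 : 0 < INR (S n)) by (apply lt_0_INR; lia).
  unfold rGamma_seq, rGamma_ratio. rewrite rprod_S.
  rewrite fact_simpl, mult_INR, RtoC_mult, Cinv_mult, RtoC_inv by lra.
  replace (1 - / INR (S n)) with (INR n / INR (S n)).
  2: rewrite S_INR in *; field; lra.
  rewrite ln_div by lra.
  replace (cpw (INR (S n)) (- z)) with (cpw (INR n) (- z) * Cexp (z * RtoC (ln (INR n) - ln (INR (S n)))))%C.
  2: { unfold cpw. rewrite <- Cexp_plus. f_equal. rewrite RtoC_minus. ring. }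
  field. split; [intros E; apply RtoC_inj in E; lra | apply RtoC_INR_fact_neq_0].
Qed.

Definition rGamma_ratio_const (M : R) : R := 4 * (1 + M) * M * M * exp M + 2 * M + 2 * M * M.

Lemma rGamma_ratio_const_pos (M : R) : 0 <= M -> 0 <= rGamma_ratio_const M.
Proof.
  intros H. unfold rGamma_ratio_const. assert (0 < exp M) by apply exp_pos.
  assert (0 <= (1 + M) * M * M * exp M) by (repeat apply Rmult_le_pos; lra). nra.
Qed.

(** Up to second order [w = z ln (1 - h)] is [- z h], so the linear parts of [1 + z h] and [Cexp w]
    cancel. The three summands of [rGamma_ratio_const] bound, in order, the remainder of the
    exponential, that of the logarithm, and the product of the linear parts. *)
Lemma rGamma_ratio_bound (M h : R) (z : C) : Cmod z <= M -> 0 <= h <= 1/2 ->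
  Cmod (rGamma_ratio h z - 1)%C <= rGamma_ratio_const M * (h * h).
Proof.
  intros Hz Hh. unfold rGamma_ratio.
  assert (Hz0 := Cmod_ge_0 z).
  destruct (ln_1_minus_bounds h Hh) as [L1 L2].
  set (w := (z * RtoC (ln (1 - h)))%C).
  assert (Hln : Rabs (ln (1 - h)) <= 2 * h) by (apply Rabs_le; nra).
  assert (Hw : Cmod w <= 2 * M * h).
  { unfold w. rewrite Cmod_mult, Cmod_R. replace (2 * M * h) with (M * (2 * h)) by ring.
    apply Rmult_le_compat; auto. apply Rabs_pos. }
  assert (Hw0 := Cmod_ge_0 w).
  assert (HwM : Cmod w <= M) by nra.
  replace ((1 + z * RtoC h) * Cexp w - 1)%C with
    ((1 + z * RtoC h) * (Cexp w - 1 - w) + (z * RtoC (h + ln (1 - h)) + z * RtoC h * w))%C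
    by (unfold w; rewrite RtoC_plus; ring).
  eapply Rle_trans. apply Cmod_triangle.
  eapply Rle_trans. apply Rplus_le_compat_l, Cmod_triangle.
  rewrite !Cmod_mult, !Cmod_R, (Rabs_pos_eq h) by lra.
  assert (E1 : Cmod (1 + z * RtoC h)%C <= 1 + M).
  { eapply Rle_trans. apply Cmod_triangle. rewrite Cmod_1, Cmod_mult, Cmod_R, (Rabs_pos_eq h) by lra. nra. }
  assert (E2 : Cmod (Cexp w - 1 - w)%C <= 4 * M * M * (h * h) * exp M).
  { eapply Rle_trans. apply Cexp_minus_1_w.
    apply Rmult_le_compat. nra. left; apply exp_pos. nra. apply exp_le_compat; auto. }
  assert (E3 : Rabs (h + ln (1 - h)) <= 2 * (h * h)) by (apply Rabs_le; nra).
  assert (E4 : Cmod (1 + z * RtoC h)%C * Cmod (Cexp w - 1 - w)%C <= (1 + M) * (4 * M * M * (h * h) * exp M))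
    by (apply Rmult_le_compat; auto using Cmod_ge_0).
  assert (E5 : Cmod z * Rabs (h + ln (1 - h)) <= M * (2 * (h * h)))
    by (apply Rmult_le_compat; auto using Cmod_ge_0, Rabs_pos).
  assert (E6 : Cmod z * h * Cmod w <= M * h * (2 * M * h)).
  { apply Rmult_le_compat; auto using Cmod_ge_0. nra. nra. }
  unfold rGamma_ratio_const. nra.
Qed.

(** Since [h^2 <= 1/m - 1/(m+1)] for [h = 1/(m+1)], the errors of the successive quotients
    telescope: their product grows at most like the exponential of [K/n - K/(n+p)], and the
    increments add up to a multiple of the same difference. *)
Lemma rGamma_seq_drift (M : R) (z : C) (n p : nat) : Cmod z <= M -> (1 <= n)%nat ->
  Cmod (rGamma_seq (n + p) z) <= Cmod (rGamma_seq n z) * exp (rGamma_ratio_const M / INR n - rGamma_ratio_const M / INR (n + p)) /\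
  Cmod (rGamma_seq (n + p) z - rGamma_seq n z)%C
    <= Cmod (rGamma_seq n z) * exp (rGamma_ratio_const M / INR n) * (rGamma_ratio_const M / INR n - rGamma_ratio_const M / INR (n + p)).
Proof.
  intros Hz Hn.
  assert (HK : 0 <= rGamma_ratio_const M) by (apply rGamma_ratio_const_pos; apply Rle_trans with (2 := Hz); apply Cmod_ge_0).
  set (K := rGamma_ratio_const M) in *. set (A := Cmod (rGamma_seq n z)).
  assert (HA : 0 <= A) by apply Cmod_ge_0.
  assert (Hn0 : 0 < INR n) by (apply lt_0_INR; lia).
  induction p as [|p [IH1 IH2]].
  - rewrite Nat.add_0_r. replace (K / INR n - K / INR n) with 0 by ring. rewrite exp_0. split.
    fold A; lra. unfold Cminus. rewrite Cplus_opp_r, Cmod_0. lra.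
  - rewrite Nat.add_succ_r. set (m := (n + p)%nat) in *.
    assert (Hm0 : 1 <= INR m) by (apply (le_INR 1); unfold m; lia).
    assert (HnM : INR n <= INR m) by (apply le_INR; unfold m; lia).
    set (h := / INR (S m)).
    assert (Hh : 0 < h <= 1/2).
    { unfold h. rewrite S_INR. split. apply Rinv_0_lt_compat; lra.
      replace (1/2) with (/2) by field. apply Rinv_le_contravar; lra. }
    assert (Hq := rGamma_ratio_bound M h z Hz ltac:(lra)). fold K in Hq.
    assert (Hd : h * h <= / INR m - / INR (S m)).
    { unfold h. rewrite S_INR. replace (/ INR m - / (INR m + 1)) with (/ INR m * / (INR m + 1)) by (field; lra).
      apply Rmult_le_compat_r. left; apply Rinv_0_lt_compat; lra. apply Rinv_le_contravar; lra. }
    set (d := K / INR m - K / INR (S m)).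
    assert (Hd2 : K * (h * h) <= d).
    { unfold d, Rdiv. rewrite <- Rmult_minus_distr_l. apply Rmult_le_compat_l; auto. }
    assert (Hd0 : 0 <= d) by (apply Rle_trans with (2 := Hd2); apply Rmult_le_pos; nra).
    rewrite (rGamma_seq_S m) by (unfold m; lia). fold h.
    set (q := rGamma_ratio h z) in *.
    set (am := rGamma_seq m z) in *.
    assert (Ham := Cmod_ge_0 am).
    split.
    + rewrite Cmod_mult.
      assert (Hq1 : Cmod q <= 1 + d).
      { assert (H := Cmod_ge_minus q 1%C). rewrite Cmod_1 in H. lra. }
      assert (Hq2 : Cmod q <= exp d) by (assert (H := exp_ineq1_le d); lra).
      replace (K / INR n - K / INR (S m)) with ((K / INR n - K / INR m) + d) by (unfold d; ring).
      rewrite exp_plus, <- Rmult_assoc. apply Rmult_le_compat; auto using Cmod_ge_0.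
    + replace (am * q - rGamma_seq n z)%C with ((am - rGamma_seq n z) + am * (q - 1))%C by ring.
      eapply Rle_trans. apply Cmod_triangle. rewrite Cmod_mult.
      assert (E : Cmod am * Cmod (q - 1)%C <= A * exp (K / INR n) * d).
      { apply Rmult_le_compat; auto using Cmod_ge_0. 2: lra.
        apply Rle_trans with (1 := IH1). apply Rmult_le_compat_l; auto. apply exp_le_compat.
        assert (0 <= K / INR m) by (apply Rdiv_le_0_compat; lra). lra. }
      unfold d in E. replace (A * exp (K / INR n) * (K / INR n - K / INR (S m))) with
        (A * exp (K / INR n) * (K / INR n - K / INR m) + A * exp (K / INR n) * (K / INR m - K / INR (S m))) by ring.
      apply Rplus_le_compat; auto.
Qed.

Lemma rGamma_seq_1 (M : R) (z : C) : Cmod z <= M -> Cmod (rGamma_seq 1 z) <= M * (M + 1).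
Proof.
  intros Hz. unfold rGamma_seq, cpw. rewrite rprod_S, rprod_0. simpl (INR 1). simpl (fact 1).
  rewrite ln_1, Cmult_0_r, Cexp_0. simpl (INR 1).
  replace (/ 1 * 1 * (z * (z + 1)))%C with (z * (z + 1))%C by (field; apply C1_nz).
  rewrite Cmod_mult. assert (H := Cmod_triangle z 1%C). rewrite Cmod_1 in H.
  apply Rmult_le_compat; auto using Cmod_ge_0. lra.
Qed.

(** [M (M + 1)] bounds the term of index 1, one exponential carries that bound to index [n], and the
    other comes from the drift beyond [n]. *)
Definition rGamma_rate_const (M : R) : R := M * (M + 1) * exp (rGamma_ratio_const M) * exp (rGamma_ratio_const M) * rGamma_ratio_const M.

Lemma rGamma_seq_cauchy (M : R) (z : C) (n p : nat) : Cmod z <= M -> (1 <= n)%nat -> (n <= p)%nat ->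
  Cmod (rGamma_seq p z - rGamma_seq n z)%C <= rGamma_rate_const M / INR n.
Proof.
  intros Hz Hn Hp.
  assert (HM : 0 <= M) by (apply Rle_trans with (2 := Hz); apply Cmod_ge_0).
  assert (HK := rGamma_ratio_const_pos M HM). 
  assert (Hn0 : 1 <= INR n) by (apply (le_INR 1); auto).
  assert (Hp0 : 1 <= INR p) by (apply (le_INR 1); lia).
  destruct (rGamma_seq_drift M z n (p - n) Hz Hn) as [_ H].
  replace (n + (p - n))%nat with p in H by lia.
  destruct (rGamma_seq_drift M z 1 (n - 1) Hz (le_n 1)) as [H1 _].
  replace (1 + (n - 1))%nat with n in H1 by lia. simpl (INR 1) in H1.
  set (K := rGamma_ratio_const M) in *.
  assert (HKn : 0 <= K / INR n) by (apply Rdiv_le_0_compat; lra).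
  assert (HKp : 0 <= K / INR p) by (apply Rdiv_le_0_compat; lra).
  assert (HKn1 : K / INR n <= K).
  { apply Rmult_le_reg_r with (INR n). lra. unfold Rdiv. rewrite Rmult_assoc, Rinv_l by lra. nra. }
  apply Rle_trans with (1 := H). unfold rGamma_rate_const. fold K.
  replace (M * (M + 1) * exp K * exp K * K / INR n) with (M * (M + 1) * exp K * exp K * (K / INR n)) by (unfold Rdiv; ring).
  apply Rmult_le_compat.
  - apply Rmult_le_pos. apply Cmod_ge_0. left; apply exp_pos.
  - assert (K / INR p <= K / INR n). { apply Rmult_le_compat_l; auto. apply Rinv_le_contravar. lra. apply le_INR; auto. }
    lra.
  - apply Rmult_le_compat. apply Cmod_ge_0. left; apply exp_pos.
    + apply Rle_trans with (1 := H1). apply Rmult_le_compat. apply Cmod_ge_0. left; apply exp_pos.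
      apply rGamma_seq_1; auto. apply exp_le_compat. replace (K / 1) with K by field. lra.
    + apply exp_le_compat; auto.
  - lra.
Qed.

Lemma rGamma_seq_ex_lim (z : C) : exists l : C, Clim eventually (fun n => rGamma_seq n z) l.
Proof.
  apply (filterlim_locally_cauchy (U := C_R_CompleteNormedModule) (F := eventually)).
  intros eps. set (B := rGamma_rate_const (Cmod z)).
  destruct (nfloor_ex (Rmax 0 (B / eps)) (Rmax_l _ _)) as [N [_ HN]].
  exists (fun n => (S N <= n)%nat). split. exists (S N); auto.
  assert (HB : B / INR (S N) < eps).
  { rewrite S_INR. assert (H := Rmax_r 0 (B / eps)). assert (He := cond_pos eps).
    assert (H2 : 0 < INR N + 1) by (assert (H3 := pos_INR N); lra).
    apply Rmult_lt_reg_r with (INR N + 1); auto. unfold Rdiv; rewrite Rmult_assoc, Rinv_l, Rmult_1_r by lra.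
    apply Rmult_lt_reg_r with (/ eps). apply Rinv_0_lt_compat; auto.
    replace (eps * (INR N + 1) * / eps) with (INR N + 1) by (field; lra).
    unfold Rdiv in *. lra. }
  assert (G : forall u v, (S N <= u)%nat -> (u <= v)%nat -> Cmod (rGamma_seq v z - rGamma_seq u z)%C < eps).
  { intros u v Hu Hv. apply Rle_lt_trans with (B / INR u). apply rGamma_seq_cauchy; auto. lra. lia.
    apply Rle_lt_trans with (2 := HB). unfold Rdiv. apply Rmult_le_compat_l.
    unfold B, rGamma_rate_const. assert (H0 := Cmod_ge_0 z). assert (H1 := rGamma_ratio_const_pos _ H0).
    assert (0 < exp (rGamma_ratio_const (Cmod z))) by apply exp_pos.
    repeat apply Rmult_le_pos; lra.
    apply Rinv_le_contravar. apply lt_0_INR; lia. apply le_INR; auto. }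
  intros u v Hu Hv. apply (norm_compat1 (V := C_R_NormedModule)).
  rewrite <- Cmod_norm. change (Cmod (rGamma_seq v z - rGamma_seq u z)%C < eps).
  destruct (Nat.le_ge_cases u v). apply G; auto.
  rewrite Cmod_minus_sym. apply G; auto.
Qed.

(** Away from the poles no approximation vanishes. From an index [n > 4 K] on, the relative drift is
    at most [exp (K/n) K/n <= 1/2], so the limit keeps at least half the modulus of the [n]-th
    term. *)
Lemma rGamma_seq_lim_neq_0 (z l : C) : ~ Gamma_pole z -> Clim eventually (fun n => rGamma_seq n z) l -> l <> 0.
Proof.
  intros Hz Hl. set (K := rGamma_ratio_const (Cmod z)).
  assert (HK : 0 <= K) by (apply rGamma_ratio_const_pos, Cmod_ge_0).
  destruct (nfloor_ex (4 * K) ltac:(lra)) as [N [_ HN]].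
  set (n := S N). assert (Hn : 4 * K < INR n) by (unfold n; rewrite S_INR; lra).
  assert (Hn0 : 1 <= INR n) by (apply (le_INR 1); unfold n; lia).
  assert (Hne : rGamma_seq n z <> 0).
  { unfold rGamma_seq. apply Cmult_neq_0. apply Cmult_neq_0.
    - intros E. apply (RtoC_INR_fact_neq_0 n). rewrite <- (Cinv_inv (RtoC _)), E. apply Cinv_0.
    - apply cpw_neq_0.
    - intros E. apply rprod_zero_iff in E. destruct E as [k [_ E]]. apply Hz. exists k; auto. }
  apply Cmod_gt_0 in Hne.
  assert (HKn : 0 <= K / INR n) by (apply Rdiv_le_0_compat; lra).
  assert (HKn4 : K / INR n <= / 4).
  { apply Rmult_le_reg_r with (INR n). lra. unfold Rdiv. rewrite Rmult_assoc, Rinv_l by lra. lra. }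
  assert (He2 : exp (K / INR n) <= 2).
  { assert (H := exp_ineq1_le (- (K / INR n))). rewrite exp_Ropp in H.
    assert (0 < exp (K / INR n)) by apply exp_pos.
    assert (H2 : (1 + - (K / INR n)) * exp (K / INR n) <= / exp (K / INR n) * exp (K / INR n)) by (apply Rmult_le_compat_r; lra).
    rewrite Rinv_l in H2 by lra. nra. }
  assert (Hl2 : Cmod (l - rGamma_seq n z)%C <= Cmod (rGamma_seq n z) / 2).
  { apply (Clim_le eventually (fun p => rGamma_seq p z - rGamma_seq n z)%C).
    apply Clim_minus; auto. apply eventually_filter. apply Clim_const, eventually_filter.
    exists n. intros p Hp. destruct (rGamma_seq_drift (Cmod z) z n (p - n) (Rle_refl _)) as [_ H].
    unfold n; lia. replace (n + (p - n))%nat with p in H by lia. fold K in H.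
    apply Rle_trans with (1 := H).
    assert (0 <= K / INR p) by (apply Rdiv_le_0_compat; try lra; apply lt_0_INR; unfold n in Hp; lia).
    assert (exp (K / INR n) * (K / INR n - K / INR p) <= / 2).
    { assert (0 < exp (K / INR n)) by apply exp_pos. nra. }
    rewrite Rmult_assoc. unfold Rdiv. apply Rmult_le_compat_l; lra. }
  intros ->. rewrite Cmod_minus_sym in Hl2. replace (rGamma_seq n z - 0)%C with (rGamma_seq n z) in Hl2 by ring. lra.
Qed.

Lemma rGamma_seq_pole (z : C) : Gamma_pole z -> eventually (fun n => rGamma_seq n z = 0).
Proof.
  intros [k Hk]. exists k. intros n Hn. unfold rGamma_seq.
  rewrite (proj2 (rprod_zero_iff n z)). ring. exists k; auto.
Qed.

Lemma Gamma_of_lim (z g : C) : Clim eventually (Gamma_seq z) g -> Gamma z = g.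
Proof.
  intros H. unfold Gamma.
  rewrite (is_lim_seq_unique _ (Re g)), (is_lim_seq_unique _ (Im g)).
  destruct g; reflexivity.
  apply (Clim_Im eventually _ _ H). apply (Clim_Re eventually _ _ H).
Qed.

(** At a pole [Gamma_seq] is eventually [/ 0 = 0]; then [Gamma z = 0], and its inverse is again 0,
    the true limit. Elsewhere the limit is nonzero and may be inverted. *)
Lemma rGamma_lim (z : C) : Clim eventually (fun n => rGamma_seq n z) (rGamma z).
Proof.
  destruct (rGamma_seq_ex_lim z) as [l Hl].
  replace (rGamma z) with l; auto. unfold rGamma.
  destruct (Classical_Prop.classic (Gamma_pole z)) as [Hp | Hp].
  - assert (Hev := rGamma_seq_pole z Hp).
    replace l with (RtoC 0).
    + rewrite (Gamma_of_lim z 0). symmetry; apply Cinv_0.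
      eapply filterlim_ext_loc. 2: apply Clim_const, eventually_filter.
      destruct Hev as [N HN]. exists (S N). intros n Hn. simpl.
      rewrite Gamma_seq_inv, HN by lia. symmetry; apply Cinv_0.
    + apply (Clim_unique eventually (fun n => rGamma_seq n z)); auto.
      eapply filterlim_ext_loc. 2: apply Clim_const, eventually_filter.
      revert Hev. apply filter_imp. auto.
  - assert (H0 := rGamma_seq_lim_neq_0 z l Hp Hl).
    rewrite (Gamma_of_lim z (/ l)%C). now rewrite Cinv_inv.
    apply filterlim_ext_loc with (fun n => / rGamma_seq n z)%C.
    exists 1%nat. intros n Hn. now rewrite Gamma_seq_inv.
    apply Clim_inv; auto. apply eventually_filter.
Qed.

Lemma Gamma_rGamma (z : C) : Gamma z = (/ rGamma z)%C.
Proof. unfold rGamma. now rewrite Cinv_inv. Qed.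

Lemma rGamma_neq_0 (z : C) : ~ Gamma_pole z -> rGamma z <> 0.
Proof. intros H. apply (rGamma_seq_lim_neq_0 z); auto. apply rGamma_lim. Qed.

Lemma rGamma_pole (z : C) : Gamma_pole z -> rGamma z = 0.
Proof.
  intros H. apply (Clim_unique eventually (fun n => rGamma_seq n z)). apply rGamma_lim.
  eapply filterlim_ext_loc. 2: apply Clim_const, eventually_filter.
  generalize (rGamma_seq_pole z H). apply filter_imp. auto.
Qed.

Lemma Re_pos_not_pole (z : C) : 0 < Re z -> ~ Gamma_pole z.
Proof. intros H [k Hk]. rewrite Hk in H. simpl in H. assert (H1 := pos_INR k). lra. Qed.

Lemma rGamma_neq_0_Re (z : C) : 0 < Re z -> rGamma z <> 0.
Proof. intros H. apply rGamma_neq_0, Re_pos_not_pole, H. Qed.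

Lemma filterlim_INR_inv (c : R) : filterlim (fun n => c / INR n) eventually (locally 0).
Proof.
  change (is_lim_seq (fun n => c / INR n) (Finite 0)).
  replace (Finite 0) with (Rbar_mult c 0) by (simpl; f_equal; ring).
  apply is_lim_seq_scal_l. replace (Finite 0) with (Rbar_inv p_infty) by reflexivity.
  apply is_lim_seq_inv. apply is_lim_seq_INR. discriminate.
Qed.

(** The rate depends on [z] only through a bound of its modulus; this uniformity on discs yields
    continuity and, later, convergence of the integrals along paths. *)
Lemma rGamma_unif (M : R) (z : C) (n : nat) : Cmod z <= M -> (1 <= n)%nat ->
  Cmod (rGamma_seq n z - rGamma z)%C <= rGamma_rate_const M / INR n.
Proof.
  intros Hz Hn. rewrite Cmod_minus_sym.
  apply (Clim_le eventually (fun p => rGamma_seq p z - rGamma_seq n z)%C).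
  apply Clim_minus. apply eventually_filter. apply rGamma_lim. apply Clim_const, eventually_filter.
  exists n. intros p Hp. apply rGamma_seq_cauchy; auto.
Qed.

Lemma continuous_rprod (n : nat) (z : C) : continuous (rprod n) z.
Proof.
  induction n.
  - apply (continuous_ext (fun z => z)). intros; symmetry; apply rprod_0. apply continuous_id.
  - apply (continuous_ext (fun z => rprod n z * (z + RtoC (INR (S n))))%C).
    intros; symmetry; apply rprod_S.
    apply Clim_mult; auto. apply locally_filter. apply Clim_plus. apply locally_filter.
    apply filterlim_id. apply Clim_const, locally_filter.
Qed.

Lemma continuous_cpw (x : R) (e : C) : continuous (cpw x) e.
Proof.
  unfold cpw. apply (continuous_comp (fun e => e * RtoC (ln x))%C Cexp). 2: apply continuous_Cexp.
  apply Clim_mult. apply locally_filter. apply filterlim_id. apply Clim_const, locally_filter.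
Qed.

Lemma continuous_Copp (z : C) : continuous Copp z.
Proof.
  apply (filterlim_ext (fun z => 0 - z)%C). intros; ring.
  assert (E : (0 - z)%C = (- z)%C) by ring. rewrite <- E.
  apply (Clim_minus (@locally C_UniformSpace z) (fun _ => RtoC 0) (fun z => z)).
  apply Clim_const, locally_filter. apply filterlim_id.
Qed.

Lemma continuous_rGamma_seq (n : nat) (z : C) : continuous (rGamma_seq n) z.
Proof.
  unfold rGamma_seq. apply Clim_mult. apply locally_filter. 2: apply continuous_rprod.
  apply Clim_mult. apply locally_filter. apply Clim_const, locally_filter.
  apply (continuous_comp Copp (cpw (INR n))). apply continuous_Copp. apply continuous_cpw.
Qed.

Lemma locally_Cmod_lt (z : C) (r : R) : 0 < r -> @locally C_UniformSpace z (fun q => Cmod (q - z)%C < r).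
Proof.
  intros Hr. apply (proj1 (Clim_eps (@locally C_UniformSpace z) (fun q => q) z)); auto. apply filterlim_id.
Qed.

Lemma continuous_rGamma (z : C) : continuous rGamma z.
Proof.
  unfold continuous. apply Clim_eps. apply locally_filter. intros eps He.
  set (M := Cmod z + 1).
  assert (Hev : eventually (fun n => rGamma_rate_const M / INR n < eps / 3 /\ (1 <= n)%nat)).
  { apply filter_and. 2: exists 1%nat; auto.
    generalize (proj1 (filterlim_locally _ _) (filterlim_INR_inv (rGamma_rate_const M)) (mkposreal (eps/3) ltac:(lra))).
    apply filter_imp. intros n Hn. change (Rabs (rGamma_rate_const M / INR n - 0) < eps / 3) in Hn.
    apply Rabs_def2 in Hn. lra. }
  destruct (filter_ex _ Hev) as [n [Hn Hn1]].
  assert (Hc := proj1 (Clim_eps (@locally C_UniformSpace z) _ _) (continuous_rGamma_seq n z) (eps/3) ltac:(lra)).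
  generalize (filter_and _ _ Hc (locally_Cmod_lt z 1 Rlt_0_1)). apply filter_imp.
  intros q [H1 H2].
  assert (Hq : Cmod q <= M).
  { unfold M. replace q with (z + (q - z))%C by ring. eapply Rle_trans. apply Cmod_triangle. lra. }
  assert (H3 := rGamma_unif M q n Hq Hn1).
  assert (H4 := rGamma_unif M z n ltac:(unfold M; lra) Hn1).
  rewrite Cmod_minus_sym in H3.
  replace (rGamma q - rGamma z)%C with ((rGamma q - rGamma_seq n q) + ((rGamma_seq n q - rGamma_seq n z)
     + (rGamma_seq n z - rGamma z)))%C by ring.
  eapply Rle_lt_trans. apply Cmod_triangle.
  eapply Rle_lt_trans. apply Rplus_le_compat_l, Cmod_triangle. lra.
Qed.

(** At finite [n] the equation holds up to the factor [1 + (z + 1)/n], which tends to 1. For the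
    reciprocal it is valid at the poles as well. *)
Lemma rGamma_rec (z : C) : rGamma z = (z * rGamma (z + 1))%C.
Proof.
  apply (Clim_unique eventually (fun n => z * rGamma_seq n (z + 1))%C).
  2: { apply Clim_mult. apply eventually_filter. apply Clim_const, eventually_filter. apply rGamma_lim. }
  apply filterlim_ext_loc with (fun n => rGamma_seq n z * (1 + (z + 1) * RtoC (1 / INR n)))%C.
  - exists 1%nat. intros n Hn. assert (Hn0 : 0 < INR n) by (apply lt_0_INR; lia).
    assert (Hn1 : RtoC (INR n) <> 0) by (intros E; apply RtoC_inj in E; lra).
    unfold rGamma_seq.
    replace (cpw (INR n) (- (z + 1))) with (cpw (INR n) (- z) * / RtoC (INR n))%C.
    2: { replace (- (z + 1))%C with (- z + RtoC (Ropp 1))%C by (rewrite RtoC_opp; ring).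
         rewrite cpw_plus, cpw_RtoC. f_equal. rewrite Rpower_Ropp, Rpower_1 by lra. now rewrite RtoC_inv by lra. }
    replace (z * (/ RtoC (INR (fact n)) * (cpw (INR n) (- z) * / RtoC (INR n)) * rprod n (z + 1)))%C
      with (/ RtoC (INR (fact n)) * (cpw (INR n) (- z) * / RtoC (INR n)) * (rprod n (z + 1) * z))%C by ring.
    rewrite rprod_shift, S_INR, RtoC_plus, RtoC_div by lra. field. split; auto. apply RtoC_INR_fact_neq_0.
  - replace (rGamma z) with (rGamma z * (1 + (z + 1) * RtoC 0))%C by ring.
    apply Clim_mult. apply eventually_filter. apply rGamma_lim.
    apply Clim_plus. apply eventually_filter. apply Clim_const, eventually_filter.
    apply Clim_mult. apply eventually_filter. apply Clim_const, eventually_filter.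
    apply Clim_RtoC. apply eventually_filter. apply filterlim_INR_inv.
Qed.

Lemma rprod_1 (n : nat) : rprod n 1 = RtoC (INR (fact (S n))).
Proof.
  induction n. rewrite rprod_0. reflexivity.
  rewrite rprod_S, IHn, (fact_simpl (S n)), mult_INR, (S_INR (S n)), RtoC_mult, RtoC_plus. ring.
Qed.

Lemma rGamma_1 : rGamma 1 = 1.
Proof.
  apply (Clim_unique eventually (fun n => rGamma_seq n 1)). apply rGamma_lim.
  apply filterlim_ext_loc with (fun n => 1 + RtoC (1 / INR n))%C.
  - exists 1%nat. intros n Hn. assert (Hn0 : 0 < INR n) by (apply lt_0_INR; lia).
    assert (Hn1 : RtoC (INR n) <> 0) by (intros E; apply RtoC_inj in E; lra).
    simpl. unfold rGamma_seq. rewrite rprod_1, fact_simpl, mult_INR, S_INR, RtoC_mult, RtoC_plus.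
    replace (- (1))%C with (RtoC (Ropp 1)) by (rewrite RtoC_opp; ring). rewrite cpw_RtoC, Rpower_Ropp, Rpower_1 by lra.
    rewrite RtoC_inv, RtoC_div by lra. field. split; auto. apply RtoC_INR_fact_neq_0.
  - assert (E : (1 + 0)%C = RtoC 1) by ring. refine (eq_ind _ (fun l : C => Clim eventually _ l) _ _ E). apply Clim_plus. apply eventually_filter. apply Clim_const, eventually_filter.
    apply Clim_RtoC. apply eventually_filter. apply filterlim_INR_inv.
Qed.

Lemma rGamma_fact (n : nat) : rGamma (1 + RtoC (INR n)) = (/ RtoC (INR (fact n)))%C.
Proof.
  induction n.
  - simpl. replace (1 + 0)%C with (RtoC 1) by ring. rewrite rGamma_1. field.
  - assert (Hn1 : RtoC (INR n + 1) <> 0) by (intros E; apply RtoC_inj in E; assert (H := pos_INR n); lra).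
    rewrite fact_simpl, mult_INR, S_INR, RtoC_mult, Cinv_mult, <- IHn, (rGamma_rec (1 + RtoC (INR n))).
    rewrite RtoC_plus in *. replace (1 + RtoC (INR n) + 1)%C with (1 + (RtoC (INR n) + 1))%C by ring. field; auto.
Qed.

(** The product is the one produced by differentiating [z^w] [n] times; this is how ordinary
    derivatives shift the argument of [rGamma]. *)
Lemma rGamma_down (n : nat) (w : C) :
  rGamma (1 + w - RtoC (INR n)) = (Cprod (map (fun j => w - RtoC (INR j))%C (seq 0 n)) * rGamma (1 + w))%C.
Proof.
  induction n.
  - simpl. replace (1 + w - 0)%C with (1 + w)%C by ring. unfold Cprod; simpl. ring.
  - rewrite seq_S, map_app, Cprod_app, rGamma_rec.
    replace (1 + w - RtoC (INR (S n)) + 1)%C with (1 + w - RtoC (INR n))%C by (rewrite S_INR, RtoC_plus; ring).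
    rewrite IHn. unfold Cprod at 3; simpl map. simpl fold_right. rewrite S_INR, RtoC_plus. ring.
Qed.

(** * Growth of Gamma on vertical lines *)

(* A primitive of [ln (1 + y^2/t^2)], increasing from [0] to [PI * y]; comparing it with the sum of
   [ln (1 + y^2/(x+k)^2)] turns Gauss' product into bounds for [|Gamma (x+iy) / Gamma x|]. *)
Definition gprim (y t : R) : R := t * ln (1 + y ^ 2 / t ^ 2) + 2 * y * atan (t / y).

Lemma gprim_derive (y t : R) : 0 < y -> 0 < t -> is_derive (gprim y) t (ln (1 + y ^ 2 / t ^ 2)).
Proof.
  intros Hy Ht. unfold gprim.
  assert (0 < y ^ 2 / t ^ 2) by (apply Rdiv_lt_0_compat; apply pow_lt; auto).
  auto_derive.
  - repeat split; auto. apply Rgt_not_eq. assert (0 < t * (t * 1)) by nra. lra.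
    replace (y * (y * 1) * / (t * (t * 1))) with (y ^ 2 / t ^ 2) by (simpl; field; lra). lra.
  - change (y ^ 2 / t ^ 2) with (y * (y * 1) * / (t * (t * 1))) in *.
    generalize (ln (1 + y * (y * 1) * / (t * (t * 1)))). intros L. field.
    assert (0 < t * t) by nra. assert (0 < y * y) by nra. repeat split; lra.
Qed.

Lemma ln_arg_decr (y s t : R) : 0 < s <= t -> ln (1 + y ^ 2 / t ^ 2) <= ln (1 + y ^ 2 / s ^ 2).
Proof.
  intros H. apply ln_le.
  - assert (0 <= y ^ 2 / t ^ 2). { apply Rdiv_le_0_compat. apply pow2_ge_0. apply pow_lt; lra. } lra.
  - apply Rplus_le_compat_l. apply Rmult_le_compat_l. apply pow2_ge_0.
    apply Rinv_le_contravar. apply pow_lt; lra. apply pow_incr; lra.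
Qed.

(** The integral test: the derivative of [gprim y] is decreasing, so its mean over a unit interval
    lies between its values at the ends. *)
Lemma gprim_step (y t : R) : 0 < y -> 0 < t ->
  ln (1 + y ^ 2 / (t + 1) ^ 2) <= gprim y (t + 1) - gprim y t <= ln (1 + y ^ 2 / t ^ 2).
Proof.
  intros Hy Ht.
  destruct (MVT_gen (gprim y) t (t + 1) (fun t => ln (1 + y ^ 2 / t ^ 2))) as [c [Hc E]].
  - intros s. rewrite Rmin_left, Rmax_right by lra. intros Hs. apply gprim_derive; lra.
  - intros s. rewrite Rmin_left, Rmax_right by lra. intros Hs.
    apply continuity_pt_filterlim, (ex_derive_continuous (V := R_NormedModule)). eexists. apply gprim_derive; lra.
  - rewrite Rmin_left, Rmax_right in Hc by lra. rewrite E.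
    replace (t + 1 - t) with 1 by ring. rewrite Rmult_1_r. split; apply ln_arg_decr; lra.
Qed.

Lemma atan_bounds (u : R) : 0 < u -> PI / 2 - / u <= atan u <= u /\ atan u <= PI / 2.
Proof.
  assert (H : forall v, 0 < v -> atan v <= v).
  { intros v Hv. destruct (MVT_gen atan 0 v (fun t => / (1 + Rsqr t))) as [c [Hc E]].
    - intros s _. apply is_derive_atan.
    - intros s _. apply continuity_pt_filterlim, (ex_derive_continuous (V := R_NormedModule)). eexists. apply is_derive_atan.
    - rewrite atan_0 in E. rewrite !Rminus_0_r in E. rewrite E. rewrite <- (Rmult_1_l v) at 2.
      apply Rmult_le_compat_r. lra. rewrite <- Rinv_1. apply Rinv_le_contravar. lra. assert (0 <= Rsqr c) by apply Rle_0_sqr. lra. }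
  intros Hu. split; [split|].
  - assert (H1 := atan_inv u Hu). assert (H2 := H (/ u) ltac:(apply Rinv_0_lt_compat; auto)). lra.
  - auto.
  - left. apply atan_bound.
Qed.

(** The first two bounds serve far out, at [t] near [x + n], where [gprim] equals [PI * y] up to
    [O(y^2/n)]; the third serves at the fixed starting point [t = x]. *)
Lemma gprim_bounds (y t : R) : 0 < y -> 0 < t ->
  PI * y - 2 * y ^ 2 / t <= gprim y t /\ gprim y t <= y ^ 2 / t + PI * y /\
  0 <= gprim y t <= t * ln (1 + y ^ 2 / t ^ 2) + 2 * t.
Proof.
  intros Hy Ht. unfold gprim.
  assert (Hu : 0 < t / y) by (apply Rdiv_lt_0_compat; auto).
  destruct (atan_bounds _ Hu) as [[B1 B2] B3].
  assert (B4 : 0 < atan (t / y)) by (rewrite <- atan_0; apply atan_increasing; auto).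
  assert (Hq : 0 < y ^ 2 / t ^ 2) by (apply Rdiv_lt_0_compat; apply pow_lt; auto).
  assert (L0 : 0 <= ln (1 + y ^ 2 / t ^ 2)) by (rewrite <- ln_1; apply ln_le; lra).
  assert (L1 := ln_le_minus_1 (1 + y ^ 2 / t ^ 2) ltac:(lra)).
  replace (/ (t / y)) with (y / t) in B1 by (field; lra).
  assert (E1 : 2 * y * (PI / 2 - y / t) <= 2 * y * atan (t / y)) by (apply Rmult_le_compat_l; lra).
  assert (E2 : 2 * y * atan (t / y) <= 2 * y * (t / y)) by (apply Rmult_le_compat_l; lra).
  assert (E3 : 2 * y * atan (t / y) <= 2 * y * (PI / 2)) by (apply Rmult_le_compat_l; lra).
  assert (E4 : t * ln (1 + y ^ 2 / t ^ 2) <= t * (y ^ 2 / t ^ 2)) by (apply Rmult_le_compat_l; lra).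
  assert (E5 : 0 <= t * ln (1 + y ^ 2 / t ^ 2)) by (apply Rmult_le_pos; lra).
  assert (E6 : 0 < 2 * y * atan (t / y)) by (apply Rmult_lt_0_compat; lra).
  replace (2 * y * (PI / 2 - y / t)) with (PI * y - 2 * y ^ 2 / t) in E1 by (field; lra).
  replace (2 * y * (t / y)) with (2 * t) in E2 by (field; lra).
  replace (t * (y ^ 2 / t ^ 2)) with (y ^ 2 / t) in E4 by (field; lra).
  repeat split; lra.
Qed.

Lemma Cmod_vertical (x y : R) : 0 < x -> Cmod (x, y) = x * exp (ln (1 + y ^ 2 / x ^ 2) / 2).
Proof.
  intros Hx. assert (0 < x ^ 2) by (apply pow_lt; auto).
  assert (0 <= y ^ 2 / x ^ 2) by (apply Rdiv_le_0_compat; auto; apply pow2_ge_0).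
  replace (exp (ln (1 + y ^ 2 / x ^ 2) / 2)) with (sqrt (1 + y ^ 2 / x ^ 2)).
  2: { rewrite <- Rpower_sqrt by lra. unfold Rpower. f_equal. field. }
  unfold Cmod; simpl fst; simpl snd.
  rewrite <- (sqrt_pow2 x) at 2 by lra. rewrite <- sqrt_mult by lra. f_equal. field; lra.
Qed.

(** Each factor satisfies [|x + k + i y| = (x + k) exp (ln (1 + y^2/(x+k)^2) / 2)], so the exponents
    form a sum that [gprim_step] compares with increments of [gprim]. In the upper bound the term
    [k = 0] has no unit interval to its left inside the range and is kept as it is. *)
Lemma rprod_vertical (n : nat) (x y : R) : 0 < x -> 0 < y ->
  Cmod (rprod n (RtoC x)) * exp ((gprim y (x + INR n + 1) - gprim y x) / 2) <= Cmod (rprod n (x, y)) /\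
  Cmod (rprod n (x, y)) <= Cmod (rprod n (RtoC x)) * exp ((ln (1 + y ^ 2 / x ^ 2) + gprim y (x + INR n) - gprim y x) / 2).
Proof.
  intros Hx Hy. induction n as [|n [IH1 IH2]].
  - rewrite !rprod_0. simpl (INR 0). rewrite Rplus_0_r, Cmod_R, Rabs_pos_eq, Cmod_vertical by lra.
    split; apply Rmult_le_compat_l; try lra; apply exp_le_compat.
    + assert (H := gprim_step y x Hy Hx). lra.
    + lra.
  - rewrite !rprod_S, !Cmod_mult.
    set (t := x + INR (S n)). assert (Ht : 0 < t) by (unfold t; assert (H := pos_INR (S n)); lra).
    replace ((x, y) + RtoC (INR (S n)))%C with ((t, y) : C) by (unfold t, Cplus, RtoC; simpl; f_equal; ring).
    replace (RtoC x + RtoC (INR (S n)))%C with (RtoC t) by (unfold t; apply RtoC_plus).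
    rewrite Cmod_R, Rabs_pos_eq, Cmod_vertical by lra.
    assert (Et : x + INR n + 1 = t) by (unfold t; rewrite S_INR; ring).
    rewrite Et in IH1.
    assert (S1 := gprim_step y t Hy Ht).
    assert (Ht' : 0 < x + INR n) by (assert (H := pos_INR n); lra).
    assert (S2 := gprim_step y (x + INR n) Hy Ht'). rewrite Et in S2.
    split.
    + replace (gprim y (t + 1) - gprim y x) with ((gprim y t - gprim y x) + (gprim y (t + 1) - gprim y t)) by ring.
      rewrite Rdiv_plus_distr, exp_plus.
      replace (Cmod (rprod n x) * t * (exp ((gprim y t - gprim y x) / 2) * exp ((gprim y (t + 1) - gprim y t) / 2)))
        with ((Cmod (rprod n x) * exp ((gprim y t - gprim y x) / 2)) * (t * exp ((gprim y (t + 1) - gprim y t) / 2))) by ring.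
      apply Rmult_le_compat; auto.
      apply Rmult_le_pos. apply Cmod_ge_0. left; apply exp_pos.
      apply Rmult_le_pos. lra. left; apply exp_pos.
      apply Rmult_le_compat_l. lra. apply exp_le_compat. lra.
    + replace (ln (1 + y ^ 2 / x ^ 2) + gprim y t - gprim y x) with
       ((ln (1 + y ^ 2 / x ^ 2) + gprim y (x + INR n) - gprim y x) + (gprim y t - gprim y (x + INR n))) by ring.
      rewrite Rdiv_plus_distr, exp_plus.
      match goal with |- _ <= ?a * t * (?b * ?c) => replace (a * t * (b * c)) with ((a * b) * (t * c)) by ring end.
      apply Rmult_le_compat; auto. apply Cmod_ge_0.
      apply Rmult_le_pos. lra. left; apply exp_pos.
      apply Rmult_le_compat_l. lra. apply exp_le_compat. lra.
Qed.

Lemma rGamma_seq_vertical (n : nat) (x y : R) : (1 <= n)%nat -> 0 < x -> 0 < y ->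
  Cmod (rGamma_seq n (RtoC x)) * exp ((PI * y - x * ln (1 + y ^ 2 / x ^ 2) - 2 * x - 2 * y ^ 2 / INR n) / 2)
    <= Cmod (rGamma_seq n (x, y)) /\
  Cmod (rGamma_seq n (x, y)) <= Cmod (rGamma_seq n (RtoC x)) * exp ((ln (1 + y ^ 2 / x ^ 2) + PI * y + y ^ 2 / INR n) / 2).
Proof.
  intros Hn Hx Hy. destruct (rprod_vertical n x y Hx Hy) as [H1 H2].
  assert (Hn0 : 0 < INR n) by (apply lt_0_INR; lia).
  unfold rGamma_seq. rewrite !Cmod_mult, !Cmod_cpw. simpl (Re (- (x, y))%C). simpl (Re (- RtoC x)%C).
  set (A := Cmod (/ RtoC (INR (fact n)))%C * Rpower (INR n) (- x)).
  assert (HA : 0 <= A). { apply Rmult_le_pos. apply Cmod_ge_0. left; apply exp_pos. }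
  destruct (gprim_bounds y x Hy Hx) as [_ [_ B1]].
  destruct (gprim_bounds y (x + INR n + 1) Hy ltac:(lra)) as [B2 _].
  destruct (gprim_bounds y (x + INR n) Hy ltac:(lra)) as [_ [B3 _]].
  assert (Hy2 : 0 <= y ^ 2) by apply pow2_ge_0.
  assert (B4 : y ^ 2 / (x + INR n) <= y ^ 2 / INR n) by (apply Rmult_le_compat_l; auto; apply Rinv_le_contravar; lra).
  assert (B5 : y ^ 2 / (x + INR n + 1) <= y ^ 2 / INR n) by (apply Rmult_le_compat_l; auto; apply Rinv_le_contravar; lra).
  split; rewrite Rmult_assoc; apply Rmult_le_compat_l; auto.
  - apply Rle_trans with (2 := H1). apply Rmult_le_compat_l. apply Cmod_ge_0. apply exp_le_compat.
    unfold Rdiv in *. lra.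
  - apply Rle_trans with (1 := H2). apply Rmult_le_compat_l. apply Cmod_ge_0. apply exp_le_compat. lra.
Qed.

(** Gauss' approximations at conjugate points have equal modulus; negative ordinates thus reduce to
    positive ones. *)
Lemma rGamma_conj_mod (x y : R) : Cmod (rGamma (x, - y)) = Cmod (rGamma (x, y)).
Proof.
  assert (H : forall n, Cmod (rGamma_seq n (x, - y)) = Cmod (rGamma_seq n (x, y))).
  { intros n. unfold rGamma_seq. rewrite !Cmod_mult, !Cmod_cpw. f_equal.
    induction n. rewrite !rprod_0. apply (Cmod_conj (x, y)).
    rewrite !rprod_S, !Cmod_mult, IHn. f_equal.
    rewrite <- Cmod_conj. f_equal. unfold Cconj, Cplus, RtoC; simpl. f_equal; ring. }
  assert (H1 := Clim_Cmod eventually _ _ (rGamma_lim (x, - y))).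
  assert (H2 := Clim_Cmod eventually _ _ (rGamma_lim (x, y))).
  apply (filterlim_locally_unique (F := eventually) (V := R_NormedModule) (fun n => Cmod (rGamma_seq n (x, y)))); auto.
  apply filterlim_ext with (2 := H1). auto.
Qed.

Lemma filterlim_exp_INR_inv (a b : R) :
  filterlim (fun n => exp ((a + b / INR n) / 2)) eventually (locally (exp (a / 2))).
Proof.
  apply (filterlim_comp _ _ _ (fun n => (a + b / INR n) / 2) exp eventually (locally (a / 2))).
  2: apply continuous_exp.
  change (is_lim_seq (fun n => (a + b / INR n) / 2) (a / 2)).
  replace (Finite (a / 2)) with (Rbar_mult (a + 0) (/ 2)) by (simpl; f_equal; field).
  apply is_lim_seq_scal_r. apply is_lim_seq_plus'. apply is_lim_seq_const. apply filterlim_INR_inv.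
Qed.

(** The errors of order [y^2 / n] vanish in the limit. What remains is the order [PI |y| / 2] in the
    exponent, up to logarithmic and constant terms. *)
Lemma rGamma_vertical (x y : R) : 0 < x ->
  Cmod (rGamma (RtoC x)) * exp ((PI * Rabs y - x * ln (1 + y ^ 2 / x ^ 2) - 2 * x) / 2) <= Cmod (rGamma (x, y)) /\
  Cmod (rGamma (x, y)) <= Cmod (rGamma (RtoC x)) * exp ((ln (1 + y ^ 2 / x ^ 2) + PI * Rabs y) / 2).
Proof.
  intros Hx.
  assert (H : forall y, 0 < y ->
    Cmod (rGamma (RtoC x)) * exp ((PI * y - x * ln (1 + y ^ 2 / x ^ 2) - 2 * x) / 2) <= Cmod (rGamma (x, y)) /\
    Cmod (rGamma (x, y)) <= Cmod (rGamma (RtoC x)) * exp ((ln (1 + y ^ 2 / x ^ 2) + PI * y) / 2)).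
  { clear y. intros y Hy.
    assert (L1 := Clim_Cmod eventually _ _ (rGamma_lim (x, y))).
    assert (L2 := Clim_Cmod eventually _ _ (rGamma_lim (RtoC x))).
    split.
    - refine (filterlim_le (F := eventually) _ _ (Finite _) (Finite _) _ (is_lim_seq_mult' _ _ _ _ L2
        (filterlim_exp_INR_inv (PI * y - x * ln (1 + y ^ 2 / x ^ 2) - 2 * x) (- 2 * y ^ 2))) L1).
      exists 1%nat. intros n Hn.
      destruct (rGamma_seq_vertical n x y Hn Hx Hy) as [E _].
      apply Rle_trans with (2 := E). right. do 3 f_equal. unfold Rdiv. ring.
    - refine (filterlim_le (F := eventually) _ _ (Finite _) (Finite _) _ L1 (is_lim_seq_mult' _ _ _ _ L2
        (filterlim_exp_INR_inv (ln (1 + y ^ 2 / x ^ 2) + PI * y) (y ^ 2)))).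
      exists 1%nat. intros n Hn.
      destruct (rGamma_seq_vertical n x y Hn Hx Hy) as [_ E]. exact E. }
  destruct (Rtotal_order y 0) as [Hy | [-> | Hy]].
  - rewrite Rabs_left by auto. rewrite <- (rGamma_conj_mod x y). replace (y ^ 2) with ((- y) ^ 2) by ring. apply H. lra.
  - rewrite Rabs_R0, Rmult_0_r. replace (0 ^ 2 / x ^ 2) with 0 by (field; lra).
    rewrite Rplus_0_r, ln_1. replace ((0 + 0) / 2) with 0 by field. rewrite exp_0, Rmult_1_r.
    split; [|right; reflexivity].
    rewrite <- (Rmult_1_r (Cmod (rGamma (x, 0)))). apply Rmult_le_compat_l. apply Cmod_ge_0.
    rewrite <- exp_0. apply exp_le_compat. lra.
  - rewrite Rabs_pos_eq by lra. apply H; auto.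
Qed.

Lemma linear_le_exp (a e t : R) : 0 <= a -> 0 < e -> 0 <= t -> a + t <= (a + / e) * exp (e * t).
Proof.
  intros Ha He Ht. assert (H := exp_ineq1_le (e * t)).
  assert (0 <= e * t) by (apply Rmult_le_pos; lra).
  assert (H1 : a <= a * exp (e * t)) by (rewrite <- (Rmult_1_r a) at 1; apply Rmult_le_compat_l; lra).
  assert (H2 : / e * (e * t) <= / e * exp (e * t)).
  { apply Rmult_le_compat_l. left; apply Rinv_0_lt_compat; auto. lra. }
  replace (/ e * (e * t)) with t in H2 by (field; lra). lra.
Qed.

(** From [ln (e v) <= e v - 1] with [v = 1 + |y|/x]. As [e] is arbitrary, the logarithms cost an
    arbitrarily small slope in [|y|]. *)
Lemma ln_sq_le (e x y : R) : 0 < e -> 0 < x ->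
  ln (1 + y ^ 2 / x ^ 2) <= 2 * (e * (1 + Rabs y / x) - 1 - ln e).
Proof.
  intros He Hx.
  assert (Hy := Rabs_pos y). assert (Hu : 0 <= Rabs y / x) by (apply Rdiv_le_0_compat; lra).
  assert (H0 : 0 <= y ^ 2 / x ^ 2) by (apply Rdiv_le_0_compat; [apply pow2_ge_0 | apply pow_lt; auto]).
  apply Rle_trans with (2 * ln (1 + Rabs y / x)).
  - replace (2 * ln (1 + Rabs y / x)) with (ln ((1 + Rabs y / x) * (1 + Rabs y / x))) by (rewrite ln_mult by lra; ring).
    apply ln_le. lra. replace (y ^ 2 / x ^ 2) with (Rabs y / x * (Rabs y / x)). nra.
    rewrite <- (pow2_abs y). field; lra.
  - apply Rmult_le_compat_l. lra.
    assert (H := ln_le_minus_1 (e * (1 + Rabs y / x)) ltac:(apply Rmult_lt_0_compat; lra)).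
    rewrite ln_mult in H by lra. lra.
Qed.

Lemma continuous_Cmod_rGamma (x : R) : continuity_pt (fun x => Cmod (rGamma (RtoC x))) x.
Proof.
  apply continuity_pt_filterlim. apply (Clim_Cmod (locally x) (fun x => rGamma (RtoC x))).
  apply (Clim_comp (locally x) RtoC rGamma). apply continuous_rGamma. apply Clim_RtoC. apply locally_filter. apply filterlim_id.
Qed.

Lemma Gamma_strip_bound (x1 x2 e : R) : 0 < x1 <= x2 -> 0 < e ->
  exists K, 0 < K /\ forall x y, x1 <= x <= x2 ->
    Cmod (/ rGamma (x, y))%C <= K * exp (- (PI / 2 - e) * Rabs y).
Proof.
  intros Hx He.
  destruct (continuity_ab_min (fun x => Cmod (rGamma (RtoC x))) x1 x2 (proj2 Hx)) as [x0 [Hmin Hx0]].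
  { intros c _. apply continuous_Cmod_rGamma. }
  set (mu := Cmod (rGamma x0)).
  assert (Hmu : 0 < mu). { apply Cmod_gt_0, rGamma_neq_0_Re. simpl; lra. }
  (* Bounds the part of the exponent that does not depend on [y], uniformly for [x <= x2]. *)
  set (B := x2 * e + x2 * Rabs (ln e) + x2).
  exists (/ mu * exp B). split. { apply Rmult_lt_0_compat. apply Rinv_0_lt_compat; auto. apply exp_pos. }
  intros x y Hxx.
  destruct (rGamma_vertical x y ltac:(lra)) as [H _].
  assert (Hn : rGamma (x, y) <> 0) by (apply rGamma_neq_0_Re; simpl; lra).
  rewrite Cmod_inv by auto.
  assert (H1 : mu * exp ((PI / 2 - e) * Rabs y - B) <= Cmod (rGamma (x, y))).
  { apply Rle_trans with (2 := H). apply Rmult_le_compat; try lra. left; apply exp_pos.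
    apply Hmin; auto. apply exp_le_compat.
    assert (L := ln_sq_le e x y He ltac:(lra)).
    assert (L2 : x * ln (1 + y ^ 2 / x ^ 2) <= x * (2 * (e * (1 + Rabs y / x) - 1 - ln e))) by (apply Rmult_le_compat_l; lra).
    replace (x * (2 * (e * (1 + Rabs y / x) - 1 - ln e))) with (2 * (e * x + e * Rabs y - x - x * ln e)) in L2 by (field; lra).
    assert (L3 : - (x * ln e) <= x2 * Rabs (ln e)).
    { rewrite <- Ropp_mult_distr_r_reverse. apply Rle_trans with (x * Rabs (ln e)).
      apply Rmult_le_compat_l. lra. rewrite <- Rabs_Ropp. apply Rle_abs.
      apply Rmult_le_compat_r. apply Rabs_pos. lra. }
    unfold B. nra. }
  assert (Hp : 0 < mu * exp ((PI / 2 - e) * Rabs y - B)) by (apply Rmult_lt_0_compat; auto; apply exp_pos).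
  apply Rle_trans with (/ (mu * exp ((PI / 2 - e) * Rabs y - B))).
  apply Rinv_le_contravar; auto.
  right. rewrite Rinv_mult, <- exp_Ropp, Rmult_assoc, <- exp_plus. do 2 f_equal. ring.
Qed.

Lemma rGamma_strip_bound_pos (x1 x2 e : R) : 0 < x1 <= x2 -> 0 < e ->
  exists K, 0 < K /\ forall x y, x1 <= x <= x2 ->
    Cmod (rGamma (x, y)) <= K * exp ((PI / 2 + e) * Rabs y).
Proof.
  intros Hx He.
  destruct (continuity_ab_maj (fun x => Cmod (rGamma (RtoC x))) x1 x2 (proj2 Hx)) as [x0 [Hmax Hx0]].
  { intros c _. apply continuous_Cmod_rGamma. }
  set (mu := Cmod (rGamma x0)) in *.
  assert (Hmu : 0 < mu). { apply Cmod_gt_0, rGamma_neq_0_Re. simpl; lra. }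
  (* Scaled by [x1] because [ln_sq_le] divides [|y|] by [x >= x1]. *)
  set (e' := e * x1). assert (He' : 0 < e') by (apply Rmult_lt_0_compat; lra).
  set (B := e' - ln e').
  exists (mu * exp B). split. { apply Rmult_lt_0_compat; auto. apply exp_pos. }
  intros x y Hxx.
  destruct (rGamma_vertical x y ltac:(lra)) as [_ H].
  apply Rle_trans with (1 := H). rewrite Rmult_assoc, <- exp_plus.
  apply Rmult_le_compat. apply Cmod_ge_0. left; apply exp_pos. apply Hmax; auto.
  apply exp_le_compat.
  assert (L := ln_sq_le e' x y He' ltac:(lra)).
  assert (E : e' * (Rabs y / x) <= e * Rabs y).
  { unfold e', Rdiv. replace (e * x1 * (Rabs y * / x)) with (e * Rabs y * (x1 * / x)) by ring.
    rewrite <- (Rmult_1_r (e * Rabs y)) at 2. apply Rmult_le_compat_l.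
    apply Rmult_le_pos. lra. apply Rabs_pos. apply Rmult_le_reg_r with x. lra. rewrite Rmult_assoc, Rinv_l by lra. lra. }
  unfold B. nra.
Qed.

(** The functional equation moves the strip to the right until it lies in the half-plane [Re z > 0].
    Each step multiplies by [|z|], a linear factor paid for with [e / 2] of the slope. *)
Lemma rGamma_strip_bound (x1 x2 e : R) : x1 <= x2 -> 0 < e ->
  exists K, 0 < K /\ forall x y, x1 <= x <= x2 ->
    Cmod (rGamma (x, y)) <= K * exp ((PI / 2 + e) * Rabs y).
Proof.
  intros Hx He.
  destruct (nfloor_ex (Rmax 0 (- x1)) (Rmax_l _ _)) as [N [_ HN]].
  assert (HN1 : - INR (S N) < x1) by (assert (H := Rmax_r 0 (- x1)); rewrite S_INR; lra).
  clear HN. revert HN1 Hx He. revert x1 x2 e. generalize (S N) as p. clear N.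
  induction p; intros x1 x2 e HN Hx He.
  - apply rGamma_strip_bound_pos; auto. simpl in HN. lra.
  - rewrite S_INR in HN. destruct (IHp (x1 + 1) (x2 + 1) (e / 2)) as [K [HK H]]; try lra.
    set (a := Rabs x1 + Rabs x2).
    assert (Ha : 0 <= a) by (assert (H1 := Rabs_pos x1); assert (H2 := Rabs_pos x2); unfold a; lra).
    set (A := a + / (e / 2)). assert (HA : 0 < A). { assert (0 < / (e / 2)) by (apply Rinv_0_lt_compat; lra). unfold A; lra. }
    exists (A * K). split. apply Rmult_lt_0_compat; auto.
    intros x y Hxx. rewrite rGamma_rec, Cmod_mult.
    replace ((x, y) + 1)%C with ((x + 1, y) : C) by (unfold Cplus, RtoC; simpl; f_equal; ring).
    assert (E1 : Cmod (x, y) <= A * exp (e / 2 * Rabs y)).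
    { apply Rle_trans with (2 := linear_le_exp a (e / 2) (Rabs y) Ha ltac:(lra) (Rabs_pos y)).
      replace ((x, y) : C) with (RtoC x + RtoC y * Ci)%C by (unfold Cplus, Cmult, RtoC, Ci; simpl; f_equal; ring).
      eapply Rle_trans. apply Cmod_triangle. rewrite Cmod_mult, Cmod_Ci, !Cmod_R, Rmult_1_r.
      apply Rplus_le_compat_r. unfold a. unfold Rabs. repeat destruct Rcase_abs; lra. }
    assert (E2 := H (x + 1) y ltac:(lra)).
    replace (A * K * exp ((PI / 2 + e) * Rabs y)) with ((A * exp (e / 2 * Rabs y)) * (K * exp ((PI / 2 + e / 2) * Rabs y))).
    apply Rmult_le_compat; auto; apply Cmod_ge_0.
    transitivity (A * K * (exp (e / 2 * Rabs y) * exp ((PI / 2 + e / 2) * Rabs y))). ring.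
    rewrite <- exp_plus. do 2 f_equal. field.
Qed.

(* Log-convexity of Gamma, read off Gauss' product. *)
Lemma rGamma_growth (x al : R) : 1 < x -> 0 < al ->
  Cmod (rGamma (RtoC (x + al))) <= Rpower (x - 1) (- al) * Cmod (rGamma (RtoC x)).
Proof.
  intros Hx Hal.
  assert (HP : forall n, Cmod (rprod n (RtoC (x + al))) <=
    Rpower ((x + INR n) / (x - 1)) al * Cmod (rprod n (RtoC x))).
  (* [1 + al/t <= exp (al/t) <= (t/(t-1))^al]. Over [t = x, x + 1, ..., x + n] the right-hand sides
     telescope to [((x + n)/(x - 1))^al]. *)
  { assert (Hstep : forall t, 1 < t -> t + al <= Rpower (t / (t - 1)) al * t).
    { intros t Ht. assert (L := ln_le_minus_1 ((t - 1) / t) ltac:(apply Rdiv_lt_0_compat; lra)).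
      rewrite ln_div in L by lra. replace ((t - 1) / t - 1) with (- / t) in L by (field; lra).
      assert (E := exp_ineq1_le (al * ln (t / (t - 1)))).
      unfold Rpower. rewrite ln_div in * by lra.
      assert (al * / t <= al * (ln t - ln (t - 1))) by (apply Rmult_le_compat_l; lra).
      apply Rle_trans with ((1 + al * / t) * t). right; field; lra.
      apply Rmult_le_compat_r; lra. }
    induction n.
    - rewrite !rprod_0, !Cmod_R, !Rabs_pos_eq by lra. simpl. rewrite Rplus_0_r. apply Hstep; auto.
    - rewrite !rprod_S, !Cmod_mult, <- !RtoC_plus, !Cmod_R.
      assert (Hn := pos_INR (S n)). assert (Hn' := pos_INR n).
      rewrite !Rabs_pos_eq by lra.
      set (t := x + INR (S n)). assert (Et : x + INR n = t - 1) by (unfold t; rewrite S_INR; ring).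
      rewrite Et in IHn.
      replace (Rpower (t / (x - 1)) al) with (Rpower ((t - 1) / (x - 1)) al * Rpower (t / (t - 1)) al).
      2: { rewrite Rpower_mult_distr.
           f_equal. field. lra. apply Rdiv_lt_0_compat; lra. apply Rdiv_lt_0_compat; lra. }
      replace (x + al + INR (S n)) with (t + al) by (unfold t; ring).
      match goal with |- _ <= ?a * ?b * (?c * ?d) => replace (a * b * (c * d)) with ((a * c) * (b * d)) by ring end.
      apply Rmult_le_compat; auto. apply Cmod_ge_0. unfold t; lra. apply Hstep. lra. }
  assert (HS : forall n, (1 <= n)%nat -> Cmod (rGamma_seq n (RtoC (x + al))) <=
    (Rpower (1 + x / INR n) al * Rpower (x - 1) (- al)) * Cmod (rGamma_seq n (RtoC x))).
  { intros n Hn. assert (Hn0 : 0 < INR n) by (apply lt_0_INR; lia).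
    assert (Hxn : 0 < x / INR n) by (apply Rdiv_lt_0_compat; lra).
    unfold rGamma_seq. rewrite !Cmod_mult, !Cmod_cpw. simpl (Re (- _)%C).
    specialize (HP n).
    set (f := Cmod (/ RtoC (INR (fact n)))%C).
    replace (- (x + al)) with (- x + - al) by ring. rewrite Rpower_plus.
    replace (Rpower (1 + x / INR n) al * Rpower (x - 1) (- al)) with
      (Rpower (INR n) (- al) * Rpower ((x + INR n) / (x - 1)) al).
    2: { unfold Rpower. rewrite <- !exp_plus. f_equal.
         replace (1 + x / INR n) with ((x + INR n) / INR n) by (field; lra).
         rewrite !ln_div by lra. ring. }
    match goal with |- ?a * (?b * ?c) * ?p <= _ * ?h * (_ * _ * ?q) =>
      replace (a * (b * c) * p) with ((a * b * c) * p) by ring;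
      replace (c * h * (a * b * q)) with ((a * b * c) * (h * q)) by ring end.
    apply Rmult_le_compat_l; auto. apply Rmult_le_pos. apply Rmult_le_pos. apply Cmod_ge_0.
    left; apply exp_pos. left; apply exp_pos. }
  assert (L1 := Clim_Cmod eventually _ _ (rGamma_lim (RtoC (x + al)))).
  assert (L2 := Clim_Cmod eventually _ _ (rGamma_lim (RtoC x))).
  assert (L3 : is_lim_seq (fun n => Rpower (1 + x / INR n) al * Rpower (x - 1) (- al)) (1 * Rpower (x - 1) (- al))).
  { apply is_lim_seq_mult'. 2: apply is_lim_seq_const.
    unfold Rpower. apply (filterlim_comp _ _ _ (fun n => al * ln (1 + x / INR n)) exp eventually (locally 0)).
    2: { assert (H := continuous_exp 0). unfold continuous in H. rewrite exp_0 in H. exact H. }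
    change (is_lim_seq (fun n => al * ln (1 + x / INR n)) 0).
    replace (Finite 0) with (Rbar_mult al (ln (1 + 0))) by (simpl; rewrite Rplus_0_r, ln_1, Rmult_0_r; reflexivity).
    apply is_lim_seq_scal_l.
    apply (filterlim_comp _ _ _ (fun n => 1 + x / INR n) ln eventually (locally (1 + 0))).
    2: apply continuous_ln; lra.
    apply (is_lim_seq_plus' (fun _ => 1)). apply is_lim_seq_const. apply filterlim_INR_inv. }
  rewrite <- (Rmult_1_l (Rpower (x - 1) (- al))).
  refine (filterlim_le (F := eventually) _ _ (Finite _) (Finite _) _ L1 (is_lim_seq_mult' _ _ _ _ L3 L2)).
  exists 1%nat. exact HS.
Qed.

(** * Dominated improper integrals and Fubini's theorem *)

Notation CRInt f a b l := (is_RInt (V := C_R_NormedModule) f a b l).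
Notation CInt f a b := (RInt (V := C_R_CompleteNormedModule) f a b).
Notation CRIntg f Fa Fb l := (is_RInt_gen (V := C_R_NormedModule) f Fa Fb l).
Notation Ccont2 h t u := (continuous (T := prod_UniformSpace R_UniformSpace R_UniformSpace) (U := C_UniformSpace) (fun p : R * R => h (fst p) (snd p)) (t, u)).

Lemma CInt_correct (f : R -> C) (a b : R) :
  (forall x, Rmin a b <= x <= Rmax a b -> Ccont f x) -> CRInt f a b (CInt f a b).
Proof.
  intros H. apply (RInt_correct (V := C_R_CompleteNormedModule)).
  apply (ex_RInt_continuous (V := C_R_CompleteNormedModule)). exact H.
Qed.

Lemma CInt_unique (f : R -> C) (a b : R) (l : C) : CRInt f a b l -> CInt f a b = l.
Proof. apply (is_RInt_unique (V := C_R_CompleteNormedModule)). Qed.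

(** Valid for both orientations of the interval, since the endpoints taken from two filters need not
    be ordered. *)
Lemma CRInt_bound (f : R -> C) (p P : R -> R) (c a b : R) (l : C) :
  0 <= c ->
  (forall u, Rmin a b <= u <= Rmax a b -> is_derive P u (p u) /\ continuous p u) ->
  (forall u, Rmin a b <= u <= Rmax a b -> Cmod (f u) <= c * p u) ->
  CRInt f a b l -> Cmod l <= c * Rabs (P b - P a).
Proof.
  assert (H : forall a b l, 0 <= c -> a <= b ->
    (forall u, Rmin a b <= u <= Rmax a b -> is_derive P u (p u) /\ continuous p u) ->
    (forall u, Rmin a b <= u <= Rmax a b -> Cmod (f u) <= c * p u) ->
    CRInt f a b l -> Cmod l <= c * Rabs (P b - P a)).
  { clear a b l. intros a b l Hc Hab H1 H2 H3.
    assert (HI : is_RInt (fun u => c * p u) a b (c * (P b - P a))).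
    { apply (is_RInt_scal (V := R_NormedModule) p a b c).
      apply (is_RInt_derive (V := R_CompleteNormedModule) P p); intros; apply H1; auto. }
    rewrite Rmin_left, Rmax_right in H2 by auto.
    assert (H := norm_RInt_le (V := C_R_NormedModule) f (fun u => c * p u) a b l _ Hab
      (fun x Hx => eq_ind _ (fun r => r <= c * p x) (H2 x Hx) _ (Cmod_norm (f x))) H3 HI).
    rewrite <- Cmod_norm in H. apply Rle_trans with (1 := H).
    apply Rmult_le_compat_l; auto. apply Rle_abs. }
  intros Hc H1 H2 H3. destruct (Rle_lt_dec a b) as [Hab | Hab].
  - apply H; auto.
  - rewrite <- Cmod_opp, Rabs_minus_sym. apply H; auto.
    + lra.
    + intros u. rewrite Rmin_comm, Rmax_comm. apply H1.
    + intros u. rewrite Rmin_comm, Rmax_comm. apply H2.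
    + apply (is_RInt_swap (V := C_R_NormedModule)) in H3. exact H3.
Qed.

Lemma CRInt_minus (f g : R -> C) (a b : R) (l m : C) :
  CRInt f a b l -> CRInt g a b m -> CRInt (fun x => f x - g x)%C a b (l - m)%C.
Proof. intros. apply (is_RInt_minus (V := C_R_NormedModule)); auto. Qed.

(* [p] controls improper integrals from [Fa] to [Fb]: it has a primitive [P] with limits at both ends. *)
Record dominator (Fa Fb : (R -> Prop) -> Prop) (D : R -> Prop) (p P : R -> R) (la lb : R) : Prop := {
  dom_Fa : ProperFilter Fa;
  dom_Fb : ProperFilter Fb;
  dom_Da : Fa D;
  dom_Db : Fb D;
  dom_conv : forall a b u, D a -> D b -> Rmin a b <= u <= Rmax a b -> D u;
  dom_open : forall u, D u -> locally u D;
  dom_deriv : forall u, D u -> is_derive P u (p u);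
  dom_cont : forall u, D u -> continuous p u;
  dom_la : filterlim P Fa (locally la);
  dom_lb : filterlim P Fb (locally lb) }.

Arguments dom_Fa {Fa Fb D p P la lb} _.
Arguments dom_Fb {Fa Fb D p P la lb} _.
Arguments dom_Da {Fa Fb D p P la lb} _.
Arguments dom_Db {Fa Fb D p P la lb} _.
Arguments dom_conv {Fa Fb D p P la lb} _.
Arguments dom_open {Fa Fb D p P la lb} _.
Arguments dom_deriv {Fa Fb D p P la lb} _.
Arguments dom_cont {Fa Fb D p P la lb} _.
Arguments dom_la {Fa Fb D p P la lb} _.
Arguments dom_lb {Fa Fb D p P la lb} _.

Lemma dominator_scal Fa Fb D p P la lb (c : R) :
  dominator Fa Fb D p P la lb ->
  dominator Fa Fb D (fun u => c * p u) (fun u => c * P u) (c * la) (c * lb).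
Proof.
  intros []. constructor; auto.
  - intros u Hu. apply is_derive_scal; auto.
  - intros u Hu. apply (continuous_mult (K := R_AbsRing) (fun _ => c)); auto. apply continuous_const.
  - eapply filterlim_comp. eauto. apply (continuous_mult (K := R_AbsRing) (fun _ => c) (fun x => x)).
    apply continuous_const. apply continuous_id.
  - eapply filterlim_comp. eauto. apply (continuous_mult (K := R_AbsRing) (fun _ => c) (fun x => x)).
    apply continuous_const. apply continuous_id.
Qed.

Lemma filter_near_R {T} (F : (T -> Prop) -> Prop) {FF : Filter F} (P : T -> R) (l eps : R) :
  0 < eps -> filterlim P F (locally l) -> F (fun x => Rabs (P x - l) < eps).
Proof. intros He H. exact (proj1 (filterlim_locally (F := F) P l) H (mkposreal eps He)). Qed.

Section Dominated.
Variables (Fa Fb : (R -> Prop) -> Prop) (D : R -> Prop) (p P : R -> R) (la lb : R).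
Hypothesis HD : dominator Fa Fb D p P la lb.
Let PFa : ProperFilter Fa := dom_Fa HD.
Let PFb : ProperFilter Fb := dom_Fb HD.
Local Existing Instance PFa.
Local Existing Instance PFb.

Lemma dom_prod_near (eps : R) : 0 < eps ->
  filter_prod Fa Fb (fun ab => D (fst ab) /\ D (snd ab) /\ Rabs (P (fst ab) - la) < eps /\ Rabs (P (snd ab) - lb) < eps).
Proof.
  intros He. apply Filter_prod with (fun a => D a /\ Rabs (P a - la) < eps) (fun b => D b /\ Rabs (P b - lb) < eps).
  - apply filter_and. exact (dom_Da HD). apply (filter_near_R Fa); auto; exact (dom_la HD).
  - apply filter_and. exact (dom_Db HD). apply (filter_near_R Fb); auto; exact (dom_lb HD).
  - simpl. tauto.
Qed.

Lemma CRIntg_iff (f : R -> C) (l : C) :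
  CRIntg f Fa Fb l <->
  (forall eps, 0 < eps -> filter_prod Fa Fb (fun ab => exists v, CRInt f (fst ab) (snd ab) v /\ Cmod (v - l)%C < eps)).
Proof.
  split.
  - intros H eps He.
    assert (HL : locally (T := C_R_NormedModule) l (fun v => Cmod (v - l)%C < eps)).
    { apply (locally_Cmod_lt l eps He). }
    exact (H _ HL).
  - intros H Q HQ. unfold filtermapi.
    destruct (proj1 (locally_C l Q) HQ) as [eps Heps].
    generalize (H eps (cond_pos eps)). apply filter_imp.
    intros ab [v [H1 H2]]. exists v; split; auto.
Qed.

Variable f : R -> C.
Variable c : R.
Hypothesis Hc : 0 <= c.
Hypothesis Hf : forall u, D u -> Ccont f u.
Hypothesis Hb : forall u, D u -> Cmod (f u) <= c * p u.

Lemma dom_CInt (a b : R) : D a -> D b -> CRInt f a b (CInt f a b).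
Proof. intros Ha Hb'. apply CInt_correct. intros x Hx. apply Hf. apply (dom_conv HD a b); auto. Qed.

Lemma dom_bound (a b : R) (l : C) : D a -> D b -> CRInt f a b l -> Cmod l <= c * Rabs (P b - P a).
Proof.
  intros Ha Hb' H. apply (CRInt_bound f p P c a b l); auto.
  - intros u Hu. assert (D u) by (apply (dom_conv HD a b); auto). split; [apply (dom_deriv HD) | apply (dom_cont HD)]; auto.
  - intros u Hu. apply Hb. apply (dom_conv HD a b); auto.
Qed.

(** Chasles' relation leaves only the two end pieces; this is the Cauchy estimate behind existence
    and tails. *)
Lemma dom_diff (a b a' b' : R) (v v' : C) : D a -> D b -> D a' -> D b' ->
  CRInt f a b v -> CRInt f a' b' v' -> Cmod (v - v')%C <= c * (Rabs (P a - P a') + Rabs (P b - P b')).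
Proof.
  intros Ha Hb1 Ha' Hb1' H H'.
  assert (H1 := dom_CInt a a' Ha Ha'). assert (H2 := dom_CInt b' b Hb1' Hb1).
  set (w := CInt f a a') in *. set (w' := CInt f b' b) in *.
  assert (H3 := is_RInt_Chasles (V := C_R_NormedModule) f a b' b _ _
     (is_RInt_Chasles (V := C_R_NormedModule) f a a' b' _ _ H1 H') H2).
  assert (E : v = (w + v' + w')%C).
  { exact (eq_trans (eq_sym (CInt_unique _ _ _ _ H)) (CInt_unique _ _ _ _ H3)). }
  rewrite E. replace (w + v' + w' - v')%C with (w + w')%C by ring.
  eapply Rle_trans. apply Cmod_triangle. rewrite Rmult_plus_distr_l. apply Rplus_le_compat.
  rewrite Rabs_minus_sym. apply dom_bound; auto. apply dom_bound; auto.
Qed.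

Lemma CRIntg_dominated : exists l : C, CRIntg f Fa Fb l.
Proof.
  destruct (proj1 (filterlim_locally_cauchy (U := C_R_CompleteNormedModule) (F := filter_prod Fa Fb)
    (fun ab => CInt f (fst ab) (snd ab)))) as [l Hl].
  (* Each end contributes less than [2 d] to the variation of [P], hence less than [4 c d] in all;
     [c + 1] covers the case [c = 0]. *)
  - intros eps. set (d := eps / (4 * (c + 1))).
    assert (He := cond_pos eps).
    assert (Hd : 0 < d) by (apply Rdiv_lt_0_compat; lra).
    eexists. split. apply (dom_prod_near d Hd).
    intros [a b] [a' b'] [H1 [H2 [H3 H4]]] [H1' [H2' [H3' H4']]]. simpl in *.
    apply (norm_compat1 (V := C_R_NormedModule)). rewrite <- Cmod_norm.
    change (Cmod (CInt f a' b' - CInt f a b)%C < eps).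
    eapply Rle_lt_trans. apply (dom_diff a' b' a b); auto; apply dom_CInt; auto.
    assert (Rabs (P a' - P a) < 2 * d).
    { replace (P a' - P a) with ((P a' - la) - (P a - la)) by ring. eapply Rle_lt_trans. apply Rabs_triang.
      rewrite Rabs_Ropp. lra. }
    assert (Rabs (P b' - P b) < 2 * d).
    { replace (P b' - P b) with ((P b' - lb) - (P b - lb)) by ring. eapply Rle_lt_trans. apply Rabs_triang.
      rewrite Rabs_Ropp. lra. }
    assert (E : (c + 1) * (4 * d) = eps) by (unfold d; field; lra). nra.
  - exists l. apply CRIntg_iff. intros eps He.
    assert (H := proj1 (Clim_eps (filter_prod Fa Fb) _ _) Hl eps He).
    generalize (filter_and _ _ H (dom_prod_near 1 Rlt_0_1)). apply filter_imp.
    intros ab [H1 [H2 [H3 _]]]. eexists. split. apply dom_CInt; auto. exact H1.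
Qed.

(** An error explicit in [P], hence uniform in any parameter that enters only through [c]; the
    exchange of integrals rests on it. *)
Lemma CRIntg_tail (l : C) (a b : R) (v : C) : CRIntg f Fa Fb l -> D a -> D b -> CRInt f a b v ->
  Cmod (v - l)%C <= c * (Rabs (P a - la) + Rabs (P b - lb)).
Proof.
  intros Hl Ha Hb1 Hv. apply le_epsilon. intros eps He. assert (He2 : 0 < eps / 2) by lra.
  set (d := eps / (4 * (c + 1))).
  assert (Hd : 0 < d) by (apply Rdiv_lt_0_compat; lra).
  destruct (filter_ex _ (filter_and _ _ (proj1 (CRIntg_iff f l) Hl _ He2) (dom_prod_near d Hd)))
    as [[a' b'] [[v' [H1 H2]] [H3 [H4 [H5 H6]]]]]. simpl in *.
  replace (v - l)%C with ((v - v') + (v' - l))%C by ring.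
  eapply Rle_trans. apply Cmod_triangle.
  assert (H7 := dom_diff a b a' b' v v' Ha Hb1 H3 H4 Hv H1).
  assert (Rabs (P a - P a') <= Rabs (P a - la) + d).
  { replace (P a - P a') with ((P a - la) - (P a' - la)) by ring. eapply Rle_trans. apply Rabs_triang.
    rewrite Rabs_Ropp. lra. }
  assert (Rabs (P b - P b') <= Rabs (P b - lb) + d).
  { replace (P b - P b') with ((P b - lb) - (P b' - lb)) by ring. eapply Rle_trans. apply Rabs_triang.
    rewrite Rabs_Ropp. lra. }
  assert (E : (c + 1) * (4 * d) = eps) by (unfold d; field; lra).
  assert (c * (Rabs (P a - P a') + Rabs (P b - P b')) <= c * (Rabs (P a - la) + Rabs (P b - lb) + 2 * d))
    by (apply Rmult_le_compat_l; lra).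
  nra.
Qed.

Lemma CRIntg_bound (l : C) : CRIntg f Fa Fb l -> Cmod l <= c * Rabs (lb - la).
Proof.
  intros Hl. apply le_epsilon. intros eps He. assert (He2 : 0 < eps / 2) by lra.
  set (d := eps / (4 * (c + 1))).
  assert (Hd : 0 < d) by (apply Rdiv_lt_0_compat; lra).
  destruct (filter_ex _ (dom_prod_near d Hd)) as [[a b] [H1 [H2 [H3 H4]]]]. simpl in *.
  assert (H5 := CRIntg_tail l a b _ Hl H1 H2 (dom_CInt a b H1 H2)).
  assert (H6 := dom_bound a b _ H1 H2 (dom_CInt a b H1 H2)).
  rewrite Cmod_minus_sym in H5.
  replace l with ((l - CInt f a b) + CInt f a b)%C by ring.
  eapply Rle_trans. apply Cmod_triangle.
  assert (Rabs (P b - P a) <= Rabs (lb - la) + 2 * d).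
  { replace (P b - P a) with ((lb - la) + ((P b - lb) - (P a - la))) by ring.
    eapply Rle_trans. apply Rabs_triang. apply Rplus_le_compat_l. eapply Rle_trans. apply Rabs_triang. rewrite Rabs_Ropp. lra. }
  assert (E : (c + 1) * (4 * d) = eps) by (unfold d; field; lra).
  assert (c * Rabs (P b - P a) <= c * (Rabs (lb - la) + 2 * d)) by (apply Rmult_le_compat_l; lra).
  assert (c * (Rabs (P a - la) + Rabs (P b - lb)) <= c * (2 * d)) by (apply Rmult_le_compat_l; lra).
  nra.
Qed.

Lemma CRIntg_unique (l l' : C) : CRIntg f Fa Fb l -> CRIntg f Fa Fb l' -> l = l'.
Proof.
  intros H1 H2. transitivity (RInt_gen (V := C_R_CompleteNormedModule) f Fa Fb).
  symmetry; apply (is_RInt_gen_unique (V := C_R_CompleteNormedModule)); auto.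
  apply (is_RInt_gen_unique (V := C_R_CompleteNormedModule)); auto.
Qed.
End Dominated.

(** * Integrals over rectangles: continuity in a parameter and change of order *)

Lemma RInt_param_cont_R (h : R -> R -> R) (S T u : R) :
  (forall t u, continuity_2d_pt h t u) -> continuous (fun u => RInt (fun t => h t u) S T) u.
Proof.
  intros Hh. assert (HI : forall u, ex_RInt (fun t => h t u) S T).
  { intros v. apply (ex_RInt_continuous (V := R_CompleteNormedModule)). intros t _.
    apply continuity_pt_filterlim. intros eps He. destruct (Hh t v (mkposreal eps He)) as [d Hd].
    exists d. split. apply cond_pos. intros x [_ Hx]. apply (Hd x v). exact Hx.
    replace (v - v) with 0 by ring. rewrite Rabs_R0. apply cond_pos. }
  apply filterlim_locally. intros eps.
  set (e := mkposreal (eps / (Rabs (T - S) + 1)) ltac:(apply Rdiv_lt_0_compat; [apply cond_pos | assert (H := Rabs_pos (T - S)); lra])).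
  destruct (uniform_continuity_2d_1d h (Rmin S T) (Rmax S T) u (fun x _ => Hh x u) e) as [d Hd].
  exists d. intros v Hv. change (Rabs (v - u) < d) in Hv.
  change (Rabs (RInt (fun t => h t v) S T - RInt (fun t => h t u) S T) < eps).
  rewrite <- (RInt_minus (V := R_CompleteNormedModule)) by auto.
  assert (Hlt : forall S T, Rmin S T <= Rmax S T) by (intros; apply Rmin_Rmax).
  assert (HJ : is_RInt (fun t => minus (h t v) (h t u)) S T (RInt (fun t => minus (h t v) (h t u)) S T)).
  { apply (RInt_correct (V := R_CompleteNormedModule)). apply (ex_RInt_minus (V := R_NormedModule)); auto. }
  assert (B' : Rabs (RInt (fun t => minus (h t v) (h t u)) S T) <= Rabs (T - S) * e).
  { apply (norm_RInt_le_const_abs (V := R_NormedModule) (fun t => minus (h t v) (h t u)) S T); auto. intros t Ht. left.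
    apply (Hd t u t v); auto.
    - assert (H := cond_pos d). lra.
    - apply Rabs_def2 in Hv. lra.
    - replace (t - t) with 0 by ring. rewrite Rabs_R0. apply cond_pos. }
  apply Rle_lt_trans with (1 := B'). unfold e; simpl.
  assert (H := Rabs_pos (T - S)). assert (He := cond_pos eps).
  apply Rmult_lt_reg_r with (Rabs (T - S) + 1). lra.
  replace (Rabs (T - S) * (eps / (Rabs (T - S) + 1)) * (Rabs (T - S) + 1)) with (Rabs (T - S) * eps) by (field; lra).
  nra.
Qed.

Lemma cont_2d_1d (h : R -> R -> R) (t u : R) : continuity_2d_pt h t u -> continuous (fun t => h t u) t /\ continuous (h t) u.
Proof.
  intros H. split; apply continuity_pt_filterlim; intros eps He; destruct (H (mkposreal eps He)) as [d Hd];
    exists d; (split; [apply cond_pos|]); intros x [_ Hx]; apply Hd; try exact Hx;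
    [replace (u - u) with 0 by ring | replace (t - t) with 0 by ring]; rewrite Rabs_R0; apply cond_pos.
Qed.

(** The double integral is seen as a function of the upper limit in the first variable.
    Differentiating it under the outer integral gives [RInt (h t) a b], it vanishes at [S], and the
    fundamental theorem concludes. *)
Lemma RInt_swap_R (h : R -> R -> R) (S T a b : R) : (forall t u, continuity_2d_pt h t u) ->
  is_RInt (fun t => RInt (h t) a b) S T (RInt (fun u => RInt (fun t => h t u) S T) a b).
Proof.
  intros Hh.
  assert (Hin : forall t, is_derive (fun x => RInt (fun u => RInt (fun t => h t u) S x) a b) t (RInt (h t) a b)).
  { intros t.
    assert (Hd : forall x u, is_derive (fun x => RInt (fun t => h t u) S x) x (h x u)).
    { intros x u. apply (is_derive_RInt (V := R_NormedModule) (fun t => h t u) (fun x => RInt (fun t => h t u) S x) S x).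
      apply filter_forall. intros y. apply (RInt_correct (V := R_CompleteNormedModule)).
      apply (ex_RInt_continuous (V := R_CompleteNormedModule)). intros s _. apply (cont_2d_1d h s u); auto.
      apply (cont_2d_1d h x u); auto. }
    replace (RInt (h t) a b) with (RInt (fun u => Derive (fun x => RInt (fun t => h t u) S x) t) a b).
    2: { apply RInt_ext. intros u _. apply is_derive_unique, Hd. }
    apply (is_derive_RInt_param (fun x u => RInt (fun t => h t u) S x)).
    - apply filter_forall. intros x u _. eexists; apply Hd.
    - intros u _. apply continuity_2d_pt_ext with h. 2: auto. intros x v. symmetry; apply is_derive_unique, Hd.
    - apply filter_forall. intros x. apply (ex_RInt_continuous (V := R_CompleteNormedModule)). intros u _.
      apply RInt_param_cont_R; auto. }
  replace (RInt (fun u => RInt (fun t => h t u) S T) a b) with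
    (minus (RInt (fun u => RInt (fun t => h t u) S T) a b) (RInt (fun u => RInt (fun t => h t u) S S) a b)).
  - apply (is_RInt_derive (V := R_CompleteNormedModule) (fun x => RInt (fun u => RInt (fun t => h t u) S x) a b)).
    intros; apply Hin. intros t _.
    apply (RInt_param_cont_R (fun u t => h t u)). intros u t'.
    intros eps. destruct (Hh t' u eps) as [d Hd]. exists d. intros x y Hx Hy. apply (Hd y x); auto.
  - rewrite (RInt_ext (fun u => RInt (fun t => h t u) S S) (fun _ => 0)).
    rewrite RInt_const. unfold minus, plus, opp, scal; simpl. unfold mult; simpl. ring.
    intros u _. apply (RInt_point (V := R_CompleteNormedModule)).
Qed.

Lemma CRInt_pair (f : R -> C) (a b : R) (x y : R) :
  is_RInt (fun t => Re (f t)) a b x -> is_RInt (fun t => Im (f t)) a b y -> CRInt f a b (x, y).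
Proof. apply (is_RInt_fct_extend_pair (U := R_NormedModule) (V := R_NormedModule) f). Qed.

Lemma Re_CInt (f : R -> C) (a b : R) : (forall x, Rmin a b <= x <= Rmax a b -> Ccont f x) ->
  RInt (fun t => Re (f t)) a b = Re (CInt f a b) /\ RInt (fun t => Im (f t)) a b = Im (CInt f a b).
Proof.
  intros H. assert (HI := CInt_correct f a b H). split; apply (is_RInt_unique (V := R_CompleteNormedModule)).
  apply (is_RInt_fct_extend_fst (U := R_NormedModule) (V := R_NormedModule) f a b _ HI).
  apply (is_RInt_fct_extend_snd (U := R_NormedModule) (V := R_NormedModule) f a b _ HI).
Qed.

Lemma Ccont2_comps (h : R -> R -> C) (t u : R) : Ccont2 h t u ->
  continuity_2d_pt (fun t u => Re (h t u)) t u /\ continuity_2d_pt (fun t u => Im (h t u)) t u.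
Proof.
  intros H. split; apply continuity_2d_pt_filterlim.
  apply (Clim_Re _ _ _ H). apply (Clim_Im _ _ _ H).
Qed.

Lemma Ccont2_fst (h : R -> R -> C) (t u : R) : Ccont2 h t u -> Ccont (fun t => h t u) t.
Proof.
  intros H. apply (continuous_comp_2 (fun t => t) (fun _ => u) h t). apply continuous_id. apply continuous_const. exact H.
Qed.

Lemma Ccont2_snd (h : R -> R -> C) (t u : R) : Ccont2 h t u -> Ccont (h t) u.
Proof.
  intros H. apply (continuous_comp_2 (fun _ => t) (fun u => u) h u). apply continuous_const. apply continuous_id. exact H.
Qed.

Lemma CInt_param_cont (h : R -> R -> C) (S T u : R) :
  (forall t u, Ccont2 h t u) -> Ccont (fun u => CInt (fun t => h t u) S T) u.
Proof.
  intros Hh.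
  apply (continuous_ext (fun u => (RInt (fun t => Re (h t u)) S T, RInt (fun t => Im (h t u)) S T) : C)).
  { intros v. destruct (Re_CInt (fun t => h t v) S T) as [-> ->].
    intros; apply (Ccont2_fst h); auto. destruct (CInt _ _ _); reflexivity. }
  apply (Clim_pair (locally u) (fun u => RInt (fun t => Re (h t u)) S T) (fun u => RInt (fun t => Im (h t u)) S T)).
  apply (RInt_param_cont_R (fun t u => Re (h t u))). intros; apply Ccont2_comps; auto.
  apply (RInt_param_cont_R (fun t u => Im (h t u))). intros; apply Ccont2_comps; auto.
Qed.

Lemma CInt_swap (h : R -> R -> C) (S T a b : R) : (forall t u, Ccont2 h t u) ->
  CRInt (fun t => CInt (h t) a b) S T (CInt (fun u => CInt (fun t => h t u) S T) a b).
Proof.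
  intros Hh.
  assert (E : forall t, CInt (h t) a b = (RInt (fun u => Re (h t u)) a b, RInt (fun u => Im (h t u)) a b)).
  { intros t. destruct (Re_CInt (h t) a b) as [-> ->]. intros; apply (Ccont2_snd h); auto. destruct (CInt _ _ _); reflexivity. }
  destruct (Re_CInt (fun u => CInt (fun t => h t u) S T) a b) as [E1 E2].
  { intros; apply CInt_param_cont; auto. }
  replace (CInt (fun u => CInt (fun t => h t u) S T) a b) with
    ((RInt (fun u => RInt (fun t => Re (h t u)) S T) a b, RInt (fun u => RInt (fun t => Im (h t u)) S T) a b) : C).
  2: { destruct (CInt (fun u => CInt (fun t => h t u) S T) a b) as [x y]. simpl in E1, E2. rewrite <- E1, <- E2.
       f_equal; apply RInt_ext; intros u _; apply (Re_CInt (fun t => h t u)); intros; apply (Ccont2_fst h); auto. }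
  apply CRInt_pair.
  - eapply is_RInt_ext. 2: apply (RInt_swap_R (fun t u => Re (h t u))); intros; apply Ccont2_comps; auto.
    intros t _. symmetry. exact (f_equal Re (E t)).
  - eapply is_RInt_ext. 2: apply (RInt_swap_R (fun t u => Im (h t u))); intros; apply Ccont2_comps; auto.
    intros t _. symmetry. exact (f_equal Im (E t)).
Qed.

(** Projection onto the segment between [a] and [b]. Composing with it makes a function continuous
    on a rectangle continuous on the whole plane, as the swap lemma requires, without changing it on
    the rectangle. *)
Definition clamp (a b x : R) : R := Rmax (Rmin a b) (Rmin (Rmax a b) x).

Lemma clamp_in (a b x : R) : Rmin a b <= clamp a b x <= Rmax a b.
Proof. unfold clamp. assert (H := Rmin_Rmax a b). set (m := Rmin a b) in *. set (M := Rmax a b) in *.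
  unfold Rmax, Rmin. repeat destruct Rle_dec; lra. Qed.

Lemma clamp_id (a b x : R) : Rmin a b <= x <= Rmax a b -> clamp a b x = x.
Proof. intros H. unfold clamp. rewrite (Rmin_right (Rmax a b)) by lra. apply Rmax_right. lra. Qed.

Lemma continuous_clamp (a b x : R) : continuous (clamp a b) x.
Proof.
  apply filterlim_locally. intros eps. exists eps. intros y Hy. change (Rabs (y - x) < eps) in Hy.
  change (Rabs (clamp a b y - clamp a b x) < eps).
  apply Rle_lt_trans with (2 := Hy). unfold clamp. assert (H := Rmin_Rmax a b).
  set (m := Rmin a b) in *. set (M := Rmax a b) in *. unfold Rmax, Rmin. unfold Rabs.
  repeat destruct Rle_dec; repeat destruct Rcase_abs; lra.
Qed.

Section Rect.
Variables (D E : R -> Prop) (h : R -> R -> C).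
Hypothesis HD : forall a b u, D a -> D b -> Rmin a b <= u <= Rmax a b -> D u.
Hypothesis HE : forall a b u, E a -> E b -> Rmin a b <= u <= Rmax a b -> E u.
Hypothesis HEo : forall u, E u -> locally u E.
Hypothesis Hh : forall t u, D t -> E u -> Ccont2 h t u.

Lemma clamp_cont2 (S T a b : R) : D S -> D T -> E a -> E b ->
  forall t u, Ccont2 (fun t u => h (clamp S T t) (clamp a b u)) t u.
Proof.
  intros HS HT Ha Hb t u.
  apply (continuous_comp_2 (fun p : R * R => clamp S T (fst p)) (fun p : R * R => clamp a b (snd p)) h (t, u)).
  - apply continuous_comp. apply continuous_fst. apply continuous_clamp.
  - apply (continuous_comp (fun p : R * R => snd p) (clamp a b)). apply continuous_snd. apply continuous_clamp.
  - apply Hh. apply (HD S T); auto. apply clamp_in. apply (HE a b); auto. apply clamp_in.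
Qed.

Lemma rect_param_cont (S T u : R) : D S -> D T -> E u -> Ccont (fun u => CInt (fun t => h t u) S T) u.
Proof.
  intros HS HT Hu. destruct (HEo u Hu) as [d Hd].
  assert (Hd2 := cond_pos d).
  assert (Ha : E (u - d / 2)). { apply Hd. change (Rabs (u - d / 2 - u) < d). apply Rabs_def1; lra. }
  assert (Hb : E (u + d / 2)). { apply Hd. change (Rabs (u + d / 2 - u) < d). apply Rabs_def1; lra. }
  apply continuous_ext_loc with (fun v => CInt (fun t => h (clamp S T t) (clamp (u - d/2) (u + d/2) v)) S T).
  - exists (mkposreal (d/2) ltac:(lra)). intros v Hv. change (Rabs (v - u) < d / 2) in Hv. apply Rabs_def2 in Hv.
    apply (RInt_ext (V := C_R_CompleteNormedModule)). intros t Ht.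
    rewrite !clamp_id; auto. rewrite Rmin_left, Rmax_right; lra. lra.
  - apply (CInt_param_cont (fun t v => h (clamp S T t) (clamp (u - d / 2) (u + d / 2) v))).
    apply clamp_cont2; auto.
Qed.

Lemma rect_swap (S T a b : R) : D S -> D T -> E a -> E b ->
  CRInt (fun t => CInt (h t) a b) S T (CInt (fun u => CInt (fun t => h t u) S T) a b).
Proof.
  intros HS HT Ha Hb.
  assert (H := CInt_swap _ S T a b (clamp_cont2 S T a b HS HT Ha Hb)).
  replace (CInt (fun u => CInt (fun t => h t u) S T) a b) with
    (CInt (fun u => CInt (fun t => h (clamp S T t) (clamp a b u)) S T) a b).
  - revert H. apply (is_RInt_ext (V := C_R_NormedModule)). intros t Ht.
    apply (RInt_ext (V := C_R_CompleteNormedModule)). intros u Hu. rewrite !clamp_id; auto; lra.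
  - apply (RInt_ext (V := C_R_CompleteNormedModule)). intros u Hu.
    apply (RInt_ext (V := C_R_CompleteNormedModule)). intros t Ht. rewrite !clamp_id; auto; lra.
Qed.
End Rect.

(** * Fubini's theorem for dominated improper integrals *)

Section Fubini.
Variables (Ta Tb Ua Ub : (R -> Prop) -> Prop) (D E : R -> Prop) (p P q Q : R -> R) (ta tb ua ub : R).
Hypothesis HD : dominator Ta Tb D p P ta tb.
Hypothesis HE : dominator Ua Ub E q Q ua ub.
Variables (h : R -> R -> C) (H G : R -> C) (I : C).
Hypothesis Hh : forall t u, D t -> E u -> Ccont2 h t u.
Hypothesis Hb : forall t u, D t -> E u -> Cmod (h t u) <= p t * q u.
Hypothesis Hq : forall u, E u -> 0 <= q u.
Hypothesis Hp : forall t, D t -> 0 <= p t.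
Hypothesis HH : forall u, E u -> CRIntg (fun t => h t u) Ta Tb (H u).
Hypothesis HG : forall t, D t -> CRIntg (h t) Ua Ub (G t).
Hypothesis HI : CRIntg G Ta Tb I.
Let PTa : ProperFilter Ta := dom_Fa HD.
Let PTb : ProperFilter Tb := dom_Fb HD.
Let PUa : ProperFilter Ua := dom_Fa HE.
Let PUb : ProperFilter Ub := dom_Fb HE.
Local Existing Instance PTa.
Local Existing Instance PTb.
Local Existing Instance PUa.
Local Existing Instance PUb.

Lemma fubini_param_cont (S T u : R) : D S -> D T -> E u -> Ccont (fun u => CInt (fun t => h t u) S T) u.
Proof. intros. apply (rect_param_cont D E); first [exact (dom_conv HD) | exact (dom_conv HE) | exact (dom_open HE) | auto]. Qed.

Lemma fubini_inner_t (S T u : R) : D S -> D T -> E u ->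
  CRInt (fun t => h t u) S T (CInt (fun t => h t u) S T) /\
  Cmod (CInt (fun t => h t u) S T - H u)%C <= q u * (Rabs (P S - ta) + Rabs (P T - tb)).
Proof.
  intros HS HT Hu.
  assert (Hc : forall t, D t -> Ccont (fun t => h t u) t) by (intros; apply (Ccont2_fst h); auto).
  assert (HR := dom_CInt Ta Tb D p P ta tb HD (fun t => h t u) Hc S T HS HT). split; auto.
  apply (CRIntg_tail Ta Tb D p P ta tb HD (fun t => h t u) (q u)); auto.
  intros t Ht. rewrite Rmult_comm. auto.
Qed.

Lemma fubini_inner_u (t a b : R) : D t -> E a -> E b ->
  CRInt (h t) a b (CInt (h t) a b) /\
  Cmod (CInt (h t) a b - G t)%C <= p t * (Rabs (Q a - ua) + Rabs (Q b - ub)).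
Proof.
  intros Ht Ha Hb1.
  assert (Hc : forall u, E u -> Ccont (h t) u) by (intros; apply (Ccont2_snd h); auto).
  assert (HR := dom_CInt Ua Ub E q Q ua ub HE (h t) Hc a b Ha Hb1). split; auto.
  apply (CRIntg_tail Ua Ub E q Q ua ub HE (h t) (p t)); auto.
Qed.

(** [H] is a locally uniform limit of integrals over compact segments: the tail at [v] carries the
    weight [q v], which stays below [q u + 1] near [u]. *)
Lemma fubini_cont (u : R) : E u -> Ccont H u.
Proof.
  intros Hu. apply Clim_eps. apply locally_filter. intros eps He. assert (He2 : 0 < eps / 2) by lra.
  set (K := q u + 1). assert (HK : 0 < K) by (assert (H0 := Hq u Hu); unfold K; lra).
  set (d := eps / (8 * K)). assert (Hd : 0 < d) by (apply Rdiv_lt_0_compat; lra).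
  assert (EK : K * (8 * d) = eps) by (unfold d; field; lra).
  destruct (filter_ex _ (dom_prod_near Ta Tb D p P ta tb HD d Hd)) as [[S T] [H1 [H2 [H3 H4]]]]. simpl in *.
  assert (Hloc : locally u (fun v => E v /\ q v < K)).
  { apply filter_and. apply (dom_open HE); auto.
    generalize (filter_near_R (locally u) q (q u) 1 Rlt_0_1 (dom_cont HE u Hu)).
    apply filter_imp. intros v Hv. apply Rabs_def2 in Hv. unfold K; lra. }
  assert (Hc := proj1 (Clim_eps (locally u) _ _) (fubini_param_cont S T u H1 H2 Hu) _ He2).
  generalize (filter_and _ _ Hloc Hc). apply filter_imp. intros v [[Ev Hqv] Hv].
  destruct (fubini_inner_t S T v H1 H2 Ev) as [_ B1].
  destruct (fubini_inner_t S T u H1 H2 Hu) as [_ B2].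
  rewrite Cmod_minus_sym in B1.
  set (cv := CInt (fun t => h t v) S T) in *. set (cu := CInt (fun t => h t u) S T) in *.
  replace (H v - H u)%C with ((H v - cv) + ((cv - cu) + (cu - H u)))%C by ring.
  eapply Rle_lt_trans. apply Cmod_triangle.
  eapply Rle_lt_trans. apply Rplus_le_compat_l, Cmod_triangle.
  assert (q v * (Rabs (P S - ta) + Rabs (P T - tb)) <= K * (2 * d)).
  { apply Rmult_le_compat. auto. assert (HA := Rabs_pos (P S - ta)). assert (HB := Rabs_pos (P T - tb)). lra. lra. lra. }
  assert (q u * (Rabs (P S - ta) + Rabs (P T - tb)) <= K * (2 * d)).
  { apply Rmult_le_compat. auto. assert (HA := Rabs_pos (P S - ta)). assert (HB := Rabs_pos (P T - tb)). lra. unfold K; lra. lra. }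
  simpl in *. lra.
Qed.

(** The double integral [k] over a large rectangle is compared with both sides: the tails in [t] act
    on the fixed increment of [Q], the tails in [u] on the increment of [P], which approaches
    [tb - ta]. The error from the ends [S], [T] is then arbitrarily small. *)
Lemma fubini_partial (a b : R) : E a -> E b ->
  Cmod (CInt H a b - I)%C <= Rabs (tb - ta) * (Rabs (Q a - ua) + Rabs (Q b - ub)).
Proof.
  intros Ha Hb1. apply le_epsilon. intros eps He. assert (He2 : 0 < eps / 2) by lra.
  set (c := Rabs (Q a - ua) + Rabs (Q b - ub)).
  assert (Hc : 0 <= c) by (assert (HA := Rabs_pos (Q a - ua)); assert (HB := Rabs_pos (Q b - ub)); unfold c; lra).
  set (K := Rabs (Q b - Q a) + c + 1).
  assert (HK : 0 < K) by (assert (HA := Rabs_pos (Q b - Q a)); unfold K; lra).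
  set (d := eps / (8 * K)). assert (Hd : 0 < d) by (apply Rdiv_lt_0_compat; lra).
  assert (EK : K * (8 * d) = eps) by (unfold d; field; lra).
  destruct (filter_ex _ (filter_and _ _ (proj1 (CRIntg_iff Ta Tb D p P ta tb HD G I) HI _ He2)
     (dom_prod_near Ta Tb D p P ta tb HD d Hd))) as [[S T] [[g [Hg1 Hg2]] [H1 [H2 [H3 H4]]]]]. simpl in *.
  assert (HcE : forall u, Rmin a b <= u <= Rmax a b -> E u) by (intros u Hu; apply (dom_conv HE a b); auto).
  assert (HcD : forall t, Rmin S T <= t <= Rmax S T -> D t) by (intros u Hu; apply (dom_conv HD S T); auto).
  assert (I1 : CRInt H a b (CInt H a b)) by (apply CInt_correct; intros; apply fubini_cont; auto).
  set (k := CInt (fun u => CInt (fun t => h t u) S T) a b).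
  assert (I2 : CRInt (fun u => CInt (fun t => h t u) S T) a b k).
  { apply CInt_correct. intros; apply fubini_param_cont; auto. }
  assert (I3 : CRInt (fun t => CInt (h t) a b) S T k) by (apply (rect_swap D E); auto; apply HD || apply HE).
  assert (B1 : Cmod (k - CInt H a b)%C <= (Rabs (P S - ta) + Rabs (P T - tb)) * Rabs (Q b - Q a)).
  { apply (CRInt_bound (fun u => CInt (fun t => h t u) S T - H u)%C q Q _ a b).
    - assert (HA := Rabs_pos (P S - ta)); assert (HB := Rabs_pos (P T - tb)); lra.
    - intros u Hu. split; [apply (dom_deriv HE) | apply (dom_cont HE)]; auto.
    - intros u Hu. rewrite Rmult_comm. apply fubini_inner_t; auto.
    - apply CRInt_minus; auto. }
  assert (B2 : Cmod (k - g)%C <= c * Rabs (P T - P S)).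
  { apply (CRInt_bound (fun t => CInt (h t) a b - G t)%C p P c S T); auto.
    - intros t Ht. split; [apply (dom_deriv HD) | apply (dom_cont HD)]; auto.
    - intros t Ht. rewrite Rmult_comm. apply fubini_inner_u; auto.
    - apply CRInt_minus; auto. }
  rewrite Cmod_minus_sym in B1.
  replace (CInt H a b - I)%C with ((CInt H a b - k) + ((k - g) + (g - I)))%C by ring.
  eapply Rle_trans. apply Cmod_triangle.
  eapply Rle_trans. apply Rplus_le_compat_l, Cmod_triangle.
  assert (Rabs (P T - P S) <= Rabs (tb - ta) + 2 * d).
  { replace (P T - P S) with ((tb - ta) + ((P T - tb) - (P S - ta))) by ring.
    eapply Rle_trans. apply Rabs_triang. apply Rplus_le_compat_l. eapply Rle_trans. apply Rabs_triang. rewrite Rabs_Ropp. lra. }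
  assert (c * Rabs (P T - P S) <= c * (Rabs (tb - ta) + 2 * d)) by (apply Rmult_le_compat_l; lra).
  assert ((Rabs (P S - ta) + Rabs (P T - tb)) * Rabs (Q b - Q a) <= 2 * d * Rabs (Q b - Q a)).
  { apply Rmult_le_compat_r. apply Rabs_pos. lra. }
  unfold K in EK. fold c in Hc. nra.
Qed.

(** Convergence of one order of integration gives the other, because the bound for a partial
    integral in [u] vanishes as [a] and [b] approach the ends. *)
Theorem fubini_dom : CRIntg H Ua Ub I.
Proof.
  apply (CRIntg_iff Ua Ub E q Q ua ub HE). intros eps He. assert (He2 : 0 < eps / 2) by lra.
  set (K := Rabs (tb - ta) + 1). assert (HK : 0 < K) by (assert (HA := Rabs_pos (tb - ta)); unfold K; lra).
  set (d := eps / (4 * K)). assert (Hd : 0 < d) by (apply Rdiv_lt_0_compat; lra).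
  assert (EK : K * (4 * d) = eps) by (unfold d; field; lra).
  generalize (dom_prod_near Ua Ub E q Q ua ub HE d Hd). apply filter_imp.
  intros [a b] [H1 [H2 [H3 H4]]]. simpl in *. exists (CInt H a b). split.
  - apply CInt_correct. intros u Hu. apply fubini_cont. apply (dom_conv HE a b); auto.
  - eapply Rle_lt_trans. apply fubini_partial; auto.
    assert (Rabs (tb - ta) * (Rabs (Q a - ua) + Rabs (Q b - ub)) <= K * (2 * d)).
    { apply Rmult_le_compat. apply Rabs_pos. assert (HA := Rabs_pos (Q a - ua)); assert (HB := Rabs_pos (Q b - ub)); lra. unfold K; lra. lra. }
    lra.
Qed.
End Fubini.

(** * Complex powers and the beta integral *)

Lemma Re_plus_R (e : C) (x : R) : Re (e + RtoC x)%C = Re e + x.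
Proof. reflexivity. Qed.

Lemma Re_R_plus (e : C) (x : R) : Re (RtoC x + e)%C = x + Re e.
Proof. reflexivity. Qed.

Lemma Cderiv_cpw (e : C) (u : R) : 0 < u -> Cderiv (fun u => cpw u e) u (e * cpw u (e - 1))%C.
Proof.
  intros Hu. unfold cpw. eapply Cderiv_eq.
  - apply (Cderiv_Cexp (fun u => e * RtoC (ln u))%C). apply Cderiv_cmult, Cderiv_RtoC, is_derive_ln; auto.
  - replace ((e - 1) * RtoC (ln u))%C with (e * RtoC (ln u) + RtoC (- ln u))%C by (rewrite RtoC_opp; ring).
    rewrite Cexp_plus, Cexp_RtoC, exp_Ropp, exp_ln by auto. ring.
Qed.

Lemma continuous_cpw2 (e : C) (u : R) : 0 < u ->
  continuous (T := prod_UniformSpace C_UniformSpace R_UniformSpace) (U := C_UniformSpace) (fun p => cpw (snd p) (fst p)) (e, u).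
Proof.
  intros Hu. unfold cpw.
  apply (continuous_comp (fun p : C * R => (fst p * RtoC (ln (snd p)))%C) Cexp). 2: apply continuous_Cexp.
  apply Clim_mult. apply locally_filter. apply (continuous_fst (U := C_UniformSpace)).
  apply Clim_RtoC. apply locally_filter.
  apply (continuous_comp (fun p : C * R => snd p) ln). apply continuous_snd. apply continuous_ln; auto.
Qed.

Lemma Ccont_cpw (e : C) (u : R) : 0 < u -> Ccont (fun u => cpw u e) u.
Proof. intros Hu. eapply Cderiv_cont, Cderiv_cpw; auto. Qed.

Lemma is_derive_Rpower (r u : R) : 0 < u -> is_derive (fun u => Rpower u r) u (r * Rpower u (r - 1)).
Proof.
  intros Hu. unfold Rpower. auto_derive; auto.
  replace ((r - 1) * ln u) with (r * ln u + - ln u) by ring. rewrite exp_plus, exp_Ropp, exp_ln by auto. field. lra.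
Qed.

Lemma continuous_Rpower (r u : R) : 0 < u -> continuous (fun u => Rpower u r) u.
Proof. intros Hu. apply (ex_derive_continuous (V := R_NormedModule)). eexists; apply is_derive_Rpower; auto. Qed.

Lemma Rpower_pos (x r : R) : 0 < Rpower x r.
Proof. apply exp_pos. Qed.

Lemma Rpower_le_compat (x y r : R) : 0 <= r -> 0 < x <= y -> Rpower x r <= Rpower y r.
Proof. intros. apply Rle_Rpower_l; auto. Qed.

Lemma Rpower_anti (x y r : R) : r <= 0 -> 0 < x <= y -> Rpower y r <= Rpower x r.
Proof.
  intros Hr Hx. unfold Rpower. apply exp_le_compat. assert (ln x <= ln y) by (apply ln_le; lra). nra.
Qed.

Lemma Rpower_at_0 (r : R) : 0 < r -> filterlim (fun u => Rpower u r) (at_right 0) (locally 0).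
Proof.
  intros Hr. apply filterlim_locally. intros eps. exists (mkposreal (Rpower eps (/ r)) (Rpower_pos _ _)).
  intros u Hu Hu0. change (Rabs (u - 0) < Rpower eps (/ r)) in Hu. change (Rabs (Rpower u r - 0) < eps).
  rewrite Rminus_0_r in *. rewrite Rabs_pos_eq in * by (try lra; left; apply Rpower_pos).
  apply Rlt_le_trans with (Rpower (Rpower eps (/ r)) r).
  apply Rlt_Rpower_l; lra. rewrite Rpower_mult, Rinv_l, Rpower_1. lra. apply cond_pos. lra.
Qed.

Lemma filterlim_left_right (z : R) : filterlim (fun u => z - u) (at_left z) (at_right 0).
Proof.
  intros P [d Hd]. exists d. intros u Hu Huz. apply Hd. 2: lra.
  change (Rabs (u - z) < d) in Hu. change (Rabs (z - u - 0) < d). rewrite Rminus_0_r, Rabs_minus_sym. auto.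
Qed.

Lemma Rpower_at_left (z r : R) : 0 < r -> filterlim (fun u => Rpower (z - u) r) (at_left z) (locally 0).
Proof.
  intros Hr. apply (filterlim_comp _ _ _ (fun u => z - u) (fun u => Rpower u r) _ (at_right 0)).
  apply filterlim_left_right. apply Rpower_at_0; auto.
Qed.

Lemma at_right_gt (a b : R) : a < b -> at_right a (fun u => a < u < b).
Proof.
  intros H. exists (mkposreal (b - a) ltac:(lra)). intros u Hu Hua. change (Rabs (u - a) < b - a) in Hu.
  apply Rabs_def2 in Hu. lra.
Qed.

Lemma at_left_lt (a b : R) : a < b -> at_left b (fun u => a < u < b).
Proof.
  intros H. exists (mkposreal (b - a) ltac:(lra)). intros u Hu Hua. change (Rabs (u - b) < b - a) in Hu.
  apply Rabs_def2 in Hu. lra.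
Qed.

Lemma open_interval_conv (z1 z2 a b u : R) : z1 < a < z2 -> z1 < b < z2 -> Rmin a b <= u <= Rmax a b -> z1 < u < z2.
Proof. intros Ha Hb. unfold Rmin, Rmax. destruct Rle_dec; lra. Qed.

Lemma open_interval_open (z1 z2 u : R) : z1 < u < z2 -> locally u (fun u => z1 < u < z2).
Proof.
  intros H. exists (mkposreal (Rmin (u - z1) (z2 - u)) ltac:(apply Rmin_pos; lra)).
  intros v Hv. change (Rabs (v - u) < Rmin (u - z1) (z2 - u)) in Hv. apply Rabs_def2 in Hv.
  assert (H1 := Rmin_l (u - z1) (z2 - u)). assert (H2 := Rmin_r (u - z1) (z2 - u)). lra.
Qed.

Lemma filterlim_at_right_id (a : R) : filterlim (fun u => u) (at_right a) (locally a).
Proof. intros P [d Hd]. exists d. intros u Hu _. apply Hd; auto. Qed.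

Lemma filterlim_at_left_id (a : R) : filterlim (fun u => u) (at_left a) (locally a).
Proof. intros P [d Hd]. exists d. intros u Hu _. apply Hd; auto. Qed.

Lemma filterlim_cont_at_right (f : R -> R) (a l : R) : continuous f a -> f a = l -> filterlim f (at_right a) (locally l).
Proof. intros H <-. eapply filterlim_comp. apply filterlim_at_right_id. exact H. Qed.

Lemma filterlim_cont_at_left (f : R -> R) (a l : R) : continuous f a -> f a = l -> filterlim f (at_left a) (locally l).
Proof. intros H <-. eapply filterlim_comp. apply filterlim_at_left_id. exact H. Qed.

Lemma filterlim_scal_R {T} (F : (T -> Prop) -> Prop) {FF : Filter F} (f : T -> R) (c l : R) :
  filterlim f F (locally l) -> filterlim (fun x => c * f x) F (locally (c * l)).
Proof.
  intros H. eapply filterlim_comp. exact H. apply (continuous_mult (K := R_AbsRing) (fun _ => c) (fun x => x)).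
  apply continuous_const. apply continuous_id.
Qed.

Lemma filterlim_plus_R {T} (F : (T -> Prop) -> Prop) {FF : Filter F} (f g : T -> R) (l m : R) :
  filterlim f F (locally l) -> filterlim g F (locally m) -> filterlim (fun x => f x + g x) F (locally (l + m)).
Proof. intros Hf Hg. eapply filterlim_comp_2; eauto. apply (filterlim_plus (V := R_NormedModule)). Qed.

(** * Euler's beta integral *)

Definition beta_q (z nu a u : R) : R := Rpower (z/2) (nu - 1) * Rpower u a + Rpower (z/2) a * Rpower (z - u) (nu - 1).
Definition beta_Q (z nu a u : R) : R :=
  Rpower (z/2) (nu - 1) / (a + 1) * Rpower u (a + 1) + - (Rpower (z/2) a / nu) * Rpower (z - u) nu.

Lemma beta_dominator (z nu a : R) : 0 < z -> 0 < nu -> -1 < a ->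
  dominator (at_right 0) (at_left z) (fun u => 0 < u < z) (beta_q z nu a) (beta_Q z nu a)
    (Rpower (z/2) (nu - 1) / (a + 1) * 0 + - (Rpower (z/2) a / nu) * Rpower (z - 0) nu)
    (Rpower (z/2) (nu - 1) / (a + 1) * Rpower z (a + 1) + - (Rpower (z/2) a / nu) * 0).
Proof.
  intros Hz Hnu Ha.
  assert (Hdz : forall u r, 0 < u < z -> is_derive (fun u => Rpower (z - u) r) u (- (r * Rpower (z - u) (r - 1)))).
  { intros u r Hu. eapply is_derive_eq.
    apply (is_derive_comp (V := R_NormedModule) (fun u => Rpower u r) (fun u => z - u)). apply is_derive_Rpower; lra.
    apply (is_derive_minus (V := R_NormedModule) (fun _ => z) (fun u => u)). apply (is_derive_const (V := R_NormedModule)). apply (is_derive_id (K := R_AbsRing)).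
    unfold scal, minus, plus, opp, zero, one; simpl. unfold mult; simpl. ring. }
  constructor.
  - apply at_right_proper_filter.
  - apply at_left_proper_filter.
  - apply at_right_gt; auto.
  - apply at_left_lt; auto.
  - intros a' b' u. apply open_interval_conv.
  - intros u. apply open_interval_open.
  - intros u Hu. eapply is_derive_eq. unfold beta_Q. apply is_derive_plus_R; apply is_derive_scal.
    apply is_derive_Rpower; lra. apply Hdz; auto.
    unfold beta_q. replace (a + 1 - 1) with a by ring. field. lra.
  - intros u Hu. unfold beta_q. apply (continuous_plus (V := R_NormedModule)).
    apply (continuous_mult (K := R_AbsRing) (fun _ => Rpower (z/2) (nu - 1))). apply continuous_const. apply continuous_Rpower; lra.
    apply (continuous_mult (K := R_AbsRing) (fun _ => Rpower (z/2) a)). apply continuous_const.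
    apply (ex_derive_continuous (V := R_NormedModule)). eexists; apply Hdz; auto.
  - unfold beta_Q. apply filterlim_plus_R. apply at_right_proper_filter.
    + apply filterlim_scal_R. apply at_right_proper_filter. apply Rpower_at_0; lra.
    + apply filterlim_scal_R. apply at_right_proper_filter.
      apply filterlim_cont_at_right; auto. apply (continuous_comp (fun u => z - u) (fun u => Rpower u nu)).
      apply (continuous_minus (V := R_NormedModule)). apply continuous_const. apply continuous_id. apply continuous_Rpower; lra.
  - unfold beta_Q. apply filterlim_plus_R. apply at_left_proper_filter.
    + apply filterlim_scal_R. apply at_left_proper_filter. apply filterlim_cont_at_left; auto. apply continuous_Rpower; lra.
    + apply filterlim_scal_R. apply at_left_proper_filter.
      apply Rpower_at_left; lra.
Qed.

(** On each half of []0, z[] one of the two decreasing powers is at most its value at [z/2]. The sum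
    of the two resulting majorants covers both halves and has the elementary primitive [beta_Q]. *)
Lemma beta_q_bound (z nu a u : R) : 0 < u < z -> nu < 1 -> a <= 0 ->
  Rpower (z - u) (nu - 1) * Rpower u a <= beta_q z nu a u.
Proof.
  intros Hu Hnu Ha. unfold beta_q.
  assert (P1 := Rpower_pos (z/2) (nu - 1)). assert (P2 := Rpower_pos (z/2) a).
  assert (P3 := Rpower_pos u a). assert (P4 := Rpower_pos (z - u) (nu - 1)).
  destruct (Rle_lt_dec u (z/2)).
  - assert (Rpower (z - u) (nu - 1) <= Rpower (z/2) (nu - 1)) by (apply Rpower_anti; lra). nra.
  - assert (Rpower u a <= Rpower (z/2) a) by (apply Rpower_anti; lra). nra.
Qed.

Lemma Rpower_split_le (z u a a' : R) : 0 < u <= z -> a' <= a -> Rpower u a <= Rpower z (a - a') * Rpower u a'.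
Proof.
  intros Hu Ha. replace a with ((a - a') + a') at 1 by ring. rewrite Rpower_plus.
  apply Rmult_le_compat_r. left; apply Rpower_pos. apply Rpower_le_compat; lra.
Qed.

(* The exponent is cut down to [min a 0] so that only the endpoint singularities have to be dominated. *)
Lemma beta_kernel_bound (z nu u : R) (e : C) : 0 < u < z -> nu < 1 ->
  Cmod (RtoC (Rpower (z - u) (nu - 1)) * cpw u e)%C <=
    Rpower z (Re e - Rmin (Re e) 0) * beta_q z nu (Rmin (Re e) 0) u.
Proof.
  intros Hu Hnu. rewrite Cmod_mult, Cmod_cpw, Cmod_R, Rabs_pos_eq by (left; apply Rpower_pos).
  assert (H := beta_q_bound z nu (Rmin (Re e) 0) u Hu Hnu (Rmin_r _ _)).
  assert (H1 := Rpower_split_le z u (Re e) (Rmin (Re e) 0) ltac:(lra) (Rmin_l _ _)).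
  assert (P := Rpower_pos (z - u) (nu - 1)). assert (P2 := Rpower_pos z (Re e - Rmin (Re e) 0)).
  apply Rle_trans with (Rpower (z - u) (nu - 1) * (Rpower z (Re e - Rmin (Re e) 0) * Rpower u (Rmin (Re e) 0))).
  apply Rmult_le_compat_l; lra. nra.
Qed.

Lemma Ccont_beta_kernel (z nu u : R) (e : C) : 0 < u < z ->
  Ccont (fun u => RtoC (Rpower (z - u) (nu - 1)) * cpw u e)%C u.
Proof.
  intros Hu. apply Clim_mult. apply locally_filter. 2: apply Ccont_cpw; lra.
  apply Clim_RtoC. apply locally_filter.
  apply (continuous_comp (fun u => z - u) (fun u => Rpower u (nu - 1))).
  apply (continuous_minus (V := R_NormedModule)). apply continuous_const. apply continuous_id. apply continuous_Rpower; lra.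
Qed.

Notation is_beta nu e l := (CRIntg (fun u => RtoC (Rpower (1 - u) (nu - 1)) * cpw u e)%C (at_right 0) (at_left 1) l).

Lemma beta_ex (nu : R) (e : C) : 0 < nu < 1 -> -1 < Re e -> exists l : C, is_beta nu e l.
Proof.
  intros Hnu He.
  assert (Ha : -1 < Rmin (Re e) 0) by (unfold Rmin; destruct Rle_dec; lra).
  apply (CRIntg_dominated _ _ _ _ _ _ _ (beta_dominator 1 nu _ Rlt_0_1 (proj1 Hnu) Ha) _ (Rpower 1 (Re e - Rmin (Re e) 0))).
  - left; apply Rpower_pos.
  - intros u Hu. apply Ccont_beta_kernel; auto.
  - intros u Hu. apply beta_kernel_bound; lra.
Qed.

Lemma unit_dominator (nu : R) : 0 < nu ->
  exists p P la lb, dominator (at_right 0) (at_left 1) (fun u => 0 < u < 1) p P la lb.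
Proof. intros H. do 4 eexists. apply (beta_dominator 1 nu 0); lra. Qed.

Lemma CRIntg_FTC (Fa Fb : (R -> Prop) -> Prop) (D : R -> Prop) (p P : R -> R) (la lb : R) (f F : R -> C) (A B : C) :
  dominator Fa Fb D p P la lb ->
  (forall u, D u -> Cderiv F u (f u)) -> (forall u, D u -> Ccont f u) ->
  Clim Fa F A -> Clim Fb F B -> CRIntg f Fa Fb (B - A)%C.
Proof.
  intros HD H1 H2 HA HB.
  assert (PFa := dom_Fa HD). assert (PFb := dom_Fb HD).
  apply (CRIntg_iff _ _ _ _ _ _ _ HD). intros eps He.
  apply Filter_prod with (fun a => D a /\ Cmod (F a - A)%C < eps / 2) (fun b => D b /\ Cmod (F b - B)%C < eps / 2).
  - apply filter_and. exact (dom_Da HD). apply (proj1 (Clim_eps Fa F A)); auto. lra.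
  - apply filter_and. exact (dom_Db HD). apply (proj1 (Clim_eps Fb F B)); auto. lra.
  - intros a b [Ha Ha'] [Hb Hb']. simpl. exists (F b - F a)%C. split.
    + apply (is_RInt_derive (V := C_R_CompleteNormedModule)); intros x Hx; [apply H1 | apply H2]; apply (dom_conv HD a b); auto.
    + replace (F b - F a - (B - A))%C with ((F b - B) + - (F a - A))%C by ring.
      eapply Rle_lt_trans. apply Cmod_triangle. rewrite Cmod_opp. lra.
Qed.

(** The module structure has real scalars only, so multiplication by a complex constant is done in
    coordinates on each bounded interval. *)
Lemma CRIntg_cmult (Fa Fb : (R -> Prop) -> Prop) (D : R -> Prop) (p P : R -> R) (la lb : R) (f : R -> C) (c l : C) :
  dominator Fa Fb D p P la lb -> CRIntg f Fa Fb l -> CRIntg (fun u => c * f u)%C Fa Fb (c * l)%C.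
Proof.
  intros HD H. apply (CRIntg_iff _ _ _ _ _ _ _ HD). intros eps He.
  assert (PFa := dom_Fa HD). assert (PFb := dom_Fb HD).
  assert (Hc := Cmod_ge_0 c).
  assert (He2 : 0 < eps / (Cmod c + 1)) by (apply Rdiv_lt_0_compat; lra).
  generalize (proj1 (CRIntg_iff _ _ _ _ _ _ _ HD f l) H _ He2). apply filter_imp.
  intros [a b] [v [H1 H2]]. exists (c * v)%C. split.
  - simpl in *. destruct c as [x y].
    assert (R1 := is_RInt_fct_extend_fst (U := R_NormedModule) (V := R_NormedModule) f a b _ H1).
    assert (R2 := is_RInt_fct_extend_snd (U := R_NormedModule) (V := R_NormedModule) f a b _ H1).
    unfold Cmult; simpl. apply CRInt_pair; simpl.
    + apply (is_RInt_minus (V := R_NormedModule)); apply (is_RInt_scal (V := R_NormedModule)); auto.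
    + apply (is_RInt_plus (V := R_NormedModule)); apply (is_RInt_scal (V := R_NormedModule)); auto.
  - replace (c * v - c * l)%C with (c * (v - l))%C by ring. rewrite Cmod_mult.
    apply Rmult_lt_compat_r with (r := Cmod c + 1) in H2; [|lra].
    replace (eps / (Cmod c + 1) * (Cmod c + 1)) with eps in H2 by (field; lra).
    assert (Hv := Cmod_ge_0 (v - l)%C). simpl in *. nra.
Qed.

Lemma CRIntg_minus (Fa Fb : (R -> Prop) -> Prop) {FFa : Filter Fa} {FFb : Filter Fb} (f g : R -> C) (l m : C) :
  CRIntg f Fa Fb l -> CRIntg g Fa Fb m -> CRIntg (fun u => f u - g u)%C Fa Fb (l - m)%C.
Proof. intros. apply (is_RInt_gen_minus (V := C_R_NormedModule)); auto. Qed.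

Lemma CRIntg_ext_dom (Fa Fb : (R -> Prop) -> Prop) (D : R -> Prop) (p P : R -> R) (la lb : R) (f g : R -> C) (l : C) :
  dominator Fa Fb D p P la lb -> (forall u, D u -> f u = g u) -> CRIntg f Fa Fb l -> CRIntg g Fa Fb l.
Proof.
  intros HD H. assert (PFa := dom_Fa HD). assert (PFb := dom_Fb HD).
  apply (is_RInt_gen_ext (V := C_R_NormedModule)).
  apply Filter_prod with D D; [exact (dom_Da HD) | exact (dom_Db HD)|].
  intros a b Ha Hb x Hx. apply H. apply (dom_conv HD a b); auto. simpl in Hx. lra.
Qed.

(** Integrates the derivative of [(1 - u)^nu u^(e+1)], a function that vanishes at both ends. *)
Lemma beta_rec (nu : R) (e l l' : C) : 0 < nu < 1 -> -1 < Re e ->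
  is_beta nu e l -> is_beta nu (e + 1)%C l' -> ((1 + e) * l = (1 + RtoC nu + e) * l')%C.
Proof.
  intros Hnu He H1 H2.
  destruct (unit_dominator nu (proj1 Hnu)) as [p [P [la [lb HD]]]].
  assert (PFa := dom_Fa HD). assert (PFb := dom_Fb HD).
  assert (H := CRIntg_minus _ _ _ _ _ _ (CRIntg_cmult _ _ _ _ _ _ _ _ (1 + e) _ HD H1)
     (CRIntg_cmult _ _ _ _ _ _ _ _ (1 + RtoC nu + e) _ HD H2)).
  assert (H0 : CRIntg (fun u => (1 + e) * (RtoC (Rpower (1 - u) (nu - 1)) * cpw u e) -
     (1 + RtoC nu + e) * (RtoC (Rpower (1 - u) (nu - 1)) * cpw u (e + 1)))%C (at_right 0) (at_left 1) (0 - 0)%C).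
  { apply (CRIntg_FTC _ _ _ _ _ _ _ _ (fun u => RtoC (Rpower (1 - u) nu) * cpw u (e + 1))%C _ _ HD).
    - intros u Hu. eapply Cderiv_eq.
      apply Cderiv_mult. apply Cderiv_RtoC.
      apply (is_derive_comp (V := R_NormedModule) (fun u => Rpower u nu) (fun u => 1 - u)). apply is_derive_Rpower; lra.
      apply (is_derive_minus (V := R_NormedModule) (fun _ => 1) (fun u => u)). apply (is_derive_const (V := R_NormedModule)). apply (is_derive_id (K := R_AbsRing)).
      apply Cderiv_cpw; lra.
      replace (e + 1 - 1)%C with e by ring.
      replace (Rpower (1 - u) nu) with (Rpower (1 - u) (nu - 1) * (1 - u)).
      2: { rewrite <- (Rpower_1 (1 - u)) at 2 by lra. rewrite <- Rpower_plus. f_equal. ring. }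
      unfold scal, minus, plus, opp, zero, one; simpl. unfold mult; simpl.
      rewrite cpw_plus, cpw_RtoC, Rpower_1 by lra.
      replace ((0 + - (1)) * (nu * Rpower (1 - u) (nu - 1))) with (- (nu * Rpower (1 - u) (nu - 1))) by ring.
      rewrite RtoC_opp, !RtoC_mult, RtoC_minus. ring.
    - intros u Hu. apply Clim_minus. apply locally_filter.
      apply Clim_mult. apply locally_filter. apply Clim_const, locally_filter. apply Ccont_beta_kernel; auto.
      apply Clim_mult. apply locally_filter. apply Clim_const, locally_filter. apply Ccont_beta_kernel; auto.
    - apply Clim_squeeze with (fun u => Rpower u (Re e + 1)). apply PFa.
      + generalize (dom_Da HD). apply filter_imp. intros u Hu.
        replace (RtoC (Rpower (1 - u) nu) * cpw u (e + 1) - 0)%C with (RtoC (Rpower (1 - u) nu) * cpw u (e + 1))%C by ring.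
        rewrite Cmod_mult, Cmod_cpw, Cmod_R, Rabs_pos_eq by (left; apply Rpower_pos).
        simpl (Re (e + 1)%C). rewrite <- (Rmult_1_l (Rpower u (Re e + 1))). apply Rmult_le_compat_r. left; apply Rpower_pos.
        apply Rle_trans with (Rpower 1 nu). apply Rpower_le_compat; lra. unfold Rpower. rewrite ln_1, Rmult_0_r, exp_0. lra.
      + apply Rpower_at_0. lra.
    - apply Clim_squeeze with (fun u => Rpower (1 - u) nu). apply PFb.
      + generalize (dom_Db HD). apply filter_imp. intros u Hu.
        replace (RtoC (Rpower (1 - u) nu) * cpw u (e + 1) - 0)%C with (RtoC (Rpower (1 - u) nu) * cpw u (e + 1))%C by ring.
        rewrite Cmod_mult, Cmod_cpw, Cmod_R, Rabs_pos_eq by (left; apply Rpower_pos).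
        simpl (Re (e + 1)%C). rewrite <- (Rmult_1_r (Rpower (1 - u) nu)) at 2. apply Rmult_le_compat_l. left; apply Rpower_pos.
        apply Rle_trans with (Rpower 1 (Re e + 1)). apply Rpower_le_compat; lra. unfold Rpower. rewrite ln_1, Rmult_0_r, exp_0. lra.
      + apply Rpower_at_left; lra. }
  assert (E := CRIntg_unique _ _ _ _ _ _ _ HD _ _ _ H H0).
  replace ((1 + e) * l)%C with (((1 + e) * l - (1 + RtoC nu + e) * l') + (1 + RtoC nu + e) * l')%C by ring.
  rewrite E. ring.
Qed.

Lemma beta_0 (nu : R) : 0 < nu < 1 -> is_beta nu 0 (/ RtoC nu)%C.
Proof.
  intros Hnu. destruct (unit_dominator nu (proj1 Hnu)) as [p [P [la [lb HD]]]].
  assert (PFa := dom_Fa HD). assert (PFb := dom_Fb HD).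
  rewrite <- RtoC_inv by lra.
  replace (RtoC (/ nu)) with (RtoC (- / nu * 0) - RtoC (- / nu * Rpower (1 - 0) nu))%C.
  2: { rewrite Rminus_0_r. unfold Rpower. rewrite ln_1, !Rmult_0_r, exp_0, <- RtoC_minus. f_equal. ring. }
  apply (CRIntg_FTC _ _ _ _ _ _ _ _ (fun u => RtoC (- / nu * Rpower (1 - u) nu)) _ _ HD).
  - intros u Hu. replace (cpw u 0) with (RtoC 1) by (unfold cpw; rewrite Cmult_0_l, Cexp_0; reflexivity).
    rewrite Cmult_1_r. apply Cderiv_RtoC. eapply is_derive_eq. apply is_derive_scal.
    apply (is_derive_comp (V := R_NormedModule) (fun u => Rpower u nu) (fun u => 1 - u)). apply is_derive_Rpower; lra.
    apply (is_derive_minus (V := R_NormedModule) (fun _ => 1) (fun u => u)). apply (is_derive_const (V := R_NormedModule)). apply (is_derive_id (K := R_AbsRing)).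
    unfold scal, minus, plus, opp, zero, one; simpl. unfold mult; simpl. field. lra.
  - intros u Hu. apply Ccont_beta_kernel; auto.
  - apply Clim_RtoC. apply PFa. apply filterlim_scal_R. apply PFa. apply filterlim_cont_at_right; auto.
    apply (continuous_comp (fun u => 1 - u) (fun u => Rpower u nu)).
    apply (continuous_minus (V := R_NormedModule)). apply continuous_const. apply continuous_id. apply continuous_Rpower; lra.
  - apply Clim_RtoC. apply PFb. apply filterlim_scal_R. apply PFb.
    apply Rpower_at_left; lra.
Qed.

(** The recurrence, iterated [n + 1] times, accumulates precisely the products of Gauss' formula for
    [1 + e] and [1 + nu + e]. *)
Lemma beta_iter (nu : R) (e l ln : C) (n : nat) : 0 < nu < 1 -> -1 < Re e ->
  is_beta nu e l -> is_beta nu (e + RtoC (INR (S n)))%C ln ->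
  (rprod n (1 + e) * l = rprod n (1 + RtoC nu + e) * ln)%C.
Proof.
  intros Hnu He Hl. revert ln. induction n; intros ln Hln.
  - rewrite !rprod_0. apply (beta_rec nu); auto.
  - assert (Hp := pos_INR (S n)).
    destruct (beta_ex nu (e + RtoC (INR (S n)))%C Hnu) as [k Hk]. rewrite ?Re_plus_R, ?re_RtoC. lra.
    assert (E := IHn k Hk). rewrite !rprod_S.
    replace (rprod n (1 + e) * (1 + e + RtoC (INR (S n))) * l)%C with ((1 + e + RtoC (INR (S n))) * (rprod n (1 + e) * l))%C by ring.
    rewrite E.
    assert (E2 := beta_rec nu (e + RtoC (INR (S n)))%C k ln Hnu).
    replace (e + RtoC (INR (S n)) + 1)%C with (e + RtoC (INR (S (S n))))%C in E2 by (rewrite (S_INR (S n)), RtoC_plus; ring).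
    specialize (E2 ltac:(rewrite Re_plus_R; lra) Hk Hln).
    replace ((1 + e + RtoC (INR (S n))) * (rprod n (1 + RtoC nu + e) * k))%C with (rprod n (1 + RtoC nu + e) * ((1 + (e + RtoC (INR (S n)))) * k))%C by ring.
    rewrite E2. ring.
Qed.

Lemma cpw_nat (u : R) (n : nat) : 0 < u -> cpw u (RtoC (INR n)) = RtoC (u ^ n).
Proof. intros Hu. rewrite cpw_RtoC, Rpower_pow; auto. Qed.

Lemma pow_dominator (n : nat) :
  dominator (at_right 0) (at_left 1) (fun u => 0 < u < 1) (fun u => u ^ n) (fun u => / INR (S n) * u ^ (S n)) 0 (/ INR (S n)).
Proof.
  assert (Hn : 0 < INR (S n)) by (apply lt_0_INR; lia).
  assert (Hd : forall u, is_derive (fun u => / INR (S n) * u ^ (S n)) u (u ^ n)).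
  { intros u. eapply is_derive_eq. apply is_derive_scal. apply (is_derive_pow (fun u => u) (S n)). apply (is_derive_id (K := R_AbsRing)).
    simpl pred. unfold one; simpl. field. simpl in Hn; lra. }
  constructor; auto.
  - apply at_right_proper_filter.
  - apply at_left_proper_filter.
  - apply at_right_gt; lra.
  - apply at_left_lt; lra.
  - intros a' b' u. apply open_interval_conv.
  - intros u. apply open_interval_open.
  - intros u _. apply (ex_derive_continuous (V := R_NormedModule)). auto_derive. auto.
  - apply filterlim_cont_at_right. apply (ex_derive_continuous (V := R_NormedModule)). eexists; apply Hd. simpl; ring.
  - apply filterlim_cont_at_left. apply (ex_derive_continuous (V := R_NormedModule)). eexists; apply Hd. rewrite pow1; ring.
Qed.

(* [|u^(e+2) - u^2| <= K (1 - u)] absorbs one power of [1 - u]. *)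
Lemma beta_shift_close (nu : R) (e l l' : C) (n : nat) : 0 < nu < 1 -> -1 < Re e ->
  is_beta nu (e + RtoC (INR (S (S n))))%C l -> is_beta nu (RtoC (INR (S (S n)))) l' ->
  Cmod (l - l')%C <= (Cmod (e + 2)%C + 2) * / INR (S n).
Proof.
  intros Hnu He H1 H2.
  assert (HD := pow_dominator n).
  assert (Hc : 0 <= Cmod (e + 2)%C + 2) by (assert (H := Cmod_ge_0 (e + 2)%C); lra).
  assert (PFa := dom_Fa HD). assert (PFb := dom_Fb HD).
  assert (H := CRIntg_minus _ _ _ _ _ _ H1 H2).
  replace (/ INR (S n)) with (Rabs (/ INR (S n) - 0)).
  2: { rewrite Rminus_0_r. apply Rabs_pos_eq. left. apply Rinv_0_lt_compat, lt_0_INR; lia. }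
  apply (CRIntg_bound _ _ _ _ _ _ _ HD _ _ Hc) in H; auto.
  - intros u Hu. apply Clim_minus. apply locally_filter. apply Ccont_beta_kernel; auto. apply Ccont_beta_kernel; auto.
  - intros u Hu.
    replace (RtoC (INR (S (S n)))) with (2 + RtoC (INR n))%C by (rewrite !S_INR, <- RtoC_plus; f_equal; ring).
    replace (e + (2 + RtoC (INR n)))%C with (e + 2 + RtoC (INR n))%C by ring.
    rewrite !(cpw_plus u _ (RtoC (INR n))), cpw_nat by lra.
    replace (RtoC (Rpower (1 - u) (nu - 1)) * (cpw u (e + 2) * RtoC (u ^ n)) - RtoC (Rpower (1 - u) (nu - 1)) * (cpw u 2 * RtoC (u ^ n)))%C
      with (RtoC (Rpower (1 - u) (nu - 1)) * (cpw u (e + 2) - cpw u 2) * RtoC (u ^ n))%C by ring.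
    rewrite !Cmod_mult, !Cmod_R, (Rabs_pos_eq (u ^ n)), Rabs_pos_eq by (left; apply Rpower_pos || apply pow_lt; lra).
    apply Rmult_le_compat_r. apply pow_le; lra.
    assert (HM := Cmod_increment_le (fun u => cpw u (e + 2) - cpw u 2)%C
      (fun u => (e + 2) * cpw u (e + 2 - 1) + - (1) * (2 * cpw u (2 - 1)))%C (Cmod (e + 2)%C + 2) u 1 ltac:(lra)).
    cbv beta in HM.
    assert (HM' : Cmod (cpw 1 (e + 2) - cpw 1 2 - (cpw u (e + 2) - cpw u 2))%C <= (Cmod (e + 2)%C + 2) * (1 - u)).
    { apply HM.
      - intros t Ht. apply (is_derive_ext (V := C_R_NormedModule) (fun u => cpw u (e + 2) + - (1) * cpw u 2)%C).
        intros t0. match goal with |- ?x = ?y => change (@eq C x y) end. ring.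
        apply Cderiv_plus. apply Cderiv_cpw; lra. apply Cderiv_cmult, Cderiv_cpw; lra.
      - intros t Ht. apply Clim_plus. apply locally_filter.
        apply Clim_mult. apply locally_filter. apply Clim_const, locally_filter. apply Ccont_cpw; lra.
        apply Clim_mult. apply locally_filter. apply Clim_const, locally_filter.
        apply Clim_mult. apply locally_filter. apply Clim_const, locally_filter. apply Ccont_cpw; lra.
      - intros t Ht. eapply Rle_trans. apply Cmod_triangle.
        assert (HR : forall r, 0 <= r -> Rpower t r <= 1).
        { intros r Hr. apply Rle_trans with (Rpower 1 r). apply Rpower_le_compat; lra. unfold Rpower. rewrite ln_1, Rmult_0_r, exp_0. lra. }
        rewrite !Cmod_mult, Cmod_opp, !Cmod_cpw, Cmod_1, Cmod_R, Rabs_pos_eq by lra.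
        simpl Re. assert (A1 := HR (Re e + 2 - 1) ltac:(lra)). assert (A2 := HR (2 - 1) ltac:(lra)).
        assert (A3 := Cmod_ge_0 (e + 2)%C). replace (fst e + 2 + - (1)) with (Re e + 2 - 1) by (unfold Re; ring).
        replace (2 + - (1)) with (2 - 1) by ring. nra. }
    rewrite <- Cmod_opp in HM'.
    replace (cpw 1 (e + 2)) with (RtoC 1) in HM' by (unfold cpw; rewrite ln_1, Cmult_0_r, Cexp_0; reflexivity).
    replace (cpw 1 2) with (RtoC 1) in HM' by (unfold cpw; rewrite ln_1, Cmult_0_r, Cexp_0; reflexivity).
    replace (- (1 - 1 - (cpw u (e + 2) - cpw u 2)))%C with (cpw u (e + 2) - cpw u 2)%C in HM' by ring.
    assert (P := Rpower_pos (1 - u) (nu - 1)).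
    apply Rle_trans with (Rpower (1 - u) (nu - 1) * ((Cmod (e + 2)%C + 2) * (1 - u))). apply Rmult_le_compat_l; lra.
    replace (Rpower (1 - u) (nu - 1) * ((Cmod (e + 2)%C + 2) * (1 - u))) with ((Cmod (e + 2)%C + 2) * (Rpower (1 - u) (nu - 1) * (1 - u))) by ring.
    rewrite <- (Rmult_1_r (Cmod (e + 2)%C + 2)) at 2. apply Rmult_le_compat_l; auto.
    rewrite <- (Rpower_1 (1 - u)) at 2 by lra. rewrite <- Rpower_plus. replace (nu - 1 + 1) with nu by ring.
    apply Rle_trans with (Rpower 1 nu). apply Rpower_le_compat; lra. unfold Rpower. rewrite ln_1, Rmult_0_r, exp_0. lra.
Qed.

(** Euler's [B (nu, 1 + e) = Gamma nu Gamma (1 + e) / Gamma (1 + nu + e)], with the factors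
    depending on [e] expressed through [rGamma]. *)
Definition CBeta (nu : R) (e : C) : C := (Gamma (RtoC nu) * (rGamma (1 + RtoC nu + e) / rGamma (1 + e)))%C.

Lemma filterlim_Rpower_INR_neg (r : R) : 0 < r -> filterlim (fun n => Rpower (INR n) (- r)) eventually (locally 0).
Proof.
  intros Hr. apply filterlim_ext_loc with (fun n => Rpower (/ INR n) r).
  - exists 1%nat. intros n Hn. assert (0 < INR n) by (apply lt_0_INR; lia).
    unfold Rpower. rewrite ln_Rinv by auto. f_equal. ring.
  - apply (filterlim_comp _ _ _ (fun n => / INR n) (fun u => Rpower u r) eventually (at_right 0)). 2: apply Rpower_at_0; auto.
    intros P [d Hd].
    assert (H := proj1 (filterlim_locally _ _) (filterlim_INR_inv 1) d).
    assert (H1 : eventually (fun n => (1 <= n)%nat)) by (exists 1%nat; auto).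
    change (eventually (fun n => P (/ INR n))).
    generalize (filter_and _ _ H H1). apply filter_imp. intros n [Hn Hn1].
    assert (0 < INR n) by (apply lt_0_INR; lia).
    apply Hd. 2: apply Rinv_0_lt_compat; auto.
    unfold Rdiv in Hn. rewrite Rmult_1_l in Hn. exact Hn.
Qed.

(** By [beta_iter] the integral is a quotient of Gauss products times the integral [F n] at exponent
    [e + n + 1]. To leading order [F n] does not depend on [e]: it differs by [O(1/n)] from the
    explicit value [F0 n] for [e = 0], which is negligible against [n^(-nu)] as [nu < 1]. Finally
    [n^nu F0 n] tends to [Gamma nu]. *)
Theorem beta_integral (nu : R) (e : C) : 0 < nu < 1 -> -1 < Re e -> is_beta nu e (CBeta nu e).
Proof.
  intros Hnu He.
  destruct (beta_ex nu e Hnu He) as [l Hl].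
  replace (CBeta nu e) with l; auto.
  assert (Hn0 : rGamma (1 + e) <> 0) by (apply rGamma_neq_0_Re; rewrite Re_R_plus; lra).
  assert (Hnunz : rGamma (RtoC nu) <> 0) by (apply rGamma_neq_0_Re; simpl; lra).
  set (F := fun n : nat => (RInt_gen (V := C_R_CompleteNormedModule) (fun u => RtoC (Rpower (1 - u) (nu - 1)) * cpw u (e + RtoC (INR (S n))))%C (at_right 0) (at_left 1) : C)).
  assert (HF : forall n, is_beta nu (e + RtoC (INR (S n)))%C (F n)).
  { intros n. destruct (beta_ex nu (e + RtoC (INR (S n)))%C Hnu) as [k Hk].
    assert (Hp := pos_INR (S n)). rewrite Re_plus_R. lra.
    apply (RInt_gen_correct (V := C_R_CompleteNormedModule)). exists k; exact Hk. }
  set (F0 := fun n : nat => (RtoC (INR (fact (S n))) * / RtoC nu / rprod n (1 + RtoC nu))%C).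
  assert (HF0 : forall n, is_beta nu (RtoC (INR (S n))) (F0 n)).
  { intros n. destruct (beta_ex nu (RtoC (INR (S n))) Hnu) as [k Hk].
    assert (Hp := pos_INR (S n)). rewrite ?Re_plus_R, ?re_RtoC. lra.
    assert (E := beta_iter nu 0 (/ RtoC nu) k n Hnu). rewrite Cplus_0_l in E.
    specialize (E ltac:(simpl; lra) (beta_0 nu Hnu) Hk). rewrite !Cplus_0_r, rprod_1 in E.
    unfold F0. rewrite E. replace (rprod n (1 + RtoC nu) * k / rprod n (1 + RtoC nu))%C with k. auto.
    field. intros E0. apply rprod_zero_iff in E0. destruct E0 as [j [_ E0]].
    assert (E1 := f_equal Re E0). simpl in E1. assert (Hj := pos_INR j). lra. }
  assert (L0 : Clim eventually (fun n => RtoC (Rpower (INR n) nu) * F0 n)%C (Gamma (RtoC nu))).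
  { rewrite Gamma_rGamma.
    apply filterlim_ext_loc with (fun n => / (rGamma_seq n (RtoC nu) * (1 + RtoC nu * RtoC (1 / INR (S n)))))%C.
    - exists 1%nat. intros n Hn. assert (Hn1 : 0 < INR n) by (apply lt_0_INR; lia).
      assert (Hn2 := RtoC_INR_fact_neq_0 n).
      assert (HSn : RtoC (INR (S n)) <> 0) by (intros E; apply RtoC_inj in E; rewrite S_INR in E; lra).
      assert (Hnu1 : RtoC nu <> 0) by (intros E; apply RtoC_inj in E; lra).
      assert (Hsum : (RtoC nu + RtoC (INR (S n)))%C <> 0).
      { rewrite <- RtoC_plus. intros E; apply RtoC_inj in E; rewrite S_INR in E; lra. }
      assert (Hr : rprod n (RtoC nu) <> 0).
      { intros E0. apply rprod_zero_iff in E0. destruct E0 as [j [_ E0]].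
        assert (E1 := f_equal Re E0). simpl in E1. assert (Hj := pos_INR j). lra. }
      unfold F0, rGamma_seq.
      replace (rprod n (1 + RtoC nu)) with (rprod n (RtoC nu) * (RtoC nu + RtoC (INR (S n))) / RtoC nu)%C.
      2: { rewrite <- rprod_shift. replace (1 + RtoC nu)%C with (RtoC nu + 1)%C by ring. field; auto. }
      rewrite fact_simpl, mult_INR, RtoC_mult, RtoC_div by (rewrite S_INR; lra).
      rewrite <- RtoC_opp, cpw_RtoC, Rpower_Ropp, RtoC_inv by (apply Rgt_not_eq, Rpower_pos).
      assert (Hpw : RtoC (Rpower (INR n) nu) <> 0) by (intros E; apply RtoC_inj in E; assert (H := Rpower_pos (INR n) nu); lra).
      field. repeat split; auto.
    - apply Clim_inv. apply eventually_filter. auto.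
      replace (rGamma (RtoC nu)) with (rGamma (RtoC nu) * (1 + RtoC nu * RtoC 0))%C by ring.
      apply Clim_mult. apply eventually_filter. apply rGamma_lim.
      apply Clim_plus. apply eventually_filter. apply Clim_const, eventually_filter.
      apply Clim_mult. apply eventually_filter. apply Clim_const, eventually_filter.
      apply Clim_RtoC. apply eventually_filter.
      apply (filterlim_comp _ _ _ S (fun n => 1 / INR n) eventually eventually). apply eventually_subseq. intros; lia.
      apply filterlim_INR_inv. }
  assert (L1 : Clim eventually (fun n => RtoC (Rpower (INR n) nu) * (F n - F0 n))%C (RtoC 0)).
  { apply Clim_squeeze with (fun n => (Cmod (e + 2)%C + 2) * Rpower (INR n) (- (1 - nu))). apply eventually_filter.
    - exists 1%nat. intros n Hn. assert (Hn1 : 0 < INR n) by (apply lt_0_INR; lia).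
      replace (RtoC (Rpower (INR n) nu) * (F n - F0 n) - 0)%C with (RtoC (Rpower (INR n) nu) * (F n - F0 n))%C by ring.
      rewrite Cmod_mult, Cmod_R, Rabs_pos_eq by (left; apply Rpower_pos).
      destruct n as [|n]; [lia|].
      assert (Hb := beta_shift_close nu e _ _ n Hnu He (HF (S n)) (HF0 (S n))).
      apply Rle_trans with (Rpower (INR (S n)) nu * ((Cmod (e + 2)%C + 2) * / INR (S n))).
      apply Rmult_le_compat_l; auto. left; apply Rpower_pos.
      replace (- (1 - nu)) with (nu + - (1)) by ring. rewrite Rpower_plus, Rpower_Ropp, Rpower_1 by auto. right; ring.
    - replace (locally 0) with (locally ((Cmod (e + 2)%C + 2) * 0)) by (f_equal; ring).
      apply filterlim_scal_R. apply eventually_filter. apply filterlim_Rpower_INR_neg. lra. }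
  assert (L2 : Clim eventually (fun n => RtoC (Rpower (INR n) nu) * F n)%C (Gamma (RtoC nu))).
  { replace (Gamma (RtoC nu)) with (0 + Gamma (RtoC nu))%C by ring.
    apply filterlim_ext with (2 := Clim_plus _ _ _ _ _ L1 L0). intros n. ring. }
  assert (E : (rGamma (1 + e) * l = rGamma (1 + RtoC nu + e) * Gamma (RtoC nu))%C).
  { apply (Clim_unique eventually (fun n => rGamma_seq n (1 + e) * l)%C).
    - apply Clim_mult. apply eventually_filter. apply rGamma_lim. apply Clim_const, eventually_filter.
    - eapply filterlim_ext_loc. 2: apply (Clim_mult _ _ _ _ _ (rGamma_lim (1 + RtoC nu + e)) L2).
      exists 1%nat. intros n Hn. simpl. assert (Hn1 : 0 < INR n) by (apply lt_0_INR; lia).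
      assert (E := beta_iter nu e l (F n) n Hnu He Hl (HF n)).
      unfold rGamma_seq.
      replace (/ RtoC (INR (fact n)) * cpw (INR n) (- (1 + e)) * rprod n (1 + e) * l)%C with
        (/ RtoC (INR (fact n)) * cpw (INR n) (- (1 + e)) * (rprod n (1 + e) * l))%C by ring.
      rewrite E. replace (- (1 + e))%C with (- (1 + RtoC nu + e) + RtoC nu)%C by ring.
      rewrite cpw_plus, cpw_RtoC. ring. }
  unfold CBeta. replace (Gamma (RtoC nu) * (rGamma (1 + RtoC nu + e) / rGamma (1 + e)))%C
    with (rGamma (1 + RtoC nu + e) * Gamma (RtoC nu) / rGamma (1 + e))%C by (unfold Cdiv; ring).
  rewrite <- E. field; auto.
Qed.

Theorem beta_integral_scaled (nu z : R) (e : C) : 0 < nu < 1 -> -1 < Re e -> 0 < z ->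
  CRIntg (fun u => RtoC (Rpower (z - u) (nu - 1)) * cpw u e)%C (at_right 0) (at_left z) (cpw z (RtoC nu + e) * CBeta nu e)%C.
Proof.
  intros Hnu He Hz.
  destruct (unit_dominator nu (proj1 Hnu)) as [p1 [P1 [la1 [lb1 HD1]]]].
  assert (HD := beta_dominator z nu 0 Hz (proj1 Hnu) ltac:(lra)).
  assert (H := CRIntg_cmult _ _ _ _ _ _ _ _ (cpw z (RtoC nu + e)) _ HD1 (beta_integral nu e Hnu He)).
  set (g := fun u => (cpw z (RtoC nu + e) * (RtoC (Rpower (1 - u) (nu - 1)) * cpw u e))%C) in *.
  (* The substitution [u / z]; the summand [+ 0] gives it the affine shape of [is_RInt_comp_lin]. *)
  apply (CRIntg_ext_dom _ _ _ _ _ _ _ (fun u => scal (V := C_R_NormedModule) (/ z) (g (/ z * u + 0))) _ _ HD).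
  - intros u Hu. rewrite scal_R_Cmult. unfold g. rewrite Rplus_0_r.
    replace (1 - / z * u) with ((z - u) * / z) by (field; lra).
    assert (0 < / z) by (apply Rinv_0_lt_compat; auto).
    rewrite <- Rpower_mult_distr by lra.
    unfold cpw. rewrite ln_mult by lra. rewrite ln_Rinv by lra.
    rewrite Cmult_plus_distr_r, Cexp_plus.
    replace (e * RtoC (- ln z + ln u))%C with (- (e * RtoC (ln z)) + e * RtoC (ln u))%C by (rewrite RtoC_plus, RtoC_opp; ring).
    rewrite Cexp_plus, Cexp_opp, <- RtoC_mult, Cexp_RtoC.
    replace (Rpower (/ z) (nu - 1)) with (z * / exp (nu * ln z)).
    2: { unfold Rpower. rewrite ln_Rinv by lra. rewrite <- exp_Ropp. rewrite <- (exp_ln z) at 1 by auto. rewrite <- exp_plus. f_equal. ring. }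
    rewrite !RtoC_mult, !RtoC_inv by (try lra; apply Rgt_not_eq, exp_pos).
    field. repeat split. apply Cexp_neq_0. intros E; apply RtoC_inj in E; assert (H1 := exp_pos (nu * ln z)); lra.
    intros E; apply RtoC_inj in E; lra.
  - apply (CRIntg_iff _ _ _ _ _ _ _ HD). intros eps Heps.
    destruct (proj1 (CRIntg_iff _ _ _ _ _ _ _ HD1 _ _) H eps Heps) as [A B HA HB HAB].
    apply Filter_prod with (fun a => A (/ z * a + 0)) (fun b => B (/ z * b + 0)).
    + destruct HA as [d Hd]. exists (mkposreal (d * z) ltac:(apply Rmult_lt_0_compat; [apply cond_pos | auto])).
      intros a Ha Ha0. change (Rabs (a - 0) < d * z) in Ha. apply Hd.
      * change (Rabs (/ z * a + 0 - 0) < d). rewrite Rplus_0_r. rewrite Rminus_0_r in *. rewrite Rabs_mult, (Rabs_pos_eq (/ z)) by (left; apply Rinv_0_lt_compat; auto).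
        apply Rmult_lt_reg_l with z; auto. rewrite <- Rmult_assoc, Rinv_r, Rmult_1_l by lra. lra.
      * rewrite Rplus_0_r. apply Rmult_lt_0_compat; auto. apply Rinv_0_lt_compat; auto.
    + destruct HB as [d Hd]. exists (mkposreal (d * z) ltac:(apply Rmult_lt_0_compat; [apply cond_pos | auto])).
      intros a Ha Ha0. change (Rabs (a - z) < d * z) in Ha. apply Hd.
      * change (Rabs (/ z * a + 0 - 1) < d). replace (/ z * a + 0 - 1) with (/ z * (a - z)) by (field; lra). rewrite Rabs_mult, (Rabs_pos_eq (/ z)) by (left; apply Rinv_0_lt_compat; auto).
        apply Rmult_lt_reg_l with z; auto. rewrite <- Rmult_assoc, Rinv_r, Rmult_1_l by lra. lra.
      * rewrite Rplus_0_r. apply Rmult_lt_reg_l with z; auto. rewrite <- Rmult_assoc, Rinv_r, Rmult_1_l by lra. lra.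
    + intros a b Ha Hb. destruct (HAB _ _ Ha Hb) as [v [Hv1 Hv2]]. simpl in *. exists v. split; auto.
      apply (is_RInt_comp_lin (V := C_R_NormedModule) g (/ z) 0 a b v Hv1).
Qed.

(** * Euler operators and the characteristic polynomial *)

Definition Csum (f : nat -> C) (n : nat) : C := sum_n (G := C_AbelianMonoid) f n.

Lemma Csum_0 (f : nat -> C) : Csum f 0 = f O.
Proof. exact (sum_O (G := C_AbelianMonoid) f). Qed.

Lemma Csum_S (f : nat -> C) (n : nat) : Csum f (S n) = (Csum f n + f (S n))%C.
Proof. exact (sum_Sn (G := C_AbelianMonoid) f n). Qed.

Lemma Csum_ext (f g : nat -> C) (n : nat) : (forall i, (i <= n)%nat -> f i = g i) -> Csum f n = Csum g n.
Proof. intros H. apply sum_n_ext_loc. exact H. Qed.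

Lemma Csum_cmult (c : C) (f : nat -> C) (n : nat) : Csum (fun i => c * f i)%C n = (c * Csum f n)%C.
Proof. induction n. now rewrite !Csum_0. rewrite !Csum_S, IHn. ring. Qed.

Lemma Csum_minus (f g : nat -> C) (n : nat) : Csum (fun i => f i - g i)%C n = (Csum f n - Csum g n)%C.
Proof. induction n. now rewrite !Csum_0. rewrite !Csum_S, IHn. ring. Qed.

(** * Iterated derivatives on the positive half-line *)

Definition Cdiff_pos (f g : R -> C) : Prop := forall z, 0 < z -> Cderiv f z (g z).

Lemma locally_pos (z : R) : 0 < z -> locally z (fun u => 0 < u).
Proof.
  intros Hz. exists (mkposreal z Hz). intros u Hu. change (Rabs (u - z) < z) in Hu. apply Rabs_def2 in Hu. lra.
Qed.

(** Nothing is known at or left of 0, so each induction step replaces the iterated derivative by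
    [F k] on a neighbourhood of [z] only. *)
Lemma chain_Derive_n (F : nat -> R -> R) (n : nat) (phi : R -> R) :
  (forall k z, (k < n)%nat -> 0 < z -> is_derive (F k) z (F (S k) z)) ->
  (forall z, 0 < z -> phi z = F O z) ->
  forall k z, (k <= n)%nat -> 0 < z -> ex_derive_n phi k z /\ Derive_n phi k z = F k z.
Proof.
  intros HF H0. induction k; intros z Hk Hz.
  - simpl. auto.
  - assert (H : is_derive (Derive_n phi k) z (F (S k) z)).
    { apply is_derive_ext_loc with (F k). 2: apply HF; auto; lia.
      generalize (locally_pos z Hz). apply filter_imp. intros u Hu. symmetry. apply IHk; auto; lia. }
    split. simpl. eexists; exact H. simpl. apply is_derive_unique, H.
Qed.

Lemma chain_CDerive_n (F : nat -> R -> C) (n : nat) (phi : R -> C) :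
  (forall k, (k < n)%nat -> Cdiff_pos (F k) (F (S k))) ->
  (forall z, 0 < z -> phi z = F O z) ->
  ex_CDerive_n_pos phi n /\ forall k z, (k <= n)%nat -> 0 < z -> CDerive_n phi k z = F k z.
Proof.
  intros HF H0.
  assert (HR := chain_Derive_n (fun k z => Re (F k z)) n (fun z => Re (phi z))
    (fun k z Hk Hz => proj1 (proj1 (Cderiv_comps _ _ _) (HF k Hk z Hz))) (fun z Hz => f_equal Re (H0 z Hz))).
  assert (HI := chain_Derive_n (fun k z => Im (F k z)) n (fun z => Im (phi z))
    (fun k z Hk Hz => proj2 (proj1 (Cderiv_comps _ _ _) (HF k Hk z Hz))) (fun z Hz => f_equal Im (H0 z Hz))).
  split.
  - intros k z Hk Hz. split; [apply HR | apply HI]; auto.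
  - intros k z Hk Hz. unfold CDerive_n. destruct (HR k z Hk Hz) as [_ ->]. destruct (HI k z Hk Hz) as [_ ->].
    destruct (F k z); reflexivity.
Qed.

Lemma CDerive_n_chain (phi : R -> C) (n : nat) : ex_CDerive_n_pos phi n ->
  forall k, (k < n)%nat -> Cdiff_pos (CDerive_n phi k) (CDerive_n phi (S k)).
Proof.
  intros H k Hk z Hz. apply Cderiv_comps. unfold CDerive_n; simpl.
  destruct (H (S k) z Hk Hz) as [H1 H2]. simpl in H1, H2.
  split; apply Derive_correct; auto.
Qed.

Lemma CDerive_n_0 (phi : R -> C) (z : R) : CDerive_n phi 0 z = phi z.
Proof. unfold CDerive_n; simpl. destruct (phi z); reflexivity. Qed.

Lemma CDerive_1_eq (phi g : R -> C) (z : R) (l : C) : 0 < z ->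
  (forall u, 0 < u -> phi u = g u) -> Cderiv g z l -> CDerive_n phi 1 z = l.
Proof.
  intros Hz Hg H. apply Cderiv_comps in H. destruct H as [H1 H2]. unfold CDerive_n; simpl.
  assert (E1 : Derive (fun t => Re (phi t)) z = Re l).
  { apply is_derive_unique. eapply is_derive_ext_loc. 2: exact H1.
    generalize (locally_pos z Hz). apply filter_imp. intros u Hu. now rewrite Hg. }
  assert (E2 : Derive (fun t => Im (phi t)) z = Im l).
  { apply is_derive_unique. eapply is_derive_ext_loc. 2: exact H2.
    generalize (locally_pos z Hz). apply filter_imp. intros u Hu. now rewrite Hg. }
  etransitivity. apply f_equal2. exact E1. exact E2. destruct l; reflexivity.
Qed.

Section Newton.
Variable alpha : R.
Hypothesis Halpha : 0 < alpha.

(* Coefficients of [prod (x - r)] in the Newton basis [N_i x = prod_(j < i) (x - j/alpha)]; since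
   [(z/alpha)^i d^i/dz^i] is [N_i] evaluated at the Euler operator [(z/alpha) d/dz], the same
   coefficients expand the composite of the operators [(z/alpha) d/dz - r]. *)
Fixpoint newton_coef (l : list C) (i : nat) : C :=
  match l with
  | [] => match i with O => RtoC 1 | S _ => RtoC 0 end
  | r :: l => ((match i with O => RtoC 0 | S j => newton_coef l j end)
               + (RtoC (INR i / alpha) - r) * newton_coef l i)%C
  end.

Definition newton (i : nat) (x : C) : C := Cprod (map (fun j => x - RtoC (INR j / alpha))%C (seq 0 i)).

Lemma newton_S (i : nat) (x : C) : newton (S i) x = (newton i x * (x - RtoC (INR i / alpha)))%C.
Proof.
  unfold newton. rewrite seq_S, map_app, Cprod_app, Nat.add_0_l.
  unfold Cprod at 2. unfold map at 2, fold_right. ring.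
Qed.

Lemma newton_coef_high (l : list C) (i : nat) : (length l < i)%nat -> newton_coef l i = 0.
Proof.
  revert i. induction l as [|r l IH]; intros i Hi; simpl in *.
  - destruct i; [lia | reflexivity].
  - destruct i; [lia|]. rewrite !IH by lia. ring.
Qed.

(** Summation by parts for the recursion of [newton_coef], with an arbitrary sequence [v]: it is
    applied both to the Newton polynomials at a point and to the terms [z^i/alpha^i phi^(i)], so
    polynomial and operator expand alike. *)
Lemma newton_sum_step (r : C) (l : list C) (v : nat -> C) (M : nat) :
  Csum (fun i => newton_coef (r :: l) i * v i)%C M =
  (Csum (fun i => newton_coef l i * (v (S i) + (RtoC (INR i / alpha) - r) * v i)) M - newton_coef l M * v (S M))%C.
Proof.
  induction M.
  - rewrite !Csum_0. simpl. ring.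
  - rewrite !Csum_S, IHM. simpl. ring.
Qed.

Lemma newton_expand (l : list C) (x : C) : Cprod (map (fun r => x - r)%C l) = Csum (fun i => newton_coef l i * newton i x)%C (length l).
Proof.
  induction l as [|r l IH].
  - simpl. rewrite Csum_0. simpl. unfold newton, Cprod; simpl. ring.
  - change (Cprod (map (fun r0 => x - r0)%C (r :: l))) with ((x - r) * Cprod (map (fun r0 => x - r0)%C l))%C.
    rewrite IH. change (length (r :: l)) with (S (length l)).
    rewrite newton_sum_step, newton_coef_high, Csum_S, (newton_coef_high l (S (length l))), <- Csum_cmult by lia.
    match goal with |- _ = (?A + ?B - ?D)%C => transitivity A; [| ring] end.
    apply Csum_ext. intros i _. rewrite newton_S. unfold Cminus. ring.
Qed.

Lemma newton_root (i j : nat) : (i < j)%nat -> newton j (RtoC (INR i / alpha)) = 0.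
Proof.
  induction j; intros H. lia. rewrite newton_S. destruct (Nat.eq_dec i j) as [-> | Hne].
  - ring.
  - rewrite IHj by lia. ring.
Qed.

Lemma newton_neq_0 (i j : nat) : (j <= i)%nat -> newton j (RtoC (INR i / alpha)) <> 0.
Proof.
  induction j; intros H. unfold newton; simpl. apply C1_nz.
  rewrite newton_S. apply Cmult_neq_0. apply IHj; lia.
  rewrite <- RtoC_minus. intros E. apply RtoC_inj in E.
  assert (H1 : INR j < INR i) by (apply lt_INR; lia).
  assert (0 < (INR i - INR j) / alpha) by (apply Rdiv_lt_0_compat; lra).
  unfold Rdiv in *. nra.
Qed.

(** Evaluation at the node [i / alpha] is triangular: the polynomials of index above [i] vanish
    there, the one of index [i] does not. *)
Lemma newton_unique (c : nat -> C) (m : nat) :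
  (forall x, Csum (fun i => c i * newton i x)%C m = 0) -> forall i, (i <= m)%nat -> c i = 0.
Proof.
  intros H i. induction i as [i IH] using (well_founded_induction Wf_nat.lt_wf). intros Hi.
  assert (E := H (RtoC (INR i / alpha))).
  assert (E2 : forall M, (i <= M <= m)%nat -> Csum (fun j => c j * newton j (RtoC (INR i / alpha)))%C M = (c i * newton i (RtoC (INR i / alpha)))%C).
  { intros M. induction M; intros HM.
    - replace i with O by lia. apply Csum_0.
    - rewrite Csum_S. destruct (Nat.eq_dec i (S M)) as [-> | Hne].
      + rewrite (Csum_ext _ (fun j => RtoC 0 * RtoC 0)%C). rewrite Csum_cmult. ring.
        intros j Hj. rewrite (IH j) by lia. ring.
      + rewrite IHM by lia. rewrite (newton_root i (S M)) by lia. ring. }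
  rewrite E2 in E by lia.
  destruct (Ceq_dec (c i) 0) as [H0 | H0]; auto. exfalso.
  apply (Cmult_neq_0 _ _ H0 (newton_neq_0 i i (le_n i)) E).
Qed.

Lemma Cderiv_Csum (v dv : nat -> R -> C) (z : R) (n : nat) :
  (forall i, (i <= n)%nat -> Cderiv (v i) z (dv i z)) ->
  Cderiv (fun u => Csum (fun i => v i u) n) z (Csum (fun i => dv i z) n).
Proof.
  induction n; intros H.
  - eapply Cderiv_eq. apply (is_derive_ext (V := C_R_NormedModule) (v O)). intros; symmetry; apply Csum_0. apply H; lia. symmetry; apply (Csum_0 (fun i => dv i z)).
  - eapply Cderiv_eq. apply (is_derive_ext (V := C_R_NormedModule) (fun u => Csum (fun i => v i u) n + v (S n) u)%C). intros; symmetry; apply Csum_S.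
    apply Cderiv_plus. apply IHn. intros; apply H; lia. apply H; lia. symmetry; apply (Csum_S (fun i => dv i z)).
Qed.

Definition euler_term (phi : R -> C) (i : nat) (z : R) : C := (RtoC (z ^ i / alpha ^ i) * CDerive_n phi i z)%C.

Lemma fold_euler (phi : R -> C) (m : nat) (l : list C) : ex_CDerive_n_pos phi m -> (length l <= m)%nat ->
  forall z, 0 < z -> fold_right (euler_op alpha) phi l z = Csum (fun i => newton_coef l i * euler_term phi i z)%C (length l).
Proof.
  intros Hphi. induction l as [|r l IH]; intros Hl z Hz.
  - simpl. rewrite Csum_0. unfold euler_term. simpl. rewrite CDerive_n_0.
    replace (1 / 1) with 1 by field. ring.
  - simpl in Hl. simpl fold_right. change (length (r :: l)) with (S (length l)).
    assert (Ha : forall i, 0 < alpha ^ i) by (intros; apply pow_lt; auto).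
    rewrite newton_sum_step, (newton_coef_high l (S (length l))), Csum_S, (newton_coef_high l (S (length l))) by lia.
    (* The derivative of the [i]-th term [T_i]; times [z / alpha] it becomes
       [(i / alpha) T_i + T_(i+1)], the rule that the Newton polynomials obey. *)
    set (dT := fun i u => (RtoC (INR i * u ^ pred i / alpha ^ i) * CDerive_n phi i u + RtoC (u ^ i / alpha ^ i) * CDerive_n phi (S i) u)%C).
    assert (HT : forall i, (i <= length l)%nat -> Cderiv (euler_term phi i) z (dT i z)).
    { intros i Hi. unfold euler_term, dT. apply (Cderiv_mult (fun z => RtoC (z ^ i / alpha ^ i))).
      - apply Cderiv_RtoC. apply (is_derive_ext (fun z => / alpha ^ i * z ^ i)). intros t. match goal with |- ?x = ?y => change (@eq R x y) end. unfold Rdiv; ring.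
        eapply is_derive_eq. apply is_derive_scal. apply (is_derive_pow (fun u => u) i). apply (is_derive_id (K := R_AbsRing)).
        unfold one; simpl. unfold Rdiv. ring.
      - apply (CDerive_n_chain phi m); auto. lia. }
    unfold euler_op.
    rewrite (CDerive_1_eq _ (fun z => Csum (fun i => newton_coef l i * euler_term phi i z)%C (length l)) z
       (Csum (fun i => newton_coef l i * dT i z)%C (length l)) Hz).
    + rewrite IH by (auto; lia). rewrite <- !Csum_cmult, <- Csum_minus.
      match goal with |- _ = (?A + ?B - ?D)%C => transitivity A; [| ring] end.
      apply Csum_ext. intros i Hi. unfold dT, euler_term.
      assert (E1 : RtoC (INR i / alpha * (z ^ i / alpha ^ i)) = RtoC (/ alpha * z * (INR i * z ^ pred i / alpha ^ i))).
      { f_equal. destruct i. simpl. field; lra. simpl pred. simpl (z ^ S i). field. split; [|lra]. apply Rgt_not_eq, (Ha (S i)). }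
      assert (E2 : RtoC (z ^ S i / alpha ^ S i) = RtoC (/ alpha * z * (z ^ i / alpha ^ i))).
      { f_equal. simpl. field. split; [|lra]. apply Rgt_not_eq, Ha. }
      rewrite E2. rewrite !RtoC_mult in *. rewrite ?RtoC_mult in E1.
      transitivity (newton_coef l i * ((RtoC (/ alpha) * RtoC z * RtoC (INR i * z ^ pred i / alpha ^ i)) * CDerive_n phi i z
         + RtoC (/ alpha) * RtoC z * RtoC (z ^ i / alpha ^ i) * CDerive_n phi (S i) z - r * (RtoC (z ^ i / alpha ^ i) * CDerive_n phi i z)))%C.
      ring. rewrite <- E1. ring.
    + intros u Hu. apply IH; auto; lia.
    + apply (Cderiv_Csum (fun i u => newton_coef l i * euler_term phi i u)%C (fun i u => newton_coef l i * dT i u)%C).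
      intros i Hi. apply Cderiv_cmult, HT; auto.
Qed.

(** [char_poly] is already an expansion in the Newton basis. Uniqueness identifies its coefficients
    with those of the product over the roots, and the identity of coefficients is then read for
    operators. *)
Lemma eq_rhs_factor (m : nat) (a : nat -> R) (roots : list C) : length roots = m ->
  (forall x, char_poly m alpha a x = (RtoC (a m) * Cprod (map (fun r => x - r) roots))%C) ->
  forall phi, ex_CDerive_n_pos phi m -> forall z, 0 < z ->
  eq_rhs m alpha a phi z = (RtoC (a m) * fold_right (euler_op alpha) phi roots z)%C.
Proof.
  intros Hlen Hroots phi Hphi z Hz.
  assert (Hc : forall i, (i <= m)%nat -> RtoC (a i) = (RtoC (a m) * newton_coef roots i)%C).
  { intros i Hi. apply Ceq_minus.
    apply (newton_unique (fun i => RtoC (a i) - RtoC (a m) * newton_coef roots i)%C m); auto.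
    intros x. rewrite (Csum_ext _ (fun i => RtoC (a i) * newton i x - RtoC (a m) * (newton_coef roots i * newton i x))%C).
    2: intros; ring.
    rewrite Csum_minus, Csum_cmult, <- Hlen, <- newton_expand, Hlen.
    specialize (Hroots x). unfold char_poly in Hroots. rewrite <- Hroots.
    unfold newton, Csum. ring. }
  rewrite (fold_euler phi m) by (auto; lia). rewrite <- Csum_cmult, Hlen.
  unfold eq_rhs. apply (Csum_ext (fun i => RtoC (a i / alpha ^ i * z ^ i) * CDerive_n phi i z)%C). intros i Hi. unfold euler_term.
  rewrite Cmult_assoc, <- Hc by auto. rewrite Cmult_assoc, <- RtoC_mult. f_equal. f_equal. field.
  apply Rgt_not_eq, pow_lt; auto.
Qed.
End Newton.

(** * Superpositions of powers *)

(* A linear way [sp_sum] of summing families of powers [z^(a + eps x)], with coefficients in [sp_adm],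
   that commutes with improper integrals; it is a contour integral for the H-function and a double
   series for the Wright functions. *)
Record superposition (X : Type) := {
  sp_sum : (X -> C) -> C -> Prop;
  sp_eps : X -> C;
  sp_adm : (X -> C) -> Prop;
  sp_eps_pos : forall x, 0 <= Re (sp_eps x);
  sp_uniq : forall f l l', sp_sum f l -> sp_sum f l' -> l = l';
  sp_cmult : forall f c l, sp_sum f l -> sp_sum (fun x => c * f x)%C (c * l)%C;
  sp_minus : forall f g l m, sp_sum f l -> sp_sum g m -> sp_sum (fun x => f x - g x)%C (l - m)%C;
  sp_adm_mult : forall F c, sp_adm F -> sp_adm (fun x => F x * (c + sp_eps x))%C;
  sp_adm_cmult : forall F c, sp_adm F -> sp_adm (fun x => F x * c)%C;
  sp_ex : forall F a u, sp_adm F -> 0 < u -> exists l, sp_sum (fun x => F x * cpw u (RtoC a + sp_eps x))%C l;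
  sp_bound : forall F a Z, sp_adm F -> 0 < Z -> exists M, 0 <= M /\ forall u l, 0 < u <= Z ->
    sp_sum (fun x => F x * cpw u (RtoC a + sp_eps x))%C l -> Cmod l <= M * Rpower u a;
  sp_fubini : forall F a Z Ua Ub E q Q ua ub (kappa H : R -> C) (g : X -> C) (I : C),
    sp_adm F -> 0 < Z -> dominator Ua Ub E q Q ua ub ->
    (forall u, E u -> 0 < u <= Z) ->
    (forall u, E u -> Ccont kappa u) ->
    (forall u, E u -> Cmod (kappa u) * Rpower u a <= q u) ->
    (forall u, E u -> sp_sum (fun x => F x * cpw u (RtoC a + sp_eps x))%C (H u)) ->
    (forall x, CRIntg (fun u => kappa u * cpw u (RtoC a + sp_eps x))%C Ua Ub (g x)) ->
    sp_sum (fun x => F x * g x)%C I ->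
    CRIntg (fun u => kappa u * H u)%C Ua Ub I }.

Arguments sp_sum {X}. Arguments sp_eps {X}. Arguments sp_adm {X}.
Arguments sp_eps_pos {X}. Arguments sp_uniq {X}. Arguments sp_cmult {X}. Arguments sp_minus {X}.
Arguments sp_adm_mult {X}. Arguments sp_adm_cmult {X}. Arguments sp_ex {X}. Arguments sp_bound {X}.
Arguments sp_fubini {X}.

(** A proper integral is an improper one between point filters; thus [sp_fubini] also covers compact
    intervals. *)
Lemma point_dominator (M z1 z2 u v : R) : z1 < u < z2 -> z1 < v < z2 ->
  dominator (at_point u) (at_point v) (fun t => z1 < t < z2) (fun _ => M) (fun t => M * t) (M * u) (M * v).
Proof.
  intros Hu Hv. constructor; auto.
  - apply at_point_filter.
  - apply at_point_filter.
  - intros a b t. apply open_interval_conv.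
  - intros t. apply open_interval_open.
  - intros t _. eapply is_derive_eq. apply is_derive_scal. apply (is_derive_id (K := R_AbsRing)). unfold one; simpl; ring.
  - intros t _. apply continuous_const.
  - intros P HP. apply locally_singleton in HP. exact HP.
  - intros P HP. apply locally_singleton in HP. exact HP.
Qed.

Lemma Rpower_bound_interval (z1 z2 a u : R) : 0 < z1 -> z1 <= u <= z2 -> Rpower u a <= Rpower z1 a + Rpower z2 a.
Proof.
  intros Hz Hu. assert (P1 := Rpower_pos z1 a). assert (P2 := Rpower_pos z2 a).
  destruct (Rle_lt_dec 0 a).
  - assert (Rpower u a <= Rpower z2 a) by (apply Rpower_le_compat; lra). lra.
  - assert (Rpower u a <= Rpower z1 a) by (apply Rpower_anti; lra). lra.
Qed.

(** * Termwise differentiation and fractional integration *)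

Section Superposition.
Context {X : Type} (S : superposition X).

Definition sp_val (F : X -> C) (a u : R) : C :=
  iota (T := C_R_CompleteNormedModule) (sp_sum S (fun x => F x * cpw u (RtoC a + sp_eps S x))%C).

Lemma sp_val_eq (F : X -> C) (a u : R) (l : C) : sp_sum S (fun x => F x * cpw u (RtoC a + sp_eps S x))%C l -> sp_val F a u = l.
Proof.
  intros H. apply (iota_unique (V := C_R_CompleteNormedModule)); auto.
  intros y Hy. apply (sp_uniq S _ _ _ Hy H).
Qed.

Lemma sp_val_spec (F : X -> C) (a u : R) : sp_adm S F -> 0 < u ->
  sp_sum S (fun x => F x * cpw u (RtoC a + sp_eps S x))%C (sp_val F a u).
Proof.
  intros HF Hu. destruct (sp_ex S F a u HF Hu) as [l Hl]. rewrite (sp_val_eq _ _ _ _ Hl). exact Hl.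
Qed.

Lemma sp_sum_ext (f g : X -> C) (l : C) : (forall x, f x = g x) -> sp_sum S f l -> sp_sum S g l.
Proof. intros H. rewrite (functional_extensionality _ _ H). auto. Qed.

Lemma sp_val_ext (F G : X -> C) (a u : R) : (forall x, F x = G x) -> sp_val F a u = sp_val G a u.
Proof. intros H. rewrite (functional_extensionality _ _ H). auto. Qed.

(** Coefficients after one differentiation. The exponent drops by one through [a], so that [sp_eps]
    stays the same. *)
Definition dcoef (F : X -> C) (a : R) (x : X) : C := (F x * (RtoC a + sp_eps S x))%C.

Lemma cpw_increment (e : C) (z1 z2 u v : R) : 0 < z1 -> z1 < u < z2 -> z1 < v < z2 ->
  CRInt (fun t => cpw t (e - 1)) u v (CInt (fun t => cpw t (e - 1)) u v) /\
  (e * CInt (fun t => cpw t (e - 1)) u v = cpw v e - cpw u e)%C.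
Proof.
  intros Hz Hu Hv.
  assert (Hpos : forall t, Rmin u v <= t <= Rmax u v -> 0 < t).
  { intros t Ht. destruct (open_interval_conv z1 z2 u v t Hu Hv Ht). lra. }
  assert (H := CInt_correct (fun t => cpw t (e - 1)) u v (fun t Ht => Ccont_cpw _ t (Hpos t Ht))).
  split; auto.
  assert (HD := point_dominator 0 z1 z2 u v Hu Hv).
  assert (H1 := CRIntg_cmult _ _ _ _ _ _ _ _ e _ HD (proj2 (is_RInt_gen_at_point (V := C_R_NormedModule) _ _ _ _) H)).
  apply (proj1 (is_RInt_gen_at_point (V := C_R_NormedModule) _ _ _ _)) in H1.
  assert (H2 : CRInt (fun t => e * cpw t (e - 1))%C u v (cpw v e - cpw u e)%C).
  { apply (is_RInt_derive (V := C_R_CompleteNormedModule) (fun t => cpw t e)).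
    - intros t Ht. apply Cderiv_cpw; auto.
    - intros t Ht. apply Clim_mult. apply locally_filter. apply Clim_const, locally_filter. apply Ccont_cpw; auto. }
  exact (eq_trans (eq_sym (CInt_unique _ _ _ _ H1)) (CInt_unique _ _ _ _ H2)).
Qed.

(** [sp_fubini] with kernel 1 on a compact interval: each power of the differentiated family
    integrates to an increment of the original power. *)
Lemma sp_val_int (F : X -> C) (a z1 z2 u v : R) : sp_adm S F -> 0 < z1 -> z1 < u < z2 -> z1 < v < z2 ->
  CRInt (sp_val (dcoef F a) (a - 1)) u v (sp_val F a v - sp_val F a u)%C.
Proof.
  intros HF Hz Hu Hv.
  set (M := Rpower z1 (a - 1) + Rpower z2 (a - 1)).
  assert (HD := point_dominator M z1 z2 u v Hu Hv).
  assert (HF' : sp_adm S (dcoef F a)) by (apply (sp_adm_mult S); auto).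
  apply (proj1 (is_RInt_gen_at_point (V := C_R_NormedModule) _ _ _ _)).
  apply (CRIntg_ext_dom _ _ _ _ _ _ _ (fun t => 1 * sp_val (dcoef F a) (a - 1) t)%C _ _ HD).
  { intros t _. apply Cmult_1_l. }
  apply (sp_fubini S (dcoef F a) (a - 1) z2 _ _ _ _ _ _ _ (fun _ => RtoC 1) _
     (fun x => CInt (fun t => cpw t (RtoC a + sp_eps S x - 1)) u v) _ HF' ltac:(lra) HD).
  - intros t Ht. lra.
  - intros t _. apply continuous_const.
  - intros t Ht. rewrite Cmod_1, Rmult_1_l. apply Rpower_bound_interval; lra.
  - intros t Ht. apply sp_val_spec; auto. lra.
  - intros x. apply (proj2 (is_RInt_gen_at_point (V := C_R_NormedModule) _ _ _ _)).
    apply (is_RInt_ext (V := C_R_NormedModule) (fun t => cpw t (RtoC a + sp_eps S x - 1))).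
    + intros t _. match goal with |- ?x = ?y => change (@eq C x y) end. rewrite Cmult_1_l. f_equal. rewrite RtoC_minus. ring.
    + apply (cpw_increment _ z1 z2); auto.
  - apply (sp_sum_ext (fun x => F x * cpw v (RtoC a + sp_eps S x) - F x * cpw u (RtoC a + sp_eps S x))%C).
    + intros x. unfold dcoef. destruct (cpw_increment (RtoC a + sp_eps S x) z1 z2 u v Hz Hu Hv) as [_ E].
      rewrite <- Cmult_assoc, E. ring.
    + apply (sp_minus S); apply sp_val_spec; auto; lra.
Qed.

(** Increments are integrals of a superposition that [sp_bound] controls near [z], which gives a
    local Lipschitz estimate. *)
Lemma sp_val_cont (F : X -> C) (a z : R) : sp_adm S F -> 0 < z -> Ccont (sp_val F a) z.
Proof.
  intros HF Hz.
  assert (HF' : sp_adm S (dcoef F a)) by (apply (sp_adm_mult S); auto).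
  destruct (sp_bound S (dcoef F a) (a - 1) (2 * z) HF' ltac:(lra)) as [M [HM0 HM]].
  set (K := M * (Rpower (z/2) (a - 1) + Rpower (2 * z) (a - 1))).
  assert (HK : 0 <= K).
  { apply Rmult_le_pos; auto. assert (H1 := Rpower_pos (z/2) (a - 1)). assert (H2 := Rpower_pos (2 * z) (a - 1)). lra. }
  apply Clim_squeeze with (fun v => K * Rabs (v - z)). apply locally_filter.
  - generalize (open_interval_open (z/2) (2*z) z ltac:(lra)). apply filter_imp. intros v Hv.
    assert (HI := sp_val_int F a (z/2) (2*z) z v HF ltac:(lra) ltac:(lra) Hv).
    apply (CRInt_bound (sp_val (dcoef F a) (a - 1)) (fun _ => 1) (fun t => t) K z v); auto.
    + intros t _. split. apply (is_derive_id (K := R_AbsRing)). apply continuous_const.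
    + intros t Ht. rewrite Rmult_1_r.
      assert (Ht' : z/2 < t < 2*z) by (apply (open_interval_conv (z/2) (2*z) z v t); lra).
      eapply Rle_trans. apply (HM t). lra. apply sp_val_spec; auto; lra.
      apply Rmult_le_compat_l; auto. apply Rpower_bound_interval; lra.
  - replace (locally 0) with (locally (K * Rabs (z - z))).
    2: { f_equal. unfold Rminus. rewrite Rplus_opp_r, Rabs_R0. ring. }
    apply (filterlim_scal_R (locally z)).
    apply (continuous_comp (fun v => v - z) Rabs). apply (continuous_minus (V := R_NormedModule)). apply continuous_id. apply continuous_const.
    apply (filterlim_Rabs (z - z)).
Qed.

(** Fundamental theorem of calculus: the integrand of [sp_val_int] is itself a superposition, hence
    continuous. *)
Lemma sp_val_deriv (F : X -> C) (a : R) : sp_adm S F -> Cdiff_pos (sp_val F a) (sp_val (dcoef F a) (a - 1)).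
Proof.
  intros HF z Hz.
  assert (HF' : sp_adm S (dcoef F a)) by (apply (sp_adm_mult S); auto).
  apply (is_derive_ext (V := C_R_NormedModule) (fun v => (sp_val F a v - sp_val F a z) + sp_val F a z)%C).
  { intros t. match goal with |- ?x = ?y => change (@eq C x y) end. ring. }
  eapply Cderiv_eq. apply Cderiv_plus. 2: apply (Cderiv_const (sp_val F a z)).
  2: apply Cplus_0_r.
  apply (is_derive_RInt (V := C_R_NormedModule) (sp_val (dcoef F a) (a - 1)) (fun v => (sp_val F a v - sp_val F a z)%C) z z).
  - generalize (open_interval_open (z/2) (2*z) z ltac:(lra)). apply filter_imp. intros v Hv.
    apply (sp_val_int F a (z/2) (2*z)); auto; lra.
  - apply sp_val_cont; auto.
Qed.

Fixpoint dcoef_n (F : X -> C) (a : R) (k : nat) : X -> C :=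
  match k with O => F | Datatypes.S k => dcoef (dcoef_n F a k) (a - INR k) end.

Lemma dcoef_n_adm (F : X -> C) (a : R) (k : nat) : sp_adm S F -> sp_adm S (dcoef_n F a k).
Proof. intros HF. induction k; simpl; auto. apply (sp_adm_mult S); auto. Qed.

Lemma dcoef_n_eq (F : X -> C) (a : R) (k : nat) (x : X) :
  dcoef_n F a k x = (F x * Cprod (map (fun j => RtoC a + sp_eps S x - RtoC (INR j)) (seq 0 k)))%C.
Proof.
  induction k.
  - unfold Cprod; simpl. ring.
  - rewrite seq_S, map_app, Cprod_app, Nat.add_0_l. unfold Cprod at 2. unfold map at 2, fold_right.
    cbn [dcoef_n]. unfold dcoef. rewrite IHk, RtoC_minus. ring.
Qed.

Lemma sp_val_chain (F : X -> C) (a : R) (k : nat) : sp_adm S F ->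
  Cdiff_pos (sp_val (dcoef_n F a k) (a - INR k)) (sp_val (dcoef_n F a (Datatypes.S k)) (a - INR (Datatypes.S k))).
Proof.
  intros HF. replace (a - INR (Datatypes.S k)) with (a - INR k - 1) by (rewrite S_INR; ring).
  apply sp_val_deriv. apply dcoef_n_adm; auto.
Qed.

Lemma sp_val_CDerive_n (F : X -> C) (a : R) (n : nat) (phi : R -> C) : sp_adm S F ->
  (forall z, 0 < z -> phi z = sp_val F a z) ->
  ex_CDerive_n_pos phi n /\ forall z, 0 < z -> CDerive_n phi n z = sp_val (dcoef_n F a n) (a - INR n) z.
Proof.
  intros HF Hphi.
  destruct (chain_CDerive_n (fun k => sp_val (dcoef_n F a k) (a - INR k)) n phi) as [H1 H2].
  - intros k _. apply sp_val_chain; auto.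
  - intros z Hz. simpl. rewrite Rminus_0_r. auto.
  - split; auto.
Qed.

(** Coefficients after the Euler operators of a list: unlike [dcoef] they leave the exponent alone
    and multiply by [(a + eps)/alpha - r]. *)
Fixpoint ecoef (alpha : R) (F : X -> C) (a : R) (l : list C) : X -> C :=
  match l with
  | [] => F
  | r :: l => fun x => (ecoef alpha F a l x * ((RtoC a - RtoC alpha * r) + sp_eps S x) * / RtoC alpha)%C
  end.

Lemma ecoef_adm (alpha : R) (F : X -> C) (a : R) (l : list C) : sp_adm S F -> sp_adm S (ecoef alpha F a l).
Proof. intros HF. induction l; simpl; auto. apply (sp_adm_cmult S), (sp_adm_mult S); auto. Qed.

Lemma ecoef_eq (alpha : R) (F : X -> C) (a : R) (l : list C) (x : X) : 0 < alpha ->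
  ecoef alpha F a l x = (F x * Cprod (map (fun r => (RtoC a + sp_eps S x) / RtoC alpha - r) l))%C.
Proof.
  intros Hal. assert (Hal0 : RtoC alpha <> 0) by (intros E; apply RtoC_inj in E; lra).
  induction l as [|r l IH]; simpl. unfold Cprod; simpl; ring.
  unfold Cprod in *; simpl. rewrite IH. field. auto.
Qed.

Lemma sp_val_cmult (F : X -> C) (a z : R) (c : C) : sp_adm S F -> 0 < z ->
  sp_val (fun x => F x * c)%C a z = (c * sp_val F a z)%C.
Proof.
  intros HF Hz. apply sp_val_eq. eapply sp_sum_ext. 2: apply (sp_cmult S), (sp_val_spec F a z HF Hz).
  intros x. simpl. ring.
Qed.

Lemma sp_val_euler (alpha : R) (F : X -> C) (a : R) (l : list C) (phi : R -> C) : 0 < alpha -> sp_adm S F ->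
  (forall z, 0 < z -> phi z = sp_val F a z) ->
  forall z, 0 < z -> fold_right (euler_op alpha) phi l z = sp_val (ecoef alpha F a l) a z.
Proof.
  intros Hal HF Hphi. induction l as [|r l IH]; intros z Hz.
  - simpl. auto.
  - simpl fold_right. assert (HE := ecoef_adm alpha F a l HF).
    assert (Hal0 : RtoC alpha <> 0) by (intros E; apply RtoC_inj in E; lra).
    unfold euler_op at 1.
    rewrite (CDerive_1_eq _ _ z _ Hz IH (sp_val_deriv _ a HE z Hz)), IH by auto.
    symmetry. apply sp_val_eq.
    assert (HE' : sp_adm S (dcoef (ecoef alpha F a l) a)) by (apply (sp_adm_mult S); auto).
    eapply sp_sum_ext. 2: apply (sp_minus S); apply (sp_cmult S); [apply (sp_val_spec _ (a - 1) z HE' Hz) | apply (sp_val_spec _ a z HE Hz)].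
    intros x. simpl. unfold dcoef.
    replace (RtoC (a - 1) + sp_eps S x)%C with (RtoC a + sp_eps S x + RtoC (Ropp 1))%C by (rewrite RtoC_minus, RtoC_opp; ring).
    rewrite cpw_plus, cpw_RtoC, Rpower_Ropp, Rpower_1, RtoC_mult, !RtoC_inv by lra.
    field. split; auto. intros E; apply RtoC_inj in E; lra.
Qed.

Lemma sp_val_RL (F : X -> C) (a nu z : R) : 0 < nu < 1 -> -1 < a -> sp_adm S F ->
  sp_adm S (fun x => F x * CBeta nu (RtoC a + sp_eps S x))%C -> 0 < z ->
  CRIntg (fun s => RtoC (Rpower (z - s) (nu - 1)) * sp_val F a s)%C (at_right 0) (at_left z)
    (sp_val (fun x => F x * CBeta nu (RtoC a + sp_eps S x))%C (nu + a) z).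
Proof.
  intros Hnu Ha HF HFB Hz.
  assert (Ham : -1 < Rmin a 0) by (unfold Rmin; destruct Rle_dec; lra).
  assert (HD := dominator_scal _ _ _ _ _ _ _ (Rpower z (a - Rmin a 0)) (beta_dominator z nu _ Hz (proj1 Hnu) Ham)).
  apply (sp_fubini S F a z _ _ _ _ _ _ _ (fun s => RtoC (Rpower (z - s) (nu - 1))) _
    (fun x => cpw z (RtoC nu + (RtoC a + sp_eps S x)) * CBeta nu (RtoC a + sp_eps S x))%C _ HF Hz HD).
  - intros u Hu. lra.
  - intros u Hu. apply Clim_RtoC. apply locally_filter. apply (continuous_comp (fun u => z - u) (fun u => Rpower u (nu - 1))).
    apply (continuous_minus (V := R_NormedModule)). apply continuous_const. apply continuous_id. apply continuous_Rpower; lra.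
  - intros u Hu. assert (H := beta_kernel_bound z nu u (RtoC a) Hu (proj2 Hnu)).
    rewrite Cmod_mult, Cmod_cpw in H. exact H.
  - intros u Hu. apply sp_val_spec; auto. lra.
  - intros x. apply beta_integral_scaled; auto.
    rewrite Re_R_plus. assert (H := sp_eps_pos S x). lra.
  - eapply sp_sum_ext. 2: apply (sp_val_spec _ (nu + a) z HFB Hz).
    intros x. simpl. rewrite RtoC_plus.
    replace (RtoC nu + RtoC a + sp_eps S x)%C with (RtoC nu + (RtoC a + sp_eps S x))%C by ring. ring.
Qed.

(** With coefficients [D x * rGamma (1 + e)] the derivative of order [alpha] merely yields
    [rGamma (1 - alpha + e)] at exponent [e - alpha], for integer and fractional order alike. What
    is left is the shift identity, a hypothesis here. Admissibility is asked for every [B] because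
    the fractional integral passes through [B = 1 + n - alpha]; [-1 < a] gives integrability at
    0. *)
Theorem sp_solution (m : nat) (alpha : R) (coefs : nat -> R) (roots : list C) (D : X -> C) (a : R) (phi : R -> C) :
  0 < alpha -> length roots = m ->
  (forall x, char_poly m alpha coefs x = (RtoC (coefs m) * Cprod (map (fun r => x - r) roots))%C) ->
  (exists n, (1 <= n)%nat /\ INR n - 1 < alpha <= INR n) ->
  -1 < a ->
  (forall B, sp_adm S (fun x => D x * rGamma (RtoC B + (RtoC a + sp_eps S x)))%C) ->
  (forall z, 0 < z ->
     sp_val (fun x => D x * rGamma (1 - RtoC alpha + (RtoC a + sp_eps S x)))%C (a - alpha) z =
     (RtoC (coefs m) * sp_val (ecoef alpha (fun x => D x * rGamma (1 + (RtoC a + sp_eps S x)))%C a roots) a z)%C) ->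
  (forall z, 0 < z -> phi z = sp_val (fun x => D x * rGamma (1 + (RtoC a + sp_eps S x)))%C a z) ->
  is_solution m alpha coefs phi.
Proof.
  intros Hal Hlen Hroots [n [Hn Hna]] Ha HD Hshift Hphi.
  set (F := fun x => (D x * rGamma (1 + (RtoC a + sp_eps S x)))%C) in *.
  assert (HF : sp_adm S F) by apply (HD 1).
  destruct (sp_val_CDerive_n F a m phi HF Hphi) as [Hex _].
  split; auto.
  assert (Hrhs : forall z, 0 < z -> eq_rhs m alpha coefs phi z =
    sp_val (fun x => D x * rGamma (1 - RtoC alpha + (RtoC a + sp_eps S x)))%C (a - alpha) z).
  { intros z Hz. rewrite Hshift by auto.
    rewrite (eq_rhs_factor alpha Hal m coefs roots Hlen Hroots phi Hex z Hz). f_equal.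
    apply sp_val_euler; auto. }
  destruct (Req_dec alpha (INR n)) as [Hint | Hnint].
  - left. exists n. split; auto. split; auto.
    destruct (sp_val_CDerive_n F a n phi HF Hphi) as [Hex2 Hd]. split; auto.
    intros z Hz. rewrite Hrhs, Hd, Hint by auto. apply sp_val_ext. intros x.
    rewrite dcoef_n_eq. unfold F.
    replace (1 - RtoC (INR n) + (RtoC a + sp_eps S x))%C with (1 + (RtoC a + sp_eps S x) - RtoC (INR n))%C by ring.
    rewrite rGamma_down. ring.
  - right. set (nu := INR n - alpha). assert (Hnu : 0 < nu < 1) by (unfold nu; lra).
    set (FB := fun x => (F x * CBeta nu (RtoC a + sp_eps S x))%C).
    (* The beta factor exchanges [rGamma (1 + e)], nonzero since [Re e > -1], for
       [rGamma (1 + nu + e)] up to the constant [Gamma nu]. *)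
    assert (HFBe : forall x, FB x = (D x * rGamma (RtoC (1 + nu) + (RtoC a + sp_eps S x)) * Gamma (RtoC nu))%C).
    { intros x. unfold FB, F, CBeta.
      rewrite RtoC_plus. field. apply rGamma_neq_0_Re. rewrite Re_R_plus, Re_R_plus. assert (H := sp_eps_pos S x). lra. }
    assert (HFB : sp_adm S FB).
    { rewrite (functional_extensionality _ _ HFBe). apply (sp_adm_cmult S). apply HD. }
    assert (Hgnu : Gamma (RtoC nu) <> 0).
    { rewrite Gamma_rGamma. intros E. assert (Hn0 : rGamma (RtoC nu) <> 0) by (apply rGamma_neq_0_Re; simpl; lra).
      apply Hn0. rewrite <- (Cinv_inv (rGamma _)), E. apply Cinv_0. }
    destruct (sp_val_CDerive_n FB (nu + a) n (sp_val FB (nu + a)) HFB (fun z _ => eq_refl)) as [Hex2 Hd].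
    exists n, (sp_val FB (nu + a)). repeat split; try (unfold nu in Hnu; lra); auto; try (apply Hex2; auto).
    + intros z Hz.
      assert (H := sp_val_RL F a nu z Hnu Ha HF HFB Hz).
      assert (HDom := beta_dominator z nu 0 Hz (proj1 Hnu) ltac:(lra)).
      apply (CRIntg_ext_dom _ _ _ _ _ _ _ _ _ _ HDom) with (2 := H).
      intros u Hu. rewrite Hphi by lra. reflexivity.
    + intros z Hz. rewrite Hrhs, Hd by auto.
      rewrite <- (sp_val_cmult _ _ _ (/ Gamma (RtoC nu))%C) by (auto; apply dcoef_n_adm; auto).
      replace (nu + a - INR n) with (a - alpha) by (unfold nu; ring).
      apply sp_val_ext. intros x. rewrite dcoef_n_eq, HFBe.
      replace (RtoC (1 + nu) + (RtoC a + sp_eps S x))%C with (1 + (RtoC (nu + a) + sp_eps S x))%C by (rewrite !RtoC_plus; ring).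
      replace (1 - RtoC alpha + (RtoC a + sp_eps S x))%C with (1 + (RtoC (nu + a) + sp_eps S x) - RtoC (INR n))%C
        by (unfold nu; rewrite RtoC_plus, RtoC_minus; ring).
      rewrite rGamma_down. field. auto.
Qed.
End Superposition.

(** * Rectangle integrals of Mellin-Barnes integrands *)

(* Holomorphy, phrased as the chain rule along paths so that it restricts at once to the sides of a
   rectangle. *)
Definition hol (D : C -> Prop) (f : C -> C) : Prop :=
  exists f' : C -> C, (forall s, D s -> continuous f' s) /\
    forall (g : R -> C) (t : R) (dg : C), D (g t) -> Cderiv g t dg -> Cderiv (fun t => f (g t)) t (dg * f' (g t))%C.

Lemma hol_ext (D : C -> Prop) (f g : C -> C) : (forall s, f s = g s) -> hol D f -> hol D g.
Proof. intros H. rewrite (functional_extensionality _ _ H). auto. Qed.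

Lemma hol_affine (D : C -> Prop) (p q : C) : hol D (fun s => p + q * s)%C.
Proof.
  exists (fun _ => q). split.
  - intros s _. apply continuous_const.
  - intros g t dg _ Hg. eapply Cderiv_eq. apply Cderiv_plus. apply (Cderiv_const p). apply Cderiv_cmult. exact Hg.
    simpl. ring.
Qed.

Lemma hol_const (D : C -> Prop) (p : C) : hol D (fun _ => p).
Proof. apply (hol_ext D (fun s => p + 0 * s)%C). intros; ring. apply hol_affine. Qed.

Lemma continuous_Cmult (f g : C -> C) (s : C) : continuous f s -> continuous g s -> continuous (fun s => f s * g s)%C s.
Proof. intros. apply Clim_mult; auto. apply locally_filter. Qed.

Lemma continuous_Cinv (f : C -> C) (s : C) : f s <> 0 -> continuous f s -> continuous (fun s => / f s)%C s.
Proof. intros. apply Clim_inv; auto. apply locally_filter. Qed.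

Lemma hol_mult (D : C -> Prop) (f g : C -> C) :
  (forall s, D s -> continuous f s) -> (forall s, D s -> continuous g s) ->
  hol D f -> hol D g -> hol D (fun s => f s * g s)%C.
Proof.
  intros Cf Cg [f' [Hf1 Hf2]] [g' [Hg1 Hg2]]. exists (fun s => f' s * g s + f s * g' s)%C. split.
  - intros s Hs. apply Clim_plus. apply locally_filter.
    apply (continuous_Cmult f' g); auto. apply (continuous_Cmult f g'); auto.
  - intros h t dh Hh Hd. eapply Cderiv_eq. apply Cderiv_mult. apply Hf2; eauto. apply Hg2; eauto. simpl. ring.
Qed.

Lemma hol_inv (D : C -> Prop) (f : C -> C) :
  (forall s, D s -> continuous f s) -> (forall s, D s -> f s <> 0) -> hol D f -> hol D (fun s => / f s)%C.
Proof.
  intros Cf H0 [f' [Hf1 Hf2]]. exists (fun s => - f' s * / (f s * f s))%C. split.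
  - intros s Hs. apply (continuous_Cmult (fun s => - f' s)%C (fun s => / (f s * f s))%C).
    apply (continuous_comp f' Copp). auto. apply continuous_Copp.
    apply (continuous_Cinv (fun s => f s * f s)%C). apply Cmult_neq_0; auto. apply continuous_Cmult; auto.
  - intros h t dh Hh Hd. eapply Cderiv_eq. apply (Cderiv_inv (fun t => f (h t))); auto. apply Hf2; eauto. simpl. field. auto.
Qed.

Lemma hol_Cexp (D : C -> Prop) (p q : C) : hol D (fun s => Cexp (p + q * s)).
Proof.
  exists (fun s => q * Cexp (p + q * s))%C. split.
  - intros s _. apply (continuous_Cmult (fun _ => q)). apply continuous_const.
    apply (continuous_comp (fun s => p + q * s)%C Cexp). 2: apply continuous_Cexp.
    apply Clim_plus. apply locally_filter. apply Clim_const, locally_filter.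
    apply Clim_mult. apply locally_filter. apply Clim_const, locally_filter. apply filterlim_id.
  - intros h t dh _ Hd. eapply Cderiv_eq. apply (Cderiv_Cexp (fun t => p + q * h t)%C).
    apply Cderiv_plus. apply Cderiv_const. apply Cderiv_cmult; eauto. simpl. ring.
Qed.

Lemma continuous_affine (p q s : C) : continuous (fun s => p + q * s)%C s.
Proof.
  apply Clim_plus. apply locally_filter. apply Clim_const, locally_filter.
  apply Clim_mult. apply locally_filter. apply Clim_const, locally_filter. apply filterlim_id.
Qed.

Lemma hol_rprod (D : C -> Prop) (n : nat) (p q : C) : hol D (fun s => rprod n (p + q * s)).
Proof.
  induction n.
  - apply (hol_ext D (fun s => p + q * s)%C). intros; now rewrite rprod_0. apply hol_affine.
  - apply (hol_ext D (fun s => rprod n (p + q * s) * (p + RtoC (INR (S n)) + q * s))%C).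
    + intros s. rewrite rprod_S. ring.
    + apply hol_mult; auto. 3: apply hol_affine.
      * intros s _. apply (continuous_comp (fun s => p + q * s)%C (rprod n)). apply continuous_affine. apply continuous_rprod.
      * intros s _. apply continuous_affine.
Qed.

Lemma continuous_rprod_affine (n : nat) (p q s : C) : continuous (fun s => rprod n (p + q * s)) s.
Proof. apply (continuous_comp (fun s => p + q * s)%C (rprod n)). apply continuous_affine. apply continuous_rprod. Qed.

Lemma continuous_rGamma_seq_affine (n : nat) (p q s : C) : continuous (fun s => rGamma_seq n (p + q * s)) s.
Proof. apply (continuous_comp (fun s => p + q * s)%C (rGamma_seq n)). apply continuous_affine. apply continuous_rGamma_seq. Qed.

Lemma hol_rGamma_seq (D : C -> Prop) (n : nat) (p q : C) : hol D (fun s => rGamma_seq n (p + q * s)).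
Proof.
  assert (H1 : hol D (fun s => Cexp (- p * RtoC (ln (INR n)) + (- q * RtoC (ln (INR n))) * s))) by apply hol_Cexp.
  assert (Hc : forall s, continuous (fun s => Cexp (- p * RtoC (ln (INR n)) + (- q * RtoC (ln (INR n))) * s)) s).
  { intros s. apply (continuous_comp (fun s => - p * RtoC (ln (INR n)) + (- q * RtoC (ln (INR n))) * s)%C Cexp).
    apply continuous_affine. apply continuous_Cexp. }
  apply (hol_ext D (fun s => / RtoC (INR (fact n)) * (Cexp (- p * RtoC (ln (INR n)) + (- q * RtoC (ln (INR n))) * s) * rprod n (p + q * s)))%C).
  - intros s. unfold rGamma_seq, cpw. rewrite Cmult_assoc. f_equal. f_equal. f_equal. ring.
  - apply hol_mult.
    + intros; apply continuous_const.
    + intros s _. apply (continuous_Cmult (fun s => Cexp (- p * RtoC (ln (INR n)) + (- q * RtoC (ln (INR n))) * s))); auto. apply continuous_rprod_affine.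
    + apply hol_const.
    + apply hol_mult; auto. intros; apply continuous_rprod_affine. apply hol_rprod.
Qed.

(** * Cauchy's theorem for rectangles *)

Definition vline (x y : R) : C := (RtoC x + Ci * RtoC y)%C.

Lemma vline_eq (x y : R) : vline x y = (x, y).
Proof. unfold vline. apply Ceq; simpl; ring. Qed.

Lemma Ccont2_vline (f : C -> C) (t u : R) : continuous f (vline u t) -> Ccont2 (fun t u => f (vline u t)) t u.
Proof.
  intros Hf. apply (continuous_comp (fun p : R * R => vline (snd p) (fst p)) f); auto.
  unfold vline. apply Clim_plus. apply locally_filter. apply Clim_RtoC. apply locally_filter. apply continuous_snd.
  apply Clim_mult. apply locally_filter. apply Clim_const, locally_filter. apply Clim_RtoC. apply locally_filter. apply continuous_fst.
Qed.

Lemma CInt_ext (f g : R -> C) (a b : R) : (forall x, Rmin a b < x < Rmax a b -> f x = g x) -> CInt f a b = CInt g a b.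
Proof. apply (RInt_ext (V := C_R_CompleteNormedModule)). Qed.

(** The integral of [f'] over the rectangle is computed in both orders: integrating in [x] first
    leaves the vertical sides, integrating in [t] first the horizontal ones, with the factor
    [1/i = - Ci]. *)
Lemma rectangle_hol (f : C -> C) (c x1 x2 S T : R) : x1 < c -> x2 < c ->
  hol (fun s => Re s < c) f ->
  CInt (fun t => f (vline x2 t) - f (vline x1 t))%C S T =
  CInt (fun x => - Ci * (f (vline x T) - f (vline x S)))%C x1 x2.
Proof.
  intros H1 H2 [f' [Hc Hd]].
  assert (HE : forall x, Rmin x1 x2 <= x <= Rmax x1 x2 -> x < c).
  { intros x. unfold Rmax. destruct Rle_dec; lra. }
  assert (HRe : forall x t, Re (vline x t) = x) by (intros; rewrite vline_eq; reflexivity).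
  assert (Hcont : forall t x, x < c -> Ccont2 (fun t u => f' (vline u t)) t x).
  { intros t x Hx. apply Ccont2_vline. apply Hc. rewrite HRe; auto. }
  assert (Hsw := rect_swap (fun _ => True) (fun x => x < c) (fun t x => f' (vline x t)) (fun _ _ _ _ _ _ => I)
     (fun a b u Ha Hb Hu => Rle_lt_trans _ _ _ (proj2 Hu) (Rmax_lub_lt _ _ _ Ha Hb)) (fun t x _ Hx => Hcont t x Hx) S T x1 x2 I I H1 H2).
  assert (I1 : forall t, CInt (fun x => f' (vline x t)) x1 x2 = (f (vline x2 t) - f (vline x1 t))%C).
  { intros t. apply CInt_unique.
    apply (is_RInt_derive (V := C_R_CompleteNormedModule) (fun x => f (vline x t))).
    - intros x Hx. eapply Cderiv_eq. apply (Hd (fun x => vline x t)).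
      rewrite HRe; auto. unfold vline. apply Cderiv_plus. apply (Cderiv_RtoC (fun x => x)). apply (is_derive_id (K := R_AbsRing)). apply Cderiv_const.
      unfold one; simpl. ring.
    - intros x Hx. apply (Ccont2_snd (fun t u => f' (vline u t)) t x). auto. }
  assert (I2 : forall x, x < c -> CInt (fun t => f' (vline x t)) S T = (- Ci * (f (vline x T) - f (vline x S)))%C).
  { intros x Hx. apply CInt_unique.
    assert (H3 : CRInt (fun t => f' (vline x t)) S T ((- Ci * f (vline x T)) - (- Ci * f (vline x S)))%C).
    { apply (is_RInt_derive (V := C_R_CompleteNormedModule) (fun t => - Ci * f (vline x t))%C).
      - intros t Ht. eapply Cderiv_eq. apply Cderiv_cmult. apply (Hd (fun t => vline x t)).
        rewrite HRe; auto. unfold vline. apply Cderiv_plus. apply Cderiv_const. apply Cderiv_cmult. apply (Cderiv_RtoC (fun x => x)). apply (is_derive_id (K := R_AbsRing)).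
        unfold one; simpl. replace (- Ci * ((0 + Ci * 1) * f' (vline x t)))%C with ((- (Ci * Ci)) * f' (vline x t))%C by ring.
        replace (- (Ci * Ci))%C with (RtoC 1). ring. apply Ceq; simpl; ring.
      - intros t Ht. apply (Ccont2_fst (fun t u => f' (vline u t)) t x). auto. }
    replace (- Ci * (f (vline x T) - f (vline x S)))%C with ((- Ci * f (vline x T)) - (- Ci * f (vline x S)))%C by ring. exact H3. }
  rewrite <- (CInt_ext (fun x => CInt (fun t => f' (vline x t)) S T) _ x1 x2).
  2: { intros x Hx. apply I2. apply HE. lra. }
  rewrite <- (CInt_ext (fun t => CInt (fun x => f' (vline x t)) x1 x2) _ S T).
  2: { intros t _. apply I1. }
  apply CInt_unique. exact Hsw.
Qed.

(* Joint convergence in the index and the point, that is, locally uniform convergence to a continuous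
   limit; in this form it is stable under products and inverses. *)
Notation cconv g f t := (Clim (filter_prod eventually (locally t)) (fun nq => g (fst nq) (snd nq)) (f t)).

(** Joint convergence is uniform near each point; compactness of the segment makes the index
    uniform. *)
Lemma cconv_unif (g : nat -> R -> C) (f : R -> C) (a b eps : R) : a <= b -> 0 < eps ->
  (forall t, a <= t <= b -> Ccont f t) -> (forall t, a <= t <= b -> cconv g f t) ->
  eventually (fun n => forall t, a <= t <= b -> Cmod (g n t - f t)%C <= eps).
Proof.
  intros Hab He Hf Hg.
  (* One positive number serves as gauge for both conditions: the radius [d] around [t] and the
     threshold [/ d] for the index. *)
  assert (Hloc : forall t, exists d : posreal, a <= t <= b -> forall n q, / d <= INR n -> Rabs (q - t) < d -> Cmod (g n q - f q)%C <= eps).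
  { intros t. destruct (Classical_Prop.classic (a <= t <= b)) as [Ht | Ht]. 2: { exists (mkposreal 1 Rlt_0_1). tauto. }
    assert (He2 : 0 < eps / 2) by lra.
    assert (H1 := proj1 (Clim_eps (filter_prod eventually (locally t)) _ _) (Hg t Ht) _ He2).
    assert (H2 := proj1 (Clim_eps (locally t) _ _) (Hf t Ht) _ He2).
    destruct H1 as [Q1 Q2 [N HN] [d1 Hd1] H1]. destruct H2 as [d2 H2].
    assert (HNp : 0 < / (INR N + 1)) by (apply Rinv_0_lt_compat; assert (H := pos_INR N); lra).
    assert (Hd : 0 < Rmin (/ (INR N + 1)) (Rmin d1 d2)).
    { apply Rmin_pos; auto. apply Rmin_pos; apply cond_pos. }
    exists (mkposreal _ Hd). intros _ n q Hn Hq. simpl in Hn, Hq.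
    assert (M1 := Rmin_l (/ (INR N + 1)) (Rmin d1 d2)). assert (M2 := Rmin_r (/ (INR N + 1)) (Rmin d1 d2)).
    assert (M3 := Rmin_l d1 d2). assert (M4 := Rmin_r d1 d2).
    assert (HNn : (N <= n)%nat).
    { apply INR_le. assert (INR N + 1 <= / Rmin (/ (INR N + 1)) (Rmin d1 d2)).
      { rewrite <- (Rinv_inv (INR N + 1)) at 1. apply Rinv_le_contravar; auto. } lra. }
    assert (E1 : Cmod (g n q - f t)%C < eps / 2).
    { apply (H1 n q). apply HN; auto. apply Hd1. change (Rabs (q - t) < d1). lra. }
    assert (E2 : Cmod (f q - f t)%C < eps / 2).
    { apply H2. change (Rabs (q - t) < d2). lra. }
    replace (g n q - f q)%C with ((g n q - f t) + - (f q - f t))%C by ring.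
    eapply Rle_trans. apply Cmod_triangle. rewrite Cmod_opp. lra. }
  set (delta := fun t => proj1_sig (constructive_indefinite_description _ (Hloc t))).
  assert (Hdelta : forall t, a <= t <= b -> forall n q, / delta t <= INR n -> Rabs (q - t) < delta t -> Cmod (g n q - f q)%C <= eps).
  { intros t. unfold delta. destruct (constructive_indefinite_description _ (Hloc t)) as [d Hd]. exact Hd. }
  destruct (compactness_value_1d a b delta) as [d Hd].
  destruct (nfloor_ex (/ d)) as [N [_ HN]]. { left. apply Rinv_0_lt_compat, cond_pos. }
  exists (S N). intros n Hn x Hx.
  (* Compactness yields the centre [t] only under a double negation, hence the argument by
     contradiction. *)
  destruct (Rle_lt_dec (Cmod (g n x - f x)%C) eps) as [H | H]; auto. exfalso.
  apply (Hd x Hx). intros [t [Ht [Hxt Hdt]]].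
  assert (Cmod (g n x - f x)%C <= eps).
  { apply (Hdelta t Ht); auto. apply Rle_trans with (/ d). apply Rinv_le_contravar. apply cond_pos. auto.
    apply le_INR in Hn. rewrite S_INR in Hn. lra. }
  lra.
Qed.

Lemma Clim_CInt (g : nat -> R -> C) (f : R -> C) (a b : R) : a <= b ->
  (forall n t, a <= t <= b -> Ccont (g n) t) ->
  (forall t, a <= t <= b -> Ccont f t) -> (forall t, a <= t <= b -> cconv g f t) ->
  Clim eventually (fun n => CInt (g n) a b) (CInt f a b).
Proof.
  intros Hab Hgc Hfc Hg. apply Clim_eps. apply eventually_filter. intros eps He.
  set (e := eps / (2 * (b - a + 1))). assert (He' : 0 < e) by (apply Rdiv_lt_0_compat; lra).
  assert (E : e * (2 * (b - a + 1)) = eps) by (unfold e; field; lra).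
  generalize (cconv_unif g f a b e Hab He' Hfc Hg). apply filter_imp. intros n Hn.
  assert (Hmm : forall x, Rmin a b <= x <= Rmax a b -> a <= x <= b) by (intros x; rewrite Rmin_left, Rmax_right; auto).
  assert (H1 := CRInt_minus _ _ _ _ _ _ (CInt_correct (g n) a b (fun x Hx => Hgc n x (Hmm x Hx)))
    (CInt_correct f a b (fun x Hx => Hfc x (Hmm x Hx)))).
  assert (H2 := CRInt_bound _ (fun _ => 1) (fun t => t) e a b _ ltac:(lra)
    (fun u _ => conj (is_derive_id (K := R_AbsRing) u) (continuous_const 1 u))
    (fun u Hu => eq_ind_r (fun r => _ <= r) (Hn u (Hmm u Hu)) (Rmult_1_r e)) H1).
  rewrite Rabs_pos_eq in H2 by lra. nra.
Qed.

(** The rate of [rGamma_unif], uniform on a disc around [p + q z], combined with the continuity of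
    the limit. *)
Lemma cconv_rGamma (p q : C) (z : C) :
  Clim (filter_prod eventually (@locally C_UniformSpace z)) (fun nq => rGamma_seq (fst nq) (p + q * snd nq)) (rGamma (p + q * z)).
Proof.
  set (w := (p + q * z)%C).
  assert (FF : Filter (filter_prod eventually (@locally C_UniformSpace z))) by (apply filter_prod_filter; [apply eventually_filter | apply locally_filter]).
  assert (Hw : Clim (filter_prod eventually (@locally C_UniformSpace z)) (fun nq : nat * C => p + q * snd nq)%C w).
  { apply Clim_plus; auto. apply Clim_const; auto. apply Clim_mult; auto. apply Clim_const; auto. apply filterlim_snd. }
  assert (H1 : Clim (filter_prod eventually (@locally C_UniformSpace z)) (fun nq : nat * C => rGamma (p + q * snd nq)) (rGamma w)).
  { apply (Clim_comp _ (fun nq : nat * C => p + q * snd nq)%C rGamma w); auto. apply continuous_rGamma. }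
  set (M := Cmod w + 1).
  assert (H2 : Clim (filter_prod eventually (@locally C_UniformSpace z)) (fun nq : nat * C => rGamma_seq (fst nq) (p + q * snd nq) - rGamma (p + q * snd nq))%C (RtoC 0)).
  { apply Clim_squeeze with (fun nq : nat * C => rGamma_rate_const M / INR (fst nq)); auto.
    - assert (Hn : filter_prod eventually (@locally C_UniformSpace z) (fun nq : nat * C => (1 <= fst nq)%nat)).
      { apply Filter_prod with (fun n => (1 <= n)%nat) (fun _ => True). exists 1%nat; auto. apply filter_true. auto. }
      generalize (filter_and _ _ Hn (proj1 (Clim_eps _ _ _) Hw 1 Rlt_0_1)). apply filter_imp. intros [n s] [Hn1 Hs]. simpl in *.
      replace (rGamma_seq n (p + q * s) - rGamma (p + q * s) - 0)%C with (rGamma_seq n (p + q * s) - rGamma (p + q * s))%C by ring.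
      apply rGamma_unif; auto. unfold M. replace (p + q * s)%C with (w + (p + q * s - w))%C by ring.
      eapply Rle_trans. apply Cmod_triangle. lra.
    - apply (filterlim_comp _ _ _ fst (fun n => rGamma_rate_const M / INR n) _ eventually). apply filterlim_fst. apply filterlim_INR_inv. }
  replace (rGamma w) with (0 + rGamma w)%C by ring.
  apply filterlim_ext with (2 := Clim_plus _ _ _ _ _ H2 H1). intros x. ring.
Qed.

(** * Rectangles for the Mellin-Barnes integrand *)

Section MellinBarnes.
Variables (roots : list C) (B alpha w c : R).
Hypothesis Hc : forall r, In r roots -> c <= - Re r.

(* The integrand of [H^{m,0}_{1,m}], with [B] in place of the parameter [1] of the lower Gamma factor. *)
Definition MB (s : C) : C :=
  (Cprod (map (fun r => / rGamma (- r + - (1) * s)) roots) * (rGamma (RtoC B + - RtoC alpha * s) * cpw w s))%C.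

(** The integrand with Gauss' approximations inserted. Left of [c] the arguments of the inverted
    factors have positive real part, so nothing is divided by zero and [hol] follows from the
    elementary rules. *)
Definition MB_seq (n : nat) (s : C) : C :=
  (Cprod (map (fun r => / rGamma_seq n (- r + - (1) * s)) roots) * (rGamma_seq n (RtoC B + - RtoC alpha * s) * cpw w s))%C.

Lemma root_Re_pos (r s : C) : In r roots -> Re s < c -> 0 < Re (- r + - (1) * s)%C.
Proof. intros Hr Hs. assert (H := Hc r Hr). destruct r, s. simpl in *. lra. Qed.

Lemma rGamma_seq_neq_0 (n : nat) (z : C) : 0 < Re z -> rGamma_seq n z <> 0.
Proof.
  intros Hz. unfold rGamma_seq. apply Cmult_neq_0. apply Cmult_neq_0.
  - intros E. apply (RtoC_INR_fact_neq_0 n). rewrite <- (Cinv_inv (RtoC _)), E. apply Cinv_0.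
  - apply cpw_neq_0.
  - intros E. apply rprod_zero_iff in E. destruct E as [k [_ E]]. apply (Re_pos_not_pole z Hz). exists k; auto.
Qed.

Lemma hol_Cprod (D : C -> Prop) (l : list C) (f : C -> C -> C) :
  (forall r, In r l -> hol D (f r) /\ forall s, D s -> continuous (f r) s) ->
  hol D (fun s => Cprod (map (fun r => f r s) l)) /\ forall s, D s -> continuous (fun s => Cprod (map (fun r => f r s) l)) s.
Proof.
  induction l as [|r l IH]; intros H.
  - split. apply (hol_const D (RtoC 1)). intros s _. apply (continuous_const (RtoC 1 : C_UniformSpace)).
  - destruct IH as [IH1 IH2]. intros; apply H; right; auto.
    destruct (H r (or_introl eq_refl)) as [H1 H2].
    split.
    + apply (hol_mult D (f r) (fun s => Cprod (map (fun r => f r s) l))); auto.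
    + intros s Hs. apply (continuous_Cmult (f r) (fun s => Cprod (map (fun r => f r s) l))); auto.
Qed.

Lemma hol_MB_seq (n : nat) : hol (fun s => Re s < c) (MB_seq n) /\ forall s, Re s < c -> continuous (MB_seq n) s.
Proof.
  destruct (hol_Cprod (fun s => Re s < c) roots (fun r s => / rGamma_seq n (- r + - (1) * s))%C) as [H1 H2].
  { intros r Hr. split.
    - apply hol_inv. intros; apply continuous_rGamma_seq_affine. intros s Hs. apply rGamma_seq_neq_0, root_Re_pos; auto. apply hol_rGamma_seq.
    - intros s Hs. apply continuous_Cinv. apply rGamma_seq_neq_0, root_Re_pos; auto. apply continuous_rGamma_seq_affine. }
  assert (H3 : hol (fun s => Re s < c) (cpw w)).
  { apply (hol_ext _ (fun s => Cexp (0 + RtoC (ln w) * s))). intros; unfold cpw; f_equal; ring. apply hol_Cexp. }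
  assert (H4 : forall s, continuous (fun s => rGamma_seq n (RtoC B + - RtoC alpha * s) * cpw w s)%C s).
  { intros s. apply (continuous_Cmult (fun s => rGamma_seq n (RtoC B + - RtoC alpha * s)) (cpw w)).
    apply continuous_rGamma_seq_affine. apply continuous_cpw. }
  split.
  - unfold MB_seq. apply hol_mult; auto.
    apply hol_mult; auto. intros; apply continuous_rGamma_seq_affine. intros; apply continuous_cpw. apply hol_rGamma_seq.
  - intros s Hs. unfold MB_seq. apply (continuous_Cmult _ _ s (H2 s Hs) (H4 s)).
Qed.

Lemma continuous_rGamma_affine (p q s : C) : continuous (fun s => rGamma (p + q * s)) s.
Proof. apply (continuous_comp (fun s => p + q * s)%C rGamma). apply continuous_affine. apply continuous_rGamma. Qed.

Lemma continuous_MB (s : C) : Re s < c -> continuous MB s.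
Proof.
  intros Hs. unfold MB.
  apply (continuous_Cmult (fun s => Cprod (map (fun r => / rGamma (- r + - (1) * s))%C roots)) (fun s => rGamma (RtoC B + - RtoC alpha * s) * cpw w s)%C).
  - assert (Hr : forall r, In r roots -> continuous (fun s => / rGamma (- r + - (1) * s))%C s).
    { intros r Hr. apply continuous_Cinv. apply rGamma_neq_0_Re, root_Re_pos; auto. apply continuous_rGamma_affine. }
    clear Hc. induction roots as [|r l IH].
    + apply continuous_const.
    + apply (continuous_Cmult (fun s => / rGamma (- r + - (1) * s))%C (fun s => Cprod (map (fun r => / rGamma (- r + - (1) * s))%C l))).
      apply Hr; left; auto. apply IH. intros; apply Hr; right; auto.
  - apply (continuous_Cmult (fun s => rGamma (RtoC B + - RtoC alpha * s)) (cpw w)). apply continuous_rGamma_affine. apply continuous_cpw.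
Qed.

Lemma cconv_MB (z : C) : Re z < c ->
  Clim (filter_prod eventually (@locally C_UniformSpace z)) (fun nq => MB_seq (fst nq) (snd nq)) (MB z).
Proof.
  intros Hz.
  assert (FF : Filter (filter_prod eventually (@locally C_UniformSpace z))) by (apply filter_prod_filter; [apply eventually_filter | apply locally_filter]).
  unfold MB_seq, MB. apply Clim_mult; auto.
  - assert (Hr : forall r, In r roots -> rGamma (- r + - (1) * z) <> 0) by (intros; apply rGamma_neq_0_Re, root_Re_pos; auto).
    clear Hc. induction roots as [|r l IH].
    + apply Clim_const; auto.
    + apply (Clim_mult _ (fun nq : nat * C => / rGamma_seq (fst nq) (- r + - (1) * snd nq))%C (fun nq : nat * C => Cprod (map (fun r => / rGamma_seq (fst nq) (- r + - (1) * snd nq))%C l))).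
      apply Clim_inv; auto. apply Hr; left; auto. apply cconv_rGamma. apply IH. intros; apply Hr; right; auto.
  - apply Clim_mult; auto. apply cconv_rGamma.
    apply (Clim_comp _ (fun nq : nat * C => snd nq) (cpw w) z). apply continuous_cpw. apply filterlim_snd.
Qed.

Lemma Ccont_vline_y (x y : R) : Ccont (fun y => vline x y) y.
Proof.
  unfold vline. apply Clim_plus. apply locally_filter. apply Clim_const, locally_filter.
  apply Clim_mult. apply locally_filter. apply Clim_const, locally_filter. apply Clim_RtoC. apply locally_filter. apply filterlim_id.
Qed.

Lemma Ccont_vline_x (x y : R) : Ccont (fun x => vline x y) x.
Proof.
  unfold vline. apply Clim_plus. apply locally_filter. apply Clim_RtoC. apply locally_filter. apply filterlim_id. apply Clim_const, locally_filter.
Qed.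

Lemma cconv_path (g : R -> C) (t : R) : Re (g t) < c -> Ccont g t ->
  cconv (fun n t => MB_seq n (g t)) (fun t => MB (g t)) t.
Proof.
  intros Ht Hg. apply (filterlim_comp _ _ _ (fun nq : nat * R => (fst nq, g (snd nq))) (fun nq : nat * C => MB_seq (fst nq) (snd nq)) _
    (filter_prod eventually (@locally C_UniformSpace (g t)))).
  2: apply cconv_MB; auto.
  apply filterlim_pair. apply filterlim_fst. apply (filterlim_comp _ _ _ snd g _ (locally t)). apply filterlim_snd. exact Hg.
Qed.

Lemma Clim_cconv_minus (g1 g2 : nat -> R -> C) (f1 f2 : R -> C) (t : R) :
  cconv g1 f1 t -> cconv g2 f2 t -> cconv (fun n t => g1 n t - g2 n t)%C (fun t => f1 t - f2 t)%C t.
Proof. intros. apply Clim_minus; auto. apply filter_prod_filter; [apply eventually_filter | apply locally_filter]. Qed.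

Lemma Ccont_minus (f g : R -> C) (t : R) : Ccont f t -> Ccont g t -> Ccont (fun t => f t - g t)%C t.
Proof. intros. apply Clim_minus; auto. apply locally_filter. Qed.

Lemma Ccont_cmult (k : C) (f : R -> C) (t : R) : Ccont f t -> Ccont (fun t => k * f t)%C t.
Proof. intros. apply Clim_mult; auto. apply locally_filter. apply Clim_const, locally_filter. Qed.

(** Cauchy's theorem holds for each [MB_seq n]; the sides are compact, so all four integrals pass to
    the limit. *)
Lemma rectangle_MB (x1 x2 S T : R) : x1 <= x2 -> x2 < c -> S <= T ->
  CInt (fun t => MB (vline x2 t) - MB (vline x1 t))%C S T =
  CInt (fun x => - Ci * (MB (vline x T) - MB (vline x S)))%C x1 x2.
Proof.
  intros H1 H2 HST.
  assert (HRe : forall x t, x <= x2 -> Re (vline x t) < c) by (intros; rewrite vline_eq; simpl; lra).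
  assert (Hy : forall x t, x <= x2 -> Ccont (fun t => MB (vline x t)) t).
  { intros x t Hx. apply (continuous_comp (fun t => vline x t) MB). apply Ccont_vline_y. apply continuous_MB; auto. }
  assert (Hx : forall x t, x <= x2 -> Ccont (fun x => MB (vline x t)) x).
  { intros x t Hx. apply (continuous_comp (fun x => vline x t) MB). apply Ccont_vline_x. apply continuous_MB; auto. }
  assert (Hyn : forall n x t, x <= x2 -> Ccont (fun t => MB_seq n (vline x t)) t).
  { intros n x t Hx'. apply (continuous_comp (fun t => vline x t) (MB_seq n)). apply Ccont_vline_y. apply hol_MB_seq; auto. }
  assert (Hxn : forall n x t, x <= x2 -> Ccont (fun x => MB_seq n (vline x t)) x).
  { intros n x t Hx'. apply (continuous_comp (fun x => vline x t) (MB_seq n)). apply Ccont_vline_x. apply hol_MB_seq; auto. }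
  apply (Clim_unique eventually (fun n => CInt (fun t => MB_seq n (vline x2 t) - MB_seq n (vline x1 t))%C S T)).
  - apply Clim_CInt; auto.
    + intros n t _. exact (Ccont_minus _ _ t (Hyn n x2 t (Rle_refl _)) (Hyn n x1 t H1)).
    + intros t _. exact (Ccont_minus _ _ t (Hy x2 t (Rle_refl _)) (Hy x1 t H1)).
    + intros t _. apply (Clim_cconv_minus (fun n t => MB_seq n (vline x2 t)) (fun n t => MB_seq n (vline x1 t)) (fun t => MB (vline x2 t)) (fun t => MB (vline x1 t))).
      apply (cconv_path (fun t => vline x2 t)). apply HRe; lra. apply Ccont_vline_y.
      apply (cconv_path (fun t => vline x1 t)). apply HRe; lra. apply Ccont_vline_y.
  - apply filterlim_ext with (fun n => CInt (fun x => - Ci * (MB_seq n (vline x T) - MB_seq n (vline x S)))%C x1 x2).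
    { intros n. symmetry. apply (rectangle_hol (MB_seq n) c); try lra. apply hol_MB_seq. }
    apply Clim_CInt; auto.
    + intros n t Ht. exact (Ccont_cmult _ _ t (Ccont_minus _ _ t (Hxn n t T (proj2 Ht)) (Hxn n t S (proj2 Ht)))).
    + intros t Ht. exact (Ccont_cmult _ _ t (Ccont_minus _ _ t (Hx t T (proj2 Ht)) (Hx t S (proj2 Ht)))).
    + intros t Ht. apply Clim_mult. apply filter_prod_filter; [apply eventually_filter | apply locally_filter].
      apply Clim_const. apply filter_prod_filter; [apply eventually_filter | apply locally_filter].
      apply (Clim_cconv_minus (fun n x => MB_seq n (vline x T)) (fun n x => MB_seq n (vline x S)) (fun x => MB (vline x T)) (fun x => MB (vline x S))).
      apply (cconv_path (fun x => vline x T)). apply HRe; lra. apply Ccont_vline_x.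
      apply (cconv_path (fun x => vline x S)). apply HRe; lra. apply Ccont_vline_x.
Qed.
End MellinBarnes.

(** * Superpositions along a vertical line *)

Notation Rline_m := (Rbar_locally m_infty).
Notation Rline_p := (Rbar_locally p_infty).

Lemma filterlim_atan_p : filterlim atan (Rbar_locally p_infty) (locally (PI / 2)).
Proof.
  apply filterlim_locally. intros eps. exists (/ eps). intros x Hx.
  assert (He := cond_pos eps). assert (Hi : 0 < / eps) by (apply Rinv_0_lt_compat; auto).
  destruct (atan_bounds x ltac:(lra)) as [[B1 _] B2].
  change (Rabs (atan x - PI / 2) < eps).
  assert (/ x < eps). { rewrite <- (Rinv_inv eps). apply Rinv_lt_contravar; auto. apply Rmult_lt_0_compat; lra. }
  assert (0 < / x) by (apply Rinv_0_lt_compat; lra).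
  apply Rabs_def1; lra.
Qed.

Lemma filterlim_atan_m : filterlim atan (Rbar_locally m_infty) (locally (- (PI / 2))).
Proof.
  apply filterlim_locally. intros eps. exists (- / eps). intros x Hx.
  assert (He := cond_pos eps). assert (Hi : 0 < / eps) by (apply Rinv_0_lt_compat; auto).
  destruct (atan_bounds (- x) ltac:(lra)) as [[B1 _] B2]. rewrite atan_opp in *.
  change (Rabs (atan x - - (PI / 2)) < eps).
  assert (/ (- x) < eps). { rewrite <- (Rinv_inv eps). apply Rinv_lt_contravar. apply Rmult_lt_0_compat; lra. lra. }
  assert (0 < / (- x)) by (apply Rinv_0_lt_compat; lra).
  apply Rabs_def1; lra.
Qed.

Lemma line_dominator : dominator Rline_m Rline_p (fun _ => True) (fun t => / (1 + t ^ 2)) atan (- (PI / 2)) (PI / 2).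
Proof.
  constructor; auto.
  - apply Rbar_locally_filter.
  - apply Rbar_locally_filter.
  - exists 0; auto.
  - exists 0; auto.
  - intros u _. apply filter_true.
  - intros u _. eapply is_derive_eq. apply is_derive_atan. unfold Rsqr. f_equal. ring.
  - intros u _. apply (ex_derive_continuous (V := R_NormedModule)). auto_derive. nra.
  - apply filterlim_atan_m.
  - apply filterlim_atan_p.
Qed.

Lemma sq1_pos (t : R) : 0 < 1 + t ^ 2.
Proof. assert (H := pow2_ge_0 t). lra. Qed.

(** Each factor [1 + t^2] is absorbed by half of the exponential, through two linear bounds of slope
    [d / 4]. *)
Lemma exp_rapid (k : nat) (d : R) : 0 < d -> exists M, 0 <= M /\ forall t, exp (- d * Rabs t) * (1 + t ^ 2) ^ k <= M.
Proof.
  revert d. induction k; intros d Hd.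
  - exists 1. split. lra. intros t. simpl. rewrite Rmult_1_r, <- exp_0. apply exp_le_compat. assert (H := Rabs_pos t). nra.
  - destruct (IHk (d / 2)) as [M [HM0 HM]]. lra.
    set (A := 1 + / (d / 4)). assert (HA : 0 < A). { assert (0 < / (d / 4)) by (apply Rinv_0_lt_compat; lra). unfold A; lra. }
    exists (A * A * M). split. repeat apply Rmult_le_pos; lra.
    intros t. assert (Ht := Rabs_pos t).
    assert (H1 := linear_le_exp 1 (d / 4) (Rabs t) Rle_0_1 ltac:(lra) Ht). fold A in H1.
    assert (H2 : 1 + t ^ 2 <= A * A * exp (d / 2 * Rabs t)).
    { rewrite <- (pow2_abs t). replace (d / 2 * Rabs t) with (d / 4 * Rabs t + d / 4 * Rabs t) by field. rewrite exp_plus.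
      replace (A * A * (exp (d / 4 * Rabs t) * exp (d / 4 * Rabs t))) with ((A * exp (d / 4 * Rabs t)) * (A * exp (d / 4 * Rabs t))) by ring.
      assert ((1 + Rabs t) * (1 + Rabs t) <= (A * exp (d / 4 * Rabs t)) * (A * exp (d / 4 * Rabs t))) by (apply Rmult_le_compat; lra).
      replace ((1 + Rabs t) * (1 + Rabs t)) with (1 + Rabs t ^ 2 + 2 * Rabs t) in H by ring. lra. }
    replace (- d * Rabs t) with (- (d / 2 * Rabs t) + - (d / 2) * Rabs t) by field. rewrite exp_plus, exp_Ropp.
    change ((1 + t ^ 2) ^ S k) with ((1 + t ^ 2) * (1 + t ^ 2) ^ k).
    assert (P := exp_pos (d / 2 * Rabs t)).
    assert (H3 : / exp (d / 2 * Rabs t) * (1 + t ^ 2) <= A * A).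
    { apply Rmult_le_reg_l with (exp (d / 2 * Rabs t)); auto. rewrite <- Rmult_assoc, Rinv_r by lra. lra. }
    assert (Hs := sq1_pos t).
    replace (/ exp (d / 2 * Rabs t) * exp (- (d / 2) * Rabs t) * ((1 + t ^ 2) * (1 + t ^ 2) ^ k)) with
      ((/ exp (d / 2 * Rabs t) * (1 + t ^ 2)) * (exp (- (d / 2) * Rabs t) * (1 + t ^ 2) ^ k)) by ring.
    apply Rmult_le_compat; auto.
    + apply Rmult_le_pos; [left; apply Rinv_0_lt_compat; auto | apply Rlt_le; auto].
    + apply Rmult_le_pos. left; apply exp_pos. apply pow_le; lra.
Qed.

(** Decay faster than every power, rather than exponential at some rate: this is stable under
    multiplication by polynomials in the exponent with no rate to track. *)
Definition rapid (F : R -> C) : Prop :=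
  (forall t, Ccont F t) /\ forall k : nat, exists M, 0 <= M /\ forall t, Cmod (F t) * (1 + t ^ 2) ^ k <= M.

Lemma rapid_bound (F : R -> C) : rapid F -> exists M, 0 <= M /\ forall t, Cmod (F t) <= M * / (1 + t ^ 2).
Proof.
  intros [_ H]. destruct (H 1%nat) as [M [HM0 HM]]. exists M. split; auto. intros t.
  assert (Hs := sq1_pos t). specialize (HM t). rewrite pow_1 in HM.
  apply Rmult_le_reg_r with (1 + t ^ 2); auto. rewrite Rmult_assoc, Rinv_l by lra. lra.
Qed.

Lemma exp_bound_rapid (F : R -> C) (K d : R) : 0 < d -> (forall t, Ccont F t) ->
  (forall t, Cmod (F t) <= K * exp (- d * Rabs t)) -> rapid F.
Proof.
  intros Hd Hc HF. split; auto. intros k. destruct (exp_rapid k d Hd) as [M [HM0 HM]].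
  assert (HK : 0 <= K).
  { assert (H := HF 0). rewrite Rabs_R0, Rmult_0_r, exp_0 in H. assert (H1 := Cmod_ge_0 (F 0)). lra. }
  exists (K * M). split. apply Rmult_le_pos; auto. intros t.
  assert (Hs := sq1_pos t).
  apply Rle_trans with (K * exp (- d * Rabs t) * (1 + t ^ 2) ^ k).
  apply Rmult_le_compat_r; auto. apply pow_le; lra. rewrite Rmult_assoc. apply Rmult_le_compat_l; auto.
Qed.

(** Purely imaginary, so that [u^(a + line_eps b t)] has modulus [u^a] for every [t]; the abscissa
    of the contour is carried by [a]. *)
Definition line_eps (b t : R) : C := (RtoC (b * t) * Ci)%C.

Lemma Re_line_exponent (a b t : R) : Re (RtoC a + line_eps b t)%C = a.
Proof. unfold line_eps. simpl. ring. Qed.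

Lemma line_eps_pos (b t : R) : 0 <= Re (line_eps b t).
Proof. unfold line_eps. simpl. right; ring. Qed.

Lemma Ccont_line_eps (b t : R) : Ccont (line_eps b) t.
Proof.
  unfold line_eps. apply Clim_mult. apply locally_filter. 2: apply Clim_const, locally_filter.
  apply Clim_RtoC. apply locally_filter. apply (continuous_mult (K := R_AbsRing) (fun _ => b) (fun t => t)).
  apply continuous_const. apply continuous_id.
Qed.

Lemma Cmod_line_term (F : C) (a b u t : R) : Cmod (F * cpw u (RtoC a + line_eps b t))%C = Cmod F * Rpower u a.
Proof. rewrite Cmod_mult, Cmod_cpw, Re_line_exponent. reflexivity. Qed.

Lemma Ccont_line_term (F : R -> C) (a b u t : R) : Ccont F t -> Ccont (fun t => F t * cpw u (RtoC a + line_eps b t))%C t.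
Proof.
  intros HF. apply Clim_mult; auto. apply locally_filter.
  apply (continuous_comp (fun t => RtoC a + line_eps b t)%C (cpw u)). 2: apply continuous_cpw.
  apply Clim_plus. apply locally_filter. apply Clim_const, locally_filter. apply Ccont_line_eps.
Qed.

Definition line_sum (f : R -> C) (l : C) : Prop := CRIntg f Rline_m Rline_p l.

Lemma line_uniq (f : R -> C) (l l' : C) : line_sum f l -> line_sum f l' -> l = l'.
Proof. exact (CRIntg_unique _ _ _ _ _ _ _ line_dominator f l l'). Qed.

Lemma line_cmult (f : R -> C) (c l : C) : line_sum f l -> line_sum (fun x => c * f x)%C (c * l)%C.
Proof. exact (CRIntg_cmult _ _ _ _ _ _ _ f c l line_dominator). Qed.

Lemma line_minus (f g : R -> C) (l m : C) : line_sum f l -> line_sum g m -> line_sum (fun x => f x - g x)%C (l - m)%C.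
Proof. exact (CRIntg_minus Rline_m Rline_p f g l m). Qed.

Lemma rapid_mult (b : R) (F : R -> C) (c : C) : rapid F -> rapid (fun x => F x * (c + line_eps b x))%C.
Proof.
  intros [H1 H2]. split.
  - intros t. apply Clim_mult. apply locally_filter. apply H1. apply Clim_plus. apply locally_filter. apply Clim_const, locally_filter. apply Ccont_line_eps.
  - intros k. destruct (H2 (S k)) as [M [HM0 HM]]. set (A := Cmod c + Rabs b).
    assert (HA : 0 <= A) by (assert (H3 := Cmod_ge_0 c); assert (H4 := Rabs_pos b); unfold A; lra).
    exists (A * M). split. apply Rmult_le_pos; auto. intros t. assert (Hs := sq1_pos t).
    assert (E : Cmod (c + line_eps b t)%C <= A * (1 + t ^ 2)).
    { eapply Rle_trans. apply Cmod_triangle. unfold line_eps. rewrite Cmod_mult, Cmod_Ci, Cmod_R, Rabs_mult, Rmult_1_r.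
      assert (Rabs t <= 1 + t ^ 2) by (rewrite <- (pow2_abs t); assert (H3 := Rabs_pos t); nra).
      assert (H3 := Cmod_ge_0 c). assert (H4 := Rabs_pos b). assert (0 <= t ^ 2) by apply pow2_ge_0. unfold A. nra. }
    rewrite Cmod_mult. specialize (HM t). change ((1 + t ^ 2) ^ S k) with ((1 + t ^ 2) * (1 + t ^ 2) ^ k) in HM.
    assert (HF := Cmod_ge_0 (F t)). assert (0 <= (1 + t ^ 2) ^ k) by (apply pow_le; lra).
    apply Rle_trans with (Cmod (F t) * (A * (1 + t ^ 2)) * (1 + t ^ 2) ^ k).
    apply Rmult_le_compat_r; auto. apply Rmult_le_compat_l; auto.
    replace (Cmod (F t) * (A * (1 + t ^ 2)) * (1 + t ^ 2) ^ k) with (A * (Cmod (F t) * ((1 + t ^ 2) * (1 + t ^ 2) ^ k))) by ring.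
    apply Rmult_le_compat_l; auto.
Qed.

Lemma rapid_cmult (F : R -> C) (c : C) : rapid F -> rapid (fun x => F x * c)%C.
Proof.
  intros [H1 H2]. split.
  - intros t. apply Clim_mult. apply locally_filter. apply H1. apply Clim_const, locally_filter.
  - intros k. destruct (H2 k) as [M [HM0 HM]]. exists (Cmod c * M). split. apply Rmult_le_pos; auto. apply Cmod_ge_0.
    intros t. rewrite Cmod_mult. replace (Cmod (F t) * Cmod c * (1 + t ^ 2) ^ k) with (Cmod c * (Cmod (F t) * (1 + t ^ 2) ^ k)) by ring.
    apply Rmult_le_compat_l; auto. apply Cmod_ge_0.
Qed.

Lemma line_term_le (F : R -> C) (a b M u t : R) : (forall t, Cmod (F t) <= M * / (1 + t ^ 2)) ->
  Cmod (F t * cpw u (RtoC a + line_eps b t))%C <= M * Rpower u a * / (1 + t ^ 2).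
Proof.
  intros HM. rewrite Cmod_line_term. replace (M * Rpower u a * / (1 + t ^ 2)) with (M * / (1 + t ^ 2) * Rpower u a) by ring.
  apply Rmult_le_compat_r; auto. left; apply Rpower_pos.
Qed.

Lemma line_ex (b : R) (F : R -> C) (a u : R) : rapid F -> exists l, line_sum (fun x => F x * cpw u (RtoC a + line_eps b x))%C l.
Proof.
  intros HF. destruct (rapid_bound F HF) as [M [HM0 HM]].
  apply (CRIntg_dominated _ _ _ _ _ _ _ line_dominator _ (M * Rpower u a)).
  - apply Rmult_le_pos; auto. left; apply Rpower_pos.
  - intros t _. apply Ccont_line_term, HF.
  - intros t _. apply line_term_le; auto.
Qed.

Lemma line_bound (b : R) (F : R -> C) (a Z : R) : rapid F -> 0 < Z -> exists M, 0 <= M /\ forall u l, 0 < u <= Z ->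
  line_sum (fun x => F x * cpw u (RtoC a + line_eps b x))%C l -> Cmod l <= M * Rpower u a.
Proof.
  intros HF _. destruct (rapid_bound F HF) as [M [HM0 HM]].
  exists (M * PI). assert (HPI := PI_RGT_0). split. apply Rmult_le_pos; lra.
  intros u l _ Hl.
  assert (H := CRIntg_bound _ _ _ _ _ _ _ line_dominator _ (M * Rpower u a)
    (Rmult_le_pos _ _ HM0 (Rlt_le _ _ (Rpower_pos u a))) (fun t _ => Ccont_line_term F a b u t (proj1 HF t))
    (fun t _ => line_term_le F a b M u t HM) l Hl).
  replace (PI / 2 - - (PI / 2)) with PI in H by field. rewrite Rabs_pos_eq in H by lra. lra.
Qed.

(** The integrand is dominated by the product of [M / (1 + t^2)] and [q u], which is the form that
    [fubini_dom] takes. *)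
Lemma line_fubini (b : R) F a Z Ua Ub E q Q ua ub (kappa H : R -> C) (g : R -> C) (I : C) :
  rapid F -> 0 < Z -> dominator Ua Ub E q Q ua ub ->
  (forall u, E u -> 0 < u <= Z) ->
  (forall u, E u -> Ccont kappa u) ->
  (forall u, E u -> Cmod (kappa u) * Rpower u a <= q u) ->
  (forall u, E u -> line_sum (fun x => F x * cpw u (RtoC a + line_eps b x))%C (H u)) ->
  (forall x, CRIntg (fun u => kappa u * cpw u (RtoC a + line_eps b x))%C Ua Ub (g x)) ->
  line_sum (fun x => F x * g x)%C I ->
  CRIntg (fun u => kappa u * H u)%C Ua Ub I.
Proof.
  intros HF HZ HE Hpos Hk Hkq HH Hg HI.
  destruct (rapid_bound F HF) as [M [HM0 HM]].
  apply (fubini_dom _ _ _ _ _ _ _ _ _ _ _ _ _ _ (dominator_scal _ _ _ _ _ _ _ M line_dominator) HE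
    (fun t u => F t * (kappa u * cpw u (RtoC a + line_eps b t)))%C _ (fun x => F x * g x)%C); auto.
  - intros t u _ Hu. apply Clim_mult. apply locally_filter.
    + apply (continuous_comp (fun p : R * R => fst p) F). apply continuous_fst. apply HF.
    + apply Clim_mult. apply locally_filter.
      * apply (continuous_comp (fun p : R * R => snd p) kappa). apply continuous_snd. apply Hk; auto.
      * apply (continuous_comp (U := prod_UniformSpace R_UniformSpace R_UniformSpace)
          (V := prod_UniformSpace C_UniformSpace R_UniformSpace) (W := C_UniformSpace)
          (fun p : R * R => (RtoC a + line_eps b (fst p), snd p)%C) (fun p : C * R => cpw (snd p) (fst p)) (t, u)).
        2: apply continuous_cpw2; apply Hpos; auto.
        intros P [d Hd].
        assert (H1 : continuous (T := prod_UniformSpace R_UniformSpace R_UniformSpace) (U := C_UniformSpace) (fun p : R * R => RtoC a + line_eps b (fst p))%C (t, u)).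
        { apply Clim_plus. apply locally_filter. apply Clim_const, locally_filter.
          apply (continuous_comp (fun p : R * R => fst p) (line_eps b)). apply continuous_fst. apply Ccont_line_eps. }
        assert (H2 : continuous (T := prod_UniformSpace R_UniformSpace R_UniformSpace) (U := R_UniformSpace) (fun p : R * R => snd p) (t, u)) by apply continuous_snd.
        assert (L1 := proj1 (filterlim_locally (U := C_UniformSpace) _ _) H1 d).
        assert (L2 := proj1 (filterlim_locally (U := R_UniformSpace) _ _) H2 d).
        unfold filtermap. generalize (filter_and _ _ L1 L2). apply filter_imp. intros p [P1 P2]. apply Hd. split; assumption.
  - intros t u _ Hu. rewrite !Cmod_mult, Cmod_cpw, Re_line_exponent.
    apply Rmult_le_compat. apply Cmod_ge_0. apply Rmult_le_pos. apply Cmod_ge_0. left; apply Rpower_pos. auto. auto.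
  - intros u Hu. apply Rle_trans with (2 := Hkq u Hu). apply Rmult_le_pos. apply Cmod_ge_0. left; apply Rpower_pos.
  - intros t _. apply Rmult_le_pos; auto. left. apply Rinv_0_lt_compat, sq1_pos.
  - intros u Hu. assert (H1 := line_cmult _ (kappa u) _ (HH u Hu)).
    apply (CRIntg_ext_dom _ _ _ _ _ _ _ _ _ _ line_dominator) with (2 := H1). intros t _. simpl. ring.
  - intros t _. apply (CRIntg_cmult _ _ _ _ _ _ _ _ _ _ HE). apply Hg.
Qed.

Definition line_superposition (b : R) : superposition R := {|
  sp_sum := line_sum;
  sp_eps := line_eps b;
  sp_adm := rapid;
  sp_eps_pos := line_eps_pos b;
  sp_uniq := line_uniq;
  sp_cmult := line_cmult;
  sp_minus := line_minus;
  sp_adm_mult := rapid_mult b;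
  sp_adm_cmult := rapid_cmult;
  sp_ex := fun F a u HF _ => line_ex b F a u HF;
  sp_bound := line_bound b;
  sp_fubini := line_fubini b |}.

(** * The H-function solution *)

Lemma roots_margin (roots : list C) (x1 x2 : R) : (forall r, In r roots -> x1 < - Re r /\ x2 < - Re r) ->
  exists c, x1 < c /\ x2 < c /\ forall r, In r roots -> c <= - Re r.
Proof.
  induction roots as [|r l IH]; intros H.
  - exists (Rmax x1 x2 + 1). assert (H1 := Rmax_l x1 x2). assert (H2 := Rmax_r x1 x2). repeat split; try lra. intros r [].
  - destruct IH as [c [H1 [H2 H3]]]. intros; apply H; right; auto.
    destruct (H r (or_introl eq_refl)) as [H4 H5].
    exists (Rmin c (- Re r)). repeat split; try (apply Rmin_glb_lt; auto).
    intros r' [<- | Hr']. apply Rmin_r. eapply Rle_trans. apply Rmin_l. auto.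
Qed.

Lemma Gamma_prod_bound (roots : list C) (c x1 x2 e : R) : (forall r, In r roots -> c <= - Re r) ->
  x1 <= x2 -> x2 < c -> 0 < e < PI / 2 ->
  exists K, 0 <= K /\ forall x y, x1 <= x <= x2 ->
    Cmod (Cprod (map (fun r => / rGamma (- r + - (1) * vline x y))%C roots)) <= K * exp (- (INR (length roots) * (PI / 2 - e)) * Rabs y).
Proof.
  intros Hc Hx Hx2 He. induction roots as [|r l IH].
  - exists 1. split. lra. intros x y _. simpl. unfold Cprod; simpl. rewrite Cmod_1, Rmult_0_l, Ropp_0, Rmult_0_l, exp_0. lra.
  - destruct IH as [K [HK0 HK]]. intros; apply Hc; right; auto.
    assert (Hr := Hc r (or_introl eq_refl)).
    destruct (Gamma_strip_bound (- Re r - x2) (- Re r - x1) e) as [K1 [HK1 HK1']]; try lra.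
    (* The imaginary part of a root translates [y]; the decay loses only this constant factor. *)
    set (A := exp ((PI / 2 - e) * Rabs (Im r))).
    exists (K1 * A * K). split. repeat apply Rmult_le_pos; try lra. left; apply exp_pos.
    intros x y Hxx. simpl map. change (Cprod (?a :: ?b)) with (a * Cprod b)%C.
    change (Cprod ((/ rGamma (- r + - (1) * vline x y))%C :: map (fun r0 => (/ rGamma (- r0 + - (1) * vline x y))%C) l))
      with (/ rGamma (- r + - (1) * vline x y) * Cprod (map (fun r0 => / rGamma (- r0 + - (1) * vline x y)) l))%C.
    rewrite Cmod_mult.
    replace (- r + - (1) * vline x y)%C with ((- Re r - x, - Im r - y) : C) by (rewrite vline_eq; destruct r; apply Ceq; simpl; ring).
    assert (E1 := HK1' (- Re r - x) (- Im r - y) ltac:(lra)). assert (E2 := HK x y Hxx).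
    assert (E3 : exp (- (PI / 2 - e) * Rabs (- Im r - y)) <= A * exp (- (PI / 2 - e) * Rabs y)).
    { unfold A. rewrite <- exp_plus. apply exp_le_compat.
      assert (Rabs y <= Rabs (- Im r - y) + Rabs (Im r)).
      { replace y with (- ((- Im r - y) + Im r)) at 1 by ring. rewrite Rabs_Ropp. apply Rabs_triang. }
      nra. }
    change (length (r :: l)) with (S (length l)). rewrite S_INR.
    replace (K1 * A * K * exp (- ((INR (length l) + 1) * (PI / 2 - e)) * Rabs y)) with
      ((K1 * (A * exp (- (PI / 2 - e) * Rabs y))) * (K * exp (- (INR (length l) * (PI / 2 - e)) * Rabs y))).
    + apply Rmult_le_compat; auto using Cmod_ge_0.
      apply Rle_trans with (1 := E1). apply Rmult_le_compat_l; lra.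
    + transitivity (K1 * A * K * (exp (- (PI / 2 - e) * Rabs y) * exp (- (INR (length l) * (PI / 2 - e)) * Rabs y))). ring.
      rewrite <- exp_plus. do 2 f_equal. ring.
Qed.

Lemma MB_bound (roots : list C) (B alpha w c x1 x2 : R) : (forall r, In r roots -> c <= - Re r) ->
  x1 <= x2 -> x2 < c -> 0 < alpha < INR (length roots) ->
  exists K d, 0 <= K /\ 0 < d /\ forall x y, x1 <= x <= x2 -> Cmod (MB roots B alpha w (vline x y)) <= K * exp (- d * Rabs y).
Proof.
  intros Hc Hx Hx2 Hal. set (L := INR (length roots)) in *. assert (HPI := PI_RGT_0).
  (* The factors decay at total rate [L (PI/2 - e) - alpha (PI/2 + e)]; with this [e], half of the
     margin [(L - alpha) PI/2] is left. *)
  set (e := PI / 4 * ((L - alpha) / (L + alpha))).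
  assert (Hq : 0 < (L - alpha) / (L + alpha) < 1).
  { split. apply Rdiv_lt_0_compat; lra. apply Rmult_lt_reg_r with (L + alpha). lra. unfold Rdiv. rewrite Rmult_assoc, Rinv_l by lra. lra. }
  assert (He : 0 < e < PI / 2) by (unfold e; nra).
  destruct (Gamma_prod_bound roots c x1 x2 e Hc Hx Hx2 He) as [K1 [HK1 HK1']]. fold L in HK1'.
  destruct (rGamma_strip_bound (B - alpha * x2) (B - alpha * x1) e) as [K2 [HK2 HK2']]; try nra.
  set (K3 := Rpower w x1 + Rpower w x2).
  assert (HK3 : forall x, x1 <= x <= x2 -> Rpower w x <= K3).
  { intros x Hxx. unfold K3. assert (P1 := Rpower_pos w x1). assert (P2 := Rpower_pos w x2). unfold Rpower in *.
    destruct (Rle_lt_dec 0 (ln w)).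
    - assert (exp (x * ln w) <= exp (x2 * ln w)) by (apply exp_le_compat; nra). lra.
    - assert (exp (x * ln w) <= exp (x1 * ln w)) by (apply exp_le_compat; nra). lra. }
  assert (HK30 : 0 <= K3) by (unfold K3; assert (P1 := Rpower_pos w x1); assert (P2 := Rpower_pos w x2); lra).
  exists (K1 * (K2 * K3)), ((L - alpha) * PI / 4). split. repeat apply Rmult_le_pos; lra. split. nra.
  intros x y Hxx. unfold MB. rewrite !Cmod_mult, Cmod_cpw.
  assert (E1 := HK1' x y Hxx).
  replace (Re (vline x y)) with x by (rewrite vline_eq; reflexivity).
  replace (RtoC B + - RtoC alpha * vline x y)%C with ((B - alpha * x, - alpha * y) : C) by (rewrite vline_eq; apply Ceq; simpl; ring).
  assert (E2 := HK2' (B - alpha * x) (- alpha * y) ltac:(nra)).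
  rewrite Rabs_mult, Rabs_Ropp, (Rabs_pos_eq alpha) in E2 by lra.
  assert (E3 := HK3 x Hxx).
  replace (K1 * (K2 * K3) * exp (- ((L - alpha) * PI / 4) * Rabs y)) with
    ((K1 * exp (- (L * (PI / 2 - e)) * Rabs y)) * ((K2 * exp ((PI / 2 + e) * (alpha * Rabs y))) * K3)).
  - apply Rmult_le_compat; auto using Cmod_ge_0. apply Rmult_le_pos. apply Cmod_ge_0. left; apply Rpower_pos.
    apply Rmult_le_compat; auto using Cmod_ge_0. left; apply Rpower_pos.
  - transitivity (K1 * (K2 * K3) * (exp (- (L * (PI / 2 - e)) * Rabs y) * exp ((PI / 2 + e) * (alpha * Rabs y)))). ring.
    rewrite <- exp_plus. do 2 f_equal. unfold e. field. lra.
Qed.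

Lemma MB_rapid (roots : list C) (B alpha w x : R) : (forall r, In r roots -> x < - Re r) ->
  0 < alpha < INR (length roots) -> rapid (fun t => MB roots B alpha w (vline x t)).
Proof.
  intros Hx Hal. destruct (roots_margin roots x x) as [c [H1 [_ Hc]]]. intros; split; auto.
  destruct (MB_bound roots B alpha w c x x Hc (Rle_refl x) H1 Hal) as [K [d [_ [Hd HK]]]].
  apply exp_bound_rapid with K d; auto.
  - intros t. apply (continuous_comp (fun t => vline x t) (MB roots B alpha w)). apply Ccont_vline_y.
    apply (continuous_MB roots B alpha w c Hc). rewrite vline_eq; exact H1.
  - intros t. apply HK; lra.
Qed.

(** Left of all poles, the integrals over the two lines up to height [n] differ by the horizontal
    sides of a rectangle, which tend to 0 by the decay of the integrand uniform in the strip. *)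
Lemma MB_contour (roots : list C) (B alpha w x1 x2 : R) (l1 l2 : C) :
  (forall r, In r roots -> x1 < - Re r /\ x2 < - Re r) -> 0 < alpha < INR (length roots) ->
  line_sum (fun t => MB roots B alpha w (vline x1 t)) l1 ->
  line_sum (fun t => MB roots B alpha w (vline x2 t)) l2 -> l1 = l2.
Proof.
  assert (H : forall x1 x2 l1 l2, x1 <= x2 -> (forall r, In r roots -> x1 < - Re r /\ x2 < - Re r) -> 0 < alpha < INR (length roots) ->
    line_sum (fun t => MB roots B alpha w (vline x1 t)) l1 -> line_sum (fun t => MB roots B alpha w (vline x2 t)) l2 -> (l2 - l1)%C = RtoC 0).
  { clear x1 x2 l1 l2. intros x1 x2 l1 l2 Hx Hr Hal H1 H2.
    destruct (roots_margin roots x1 x2 Hr) as [c [Hc1 [Hc2 Hc]]].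
    set (f := MB roots B alpha w) in *.
    destruct (MB_bound roots B alpha w c x1 x2 Hc Hx Hc2 Hal) as [K [d [HK0 [Hd HK]]]]. fold f in HK.
    destruct (exp_rapid 1 d Hd) as [M [HM0 HM]].
    assert (Hb : forall x y, x1 <= x <= x2 -> Cmod (f (vline x y)) <= K * M * / (1 + y ^ 2)).
    { intros x y Hxx. apply Rle_trans with (1 := HK x y Hxx). rewrite Rmult_assoc. apply Rmult_le_compat_l; auto.
      assert (Hs := sq1_pos y). specialize (HM y). rewrite pow_1 in HM.
      apply Rmult_le_reg_r with (1 + y ^ 2); auto. rewrite (Rmult_assoc M), Rinv_l by lra. lra. }
    assert (HKM : 0 <= K * M) by (apply Rmult_le_pos; auto).
    assert (Hcy : forall x t, x <= x2 -> Ccont (fun t => f (vline x t)) t).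
    { intros x t Hxx. apply (continuous_comp (fun t => vline x t) f). apply Ccont_vline_y.
      apply (continuous_MB roots B alpha w c Hc). rewrite vline_eq; simpl; lra. }
    assert (Hcx : forall x t, x <= x2 -> Ccont (fun x => f (vline x t)) x).
    { intros x t Hxx. apply (continuous_comp (fun x => vline x t) f). apply Ccont_vline_x.
      apply (continuous_MB roots B alpha w c Hc). rewrite vline_eq; simpl; lra. }
    assert (HL := line_minus _ _ _ _ H2 H1).
    set (g := fun t => (f (vline x2 t) - f (vline x1 t))%C) in *.
    assert (Hg1 : forall t, Ccont g t) by (intros t; exact (Ccont_minus _ _ t (Hcy x2 t (Rle_refl _)) (Hcy x1 t Hx))).
    assert (Hg2 : forall t, Cmod (g t) <= 2 * (K * M) * / (1 + t ^ 2)).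
    { intros t. unfold g, Cminus. eapply Rle_trans. apply Cmod_triangle. rewrite Cmod_opp.
      assert (E1 := Hb x1 t ltac:(lra)). assert (E2 := Hb x2 t ltac:(lra)). lra. }
    apply (Clim_unique eventually (fun n => CInt g (- INR n) (INR n))).
    - apply Clim_squeeze with (fun n => 2 * (K * M) * (Rabs (atan (- INR n) - - (PI / 2)) + Rabs (atan (INR n) - PI / 2))).
      apply eventually_filter.
      + apply filter_forall. intros n.
        apply (CRIntg_tail _ _ _ _ _ _ _ line_dominator g (2 * (K * M)) ltac:(lra) (fun t _ => Hg1 t) (fun t _ => Hg2 t)
          (l2 - l1)%C (- INR n) (INR n) _ HL I I). apply CInt_correct. intros; apply Hg1.
      + replace (locally 0) with (locally (2 * (K * M) * (Rabs (- (PI / 2) - - (PI / 2)) + Rabs (PI / 2 - PI / 2)))).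
        2: { f_equal. unfold Rminus. rewrite !Rplus_opp_r, Rabs_R0. ring. }
        apply filterlim_scal_R. apply eventually_filter. apply filterlim_plus_R. apply eventually_filter.
        * apply (filterlim_comp _ _ _ (fun n => - INR n) (fun u => Rabs (atan u - - (PI / 2))) _ Rline_m).
          -- change (is_lim_seq (fun n => - INR n) (Rbar_opp p_infty)). apply -> is_lim_seq_opp. apply is_lim_seq_INR.
          -- apply (filterlim_comp _ _ _ atan (fun v => Rabs (v - - (PI / 2))) _ (locally (- (PI / 2)))). apply filterlim_atan_m.
             apply (continuous_comp (fun v => v - - (PI / 2)) Rabs). apply (continuous_minus (V := R_NormedModule)). apply continuous_id. apply continuous_const. apply (filterlim_Rabs (- (PI / 2) - - (PI / 2))).
        * apply (filterlim_comp _ _ _ (fun n => INR n) (fun u => Rabs (atan u - PI / 2)) _ Rline_p).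
          -- exact is_lim_seq_INR.
          -- apply (filterlim_comp _ _ _ atan (fun v => Rabs (v - PI / 2)) _ (locally (PI / 2))). apply filterlim_atan_p.
             apply (continuous_comp (fun v => v - PI / 2) Rabs). apply (continuous_minus (V := R_NormedModule)). apply continuous_id. apply continuous_const. apply (filterlim_Rabs (PI / 2 - PI / 2)).
    - apply Clim_squeeze with (fun n => 2 * (K * M) * (x2 - x1) / INR n). apply eventually_filter.
      2: apply filterlim_INR_inv.
      exists 1%nat. intros n Hn. assert (Hn0 : 1 <= INR n) by (apply (le_INR 1); auto).
      unfold g, f. rewrite (rectangle_MB roots B alpha w c Hc x1 x2 (- INR n) (INR n)) by lra. fold f.
      set (h := fun x => (- Ci * (f (vline x (INR n)) - f (vline x (- INR n))))%C).
      unfold Cminus at 1. rewrite Copp_0, Cplus_0_r.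
      assert (Hmm : forall x, Rmin x1 x2 <= x <= Rmax x1 x2 -> x1 <= x <= x2) by (intros x; rewrite Rmin_left, Rmax_right; auto).
      assert (HI : CRInt h x1 x2 (CInt h x1 x2)).
      { apply CInt_correct. intros x Hxx. apply Hmm in Hxx. exact (Ccont_cmult _ _ x (Ccont_minus _ _ x (Hcx x (INR n) (proj2 Hxx)) (Hcx x (- INR n) (proj2 Hxx)))). }
      assert (HB := CRInt_bound h (fun _ => 1) (fun t => t) (2 * (K * M) / INR n) x1 x2 (CInt h x1 x2)).
      cbv beta in HB. rewrite (Rabs_pos_eq (x2 - x1)) in HB by lra.
      replace (2 * (K * M) * (x2 - x1) / INR n) with (2 * (K * M) / INR n * (x2 - x1)) by (unfold Rdiv; ring).
      apply HB; auto.
      + apply Rdiv_le_0_compat; lra.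
      + intros u _. split. apply (is_derive_id (K := R_AbsRing)). apply continuous_const.
      + intros u Hu. apply Hmm in Hu. unfold h. rewrite Cmod_mult, Cmod_opp, Cmod_Ci, Rmult_1_l, Rmult_1_r.
        unfold Cminus. eapply Rle_trans. apply Cmod_triangle. rewrite Cmod_opp.
        assert (E1 := Hb u (INR n) Hu). assert (E2 := Hb u (- INR n) Hu). replace ((- INR n) ^ 2) with (INR n ^ 2) in E2 by ring.
        assert (E3 : / (1 + INR n ^ 2) <= / INR n) by (apply Rinv_le_contravar; nra).
        assert (E4 : K * M * / (1 + INR n ^ 2) <= K * M * / INR n) by (apply Rmult_le_compat_l; auto).
        unfold Rdiv. lra. }
  intros Hr Hal H1 H2. destruct (Rle_lt_dec x1 x2) as [Hx | Hx].
  - assert (E := H x1 x2 l1 l2 Hx Hr Hal H1 H2). replace l2 with (l2 - l1 + l1)%C by ring. rewrite E; ring.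
  - assert (E := H x2 x1 l2 l1 (Rlt_le _ _ Hx) (fun r Hr' => conj (proj2 (Hr r Hr')) (proj1 (Hr r Hr'))) Hal H2 H1).
    replace l1 with (l1 - l2 + l2)%C by ring. rewrite E; ring.
Qed.

Section Fox.
Variables (alpha : R) (roots : list C).
Let m := length roots.
Hypothesis Halpha : 0 < alpha < INR m.
Let upper : list (C * R) := [(RtoC 1, alpha)].
Let lower : list (C * R) := map (fun r => (- r, 1)%C) roots.

Lemma FoxH_integrand_MB (w : R) (s : C) : 0 < w -> FoxH_integrand m 0 upper lower (RtoC w) s = MB roots 1 alpha w s.
Proof.
  intros Hw. unfold FoxH_integrand, MB, upper, lower.
  replace m with (length (map (fun r : C => ((- r)%C, 1)) roots)) by apply length_map.
  rewrite firstn_all, skipn_all, map_map. simpl firstn. simpl skipn. rewrite Cpower_pos by auto.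
  replace (map (fun x : C => Gamma (fst ((- x)%C, 1) - snd ((- x)%C, 1) * s)) roots) with
    (map (fun r => / rGamma (- r + - (1) * s))%C roots).
  - unfold Cprod at 2 3 4. simpl. rewrite !Cmult_1_r.
    fold (rGamma (1 - RtoC alpha * s)). replace (1 - RtoC alpha * s)%C with (1 + - RtoC alpha * s)%C by ring. ring.
  - apply map_ext. intros r. rewrite Gamma_rGamma. simpl. do 2 f_equal. ring.
Qed.

Lemma FoxH_separates_iff (gamma : R) : FoxH_separates m 0 upper lower gamma <-> forall r, In r roots -> gamma < - Re r.
Proof.
  unfold FoxH_separates. replace (firstn m lower) with lower.
  2: { unfold lower. replace m with (length (map (fun r : C => ((- r)%C, 1)) roots)) by apply length_map. now rewrite firstn_all. }
  split.
  - intros [H _] r Hr. replace (- Re r) with (Re (- r)%C) by reflexivity.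
    apply (H ((- r)%C, 1)). unfold lower. apply (in_map (fun r => ((- r)%C, 1))). auto.
    exists O. simpl. ring.
  - intros H. split. 2: intros p s [].
    intros p s Hp [k Hk]. unfold lower in Hp. apply in_map_iff in Hp. destruct Hp as [r [<- Hr]]. simpl in Hk.
    assert (E := f_equal Re Hk). specialize (H r Hr). assert (Hk0 := pos_INR k). destruct r, s. simpl in *. lra.
Qed.

(** [is_FoxH] leaves the abscissa free; [FoxH], being defined by [iota], has this value because all
    separating lines give the same integral. *)
Lemma FoxH_value (w gamma : R) (l : C) : 0 < w -> (forall r, In r roots -> gamma < - Re r) ->
  line_sum (fun t => MB roots 1 alpha w (vline gamma t)) l ->
  is_FoxH m 0 upper lower (RtoC w) (l / (2 * RtoC PI))%C /\ FoxH m 0 upper lower (RtoC w) = (l / (2 * RtoC PI))%C.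
Proof.
  intros Hw Hg Hl.
  assert (HPI := PI_RGT_0). assert (HPI0 : RtoC PI <> 0) by (intros E; apply RtoC_inj in E; lra).
  assert (H2 : RtoC 2 <> 0) by (intros E; apply RtoC_inj in E; lra).
  assert (H1 : is_FoxH m 0 upper lower (RtoC w) (l / (2 * RtoC PI))%C).
  (* The contour integral includes [ds = i dt]; this [i] cancels the one in [2 pi i]. *)
  { exists gamma, (Ci * l)%C. split. apply FoxH_separates_iff; auto. split.
    - assert (H := line_cmult _ Ci _ Hl).
      apply (CRIntg_ext_dom _ _ _ _ _ _ _ _ _ _ line_dominator) with (2 := H). intros t _. simpl.
      rewrite FoxH_integrand_MB by auto. unfold vline. ring.
    - field. repeat split; auto. apply Ci_nz. }
  split; auto. apply (iota_unique (V := C_R_CompleteNormedModule)); auto.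
  intros y [g' [J [Hs [HJ Hy]]]]. rewrite FoxH_separates_iff in Hs.
  assert (HJ' : line_sum (fun t => MB roots 1 alpha w (vline g' t)) (- Ci * J)%C).
  { assert (H := line_cmult _ (- Ci)%C _ HJ).
    apply (CRIntg_ext_dom _ _ _ _ _ _ _ _ _ _ line_dominator) with (2 := H). intros t _. simpl.
    rewrite FoxH_integrand_MB by auto. fold (vline g' t).
    replace (- Ci * (MB roots 1 alpha w (vline g' t) * Ci))%C with (- (Ci * Ci) * MB roots 1 alpha w (vline g' t))%C by ring.
    replace (- (Ci * Ci))%C with (RtoC 1) by (apply Ceq; simpl; ring). ring. }
  rewrite (MB_contour roots 1 alpha w gamma g' l _ (fun r Hr => conj (Hg r Hr) (Hs r Hr)) Halpha Hl HJ').
  rewrite Hy. match goal with |- ?x = ?y => change (@eq C x y) end. transitivity ((- (Ci * Ci)) * J / (2 * RtoC PI * Ci) )%C.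
  replace (- (Ci * Ci))%C with (RtoC 1) by (apply Ceq; simpl; ring). unfold Cdiv. now rewrite Cmult_1_l.
  field. repeat split; auto. apply Ci_nz.
Qed.

Variables (am : R) (coefs : nat -> R).
Hypothesis Ham : 0 < am.
Let W (z : R) : R := Rpower z (- alpha) / am.

Lemma fox_w_pos (z : R) : 0 < W z.
Proof. apply Rdiv_lt_0_compat; auto. apply Rpower_pos. Qed.

Lemma cpw_fox_w (z : R) (s : C) : cpw (W z) s = (cpw (/ am) s * cpw z (- RtoC alpha * s))%C.
Proof.
  unfold cpw, W. rewrite <- Cexp_plus. f_equal. unfold Rdiv. rewrite ln_mult by (apply Rpower_pos || apply Rinv_0_lt_compat; auto).
  unfold Rpower. rewrite ln_exp, RtoC_plus, RtoC_mult, RtoC_opp. ring.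
Qed.

(** An abscissa left of every pole and negative, so that the exponent [- alpha s] of [z] has
    positive real part and the Riemann-Liouville integral converges at 0. *)
Definition fox_line : R := - fold_right (fun r x => Rabs (Re r) + x) 1 roots.

Lemma fox_line_spec : fox_line < 0 /\ forall r, In r roots -> fox_line < - Re r.
Proof.
  unfold fox_line. assert (H : 0 < fold_right (fun r x => Rabs (Re r) + x) 1 roots).
  { clear. induction roots; simpl. lra. assert (H := Rabs_pos (Re a)). lra. }
  split. lra. clear H. generalize roots. induction roots0 as [|r l IH]; intros r' Hr. destruct Hr.
  simpl. assert (HP : 0 < fold_right (fun r x => Rabs (Re r) + x) 1 l).
  { clear. induction l; simpl. lra. assert (H := Rabs_pos (Re a)). lra. }
  assert (H0 := Rle_abs (Re r)). assert (H1 := Rabs_pos (Re r)). destruct Hr as [<- | Hr]. lra. specialize (IH r' Hr). lra.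
Qed.

(** [x Gamma x = Gamma (x + 1)] with [x = - r - s]: the Euler factors replace each root [r] by
    [r - 1]. *)
Lemma Cprod_shift (l : list C) (s : C) : (forall r, In r l -> 0 < Re (- r + - (1) * s)%C) ->
  (Cprod (map (fun r => / rGamma (- r + - (1) * s)) l) * Cprod (map (fun r => - s - r) l))%C =
  Cprod (map (fun r => / rGamma (- r + - (1) * s)) (map (fun r => r - 1) l))%C.
Proof.
  induction l as [|r l IH]; intros H. unfold Cprod; simpl. ring.
  simpl map. unfold Cprod in *. simpl fold_right. rewrite <- IH by (intros; apply H; right; auto).
  assert (Hr := H r (or_introl eq_refl)).
  assert (H0 := rGamma_neq_0_Re _ Hr).
  assert (E := rGamma_rec (- r + - (1) * s)%C).
  assert (H1 : rGamma (- r + - (1) * s + 1) <> 0) by (intros E1; apply H0; rewrite E, E1; ring).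
  assert (H2 : (- r + - (1) * s)%C <> 0) by (intros E1; apply H0; rewrite E, E1; ring).
  replace (- (r - 1) + - (1) * s)%C with (- r + - (1) * s + 1)%C by ring.
  rewrite E. replace (- s - r)%C with (- r + - (1) * s)%C by ring.
  clear IH Hr H. set (x := (- r + - (1) * s)%C) in *. clearbody x. field; auto.
Qed.

Theorem fox_solution : coefs m = am ->
  (forall x, char_poly m alpha coefs x = (RtoC (coefs m) * Cprod (map (fun r => x - r) roots))%C) ->
  (forall z, 0 < z -> is_FoxH m 0 upper lower (RtoC (W z)) (FoxH m 0 upper lower (RtoC (W z)))) /\
  forall c1 : C, is_solution m alpha coefs (fun z => c1 * FoxH m 0 upper lower (RtoC (W z)))%C.
Proof.
  intros Hcm Hroots. destruct fox_line_spec as [Hg0 Hg]. set (gamma := fox_line) in *.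
  set (LS := line_superposition (- alpha)).
  (* At [s = gamma + i t] the power of [z] in the integrand has exponent
     [- alpha s = a - i alpha t]. *)
  set (a := - alpha * gamma).
  assert (Ha : -1 < a) by (unfold a; nra).
  assert (He : forall t, (RtoC a + sp_eps LS t)%C = (- RtoC alpha * vline gamma t)%C).
  { intros t. simpl. unfold line_eps, a, vline. rewrite !RtoC_mult, RtoC_opp. ring. }
  assert (Hval : forall w, exists l, line_sum (fun t => MB roots 1 alpha w (vline gamma t)) l).
  { intros w. apply (CRIntg_dominated _ _ _ _ _ _ _ line_dominator _ (proj1_sig (constructive_indefinite_description _ (rapid_bound _ (MB_rapid roots 1 alpha w gamma Hg Halpha))))).
    - destruct (constructive_indefinite_description _ _) as [M [H1 H2]]. exact H1.
    - intros t _. apply (MB_rapid roots 1 alpha w gamma Hg Halpha).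
    - intros t _. destruct (constructive_indefinite_description _ _) as [M [H1 H2]]. apply H2. }
  split.
  { intros z Hz. destruct (Hval (W z)) as [l Hl]. destruct (FoxH_value (W z) gamma l (fox_w_pos z) Hg Hl) as [H1 H2].
    rewrite H2. exact H1. }
  intros c1. assert (HPI := PI_RGT_0).
  set (k := (c1 / (2 * RtoC PI))%C).
  (* What remains of the integrand once the factor [rGamma] and the power of [z] are taken out. *)
  set (Dc := fun t => (Cprod (map (fun r => / rGamma (- r + - (1) * vline gamma t)) roots) * cpw (/ am) (vline gamma t) * k)%C).
  assert (HDc : forall B t, (Dc t * rGamma (RtoC B + (RtoC a + sp_eps LS t)))%C = (MB roots B alpha (/ am) (vline gamma t) * k)%C).
  { intros B t. rewrite He. unfold Dc, MB. ring. }
  assert (HMBz : forall B z t, 0 < z -> (MB roots B alpha (/ am) (vline gamma t) * k * cpw z (RtoC a + sp_eps LS t))%C = (k * MB roots B alpha (W z) (vline gamma t))%C).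
  { intros B z t Hz. rewrite He. unfold MB. rewrite cpw_fox_w. ring. }
  apply (sp_solution LS m alpha coefs roots Dc a).
  - apply Halpha.
  - reflexivity.
  - exact Hroots.
  - assert (Hal0 := proj1 Halpha). destruct (nfloor_ex alpha ltac:(lra)) as [N [HN1 HN2]].
    destruct (Req_dec (INR N) alpha) as [E | E].
    + exists N. destruct N; [simpl in E; lra|]. split. lia. lra.
    + exists (S N). split. lia. rewrite S_INR. lra.
  - exact Ha.
  - intros B. rewrite (functional_extensionality _ _ (HDc B)). apply rapid_cmult. apply MB_rapid; auto.
  (* Both sides become integrals of the same function, built on the roots [r - 1]: the right-hand
     side by [Cprod_shift] on the line [gamma], the left-hand side by the substitution [s + 1] on
     the line [gamma + 1]. The poles have moved right by one, so both lines are on their left. The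
     factor [am] comes from [am^(-s) = am * am^(-(s+1))]. *)
  - intros z Hz. rewrite Hcm. set (roots' := map (fun r => (r - 1)%C) roots).
    assert (Hlen' : length roots' = m) by apply length_map.
    assert (Hal' : 0 < alpha < INR (length roots')) by (rewrite Hlen'; exact Halpha).
    assert (Hr' : forall r, In r roots' -> gamma < - Re r /\ gamma + 1 < - Re r).
    { intros r Hr. apply in_map_iff in Hr. destruct Hr as [r0 [<- Hr0]]. specialize (Hg r0 Hr0). simpl. unfold Re in Hg. lra. }
    assert (Hex : forall x, (forall r, In r roots' -> x < - Re r) -> exists l, line_sum (fun t => MB roots' 1 alpha (W z) (vline x t)) l).
    { intros x Hx. assert (Hrap := MB_rapid roots' 1 alpha (W z) x Hx Hal'). destruct (rapid_bound _ Hrap) as [M [H1 H2]].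
      apply (CRIntg_dominated _ _ _ _ _ _ _ line_dominator _ M H1). intros t _; apply Hrap. intros t _; apply H2. }
    destruct (Hex gamma) as [l1 Hl1]. apply Hr'. destruct (Hex (gamma + 1)) as [l2 Hl2]. apply Hr'.
    assert (El : l1 = l2) by (apply (MB_contour roots' 1 alpha (W z) gamma (gamma + 1)); auto).
    assert (Ham0 : RtoC am <> 0) by (intros E; apply RtoC_inj in E; lra).
    rewrite (sp_val_eq LS _ _ _ (RtoC am * k * l2)%C), (sp_val_eq LS _ _ _ (k * l1)%C), El. ring.
    + apply (sp_sum_ext LS (fun t => k * MB roots' 1 alpha (W z) (vline gamma t))%C). 2: apply line_cmult; auto.
      intros t.
      assert (HE : map (fun r => ((RtoC a + sp_eps LS t) / RtoC alpha - r)%C) roots = map (fun r => - vline gamma t - r)%C roots).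
      { apply map_ext. intros r. rewrite He. field. intros E; apply RtoC_inj in E; lra. }
      rewrite ecoef_eq, HE by lra. assert (HD1 := HDc 1 t). rewrite HD1.
      replace (MB roots 1 alpha (/ am) (vline gamma t) * k * Cprod (map (fun r => - vline gamma t - r) roots) * cpw z (RtoC a + sp_eps LS t))%C
        with (MB roots 1 alpha (/ am) (vline gamma t) * k * cpw z (RtoC a + sp_eps LS t) * Cprod (map (fun r => - vline gamma t - r) roots))%C by ring.
      rewrite HMBz by auto. unfold MB. unfold roots'. rewrite <- Cprod_shift. ring.
      intros r Hr. specialize (Hg r Hr). rewrite vline_eq. destruct r. simpl in *. lra.
    + apply (sp_sum_ext LS (fun t => RtoC am * k * MB roots' 1 alpha (W z) (vline (gamma + 1) t))%C). 2: apply line_cmult; auto.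
      intros t.
      replace (RtoC (a - alpha) + sp_eps LS t)%C with (- RtoC alpha * vline (gamma + 1) t)%C.
      2: { simpl. unfold line_eps, a, vline. rewrite RtoC_minus, !RtoC_mult, RtoC_plus, RtoC_opp. ring. }
      rewrite He. unfold Dc, MB. rewrite cpw_fox_w. unfold roots'. rewrite map_map.
      assert (Ev : vline (gamma + 1) t = (vline gamma t + 1)%C) by (unfold vline; rewrite RtoC_plus; ring).
      rewrite Ev.
      replace (map (fun x => / rGamma (- (x - 1) + - (1) * (vline gamma t + 1)))%C roots) with (map (fun r => / rGamma (- r + - (1) * vline gamma t))%C roots).
      2: { apply map_ext. intros r. do 2 f_equal. ring. }
      rewrite (cpw_plus (/ am) (vline gamma t) 1), cpw_RtoC, Rpower_1, RtoC_inv by (try apply Rinv_0_lt_compat; lra).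
      replace (1 - RtoC alpha + - RtoC alpha * vline gamma t)%C with (1 + - RtoC alpha * (vline gamma t + 1))%C by ring.
      field. auto.
  - intros z Hz. destruct (Hval (W z)) as [l Hl]. destruct (FoxH_value (W z) gamma l (fox_w_pos z) Hg Hl) as [_ H2].
    rewrite H2. symmetry. apply sp_val_eq.
    replace (c1 * (l / (2 * RtoC PI)))%C with (k * l)%C.
    + apply (sp_sum_ext LS (fun t => k * MB roots 1 alpha (W z) (vline gamma t))%C). 2: apply line_cmult; auto.
      intros t. assert (HD1 := HDc 1 t). rewrite HD1, HMBz by auto. reflexivity.
    + unfold k. field. intros E; apply RtoC_inj in E; lra.
Qed.
End Fox.

(** * Superpositions over a double series *)

Lemma Cmod_Csum_le (f : nat -> C) (g : R) (n : nat) : (forall i, (i <= n)%nat -> Cmod (f i) <= g) -> Cmod (Csum f n) <= INR (S n) * g.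
Proof.
  induction n; intros H.
  - rewrite Csum_0. simpl. rewrite Rmult_1_l. apply H; auto.
  - rewrite Csum_S, S_INR. eapply Rle_trans. apply Cmod_triangle.
    assert (H1 := IHn (fun i Hi => H i (le_S _ _ Hi))). assert (H2 := H (S n) (le_n _)). lra.
Qed.

Lemma Csum_geom_diff (g : nat -> C) (A : R) (N k : nat) : (forall i, Cmod (g i) <= A * (1/2) ^ i) ->
  Cmod (Csum g (N + k) - Csum g N)%C <= A * ((1/2) ^ N - (1/2) ^ (N + k)).
Proof.
  intros Hg. induction k.
  - rewrite Nat.add_0_r. unfold Cminus. rewrite Cplus_opp_r, Cmod_0. lra.
  - rewrite Nat.add_succ_r, Csum_S.
    replace (Csum g (N + k) + g (S (N + k)) - Csum g N)%C with ((Csum g (N + k) - Csum g N) + g (S (N + k)))%C by ring.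
    eapply Rle_trans. apply Cmod_triangle. assert (H := Hg (S (N + k))). simpl pow in *. lra.
Qed.

Lemma half_pow_pos (N : nat) : 0 < (1/2) ^ N.
Proof. apply pow_lt; lra. Qed.

Lemma filterlim_half_pow (A : R) : filterlim (fun N => A * (1/2) ^ N) eventually (locally 0).
Proof.
  change (is_lim_seq (fun N => A * (1/2) ^ N) 0). replace (Finite 0) with (Rbar_mult A 0) by (simpl; f_equal; ring).
  apply is_lim_seq_scal_l. apply is_lim_seq_geom. rewrite Rabs_pos_eq; lra.
Qed.

Lemma Csum_geom_ex (g : nat -> C) (A : R) : (forall i, Cmod (g i) <= A * (1/2) ^ i) ->
  exists l : C, Clim eventually (Csum g) l.
Proof.
  intros Hg. apply (filterlim_locally_cauchy (U := C_R_CompleteNormedModule) (F := eventually)).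
  intros eps.
  assert (Hev := proj1 (filterlim_locally _ _) (filterlim_half_pow A) eps).
  destruct Hev as [N HN].
  assert (G : forall u v, (N <= u)%nat -> (u <= v)%nat -> Cmod (Csum g v - Csum g u)%C < eps).
  { intros u v Hu Hv. assert (H := Csum_geom_diff g A u (v - u) Hg). replace (u + (v - u))%nat with v in H by lia.
    assert (H1 := HN u Hu). change (Rabs (A * (1/2) ^ u - 0) < eps) in H1. rewrite Rminus_0_r in H1. apply Rabs_def2 in H1.
    assert (HA : 0 <= A). { assert (H2 := Hg O). assert (H3 := Cmod_ge_0 (g O)). simpl in H2. lra. }
    assert (0 <= A * (1/2) ^ v) by (apply Rmult_le_pos; auto; left; apply half_pow_pos). lra. }
  exists (fun n => (N <= n)%nat). split. exists N; auto.
  intros u v Hu Hv. apply (norm_compat1 (V := C_R_NormedModule)). rewrite <- Cmod_norm.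
  change (Cmod (Csum g v - Csum g u)%C < eps).
  destruct (Nat.le_ge_cases u v). apply G; auto. rewrite Cmod_minus_sym. apply G; auto.
Qed.

Lemma Csum_geom_tail (g : nat -> C) (A : R) (l : C) (N : nat) : (forall i, Cmod (g i) <= A * (1/2) ^ i) ->
  Clim eventually (Csum g) l -> Cmod (l - Csum g N)%C <= A * (1/2) ^ N.
Proof.
  intros Hg Hl. apply (Clim_le eventually (fun p => Csum g p - Csum g N)%C).
  - apply Clim_minus; auto. apply eventually_filter. apply Clim_const, eventually_filter.
  - exists N. intros p Hp. assert (H := Csum_geom_diff g A N (p - N) Hg). replace (N + (p - N))%nat with p in H by lia.
    assert (HA : 0 <= A). { assert (H2 := Hg O). assert (H3 := Cmod_ge_0 (g O)). simpl in H2. lra. }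
    assert (0 <= A * (1/2) ^ p) by (apply Rmult_le_pos; auto; left; apply half_pow_pos). lra.
Qed.

Lemma Csum_swap (f : nat -> nat -> C) (N p : nat) : Csum (fun i => Csum (f i) p) N = Csum (fun j => Csum (fun i => f i j) N) p.
Proof.
  induction N.
  - rewrite Csum_0. apply Csum_ext. intros; now rewrite Csum_0.
  - rewrite Csum_S, IHN. clear IHN. induction p.
    + rewrite !Csum_0, Csum_S. reflexivity.
    + rewrite !(Csum_S _ p). rewrite Csum_S, <- IHp. ring.
Qed.

Lemma Csum_shift (f : nat -> C) (N : nat) : Csum f (S N) = (f O + Csum (fun i => f (S i)) N)%C.
Proof.
  induction N. rewrite Csum_S, !Csum_0. reflexivity.
  rewrite Csum_S, IHN, (Csum_S (fun i => f (S i))). ring.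
Qed.

Lemma Clim_shift (f : nat -> C) (l : C) : Clim eventually (fun n => f (S n)) l -> Clim eventually f l.
Proof.
  intros H P HP. destruct (H P HP) as [N HN]. exists (S N). intros n Hn. destruct n; [lia|]. apply HN. lia.
Qed.

Section Double.
Variables (alpha : R) (p : nat).
Hypothesis Halpha : 0 < alpha.

(* The index [(i, j)] stands for [z^(alpha (i+1) - k)] with [k = j + 1]; the factor [z^(alpha - n)],
   [n = p + 1], is split off to keep the remaining exponents nonnegative. *)
Definition double_eps (x : nat * nat) : C := RtoC (alpha * INR (fst x) + INR (p - snd x)).

Definition double_row (f : nat * nat -> C) (i : nat) : C := Csum (fun j => f (i, j)) p.

Definition double_sum (f : nat * nat -> C) (l : C) : Prop := Clim eventually (Csum (double_row f)) l.

(** Decay in [i] beyond every geometric rate, uniformly over the columns. Multiplication by a linear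
    factor in [i] is absorbed by doubling [rho], since [i + 1 <= 2^i]. *)
Definition double_adm (F : nat * nat -> C) : Prop :=
  forall rho, 0 < rho -> exists M, 0 <= M /\ forall i j, (j <= p)%nat -> Cmod (F (i, j)) * rho ^ i <= M.

Lemma double_eps_pos (x : nat * nat) : 0 <= Re (double_eps x).
Proof. unfold double_eps. simpl. assert (H1 := pos_INR (fst x)). assert (H2 := pos_INR (p - snd x)). nra. Qed.

Lemma double_uniq f l l' : double_sum f l -> double_sum f l' -> l = l'.
Proof. apply (Clim_unique eventually). Qed.

Lemma double_cmult f (c l : C) : double_sum f l -> double_sum (fun x => c * f x)%C (c * l)%C.
Proof.
  intros H. unfold double_sum. apply filterlim_ext with (fun N => c * Csum (double_row f) N)%C.
  - intros N. rewrite <- Csum_cmult. apply Csum_ext. intros i _. unfold double_row. now rewrite <- Csum_cmult.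
  - apply Clim_mult; auto. apply eventually_filter. apply Clim_const, eventually_filter.
Qed.

Lemma double_minus f g (l m : C) : double_sum f l -> double_sum g m -> double_sum (fun x => f x - g x)%C (l - m)%C.
Proof.
  intros H1 H2. unfold double_sum. apply filterlim_ext with (fun N => Csum (double_row f) N - Csum (double_row g) N)%C.
  - intros N. rewrite <- Csum_minus. apply Csum_ext. intros i _. unfold double_row. now rewrite <- Csum_minus.
  - apply Clim_minus; auto. apply eventually_filter.
Qed.

Lemma INR_le_pow2 (i : nat) : INR i + 1 <= 2 ^ i.
Proof. induction i. simpl; lra. rewrite S_INR. simpl. assert (H := pos_INR i). lra. Qed.

Lemma double_adm_mult F c : double_adm F -> double_adm (fun x => F x * (c + double_eps x))%C.
Proof.
  intros HF rho Hr. destruct (HF (2 * rho)) as [M [HM0 HM]]. lra.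
  assert (Hp := pos_INR p). assert (Hc := Cmod_ge_0 c).
  set (A := Cmod c + alpha + INR p). assert (HA : 0 <= A) by (unfold A; lra).
  exists (A * M). split. apply Rmult_le_pos; auto. intros i j Hj. rewrite Cmod_mult.
  assert (E : Cmod (c + double_eps (i, j))%C <= A * 2 ^ i).
  { eapply Rle_trans. apply Cmod_triangle. unfold double_eps. simpl fst. simpl snd.
    assert (Hi := pos_INR i). assert (Hpj : INR (p - j) <= INR p) by (apply le_INR; lia). assert (Hpj0 := pos_INR (p - j)).
    rewrite Cmod_R, Rabs_pos_eq by nra. assert (H2 := INR_le_pow2 i). unfold A. nra. }
  specialize (HM i j Hj). rewrite Rpow_mult_distr in HM.
  assert (0 <= rho ^ i) by (apply pow_le; lra). assert (H1 := Cmod_ge_0 (F (i, j))).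
  apply Rle_trans with (Cmod (F (i, j)) * (A * 2 ^ i) * rho ^ i).
  apply Rmult_le_compat_r; auto. apply Rmult_le_compat_l; auto.
  replace (Cmod (F (i, j)) * (A * 2 ^ i) * rho ^ i) with (A * (Cmod (F (i, j)) * (2 ^ i * rho ^ i))) by ring.
  apply Rmult_le_compat_l; auto.
Qed.

Lemma double_adm_cmult F c : double_adm F -> double_adm (fun x => F x * c)%C.
Proof.
  intros HF rho Hr. destruct (HF rho Hr) as [M [HM0 HM]]. assert (Hc := Cmod_ge_0 c).
  exists (Cmod c * M). split. apply Rmult_le_pos; auto. intros i j Hj. rewrite Cmod_mult.
  replace (Cmod (F (i, j)) * Cmod c * rho ^ i) with (Cmod c * (Cmod (F (i, j)) * rho ^ i)) by ring.
  apply Rmult_le_compat_l; auto.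
Qed.

Lemma double_row_bound F (a Z : R) : double_adm F -> 0 < Z -> exists A, 0 <= A /\ forall u i, 0 < u <= Z ->
  Cmod (double_row (fun x => F x * cpw u (RtoC a + double_eps x))%C i) <= A * Rpower u a * (1/2) ^ i.
Proof.
  (* For [u <= Z] the [i]-th row contains [u^(alpha i) <= (rho/2)^i], which leaves a geometric
     series of ratio [1/2]. *)
  intros HF HZ. set (rho := 2 * Rpower Z alpha).
  assert (HZa := Rpower_pos Z alpha).
  destruct (HF rho) as [M [HM0 HM]]. unfold rho; lra.
  set (B := Rpower Z 0 + Rpower (Z + 1) (INR p)).
  assert (HB : 0 <= B). { unfold B. assert (H1 := Rpower_pos Z 0). assert (H2 := Rpower_pos (Z + 1) (INR p)). lra. }
  exists (INR (S p) * (M * B)). split. apply Rmult_le_pos. apply pos_INR. apply Rmult_le_pos; auto.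
  intros u i Hu. unfold double_row.
  replace (INR (S p) * (M * B) * Rpower u a * (1/2) ^ i) with (INR (S p) * (M * B * Rpower u a * (1/2) ^ i)) by ring.
  apply Cmod_Csum_le. intros j Hj. rewrite Cmod_mult, Cmod_cpw.
  unfold double_eps. rewrite Re_R_plus, re_RtoC. simpl fst. simpl snd. rewrite !Rpower_plus.
  assert (E1 : Rpower u (alpha * INR i) <= (1/2) ^ i * rho ^ i).
  { rewrite <- Rpow_mult_distr. replace (1/2 * rho) with (Rpower Z alpha) by (unfold rho; field).
    rewrite <- Rpower_mult, <- Rpower_pow by apply Rpower_pos. apply Rpower_le_compat. apply pos_INR. split. apply Rpower_pos.
    apply Rpower_le_compat; lra. }
  assert (E2 : Rpower u (INR (p - j)) <= B).
  { apply Rle_trans with (Rpower (Z + 1) (INR (p - j))). apply Rpower_le_compat. apply pos_INR. lra.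
    assert (Rpower (Z + 1) (INR (p - j)) <= Rpower (Z + 1) (INR p)).
    { apply Rle_Rpower. lra. apply le_INR; lia. }
    unfold B. assert (H1 := Rpower_pos Z 0). lra. }
  specialize (HM i j Hj).
  assert (P1 := Rpower_pos u a). assert (P2 := Rpower_pos u (alpha * INR i)). assert (P3 := Rpower_pos u (INR (p - j))).
  assert (HFp := Cmod_ge_0 (F (i, j))). assert (Hh := half_pow_pos i).
  assert (Hrho : 0 <= rho ^ i) by (apply pow_le; unfold rho; lra).
  apply Rle_trans with (Cmod (F (i, j)) * (Rpower u a * (((1/2) ^ i * rho ^ i) * B))).
  - apply Rmult_le_compat_l; auto. apply Rmult_le_compat_l. lra. apply Rmult_le_compat; lra.
  - replace (Cmod (F (i, j)) * (Rpower u a * (((1/2) ^ i * rho ^ i) * B))) with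
      ((Cmod (F (i, j)) * rho ^ i) * (B * Rpower u a * (1/2) ^ i)) by ring.
    replace (M * B * Rpower u a * (1/2) ^ i) with (M * (B * Rpower u a * (1/2) ^ i)) by ring.
    apply Rmult_le_compat_r; auto. repeat apply Rmult_le_pos; lra.
Qed.

Lemma double_ex F a u : double_adm F -> 0 < u -> exists l, double_sum (fun x => F x * cpw u (RtoC a + double_eps x))%C l.
Proof.
  intros HF Hu. destruct (double_row_bound F a u HF Hu) as [A [HA0 HA]].
  apply (Csum_geom_ex _ (A * Rpower u a)). intros i. apply HA. lra.
Qed.

Lemma double_bound F a Z : double_adm F -> 0 < Z -> exists M, 0 <= M /\ forall u l, 0 < u <= Z ->
  double_sum (fun x => F x * cpw u (RtoC a + double_eps x))%C l -> Cmod l <= M * Rpower u a.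
Proof.
  intros HF HZ. destruct (double_row_bound F a Z HF HZ) as [A [HA0 HA]].
  exists (2 * A). split. lra. intros u l Hu Hl.
  set (g := double_row (fun x => F x * cpw u (RtoC a + double_eps x))%C).
  assert (Hg : forall i, Cmod (g i) <= A * Rpower u a * (1/2) ^ i) by (intros; apply HA; auto).
  assert (H := Csum_geom_tail g _ l O Hg Hl). rewrite Csum_0 in H. assert (H0 := Hg O). simpl pow in *.
  replace l with (l - g O + g O)%C by ring. eapply Rle_trans. apply Cmod_triangle. lra.
Qed.

Lemma CRIntg_ext (Ua Ub : (R -> Prop) -> Prop) (f g : R -> C) (l : C) :
  (forall u, f u = g u) -> CRIntg f Ua Ub l -> CRIntg g Ua Ub l.
Proof. intros H. rewrite (functional_extensionality f g H). auto. Qed.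

Lemma CRIntg_Csum Ua Ub {PUa : Filter Ua} {PUb : Filter Ub} (f : nat -> R -> C) (g : nat -> C) (n : nat) :
  (forall i, (i <= n)%nat -> CRIntg (f i) Ua Ub (g i)) -> CRIntg (fun u => Csum (fun i => f i u) n) Ua Ub (Csum g n).
Proof.
  induction n; intros H.
  - rewrite Csum_0. apply (CRIntg_ext _ _ (f O)). intros; now rewrite Csum_0. apply H; auto.
  - rewrite Csum_S. apply (CRIntg_ext _ _ (fun u => Csum (fun i => f i u) n + f (S n) u)%C).
    intros; now rewrite Csum_S.
    apply (is_RInt_gen_plus (V := C_R_NormedModule)). apply IHn; auto. apply H; auto.
Qed.

Lemma Ccont_Csum (f : nat -> R -> C) (u : R) (n : nat) :
  (forall i, (i <= n)%nat -> Ccont (f i) u) -> Ccont (fun u => Csum (fun i => f i u) n) u.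
Proof.
  induction n; intros H.
  - apply (continuous_ext (f O)). intros; now rewrite Csum_0. apply H; auto.
  - apply (continuous_ext (fun u => Csum (fun i => f i u) n + f (S n) u)%C). intros; now rewrite Csum_S.
    apply Clim_plus. apply locally_filter. apply IHn; auto. apply H; auto.
Qed.

(** Finite partial sums commute with the integral by linearity. The remainder after row [N] is at
    most [A 2^(-N) u^a]; multiplied by [kappa] it is dominated by [A 2^(-N) q u], so its integral
    tends to 0. *)
Lemma double_fubini F a Z Ua Ub E q Q ua ub (kappa H : R -> C) (g : nat * nat -> C) (I : C) :
  double_adm F -> 0 < Z -> dominator Ua Ub E q Q ua ub ->
  (forall u, E u -> 0 < u <= Z) ->
  (forall u, E u -> Ccont kappa u) ->
  (forall u, E u -> Cmod (kappa u) * Rpower u a <= q u) ->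
  (forall u, E u -> double_sum (fun x => F x * cpw u (RtoC a + double_eps x))%C (H u)) ->
  (forall x, CRIntg (fun u => kappa u * cpw u (RtoC a + double_eps x))%C Ua Ub (g x)) ->
  double_sum (fun x => F x * g x)%C I ->
  CRIntg (fun u => kappa u * H u)%C Ua Ub I.
Proof.
  intros HF HZ HE Hpos Hk Hkq HH Hg HI.
  assert (PUa := dom_Fa HE). assert (PUb := dom_Fb HE).
  destruct (double_row_bound F a Z HF HZ) as [A [HA0 HA]].
  set (row := fun i u => double_row (fun x => F x * cpw u (RtoC a + double_eps x))%C i).
  set (HN := fun N u => Csum (fun i => row i u) N).
  assert (Htail : forall N u, E u -> Cmod (H u - HN N u)%C <= A * (1/2) ^ N * Rpower u a).
  { intros N u Hu. assert (T := Csum_geom_tail (fun i => row i u) (A * Rpower u a) (H u) N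
      (fun i => HA u i (Hpos u Hu)) (HH u Hu)). unfold HN. lra. }
  assert (HNc : forall N u, E u -> Ccont (HN N) u).
  { intros N u Hu. apply Ccont_Csum. intros i _. apply Ccont_Csum. intros j _. apply Clim_mult. apply locally_filter.
    apply Clim_const, locally_filter. apply Ccont_cpw. apply Hpos; auto. }
  assert (Hc : forall u, E u -> Ccont H u).
  { intros u Hu. apply Clim_eps. apply locally_filter. intros eps Heps.
    set (K := A * (Rpower u a + 1)).
    assert (Hru := Rpower_pos u a). assert (HK : 0 <= K) by (apply Rmult_le_pos; lra).
    assert (Hev := filter_near_R eventually _ _ _ (Rdiv_lt_0_compat eps 3 Heps ltac:(lra)) (filterlim_half_pow K)).
    destruct (filter_ex _ Hev) as [N HNN]. rewrite Rminus_0_r in HNN. apply Rabs_def2 in HNN.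
    assert (He3 : 0 < eps / 3) by lra.
    assert (L1 := proj1 (Clim_eps (locally u) _ _) (HNc N u Hu) _ He3).
    assert (L2 := dom_open HE u Hu).
    assert (L3 := filter_near_R (locally u) (fun u => Rpower u a) _ 1 Rlt_0_1 (continuous_Rpower a u (proj1 (Hpos u Hu)))).
    generalize (filter_and _ _ L1 (filter_and _ _ L2 L3)). apply filter_imp. intros v [V1 [V2 V3]].
    assert (T1 := Htail N v V2). assert (T2 := Htail N u Hu).
    apply Rabs_def2 in V3. assert (Hh := half_pow_pos N).
    assert (HAh : 0 <= A * (1/2) ^ N) by (apply Rmult_le_pos; lra).
    assert (T1' : A * (1/2) ^ N * Rpower v a <= K * (1/2) ^ N).
    { unfold K. replace (A * (Rpower u a + 1) * (1/2) ^ N) with (A * (1/2) ^ N * (Rpower u a + 1)) by ring. apply Rmult_le_compat_l; lra. }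
    assert (T2' : A * (1/2) ^ N * Rpower u a <= K * (1/2) ^ N).
    { unfold K. replace (A * (Rpower u a + 1) * (1/2) ^ N) with (A * (1/2) ^ N * (Rpower u a + 1)) by ring. apply Rmult_le_compat_l; lra. }
    replace (H v - H u)%C with ((H v - HN N v) + ((HN N v - HN N u) + - (H u - HN N u)))%C by ring.
    eapply Rle_lt_trans. apply Cmod_triangle. eapply Rle_lt_trans. apply Rplus_le_compat_l, Cmod_triangle.
    rewrite Cmod_opp. lra. }
  assert (HkHc : forall u, E u -> Ccont (fun u => kappa u * H u)%C u).
  { intros u Hu. apply Clim_mult. apply locally_filter. apply Hk; auto. apply Hc; auto. }
  assert (HIN : forall N, CRIntg (fun u => kappa u * HN N u)%C Ua Ub (Csum (double_row (fun x => F x * g x)%C) N)).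
  { intros N. apply (CRIntg_ext _ _
      (fun u => Csum (fun i => Csum (fun j => F (i, j) * (kappa u * cpw u (RtoC a + double_eps (i, j)))) p) N)%C).
    - intros u. unfold HN. rewrite <- Csum_cmult. apply Csum_ext. intros i _. unfold row, double_row.
      rewrite <- Csum_cmult. apply Csum_ext. intros j _. ring.
    - apply CRIntg_Csum; try apply PUa; try apply PUb. intros i _.
      apply CRIntg_Csum; try apply PUa; try apply PUb. intros j _. apply (CRIntg_cmult _ _ _ _ _ _ _ _ _ _ HE). apply Hg. }
  apply (CRIntg_iff _ _ _ _ _ _ _ HE). intros eps Heps.
  set (K := A * (Rabs (ub - ua) + 2)).
  assert (Hab := Rabs_pos (ub - ua)).
  assert (He3 : 0 < eps / 3) by lra.
  assert (Hev1 := filter_near_R eventually _ _ _ He3 (filterlim_half_pow K)).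
  assert (Hev2 := proj1 (Clim_eps eventually _ _) HI _ He3).
  destruct (filter_ex _ (filter_and _ _ Hev1 Hev2)) as [N [N1 N2]]. rewrite Rminus_0_r in N1. apply Rabs_def2 in N1.
  generalize (filter_and _ _ (proj1 (CRIntg_iff _ _ _ _ _ _ _ HE _ _) (HIN N) _ He3) (dom_prod_near _ _ _ _ _ _ _ HE 1 Rlt_0_1)).
  apply filter_imp. intros [x y] [[v [V1 V2]] [X1 [X2 [X3 X4]]]]. simpl in *.
  assert (HkI := dom_CInt _ _ _ _ _ _ _ HE _ HkHc x y X1 X2).
  exists (CInt (fun u => kappa u * H u)%C x y). split; auto.
  set (w := CInt (fun u => kappa u * H u)%C x y : C) in *.
  assert (Hh := half_pow_pos N).
  assert (HAh : 0 <= A * (1/2) ^ N) by (apply Rmult_le_pos; lra).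
  assert (B1 : Cmod (w - v)%C <= A * (1/2) ^ N * Rabs (Q y - Q x)).
  { apply (dom_bound _ _ _ _ _ _ _ HE (fun u => kappa u * H u - kappa u * HN N u)%C _ HAh); auto.
    - intros u Hu. replace (kappa u * H u - kappa u * HN N u)%C with (kappa u * (H u - HN N u))%C by ring.
      rewrite Cmod_mult. apply Rle_trans with (Cmod (kappa u) * (A * (1/2) ^ N * Rpower u a)).
      apply Rmult_le_compat_l. apply Cmod_ge_0. apply Htail; auto.
      replace (Cmod (kappa u) * (A * (1/2) ^ N * Rpower u a)) with (A * (1/2) ^ N * (Cmod (kappa u) * Rpower u a)) by ring.
      apply Rmult_le_compat_l; auto.
    - apply CRInt_minus; auto. }
  assert (B2 : Rabs (Q y - Q x) <= Rabs (ub - ua) + 2).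
  { replace (Q y - Q x) with ((ub - ua) + ((Q y - ub) - (Q x - ua))) by ring.
    eapply Rle_trans. apply Rabs_triang. apply Rplus_le_compat_l. eapply Rle_trans. apply Rabs_triang. rewrite Rabs_Ropp. lra. }
  assert (B3 : A * (1/2) ^ N * Rabs (Q y - Q x) <= K * (1/2) ^ N).
  { unfold K. replace (A * (Rabs (ub - ua) + 2) * (1/2) ^ N) with (A * (1/2) ^ N * (Rabs (ub - ua) + 2)) by ring. apply Rmult_le_compat_l; auto. }
  set (IN := Csum (double_row (fun x => F x * g x)%C) N) in *.
  replace (w - I)%C with ((w - v) + ((v - IN) + (IN - I)))%C by ring.
  eapply Rle_lt_trans. apply Cmod_triangle. eapply Rle_lt_trans. apply Rplus_le_compat_l, Cmod_triangle. lra.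
Qed.

Definition double_superposition : superposition (nat * nat) := {|
  sp_sum := double_sum;
  sp_eps := double_eps;
  sp_adm := double_adm;
  sp_eps_pos := double_eps_pos;
  sp_uniq := double_uniq;
  sp_cmult := double_cmult;
  sp_minus := double_minus;
  sp_adm_mult := double_adm_mult;
  sp_adm_cmult := double_adm_cmult;
  sp_ex := double_ex;
  sp_bound := double_bound;
  sp_fubini := double_fubini |}.
End Double.

(** * The Wright function solution *)

Lemma eventually_decr_bounded (U : nat -> R) (N : nat) : (forall i, (N <= i)%nat -> U (S i) <= U i) ->
  exists M, 0 <= M /\ forall i, U i <= M.
Proof.
  intros H.
  assert (Hfin : forall n, exists M, 0 <= M /\ forall i, (i <= n)%nat -> U i <= M).
  { induction n as [|n [M [HM0 HM]]].
    - exists (Rmax 0 (U O)). split. apply Rmax_l. intros i Hi. replace i with O by lia. apply Rmax_r.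
    - exists (Rmax M (U (S n))). split. apply Rle_trans with (1 := HM0), Rmax_l.
      intros i Hi. destruct (Nat.eq_dec i (S n)) as [-> | Hne]. apply Rmax_r.
      apply Rle_trans with M. apply HM; lia. apply Rmax_l. }
  destruct (Hfin N) as [M [HM0 HM]]. exists M. split; auto. intros i.
  destruct (Nat.le_gt_cases i N) as [Hi | Hi]. apply HM; auto.
  replace i with (N + (i - N))%nat by lia. generalize (i - N)%nat as k. clear Hi.
  induction k. rewrite Nat.add_0_r. apply HM; auto.
  rewrite Nat.add_succ_r. eapply Rle_trans. apply H. lia. exact IHk.
Qed.

Lemma eventually_INR_gt (x : R) : eventually (fun i => x < INR i).
Proof.
  destruct (nfloor_ex (Rmax 0 x) (Rmax_l _ _)) as [N [_ HN]]. exists (S N). intros n Hn.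
  apply le_INR in Hn. rewrite S_INR in Hn. assert (H := Rmax_r 0 x). lra.
Qed.

(** [Gamma (A + i + 1) = (A + i) Gamma (A + i)] and [|A + i| <= 2 i]: one step costs at most [2 i]
    for each parameter. *)
Lemma Gamma_list_step (As : list C) (i : nat) : (forall A, In A As -> Cmod A < INR i) -> (0 < i)%nat ->
  Cmod (Cprod (map (fun A => / rGamma (A + RtoC (INR (S i)))) As))%C <=
  (2 * INR i) ^ length As * Cmod (Cprod (map (fun A => / rGamma (A + RtoC (INR i))) As))%C.
Proof.
  intros HA Hi. assert (Hi0 : 1 <= INR i) by (apply (le_INR 1); auto).
  induction As as [|A l IH].
  - unfold Cprod; simpl. lra.
  - unfold Cprod in *. cbn [map fold_right]. rewrite !Cmod_mult.
    assert (IH' := IH (fun A' H => HA A' (or_intror H))).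
    assert (HA' := HA A (or_introl eq_refl)).
    assert (Hne : (A + RtoC (INR i))%C <> 0).
    { intros E. assert (E2 : A = (- RtoC (INR i))%C) by (replace A with (A + RtoC (INR i) - RtoC (INR i))%C by ring; rewrite E; ring).
      rewrite E2, Cmod_opp, Cmod_R, Rabs_pos_eq in HA' by lra. lra. }
    assert (E : (/ rGamma (A + RtoC (INR (S i))))%C = ((A + RtoC (INR i)) * / rGamma (A + RtoC (INR i)))%C).
    { rewrite (rGamma_rec (A + RtoC (INR i))), Cinv_mult, S_INR, RtoC_plus.
      replace (A + RtoC (INR i) + 1)%C with (A + (RtoC (INR i) + 1))%C by ring.
      rewrite Cmult_assoc, Cinv_r by auto. ring. }
    rewrite E, Cmod_mult. cbn [length pow].
    set (x := Cmod (/ rGamma (A + RtoC (INR i)))). set (y := Cmod (fold_right Cmult 1 (map (fun A0 => / rGamma (A0 + RtoC (INR i))) l))%C) in *.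
    assert (Hb : Cmod (A + RtoC (INR i))%C <= 2 * INR i).
    { eapply Rle_trans. apply Cmod_triangle. rewrite Cmod_R, Rabs_pos_eq by lra. lra. }
    assert (Hx : 0 <= x) by apply Cmod_ge_0.
    replace (2 * INR i * (2 * INR i) ^ length l * (x * y)) with ((2 * INR i * x) * ((2 * INR i) ^ length l * y)) by ring.
    apply Rmult_le_compat; auto using Cmod_ge_0. apply Rmult_le_pos; auto using Cmod_ge_0.
    apply Rmult_le_compat_r; auto.
Qed.

(** Ratio test: the numerator gains at most [(2 i)^L] per step, the factor [rGamma] loses order
    [i^(-al)] by [rGamma_growth], and [L < al]. The terms are thus eventually decreasing, for every
    [rho]. *)
Lemma wright_coef_bound (As : list C) (al B rho : R) : INR (length As) < al -> 0 < rho ->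
  exists M, 0 <= M /\ forall i,
    Cmod (Cprod (map (fun A => / rGamma (A + RtoC (INR i))) As) * rGamma (RtoC (B + al * INR i)))%C * rho ^ i <= M.
Proof.
  intros Hal Hrho. set (L := length As) in *.
  assert (HL := pos_INR L). assert (Hal0 : 0 < al) by lra.
  (* The constant of the ratio bound [K i^(L - al)]; its last factor comes from replacing [x - 1] by
     the smaller [al i / 2]. *)
  set (K := rho * 2 ^ L * Rpower (al / 2) (- al)).
  assert (HK : 0 < K).
  { unfold K. apply Rmult_lt_0_compat. apply Rmult_lt_0_compat; auto. apply pow_lt; lra. apply Rpower_pos. }
  assert (Hev1 := filter_near_R eventually _ _ _ (Rinv_0_lt_compat _ HK) (filterlim_Rpower_INR_neg (al - INR L) ltac:(lra))).
  (* This threshold gives [al i / 2 <= x - 1] for [x = B + al i]; the next one gives [x > 2], inside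
     the range of [rGamma_growth]. *)
  assert (Hev2 := eventually_INR_gt (2 * (1 - B) / al)).
  assert (Hev2' := eventually_INR_gt ((2 - B) / al)).
  assert (Hev3 : eventually (fun i => forall A, In A As -> Cmod A < INR i)).
  { clear. induction As as [|A l IH]. exists O; intros n _ A [].
    generalize (filter_and _ _ (eventually_INR_gt (Cmod A)) IH). apply filter_imp. intros i [H1 H2] A' [<- | H']; auto. }
  destruct (filter_and _ _ (filter_and _ _ Hev1 (filter_and _ _ Hev2 Hev2')) Hev3) as [N HN].
  apply (eventually_decr_bounded _ (S N)). intros i Hi.
  destruct (HN i ltac:(lia)) as [[H1 [H2 H2']] H3].
  assert (Hi0 : 1 <= INR i) by (apply (le_INR 1); lia).
  rewrite Rminus_0_r, Rabs_pos_eq in H1 by (left; apply Rpower_pos).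
  rewrite !Cmod_mult.
  assert (E1 := Gamma_list_step As i H3 ltac:(lia)). fold L in E1.
  set (x := B + al * INR i).
  assert (Hx2 : 2 < x).
  { apply Rmult_lt_compat_l with (r := al) in H2'; auto. replace (al * ((2 - B) / al)) with (2 - B) in H2' by (field; lra). unfold x; lra. }
  assert (Hxh : al / 2 * INR i <= x - 1).
  { apply Rmult_lt_compat_l with (r := al) in H2; auto. replace (al * (2 * (1 - B) / al)) with (2 * (1 - B)) in H2 by (field; lra). unfold x; lra. }
  assert (E2 := rGamma_growth x al ltac:(lra) Hal0).
  replace (B + al * INR (S i)) with (x + al) by (unfold x; rewrite S_INR; ring).
  assert (E3 : Rpower (x - 1) (- al) <= Rpower (al / 2) (- al) * Rpower (INR i) (- al)).
  { rewrite Rpower_mult_distr by lra. apply Rpower_anti. lra. split; auto. apply Rmult_lt_0_compat; lra. }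
  set (g := Cmod (Cprod (map (fun A => / rGamma (A + RtoC (INR i)))%C As))) in *.
  set (h := Cmod (rGamma (RtoC x))) in *.
  assert (Hg0 : 0 <= g) by apply Cmod_ge_0. assert (Hh0 : 0 <= h) by apply Cmod_ge_0.
  assert (Hri : 0 < rho ^ i) by (apply pow_lt; auto).
  assert (P1 := Rpower_pos (al / 2) (- al)). assert (P2 := Rpower_pos (INR i) (- al)).
  apply Rle_trans with ((2 * INR i) ^ L * g * (Rpower (al / 2) (- al) * Rpower (INR i) (- al) * h) * (rho * rho ^ i)).
  - simpl pow at 1. apply Rmult_le_compat_r. apply Rmult_le_pos; lra.
    apply Rmult_le_compat; auto using Cmod_ge_0. apply Rle_trans with (1 := E2). apply Rmult_le_compat_r; auto.
  - replace ((2 * INR i) ^ L * g * (Rpower (al / 2) (- al) * Rpower (INR i) (- al) * h) * (rho * rho ^ i)) with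
      ((K * Rpower (INR i) (- (al - INR L))) * (g * h * rho ^ i)).
    + rewrite <- (Rmult_1_l (g * h * rho ^ i)) at 2. apply Rmult_le_compat_r. repeat apply Rmult_le_pos; lra.
      apply Rmult_le_reg_l with (/ K). apply Rinv_0_lt_compat; auto. rewrite <- Rmult_assoc, Rinv_l by lra. lra.
    + unfold K. rewrite Rpow_mult_distr. replace (- (al - INR L)) with (INR L + - al) by ring.
      rewrite Rpower_plus, Rpower_pow by lra. ring.
Qed.

Section WrightSolution.
Variables (alpha am : R) (roots : list C) (coefs : nat -> R) (c : nat -> C) (p : nat).
Let m := length roots.
Let n := S p.
Hypothesis Halpha : INR m < alpha.
Hypothesis Hn : INR n - 1 < alpha < INR n.
Hypothesis Ham : am <> 0.
Hypothesis Hdef : forall k, (1 <= k <= n)%nat -> c k <> 0 -> Wright_defined (sol_upper alpha roots k).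

Lemma wright_alpha_pos : 0 < alpha.
Proof. assert (H := pos_INR m). lra. Qed.
Let Hal := wright_alpha_pos.

Definition wright_arg (k : nat) (r : C) : C := (1 - RtoC (INR k / alpha) - r)%C.

Definition wright_num (k i : nat) : C := Cprod (map (fun r => / rGamma (wright_arg k r + RtoC (INR i)))%C roots).

Lemma wright_arg_not_pole (k i : nat) (r : C) : (1 <= k <= n)%nat -> c k <> 0 -> In r roots ->
  ~ Gamma_pole (wright_arg k r + RtoC (INR i)).
Proof.
  intros Hk Hc Hr. assert (H := Hdef k Hk Hc (wright_arg k r, 1)).
  replace (wright_arg k r + RtoC (INR i))%C with (fst (wright_arg k r, 1) + RtoC (snd (wright_arg k r, 1)) * RtoC (INR i))%C by (simpl; ring).
  apply H. unfold sol_upper. apply in_or_app. left. apply (in_map (fun r => (wright_arg k r, 1))). auto.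
Qed.

(** The parameter [(1, 1)] of the upper row contributes [Gamma (1 + i) = i!], which cancels the
    factorial of the series. *)
Lemma Wright_term_eq (k i : nat) (w : C) :
  Wright_term (sol_upper alpha roots k) (sol_lower alpha k) w i =
  (wright_num k i * rGamma (RtoC (1 + alpha - INR k + alpha * INR i)) * w ^ i)%C.
Proof.
  unfold Wright_term, sol_upper, sol_lower. rewrite map_app, Cprod_app, map_map.
  cbn [map fst snd]. unfold Cprod at 2 3. cbn [fold_right].
  replace (Cprod (map (fun x : C => Gamma (1 - RtoC (INR k / alpha) - x + 1 * RtoC (INR i))) roots)) with (wright_num k i).
  2: { unfold wright_num. f_equal. apply map_ext. intros r. rewrite Gamma_rGamma. unfold wright_arg. do 2 f_equal. ring. }
  fold (rGamma (RtoC (1 + alpha - INR k) + RtoC alpha * RtoC (INR i))). rewrite <- (RtoC_mult alpha), <- (RtoC_plus (1 + alpha - INR k)).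
  replace (1 + 1 * RtoC (INR i))%C with (1 + RtoC (INR i))%C by ring.
  rewrite (Gamma_rGamma (1 + RtoC (INR i))), rGamma_fact, Cinv_inv.
  field. apply RtoC_INR_fact_neq_0.
Qed.

Lemma wright_bound (k : nat) (B rho : R) : 0 < rho -> exists M, 0 <= M /\ forall i,
  Cmod (wright_num k i * rGamma (RtoC (B + alpha * INR i)))%C * rho ^ i <= M.
Proof.
  intros Hrho. destruct (wright_coef_bound (map (wright_arg k) roots) alpha B rho) as [M [HM0 HM]]; auto.
  rewrite length_map. exact Halpha.
  exists M. split; auto. intros i. specialize (HM i). rewrite map_map in HM. exact HM.
Qed.

Lemma Clim_Csum_is_series (f : nat -> C) (l : C) : Clim eventually (Csum f) l -> is_series (V := C_R_NormedModule) f l.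
Proof. intros H. exact H. Qed.

Lemma Re_Csum (f : nat -> C) (N : nat) : Re (Csum f N) = sum_n (fun i => Re (f i)) N.
Proof. induction N. rewrite Csum_0, sum_O. reflexivity. rewrite Csum_S, sum_Sn, <- IHN. reflexivity. Qed.

Lemma Im_Csum (f : nat -> C) (N : nat) : Im (Csum f N) = sum_n (fun i => Im (f i)) N.
Proof. induction N. rewrite Csum_0, sum_O. reflexivity. rewrite Csum_S, sum_Sn, <- IHN. reflexivity. Qed.

Lemma Wright_value (k : nat) (w : C) : Clim eventually
  (Csum (Wright_term (sol_upper alpha roots k) (sol_lower alpha k) w)) (Wright (sol_upper alpha roots k) (sol_lower alpha k) w).
Proof.
  clear Hn Hdef Ham.
  set (f := Wright_term (sol_upper alpha roots k) (sol_lower alpha k) w).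
  assert (Hex : exists l : C, Clim eventually (Csum f) l).
  (* This radius exceeds [2 |w|], so the terms are at most [M 2^(-i)]. *)
  { destruct (wright_bound k (1 + alpha - INR k) (2 * (Cmod w + 1))) as [M [HM0 HM]]. assert (H := Cmod_ge_0 w); lra.
    apply (Csum_geom_ex f M). intros i. unfold f. rewrite Wright_term_eq, Cmod_mult, Cmod_pow.
    specialize (HM i). assert (Hw := Cmod_ge_0 w).
    set (u := Cmod (wright_num k i * rGamma (RtoC (1 + alpha - INR k + alpha * INR i)))%C) in *.
    assert (Hu : 0 <= u) by apply Cmod_ge_0.
    assert (E : Cmod w ^ i <= (1/2) ^ i * (2 * (Cmod w + 1)) ^ i).
    { rewrite <- Rpow_mult_distr. apply pow_incr. lra. }
    assert (Hh := half_pow_pos i).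
    apply Rle_trans with (u * ((1/2) ^ i * (2 * (Cmod w + 1)) ^ i)). apply Rmult_le_compat_l; auto.
    replace (u * ((1/2) ^ i * (2 * (Cmod w + 1)) ^ i)) with ((u * (2 * (Cmod w + 1)) ^ i) * (1/2) ^ i) by ring.
    apply Rmult_le_compat_r; lra. }
  destruct Hex as [l Hl]. replace (Wright _ _ w) with l; auto.
  unfold Wright. fold f.
  assert (H1 : is_series (fun i => Re (f i)) (Re l)).
  { apply filterlim_ext with (fun N => Re (Csum f N)). apply Re_Csum. apply (Clim_Re eventually _ _ Hl). }
  assert (H2 : is_series (fun i => Im (f i)) (Im l)).
  { apply filterlim_ext with (fun N => Im (Csum f N)). apply Im_Csum. apply (Clim_Im eventually _ _ Hl). }
  rewrite (is_series_unique _ _ H1), (is_series_unique _ _ H2). destruct l; reflexivity.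
Qed.

Lemma wright_argument_pow (z : R) (i : nat) :
  (RtoC (am * Rpower z alpha) ^ i)%C = (RtoC am ^ i * cpw z (RtoC (alpha * INR i)))%C.
Proof.
  rewrite cpw_RtoC, <- Rpower_mult, Rpower_pow by apply Rpower_pos.
  rewrite <- !RtoC_pow, <- RtoC_mult, Rpow_mult_distr. reflexivity.
Qed.

Let DS := double_superposition alpha p Hal.
Let a := alpha - INR n.

(** Coefficient of [z^(alpha (i+1) - k)] without its factor [rGamma]; the power of [am] is split off
    from the argument [am z^alpha]. *)
Definition wright_D (x : nat * nat) : C := (c (S (snd x)) * wright_num (S (snd x)) (fst x) * RtoC am ^ fst x)%C.

Lemma double_exponent (i j : nat) : (j <= p)%nat ->
  (RtoC a + sp_eps DS (i, j))%C = RtoC (alpha * INR (S i) - INR (S j)).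
Proof.
  intros Hj. change (sp_eps DS (i, j)) with (double_eps alpha p (i, j)). unfold double_eps, a, n. simpl fst. simpl snd. rewrite <- RtoC_plus. f_equal.
  rewrite minus_INR by auto. rewrite !S_INR. ring.
Qed.

Lemma wright_D_adm (B : R) : sp_adm DS (fun x => wright_D x * rGamma (RtoC B + (RtoC a + sp_eps DS x)))%C.
Proof.
  intros rho Hrho. assert (Ham' : 0 < Rabs am) by (apply Rabs_pos_lt; auto).
  assert (H : forall q, (q <= p)%nat -> exists M, 0 <= M /\ forall i j, (j <= q)%nat ->
     Cmod (wright_D (i, j) * rGamma (RtoC B + (RtoC a + sp_eps DS (i, j))))%C * rho ^ i <= M).
  { assert (Hone : forall j, (j <= p)%nat -> exists M, 0 <= M /\ forall i,
      Cmod (wright_D (i, j) * rGamma (RtoC B + (RtoC a + sp_eps DS (i, j))))%C * rho ^ i <= M).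
    { intros j Hj. destruct (wright_bound (S j) (B + alpha - INR (S j)) (Rabs am * rho)) as [M [HM0 HM]].
      apply Rmult_lt_0_compat; auto.
      exists (Cmod (c (S j)) * M). split. apply Rmult_le_pos; auto. apply Cmod_ge_0.
      intros i. rewrite double_exponent by auto. rewrite <- RtoC_plus.
      replace (B + (alpha * INR (S i) - INR (S j))) with (B + alpha - INR (S j) + alpha * INR i) by (rewrite (S_INR i); ring).
      specialize (HM i). unfold wright_D. simpl fst. simpl snd. rewrite !Cmod_mult in *. rewrite Cmod_pow, Cmod_R.
      rewrite Rpow_mult_distr in HM.
      match goal with |- ?x1 * ?x2 * ?x3 * ?x4 * ?x5 <= _ => replace (x1 * x2 * x3 * x4 * x5) with (x1 * (x2 * x4 * (x3 * x5))) by ring end.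
      apply Rmult_le_compat_l; auto. apply Cmod_ge_0. }
    induction q as [|q IH]; intros Hq.
    - destruct (Hone O Hq) as [M [H1 H2]]. exists M. split; auto. intros i j Hj. replace j with O by lia. auto.
    - destruct (IH ltac:(lia)) as [M1 [H1 H2]]. destruct (Hone (S q) Hq) as [M2 [H3 H4]].
      exists (M1 + M2). split. lra. intros i j Hj. destruct (Nat.eq_dec j (S q)) as [-> | Hne].
      + specialize (H4 i). lra.
      + specialize (H2 i j ltac:(lia)). lra. }
  apply (H p (le_n p)).
Qed.

(** The functional equation in inverse form. It depends on definedness: at argument 0 the convention
    [/ 0 = 0] would make the right-hand factor vanish, whereas the left-hand one is
    [Gamma 1 = 1]. *)
Lemma wright_num_S (k i : nat) : (1 <= k <= n)%nat -> c k <> 0 ->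
  wright_num k (S i) = (wright_num k i * Cprod (map (fun r => wright_arg k r + RtoC (INR i)) roots))%C.
Proof.
  intros Hk Hc. unfold wright_num.
  assert (H : forall r, In r roots -> ~ Gamma_pole (wright_arg k r + RtoC (INR i))) by (intros; apply wright_arg_not_pole; auto).
  clear - H. induction roots as [|r l IH]. unfold Cprod; simpl; ring.
  unfold Cprod in *. cbn [map fold_right]. rewrite IH by (intros; apply H; right; auto).
  assert (Hr := rGamma_neq_0 _ (H r (or_introl eq_refl))).
  assert (E := rGamma_rec (wright_arg k r + RtoC (INR i))).
  replace (wright_arg k r + RtoC (INR (S i)))%C with (wright_arg k r + RtoC (INR i) + 1)%C by (rewrite S_INR, RtoC_plus; ring).
  set (x := (wright_arg k r + RtoC (INR i))%C) in *. clearbody x.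
  assert (H1 : rGamma (x + 1) <> 0) by (intros E1; apply Hr; rewrite E, E1; ring).
  assert (H2 : x <> 0) by (intros E1; apply Hr; rewrite E, E1; ring).
  rewrite E. field; auto.
Qed.

(** Row [i + 1] on the left equals row [i] on the right: the Euler factors are the
    [wright_arg k r + i] that raise [wright_num] by one index. Row 0 on the left is zero and is
    removed before the comparison. *)
Lemma wright_shift (z : R) : 0 < z ->
  sp_val DS (fun x => wright_D x * rGamma (1 - RtoC alpha + (RtoC a + sp_eps DS x)))%C (a - alpha) z =
  (RtoC am * sp_val DS (ecoef DS alpha (fun x => wright_D x * rGamma (1 + (RtoC a + sp_eps DS x)))%C a roots) a z)%C.
Proof.
  intros Hz. set (F := fun x => (wright_D x * rGamma (1 + (RtoC a + sp_eps DS x)))%C).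
  assert (HE : sp_adm DS (ecoef DS alpha F a roots)) by (apply ecoef_adm; exact (wright_D_adm 1)).
  apply sp_val_eq. apply Clim_shift.
  assert (H := sp_cmult DS _ (RtoC am) _ (sp_val_spec DS _ a z HE Hz)).
  revert H. apply filterlim_ext. intros N. rewrite Csum_shift.
  assert (Hal0 : RtoC alpha <> 0) by (intros E; apply RtoC_inj in E; lra).
  replace (double_row p (fun x => wright_D x * rGamma (1 - RtoC alpha + (RtoC a + sp_eps DS x)) * cpw z (RtoC (a - alpha) + sp_eps DS x))%C 0) with (RtoC 0).
  - rewrite Cplus_0_l. apply Csum_ext. intros i _. apply Csum_ext. intros j Hj.
    rewrite ecoef_eq by auto. unfold F. rewrite RtoC_minus.
    replace (RtoC a - RtoC alpha + sp_eps DS (S i, j))%C with (RtoC a + sp_eps DS (S i, j) - RtoC alpha)%C by ring.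
    rewrite !double_exponent by auto.
    replace (1 - RtoC alpha + RtoC (alpha * INR (S (S i)) - INR (S j)))%C with (1 + RtoC (alpha * INR (S i) - INR (S j)))%C
      by (rewrite (S_INR (S i)), !RtoC_minus, !RtoC_mult, RtoC_plus; ring).
    replace (RtoC (alpha * INR (S (S i)) - INR (S j)) - RtoC alpha)%C with (RtoC (alpha * INR (S i) - INR (S j)))
      by (rewrite (S_INR (S i)), !RtoC_minus, !RtoC_mult, RtoC_plus; ring).
    unfold wright_D. simpl fst. simpl snd.
    (* Definedness is assumed only for nonzero [c k]; for the others both terms are 0. *)
    destruct (Ceq_dec (c (S j)) 0) as [-> | Hc]. ring.
    rewrite wright_num_S by (auto; unfold n; lia).
    replace (map (fun r => RtoC (alpha * INR (S i) - INR (S j)) / RtoC alpha - r)%C roots) with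
      (map (fun r => wright_arg (S j) r + RtoC (INR i))%C roots).
    + change (RtoC am ^ S i)%C with (RtoC am * RtoC am ^ i)%C. ring.
    + apply map_ext. intros r. unfold wright_arg. rewrite RtoC_div, RtoC_minus, RtoC_mult, (S_INR i), (RtoC_plus (INR i)) by lra.
      field. auto.
  - unfold double_row. rewrite (Csum_ext _ (fun j => RtoC 0 * RtoC 0)%C). rewrite Csum_cmult; ring.
    intros j Hj. rewrite double_exponent by auto. rewrite rGamma_pole. ring.
    (* In row 0 the argument is [1 - alpha + (alpha - (j + 1)) = - j], a zero of [rGamma]. *)
    exists j. rewrite (S_INR 0), (S_INR j). simpl. rewrite RtoC_minus, RtoC_mult, !RtoC_plus. ring.
Qed.

(** Finitely many series are summed: their partial sums are exchanged with the sum over [k] at each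
    finite stage, and only then does the limit enter. *)
Lemma wright_phi (z : R) : 0 < z ->
  Csum (fun j => c (S j) * RtoC (Rpower z (alpha - INR (S j)))
    * Wright (sol_upper alpha roots (S j)) (sol_lower alpha (S j)) (RtoC (am * Rpower z alpha)))%C p =
  sp_val DS (fun x => wright_D x * rGamma (1 + (RtoC a + sp_eps DS x)))%C a z.
Proof.
  intros Hz. symmetry. apply sp_val_eq.
  set (w := RtoC (am * Rpower z alpha)).
  apply filterlim_ext with (fun N => Csum (fun j => c (S j) * RtoC (Rpower z (alpha - INR (S j))) *
    Csum (Wright_term (sol_upper alpha roots (S j)) (sol_lower alpha (S j)) w) N)%C p).
  - intros N. unfold double_row. rewrite Csum_swap. apply Csum_ext. intros j Hj. rewrite <- Csum_cmult.
    apply Csum_ext. intros i _. rewrite Wright_term_eq, double_exponent by auto. unfold w. rewrite wright_argument_pow.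
    unfold wright_D. simpl fst. simpl snd. rewrite <- !RtoC_plus.
    replace (1 + (alpha * INR (S i) - INR (S j))) with (1 + alpha - INR (S j) + alpha * INR i) by (rewrite (S_INR i); ring).
    replace (alpha * INR (S i) - INR (S j)) with ((alpha - INR (S j)) + alpha * INR i) by (rewrite (S_INR i); ring).
    rewrite (RtoC_plus (alpha - INR (S j)) (alpha * INR i)), cpw_plus, (cpw_RtoC z (alpha - INR (S j))). ring.
  - assert (H : forall q, Clim eventually (fun N => Csum (fun j => c (S j) * RtoC (Rpower z (alpha - INR (S j))) *
      Csum (Wright_term (sol_upper alpha roots (S j)) (sol_lower alpha (S j)) w) N)%C q)
      (Csum (fun j => c (S j) * RtoC (Rpower z (alpha - INR (S j))) * Wright (sol_upper alpha roots (S j)) (sol_lower alpha (S j)) w)%C q)).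
    { assert (H1 : forall j, Clim eventually (fun N => c (S j) * RtoC (Rpower z (alpha - INR (S j))) *
        Csum (Wright_term (sol_upper alpha roots (S j)) (sol_lower alpha (S j)) w) N)%C
        (c (S j) * RtoC (Rpower z (alpha - INR (S j))) * Wright (sol_upper alpha roots (S j)) (sol_lower alpha (S j)) w)%C).
      { intros j. apply Clim_mult. apply eventually_filter. apply Clim_const, eventually_filter. apply Wright_value. }
      induction q.
      - rewrite Csum_0. eapply filterlim_ext. 2: apply H1. intros N. symmetry. apply Csum_0.
      - rewrite Csum_S. eapply filterlim_ext. 2: apply (Clim_plus _ _ _ _ _ IHq (H1 (S q))). intros N. symmetry. apply Csum_S. }
    apply H.
Qed.

Theorem wright_solution (phi : R -> C) : coefs m = am ->
  (forall x, char_poly m alpha coefs x = (RtoC (coefs m) * Cprod (map (fun r => x - r) roots))%C) ->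
  (forall z, 0 < z -> phi z = Csum (fun j => c (S j) * RtoC (Rpower z (alpha - INR (S j)))
    * Wright (sol_upper alpha roots (S j)) (sol_lower alpha (S j)) (RtoC (am * Rpower z alpha)))%C p) ->
  is_solution m alpha coefs phi.
Proof.
  intros Hcm Hroots Hphi.
  apply (sp_solution DS m alpha coefs roots wright_D a); auto.
  - exists n. split. unfold n; lia. lra.
  (* The lowest exponent is [alpha - n]; [n - 1 < alpha] keeps it above [-1]. *)
  - unfold a. lra.
  - intros B. apply wright_D_adm.
  - intros z Hz. rewrite Hcm. apply wright_shift; auto.
  - intros z Hz. rewrite Hphi, wright_phi by auto. reflexivity.
Qed.
End WrightSolution.

Open Scope C_scope.

Theorem theorem4p1 (m : nat) (alpha : R) (a : nat -> R) (roots : list C)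
  (Hm : (0 < m)%nat) (Halpha : (0 < alpha)%R) (Ham : a m <> 0%R)
  (Hlen : length roots = m)
  (Hroots : forall x : C,
      char_poly m alpha a x = a m * Cprod (map (fun r => x - r) roots)) :
  (forall phi : R -> C, ex_CDerive_n_pos phi m ->
     forall z : R, (0 < z)%R ->
       eq_rhs m alpha a phi z = a m * fold_right (euler_op alpha) phi roots z)
  /\
  ((alpha < INR m)%R -> (0 < a m)%R ->
     let upper := [(RtoC 1, alpha)] in
     let lower := map (fun r => (- r, 1%R)) roots in
     let w := fun z : R => RtoC (Rpower z (- alpha) / a m) in
     (forall z : R, (0 < z)%R ->
        is_FoxH m 0 upper lower (w z) (FoxH m 0 upper lower (w z)))
     /\
     forall c1 : C,
       is_solution m alpha a (fun z => c1 * FoxH m 0 upper lower (w z)))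
  /\
  ((INR m < alpha)%R ->
     forall n : nat, (0 < n)%nat -> (INR n - 1 < alpha < INR n)%R ->
     let w := fun z : R => RtoC (a m * Rpower z alpha) in
     forall c : nat -> C,
       (forall k : nat, (1 <= k <= n)%nat -> c k <> 0 ->
          Wright_defined (sol_upper alpha roots k)) ->
       (forall (k : nat) (z : R), (1 <= k <= n)%nat -> c k <> 0 -> (0 < z)%R ->
          is_Wright (sol_upper alpha roots k) (sol_lower alpha k) (w z)
            (Wright (sol_upper alpha roots k) (sol_lower alpha k) (w z)))
       /\
       is_solution m alpha a
         (fun z => sum_n_m (fun k =>
            c k * Rpower z (alpha - INR k)
            * Wright (sol_upper alpha roots k) (sol_lower alpha k) (w z)) 1 n)).
Proof.
  split; [|split].
  - exact (eq_rhs_factor alpha Halpha m a roots Hlen Hroots).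
  - intros Hlt Hpos. subst m.
    exact (fox_solution alpha roots (conj Halpha Hlt) (a (length roots)) a Hpos eq_refl Hroots).
  - intros Hlt n Hn Hna w c Hdef. subst m. destruct n as [|p]; [lia|]. split.
    + intros k z Hk Hc Hz. split. apply Hdef; auto.
      apply Clim_Csum_is_series. apply Wright_value; auto.
    + apply (wright_solution alpha (a (length roots)) roots a c p); auto.
      (* Reindexes the sum over [1 <= k <= n] by [j = k - 1], which runs from 0 to [p = n - 1]. *)
      intros z Hz. unfold w. symmetry. apply (sum_n_m_S (G := C_AbelianMonoid) (fun k => c k * Rpower z (alpha - INR k)
            * Wright (sol_upper alpha roots k) (sol_lower alpha k) (a (length roots) * Rpower z alpha)%R) 0 p).
Qed.
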